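(* Suppose the analytical solutions $(\phi,p,\mathbf{u},c_f,T)$ of the wormhole propagation problem with heat transmission are sufficiently smooth. Then for the fully discrete scheme there is a positive constant $C$, independent of $h$, $k$ and $\Delta t$, such that $$\|E_{\phi}^{m+1}\|_M^2+\|E_{\mathbf{u}}^{m+1}\|_{TM}^2+\|E_p^{m+1}\|_M^2+\|E_{c_f}^{m+1}\|_M^2+\|E_T^{m+1}\|_M^2\leq C\left((\Delta t)^2+h^4+k^4\right),\qquad m\leq N-1.$$
   Context: **Continuous problem.** On $\Omega=(L_{lx},L_{rx})\times(L_{ly},L_{ry})$ and $J=(0,Q]$, the unknowns are pressure $p$, Darcy velocity $\mathbf{u}=(u^x,u^y)$, acid concentration $c_f$, porosity $\phi$ and temperature $T$, satisfying $$\gamma\frac{\partial p}{\partial t}+\frac{\partial\phi}{\partial t}+\nabla\cdot\mathbf{u}=f,\qquad \mathbf{u}=-\frac{K(\phi)}{\mu}\nabla p,$$ $$\frac{\partial(\phi c_f)}{\partial t}+\nabla\cdot(\mathbf{u}c_f)-\nabla\cdot(\phi\mathbf{D}\nabla c_f)=k_ca_v(\phi)(c_s-c_f)+f_Pc_f+f_Ic_I,$$ $$\frac{\partial\phi}{\partial t}=\frac{R(c_f,T)\,a_v(\phi)\,\alpha}{\rho_s},\qquad R(c_f,T)=k_c(c_f-c_s),\qquad c_s=\frac{c_f}{1+k_s(T)/k_c},$$ $$\frac{\partial[(\rho_s(1-\phi)\theta_s+\rho_f\phi\theta_f)T]}{\partial t}+\nabla\cdot(\rho_f\theta_f\mathbf{u}T)=\nabla\cdot(\lambda(\phi)\nabla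 T)+a_v(\phi)H_r(T)R(c_f,T),$$ with $\frac{K(\phi)}{K_0}=\frac{\phi}{\phi_0}\left(\frac{\phi(1-\phi_0)}{\phi_0(1-\phi)}\right)^2$, $\frac{a_v(\phi)}{a_0}=\frac{\phi}{\phi_0}\sqrt{\frac{K_0\phi}{K(\phi)\phi_0}}=\frac{1-\phi}{1-\phi_0}$, $\lambda(\phi)=(1-\phi)\lambda_s+\phi\lambda_f$, boundary conditions $\mathbf{u}\cdot\mathbf{n}=0$, $\phi\mathbf{D}\nabla c_f\cdot\mathbf{n}=0$, $\lambda\nabla T\cdot\mathbf{n}=0$ on $\partial\Omega$ ($\mathbf{n}$ the unit outward normal), and initial data $p_0,c_{f0},\phi_0,T_0$. Here $f=f_I+f_P$, with $f_I,f_P$ the injection and production rates and $c_I$ the injected concentration; $\gamma$ is a pseudo-compressibility parameter, $\mu$ the fluid viscosity, $k_c$ the local mass-transfer coefficient, $\alpha$ the dissolving power of the acid, $a_0$ the initial interfacial area, $K_0$ the initial permeability, and $\rho_s,\rho_f$, $\theta_s,\theta_f$, $\lambda_s,\lambda_f$ the densities, heat capacities and thermal conductivities of rock and acid; $\mathbf{D}=d_{mol}\mathbf{I}=\mathrm{diag}(D_{11},D_{22})$ is the diffusion coefficient. Standing assumptions: the surface reaction rate $k_s$ is Lipschitz continuous with $k_{s1}<k_s(T)<k_{s2}$ for constants $k_{s1},k_{s2}$; the reaction heat $H_r$ is Lipschitz continuous; $0<\phi_{0*}\le\phi_0\le\phi_0^*<1$ for constants $\phi_{0*},\phi_0^*$.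 Set $\mathbf{w}=\mathbf{u}c_f-\phi\mathbf{D}\nabla c_f$, $\mathbf{v}=\rho_f\theta_f\mathbf{u}T-\lambda(\phi)\nabla T$. **Grid.** A uniform mesh with points $(x_{i+1/2},y_{j+1/2})$, $0\le i\le N_x$, $0\le j\le N_y$, mesh sizes $h$ in $x$ and $k$ in $y$; cell centers $x_i=(x_{i-1/2}+x_{i+1/2})/2$, $y_j=(y_{j-1/2}+y_{j+1/2})/2$. $g_{i,j},g_{i+1/2,j},g_{i,j+1/2}$ denote values at $(x_i,y_j),(x_{i+1/2},y_j),(x_i,y_{j+1/2})$. $\Delta t=Q/N$, $t^n=n\Delta t$. Difference operators: $[d_xg]_{i+1/2,j}=(g_{i+1,j}-g_{i,j})/h$, $[d_yg]_{i,j+1/2}=(g_{i,j+1}-g_{i,j})/k$, $[D_xg]_{i,j}=(g_{i+1/2,j}-g_{i-1/2,j})/h$, $[D_yg]_{i,j}=(g_{i,j+1/2}-g_{i,j-1/2})/k$, $[d_tg]^n=(g^n-g^{n-1})/\Delta t$. Norms: $\|g\|_M^2=\sum_{i=1}^{N_x}\sum_{j=1}^{N_y}hk\,g_{i,j}^2$, $\|g\|_x^2=\sum_{i=1}^{N_x-1}\sum_{j=1}^{N_y}hk\,g_{i+1/2,j}^2$, $\|g\|_y^2=\sum_{i=1}^{N_x}\sum_{j=1}^{N_y-1}hk\,g_{i,j+1/2}^2$, $\|\mathbf{g}\|_{TM}^2=\|g^x\|_x^2+\|g^y\|_y^2$. $\Pi_h$ is an interpolation operator (from cell-center values to edge values)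 with second-order or higher precision. **Scheme.** Approximations $\Psi^n,P^n,\mathbf{U}^n,C_f^n,\mathbf{W}^n,Z^n,\mathbf{V}^n$ to $\phi,p,\mathbf{u},c_f,\mathbf{w},T,\mathbf{v}$ at $t^n$, with $\Psi,P,C_f,Z$ at cell centers and $x$- (resp. $y$-) components of $\mathbf{U},\mathbf{W},\mathbf{V}$ at $(x_{i+1/2},y_j)$ (resp. $(x_i,y_{j+1/2})$); the normal components of $\mathbf{U},\mathbf{W},\mathbf{V}$ vanish on boundary edges; $P^0,C_f^0,Z^0,\Psi^0$ are the cell-center values of $p_0,c_{f0},T_0,\phi_0$. With $\overline{C}^{\,n}_f=\max\{0,\min\{C^n_f,1\}\}$, for $n=0,\dots,N-1$: $$[d_t\Psi]^{n+1}_{i,j}=\frac{\alpha k_ca_0}{\rho_s}\left(1-\frac{1}{1+k_s(Z^n_{i,j})/k_c}\right)\frac{1-\Psi^{n+1}_{i,j}}{1-\Psi^0_{i,j}}\overline{C}^{\,n}_{f,i,j},$$ $$\gamma[d_tP]^{n+1}_{i,j}+[d_t\Psi]^{n+1}_{i,j}+[D_xU^x]^{n+1}_{i,j}+[D_yU^y]^{n+1}_{i,j}=f^{n+1}_{i,j},$$ $$U^{x,n+1}_{i+1/2,j}=-\frac{K(\Pi_h\Psi^{n+1}_{i+1/2,j})}{\mu}[d_xP]^{n+1}_{i+1/2,j},\quad U^{y,n+1}_{i,j+1/2}=-\frac{K(\Pi_h\Psi^{n+1}_{i,j+1/2})}{\mu}[d_yP]^{n+1}_{i,j+1/2},$$ $$[d_t(\Psi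 C_f)]^{n+1}_{i,j}+[D_xW^x]^{n+1}_{i,j}+[D_yW^y]^{n+1}_{i,j}=k_ca_v(\Psi^{n+1}_{i,j})\left(\frac{1}{1+k_s(Z^n_{i,j})/k_c}-1\right)C^{n+1}_{f,i,j}+f_P^{n+1}C^{n+1}_{f,i,j}+f_I^{n+1}c_I^{n+1},$$ $$W^{x,n+1}_{i+1/2,j}=U^{x,n+1}_{i+1/2,j}\Pi_hC^{n+1}_{f,i+1/2,j}-\Pi_h\Psi^{n+1}_{i+1/2,j}D_{11}[d_xC_f]^{n+1}_{i+1/2,j},\quad W^{y,n+1}_{i,j+1/2}=U^{y,n+1}_{i,j+1/2}\Pi_hC^{n+1}_{f,i,j+1/2}-\Pi_h\Psi^{n+1}_{i,j+1/2}D_{22}[d_yC_f]^{n+1}_{i,j+1/2},$$ $$[d_t((\rho_s(1-\Psi)\theta_s+\rho_f\Psi\theta_f)Z)]^{n+1}_{i,j}+[D_xV^x]^{n+1}_{i,j}+[D_yV^y]^{n+1}_{i,j}=a_v(\Psi^{n+1}_{i,j})H_r(Z^n_{i,j})R(\overline{C}^{\,n+1}_{f,i,j},Z^n_{i,j}),$$ $$V^{x,n+1}_{i+1/2,j}=\rho_f\theta_fU^{x,n+1}_{i+1/2,j}\Pi_hZ^{n+1}_{i+1/2,j}-\lambda(\Pi_h\Psi^{n+1}_{i+1/2,j})[d_xZ]^{n+1}_{i+1/2,j},\quad V^{y,n+1}_{i,j+1/2}=\rho_f\theta_fU^{y,n+1}_{i,j+1/2}\Pi_hZ^{n+1}_{i,j+1/2}-\lambda(\Pi_h\Psi^{n+1}_{i,j+1/2})[d_yZ]^{n+1}_{i,j+1/2}.$$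 **Errors.** At the respective grid points: $E_p=P-p$, $E_{\mathbf{u}}=\mathbf{U}-\mathbf{u}$, $E_{c_f}=C_f-c_f$, $E_T=Z-T$, $E_\phi=\Psi-\phi$.
   Formalization: Proved for h, k and Δt below a threshold depending only on the data, the exact solution and Π_h, assuming 0≤c_f≤1 for the exact solution, f_P bounded and k_{s1}≥0; Π_h is linear, with boundedly many bounded weights along grid lines. Without the first three the bound can fail. *)

(* Defs.v *)
From Stdlib Require Export Reals Lra Lia.
From Coquelicot Require Export Coquelicot.
Open Scope R_scope.

(** * The continuous problem *)

(** Functions of [(x, y, t)]. *)
Definition field := R -> R -> R -> R.

Definition px (g : field) : field := fun x y t => Derive (fun s => g s y t) x.
Definition py (g : field) : field := fun x y t => Derive (fun s => g x s t) y.
Definition pt (g : field) : field := fun x y t => Derive (fun s => g x y s) t.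
Definition div2 (gx gy : field) : field := fun x y t => px gx x y t + py gy x y t.

(** [Cclass r g]: [g] is of class C^r on R^3.  A function is C^r up to the
    boundary of the box [Omega x J] exactly when it is the restriction of a C^r
    function on R^3 (Whitney), so the solution is represented by such an
    extension; nothing but its smoothness is required outside the box. *)
Fixpoint Cclass (r : nat) (g : field) : Prop :=
  match r with
  | O => forall x y t : R,
      continuous (fun q : R * R * R => g (fst (fst q)) (snd (fst q)) (snd q))
                 ((x, y), t)
  | S r' =>
      (forall x y t : R,
          ex_derive (fun s => g s y t) x /\
          ex_derive (fun s => g x s t) y /\
          ex_derive (fun s => g x y s) t) /\
      Cclass r' (px g) /\ Cclass r' (py g) /\ Cclass r' (pt g)
  end.

Definition Lipschitz (g : R -> R) : Prop :=
  exists L : R, forall a b : R, Rabs (g a - g b) <= L * Rabs (a - b).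

Record problem := Problem {
  Llx : R; Lrx : R; Lly : R; Lry : R;
  Qend : R;
  gamma : R; mu : R; kc : R; alpha : R; a0 : R; K0 : R;
  rho_s : R; rho_f : R; theta_s : R; theta_f : R;
  lambda_s : R; lambda_f : R;
  dmol : R;
  ks : R -> R; Hr : R -> R;
  fI : field; fP : field; cI : field;
  p0 : R -> R -> R; cf0 : R -> R -> R; phi0 : R -> R -> R; T0 : R -> R -> R
}.

Definition Omega (A : problem) (x y : R) : Prop :=
  Llx A < x < Lrx A /\ Lly A < y < Lry A.

Definition Omega_closure (A : problem) (x y : R) : Prop :=
  Llx A <= x <= Lrx A /\ Lly A <= y <= Lry A.

Definition D11 (A : problem) : R := dmol A.
Definition D22 (A : problem) : R := dmol A.

(** [perm] and [av] are K(phi) and a_v(phi); they depend on the point of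
    Omega through the initial porosity [f0] at that point. *)
Definition perm (A : problem) (f0 f : R) : R :=
  K0 A * (f / f0 * (f * (1 - f0) / (f0 * (1 - f))) ^ 2).

Definition av (A : problem) (f0 f : R) : R := a0 A * ((1 - f) / (1 - f0)).

Lemma av_perm (A : problem) (f0 f : R) :
  0 < K0 A -> 0 < f0 < 1 -> 0 < f < 1 ->
  av A f0 f = a0 A * (f / f0 * sqrt (K0 A * f / (perm A f0 f * f0))).
Proof.
intros HK [H1 H2] [H3 H4]; unfold av, perm; f_equal.
assert (Hq : 0 <= f0 * (1 - f) / (f * (1 - f0))).
{ apply Rlt_le, Rdiv_lt_0_compat; apply Rmult_lt_0_compat; lra. }
replace (K0 A * f / (K0 A * (f / f0 * (f * (1 - f0) / (f0 * (1 - f))) ^ 2) * f0))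
  with ((f0 * (1 - f) / (f * (1 - f0))) * (f0 * (1 - f) / (f * (1 - f0))))
  by (field; repeat split; lra).
rewrite sqrt_square by exact Hq.
field; repeat split; lra.
Qed.

Definition lambda (A : problem) (f : R) : R :=
  (1 - f) * lambda_s A + f * lambda_f A.

Definition heat_cap (A : problem) (f : R) : R :=
  rho_s A * (1 - f) * theta_s A + rho_f A * f * theta_f A.

Definition csurf (A : problem) (c T : R) : R := c / (1 + ks A T / kc A).

Definition Rreact (A : problem) (c T : R) : R := kc A * (c - csurf A c T).

Definition ftot (A : problem) : field := fun x y t => fI A x y t + fP A x y t.

Record standing_assumptions (A : problem) : Prop := {
  domain_nonempty : Llx A < Lrx A /\ Lly A < Lry A /\ 0 < Qend A;
  gamma_pos : 0 < gamma A;
  mu_pos : 0 < mu A;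
  kc_pos : 0 < kc A;
  alpha_pos : 0 < alpha A;
  a0_pos : 0 < a0 A;
  K0_pos : 0 < K0 A;
  rho_pos : 0 < rho_s A /\ 0 < rho_f A;
  theta_pos : 0 < theta_s A /\ 0 < theta_f A;
  lambda_pos : 0 < lambda_s A /\ 0 < lambda_f A;
  dmol_pos : 0 < dmol A;
  ks_lipschitz : Lipschitz (ks A);
  ks_bounds : exists ks1 ks2 : R, 0 <= ks1 /\ forall T : R, ks1 < ks A T < ks2;
  Hr_lipschitz : Lipschitz (Hr A);
  phi0_bounds : exists phi_lo phi_hi : R, 0 < phi_lo /\ phi_hi < 1 /\
    forall x y : R, Omega A x y -> phi_lo <= phi0 A x y <= phi_hi;
  fP_bounded : exists M : R, forall x y t : R,
    Omega A x y -> 0 < t <= Qend A -> Rabs (fP A x y t) <= M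
}.

Record state := State {
  phi : field; p : field; ux : field; uy : field; cf : field; Tf : field
}.

Definition smooth (r : nat) (S : state) : Prop :=
  Cclass r (phi S) /\ Cclass r (p S) /\ Cclass r (ux S) /\ Cclass r (uy S) /\
  Cclass r (cf S) /\ Cclass r (Tf S).

Record exact_solution (A : problem) (S : state) : Prop := {
  mass_eq : forall x y t : R, Omega A x y -> 0 < t <= Qend A ->
    gamma A * pt (p S) x y t + pt (phi S) x y t + div2 (ux S) (uy S) x y t
    = ftot A x y t;
  darcy_x : forall x y t : R, Omega A x y -> 0 < t <= Qend A ->
    ux S x y t = - (perm A (phi0 A x y) (phi S x y t) / mu A) * px (p S) x y t;
  darcy_y : forall x y t : R, Omega A x y -> 0 < t <= Qend A ->
    uy S x y t = - (perm A (phi0 A x y) (phi S x y t) / mu A) * py (p S) x y t;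
  acid_eq : forall x y t : R, Omega A x y -> 0 < t <= Qend A ->
    pt (fun x y t => phi S x y t * cf S x y t) x y t
    + div2 (fun x y t => ux S x y t * cf S x y t)
           (fun x y t => uy S x y t * cf S x y t) x y t
    - div2 (fun x y t => phi S x y t * D11 A * px (cf S) x y t)
           (fun x y t => phi S x y t * D22 A * py (cf S) x y t) x y t
    = kc A * av A (phi0 A x y) (phi S x y t)
        * (csurf A (cf S x y t) (Tf S x y t) - cf S x y t)
      + fP A x y t * cf S x y t + fI A x y t * cI A x y t;
  porosity_eq : forall x y t : R, Omega A x y -> 0 < t <= Qend A ->
    pt (phi S) x y t
    = Rreact A (cf S x y t) (Tf S x y t)
      * av A (phi0 A x y) (phi S x y t) * alpha A / rho_s A;
  heat_eq : forall x y t : R, Omega A x y -> 0 < t <= Qend A ->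
    pt (fun x y t => heat_cap A (phi S x y t) * Tf S x y t) x y t
    + div2 (fun x y t => rho_f A * theta_f A * ux S x y t * Tf S x y t)
           (fun x y t => rho_f A * theta_f A * uy S x y t * Tf S x y t) x y t
    = div2 (fun x y t => lambda A (phi S x y t) * px (Tf S) x y t)
           (fun x y t => lambda A (phi S x y t) * py (Tf S) x y t) x y t
      + av A (phi0 A x y) (phi S x y t) * Hr A (Tf S x y t)
        * Rreact A (cf S x y t) (Tf S x y t);
  no_flow_x : forall x y t : R,
    x = Llx A \/ x = Lrx A -> Lly A < y < Lry A -> 0 < t <= Qend A ->
    ux S x y t = 0 /\
    phi S x y t * D11 A * px (cf S) x y t = 0 /\
    lambda A (phi S x y t) * px (Tf S) x y t = 0;
  no_flow_y : forall x y t : R,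
    y = Lly A \/ y = Lry A -> Llx A < x < Lrx A -> 0 < t <= Qend A ->
    uy S x y t = 0 /\
    phi S x y t * D22 A * py (cf S) x y t = 0 /\
    lambda A (phi S x y t) * py (Tf S) x y t = 0;
  initial_data : forall x y : R, Omega A x y ->
    p S x y 0 = p0 A x y /\ cf S x y 0 = cf0 A x y /\
    phi S x y 0 = phi0 A x y /\ Tf S x y 0 = T0 A x y;
  (** [c_f] is a normalised concentration: it takes values in the interval onto
      which the scheme cuts off [C_f]. *)
  concentration_range : forall x y t : R, Omega A x y -> 0 <= t <= Qend A ->
    0 <= cf S x y t <= 1
}.

(** * The grid *)

(** Grid functions.  For cell-centre quantities [g i j] is g_{i,j}
    (1 <= i <= Nx, 1 <= j <= Ny); for x-edge quantities [g i j] is g_{i+1/2,j}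
    (0 <= i <= Nx); for y-edge quantities [g i j] is g_{i,j+1/2} (0 <= j <= Ny). *)
Definition gridfun := nat -> nat -> R.

Definition hx (A : problem) (Nx : nat) : R := (Lrx A - Llx A) / INR Nx.
Definition ky (A : problem) (Ny : nat) : R := (Lry A - Lly A) / INR Ny.
Definition dt (A : problem) (N : nat) : R := Qend A / INR N.

(** [xe i] is x_{i+1/2}, [xc i] is x_i; likewise in y. *)
Definition xe (A : problem) (Nx i : nat) : R := Llx A + INR i * hx A Nx.
Definition ye (A : problem) (Ny j : nat) : R := Lly A + INR j * ky A Ny.
Definition xc (A : problem) (Nx i : nat) : R := (xe A Nx (i - 1) + xe A Nx i) / 2.
Definition yc (A : problem) (Ny j : nat) : R := (ye A Ny (j - 1) + ye A Ny j) / 2.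
Definition tn (A : problem) (N n : nat) : R := INR n * dt A N.

Definition at_centers (A : problem) (Nx Ny : nat) (g : R -> R -> R) : gridfun :=
  fun i j => g (xc A Nx i) (yc A Ny j).
Definition at_xedges (A : problem) (Nx Ny : nat) (g : R -> R -> R) : gridfun :=
  fun i j => g (xe A Nx i) (yc A Ny j).
Definition at_yedges (A : problem) (Nx Ny : nat) (g : R -> R -> R) : gridfun :=
  fun i j => g (xc A Nx i) (ye A Ny j).

(** The lower-case differences map centres to edges, the upper-case ones edges to
    centres.  [dtm g n] is [d_t g]^{n}, for n >= 1. *)
Definition dxm (h : R) (g : gridfun) : gridfun := fun i j => (g (S i) j - g i j) / h.
Definition dym (k : R) (g : gridfun) : gridfun := fun i j => (g i (S j) - g i j) / k.
Definition Dxm (h : R) (g : gridfun) : gridfun :=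
  fun i j => (g i j - g (i - 1)%nat j) / h.
Definition Dym (k : R) (g : gridfun) : gridfun :=
  fun i j => (g i j - g i (j - 1)%nat) / k.
Definition dtm (tau : R) (g : nat -> gridfun) (n : nat) : gridfun :=
  fun i j => (g n i j - g (n - 1)%nat i j) / tau.

(** Squared norms; [sum_n_m] over an empty range is 0. *)
Definition normM2 (A : problem) (Nx Ny : nat) (g : gridfun) : R :=
  sum_n_m (fun i => sum_n_m (fun j =>
    hx A Nx * ky A Ny * (g i j) ^ 2) 1 Ny) 1 Nx.
Definition normx2 (A : problem) (Nx Ny : nat) (g : gridfun) : R :=
  sum_n_m (fun i => sum_n_m (fun j =>
    hx A Nx * ky A Ny * (g i j) ^ 2) 1 Ny) 1 (Nx - 1).
Definition normy2 (A : problem) (Nx Ny : nat) (g : gridfun) : R :=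
  sum_n_m (fun i => sum_n_m (fun j =>
    hx A Nx * ky A Ny * (g i j) ^ 2) 1 (Ny - 1)) 1 Nx.
Definition normTM2 (A : problem) (Nx Ny : nat) (gx gy : gridfun) : R :=
  normx2 A Nx Ny gx + normy2 A Nx Ny gy.

(** * The interpolation operator *)

(** One operator per grid [Nx], [Ny], with its values on x-edges and y-edges.
    Values on boundary edges are never used. *)
Record interp := Interp {
  Pix : nat -> nat -> gridfun -> gridfun;
  Piy : nat -> nat -> gridfun -> gridfun
}.

(** The value at an edge is a linear combination, with bounded weights, of the
    values at the [s] nearest centres (as far as they exist) on either side of
    the edge along the grid line through it; [s] and the bound on the weights do
    not depend on the grid.  Weights may be negative, as for Lagrange
    interpolation of higher degree. *)
Definition local_linear (P : interp) : Prop :=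
  exists (s : nat) (M : R) (wx wy : nat -> nat -> nat -> nat -> nat -> R),
    (forall Nx Ny i j l : nat,
        Rabs (wx Nx Ny i j l) <= M /\ Rabs (wy Nx Ny i j l) <= M) /\
    (forall (Nx Ny i j : nat) (g : gridfun),
        (1 <= i < Nx)%nat -> (1 <= j <= Ny)%nat ->
        Pix P Nx Ny g i j =
        sum_n_m (fun l => wx Nx Ny i j l * g l j)
                (Nat.max 1 (S i - s)) (Nat.min Nx (i + s))) /\
    (forall (Nx Ny i j : nat) (g : gridfun),
        (1 <= i <= Nx)%nat -> (1 <= j < Ny)%nat ->
        Piy P Nx Ny g i j =
        sum_n_m (fun l => wy Nx Ny i j l * g i l)
                (Nat.max 1 (S j - s)) (Nat.min Ny (j + s))).

(** Error at most C (h^2 + k^2) times a bound on the second derivatives. *)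
Definition second_order (A : problem) (P : interp) : Prop :=
  exists C : R, forall (g : R -> R -> R) (B : R),
    let G : field := fun x y _ => g x y in
    Cclass 2 G ->
    (forall x y : R, Omega_closure A x y ->
        Rabs (px (px G) x y 0) <= B /\ Rabs (px (py G) x y 0) <= B /\
        Rabs (py (py G) x y 0) <= B) ->
    (forall Nx Ny i j : nat, (1 <= i < Nx)%nat -> (1 <= j <= Ny)%nat ->
        Rabs (Pix P Nx Ny (at_centers A Nx Ny g) i j - at_xedges A Nx Ny g i j)
        <= C * B * (hx A Nx ^ 2 + ky A Ny ^ 2)) /\
    (forall Nx Ny i j : nat, (1 <= i <= Nx)%nat -> (1 <= j < Ny)%nat ->
        Rabs (Piy P Nx Ny (at_centers A Nx Ny g) i j - at_yedges A Nx Ny g i j)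
        <= C * B * (hx A Nx ^ 2 + ky A Ny ^ 2)).

Definition interpolation_operator (A : problem) (P : interp) : Prop :=
  local_linear P /\ second_order A P.

(** * The fully discrete scheme *)

(** The first argument of each component is the time level.  Levels 0 of the
    fluxes are not used. *)
Record discrete := Discrete {
  Psi : nat -> gridfun; Pd : nat -> gridfun;
  Ux : nat -> gridfun; Uy : nat -> gridfun;
  Cf : nat -> gridfun; Wx : nat -> gridfun; Wy : nat -> gridfun;
  Z : nat -> gridfun; Vx : nat -> gridfun; Vy : nat -> gridfun
}.

Definition cutoff (c : R) : R := Rmax 0 (Rmin c 1).

Definition is_cell (Nx Ny i j : nat) : Prop := (1 <= i <= Nx)%nat /\ (1 <= j <= Ny)%nat.
Definition is_xedge (Nx Ny i j : nat) : Prop := (1 <= i < Nx)%nat /\ (1 <= j <= Ny)%nat.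
Definition is_yedge (Nx Ny i j : nat) : Prop := (1 <= i <= Nx)%nat /\ (1 <= j < Ny)%nat.

Definition sample (A : problem) (Nx Ny N : nat) (g : field) (n : nat) : gridfun :=
  at_centers A Nx Ny (fun x y => g x y (tn A N n)).

Record scheme (A : problem) (P : interp) (Nx Ny N : nat) (X : discrete) : Prop := {
  sch_init : forall i j : nat, is_cell Nx Ny i j ->
    Pd X 0%nat i j = at_centers A Nx Ny (p0 A) i j /\
    Cf X 0%nat i j = at_centers A Nx Ny (cf0 A) i j /\
    Z X 0%nat i j = at_centers A Nx Ny (T0 A) i j /\
    Psi X 0%nat i j = at_centers A Nx Ny (phi0 A) i j;
  sch_bdry_x : forall n i j : nat, (n < N)%nat ->
    i = 0%nat \/ i = Nx -> (1 <= j <= Ny)%nat ->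
    Ux X (S n) i j = 0 /\ Wx X (S n) i j = 0 /\ Vx X (S n) i j = 0;
  sch_bdry_y : forall n i j : nat, (n < N)%nat ->
    j = 0%nat \/ j = Ny -> (1 <= i <= Nx)%nat ->
    Uy X (S n) i j = 0 /\ Wy X (S n) i j = 0 /\ Vy X (S n) i j = 0;
  sch_porosity : forall n i j : nat, (n < N)%nat -> is_cell Nx Ny i j ->
    dtm (dt A N) (Psi X) (S n) i j
    = alpha A * kc A * a0 A / rho_s A
      * (1 - 1 / (1 + ks A (Z X n i j) / kc A))
      * ((1 - Psi X (S n) i j) / (1 - Psi X 0%nat i j))
      * cutoff (Cf X n i j);
  sch_mass : forall n i j : nat, (n < N)%nat -> is_cell Nx Ny i j ->
    gamma A * dtm (dt A N) (Pd X) (S n) i j + dtm (dt A N) (Psi X) (S n) i j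
    + Dxm (hx A Nx) (Ux X (S n)) i j + Dym (ky A Ny) (Uy X (S n)) i j
    = sample A Nx Ny N (ftot A) (S n) i j;
  sch_darcy_x : forall n i j : nat, (n < N)%nat -> is_xedge Nx Ny i j ->
    Ux X (S n) i j
    = - (perm A (at_xedges A Nx Ny (phi0 A) i j) (Pix P Nx Ny (Psi X (S n)) i j) / mu A)
      * dxm (hx A Nx) (Pd X (S n)) i j;
  sch_darcy_y : forall n i j : nat, (n < N)%nat -> is_yedge Nx Ny i j ->
    Uy X (S n) i j
    = - (perm A (at_yedges A Nx Ny (phi0 A) i j) (Piy P Nx Ny (Psi X (S n)) i j) / mu A)
      * dym (ky A Ny) (Pd X (S n)) i j;
  sch_acid : forall n i j : nat, (n < N)%nat -> is_cell Nx Ny i j ->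
    dtm (dt A N) (fun m i j => Psi X m i j * Cf X m i j) (S n) i j
    + Dxm (hx A Nx) (Wx X (S n)) i j + Dym (ky A Ny) (Wy X (S n)) i j
    = kc A * av A (at_centers A Nx Ny (phi0 A) i j) (Psi X (S n) i j)
        * (1 / (1 + ks A (Z X n i j) / kc A) - 1) * Cf X (S n) i j
      + sample A Nx Ny N (fP A) (S n) i j * Cf X (S n) i j
      + sample A Nx Ny N (fI A) (S n) i j * sample A Nx Ny N (cI A) (S n) i j;
  sch_W_x : forall n i j : nat, (n < N)%nat -> is_xedge Nx Ny i j ->
    Wx X (S n) i j
    = Ux X (S n) i j * Pix P Nx Ny (Cf X (S n)) i j
      - Pix P Nx Ny (Psi X (S n)) i j * D11 A * dxm (hx A Nx) (Cf X (S n)) i j;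
  sch_W_y : forall n i j : nat, (n < N)%nat -> is_yedge Nx Ny i j ->
    Wy X (S n) i j
    = Uy X (S n) i j * Piy P Nx Ny (Cf X (S n)) i j
      - Piy P Nx Ny (Psi X (S n)) i j * D22 A * dym (ky A Ny) (Cf X (S n)) i j;
  sch_heat : forall n i j : nat, (n < N)%nat -> is_cell Nx Ny i j ->
    dtm (dt A N) (fun m i j => heat_cap A (Psi X m i j) * Z X m i j) (S n) i j
    + Dxm (hx A Nx) (Vx X (S n)) i j + Dym (ky A Ny) (Vy X (S n)) i j
    = av A (at_centers A Nx Ny (phi0 A) i j) (Psi X (S n) i j) * Hr A (Z X n i j)
      * Rreact A (cutoff (Cf X (S n) i j)) (Z X n i j);
  sch_V_x : forall n i j : nat, (n < N)%nat -> is_xedge Nx Ny i j ->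
    Vx X (S n) i j
    = rho_f A * theta_f A * Ux X (S n) i j * Pix P Nx Ny (Z X (S n)) i j
      - lambda A (Pix P Nx Ny (Psi X (S n)) i j) * dxm (hx A Nx) (Z X (S n)) i j;
  sch_V_y : forall n i j : nat, (n < N)%nat -> is_yedge Nx Ny i j ->
    Vy X (S n) i j
    = rho_f A * theta_f A * Uy X (S n) i j * Piy P Nx Ny (Z X (S n)) i j
      - lambda A (Piy P Nx Ny (Psi X (S n)) i j) * dym (ky A Ny) (Z X (S n)) i j
}.


(** * Errors at time level [n] *)

Definition err_center (A : problem) (Nx Ny N : nat)
    (G : nat -> gridfun) (g : field) (n : nat) : gridfun :=
  fun i j => G n i j - sample A Nx Ny N g n i j.
Definition err_xedge (A : problem) (Nx Ny N : nat)
    (G : nat -> gridfun) (g : field) (n : nat) : gridfun :=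
  fun i j => G n i j - at_xedges A Nx Ny (fun x y => g x y (tn A N n)) i j.
Definition err_yedge (A : problem) (Nx Ny N : nat)
    (G : nat -> gridfun) (g : field) (n : nat) : gridfun :=
  fun i j => G n i j - at_yedges A Nx Ny (fun x y => g x y (tn A N n)) i j.

(* Main.v *)
Require Import Defs.
From Stdlib Require Import Arith Bool Classical ClassicalEpsilon FunctionalExtensionality List.

(** The errors are estimated in a chain of energy inequalities, which a bootstrap
    over the time levels closes; the rate is the sum [eps] of the time step and of
    the squares of the mesh sizes, and what is proved is that the squared errors are
    at most a constant times [eps ^ 2].

    Porosity.  At each cell the solid fraction solves the implicit Euler scheme of
    [v' = - s v] with a bounded non-negative rate, so the discrete porosity stays in a
    fixed compact part of the interval from 0 to 1, and its error is driven by the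
    errors of concentration and temperature at the preceding level
    ([porosity_range], [porosity_error]).

    Flow.  Darcy's law is used in the form [rho U = - dP], with the resistance [rho]
    of the discrete porosity.  Testing the mass balance with the time increment of the
    pressure error turns the flux term into the increment of the energy of the velocity
    error; the consistency error of Darcy's law enters through its time increment only,
    and the pseudo-compressibility leaves the square of the pressure rate as dissipation
    ([pressure_step], [flow_step]).

    Concentration and temperature.  Both fit one scheme with an affine capacity and an
    affine diffusivity ([transport_step], [transported_step]).  The test function is the
    error itself.  Three terms are delicate.  Convection of the error by the two-point
    average is skew-symmetric up to the discrete divergence of [U].  By the mass balance
    this divergence is bounded up to the pressure rate, and the product of the pressure
    rate with the squared error is handled by the discrete Ladyzhenskaya inequality
    ([ladyzhenskaya]).  The difference between the interpolation of high order, whose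
    weights may be negative, and the two-point average is absorbed by diffusion, because
    the velocity times the mesh size is small ([velocity_small]).

    Both [velocity_small] and the fact that the interpolated porosity stays in the
    interval where the coefficients are regular ([range_of_dissipation]) rest on
    [neighbour_oscillation]: neighbouring values of a grid function differ by no more
    than its discrete H^1 seminorm, with a constant that is independent of the ratio of
    the mesh sizes.  Hence the mesh sizes and the time step need no mutual relation.

    The last two facts hold as long as the errors of pressure, concentration and
    temperature are small, which the estimates themselves provide: [bootstrap] runs an
    induction over the time levels in which crude bounds for the new level put the
    smallness conditions in force, and the discrete Gronwall inequality then gives a
    constant that does not depend on them. *)

(** Generic lemmas on sums return equations between elements of an abstract monoid
    carrier, which [ring] does not recognise as real numbers. *)
Ltac rring := match goal with |- @eq _ ?a ?b => change (@eq R a b) end; ring.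

(** * Finite sums *)

Definition S2 (a b : nat) (F : gridfun) : R :=
  sum_n_m (fun i => sum_n_m (fun j => F i j) 1 b) 1 a.

Lemma rsum_plus (u v : nat -> R) n m :
  sum_n_m (fun k => u k + v k) n m = sum_n_m u n m + sum_n_m v n m.
Proof. exact (sum_n_m_plus u v n m). Qed.

Lemma rsum_scal (a : R) (u : nat -> R) n m :
  sum_n_m (fun k => a * u k) n m = a * sum_n_m u n m.
Proof. exact (sum_n_m_mult_l a u n m). Qed.

Lemma rsum_ext (u v : nat -> R) n m :
  (forall k, (n <= k <= m)%nat -> u k = v k) -> sum_n_m u n m = sum_n_m v n m.
Proof. exact (sum_n_m_ext_loc u v n m). Qed.

Lemma rsum_empty (u : nat -> R) n m : (m < n)%nat -> sum_n_m u n m = 0.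
Proof. exact (sum_n_m_zero u n m). Qed.

Lemma rsum_last (u : nat -> R) n m : (n <= S m)%nat ->
  sum_n_m u n (S m) = sum_n_m u n m + u (S m).
Proof. exact (sum_n_Sm u n m). Qed.

Lemma rsum_le (u v : nat -> R) n m :
  (forall k, (n <= k <= m)%nat -> u k <= v k) -> sum_n_m u n m <= sum_n_m v n m.
Proof.
induction m as [|m IH]; intros H.
- destruct n as [|n].
  + rewrite !sum_n_n; apply H; lia.
  + rewrite !rsum_empty by lia; lra.
- destruct (le_lt_dec n (S m)) as [L|L].
  + rewrite !rsum_last by lia; apply Rplus_le_compat.
    * apply IH; intros k Hk; apply H; lia.
    * apply H; lia.
  + rewrite !rsum_empty by lia; lra.
Qed.

Lemma rsum_zero n m : sum_n_m (fun _ => 0) n m = 0.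
Proof. exact (sum_n_m_const_zero (G := R_AbelianMonoid) n m). Qed.

Lemma rsum_ge0 (u : nat -> R) n m :
  (forall k, (n <= k <= m)%nat -> 0 <= u k) -> 0 <= sum_n_m u n m.
Proof.
intros H; rewrite <- (rsum_zero n m); apply rsum_le; exact H.
Qed.

Lemma rsum_abs (u : nat -> R) n m :
  Rabs (sum_n_m u n m) <= sum_n_m (fun k => Rabs (u k)) n m.
Proof. exact (norm_sum_n_m (K := R_AbsRing) u n m). Qed.

Lemma rsum_subrange (u : nat -> R) n m n' m' :
  (n <= n')%nat -> (m' <= m)%nat -> (forall k, (n <= k <= m)%nat -> 0 <= u k) ->
  sum_n_m u n' m' <= sum_n_m u n m.
Proof.
intros H1 H2 H.
destruct (le_lt_dec n' m') as [L|L].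
2:{ rewrite rsum_empty by lia; apply rsum_ge0; exact H. }
rewrite (sum_n_m_Chasles u n m' m) by lia.
assert (0 <= sum_n_m u (S m') m) by (apply rsum_ge0; intros; apply H; lia).
destruct n' as [|n'].
- replace n with 0%nat by lia; change (@plus _) with Rplus; lra.
- rewrite (sum_n_m_Chasles u n n' m') by lia.
  assert (0 <= sum_n_m u n n') by (apply rsum_ge0; intros; apply H; lia).
  change (@plus _) with Rplus; lra.
Qed.

Lemma rsum_term (u : nat -> R) n m k :
  (forall l, (n <= l <= m)%nat -> 0 <= u l) -> (n <= k <= m)%nat ->
  u k <= sum_n_m u n m.
Proof.
intros H Hk; rewrite <- (sum_n_n (G := R_AbelianMonoid) u k).
apply rsum_subrange; [lia|lia|exact H].
Qed.

Lemma rsum_swap (F : nat -> nat -> R) a b c d :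
  sum_n_m (fun i => sum_n_m (fun j => F i j) a b) c d
  = sum_n_m (fun j => sum_n_m (fun i => F i j) c d) a b.
Proof.
induction d as [|d IH].
- destruct c as [|c].
  + rewrite sum_n_n; apply rsum_ext; intros; rewrite sum_n_n; reflexivity.
  + rewrite rsum_empty by lia.
    rewrite <- (rsum_zero a b); apply rsum_ext; intros; now rewrite rsum_empty by lia.
- destruct (le_lt_dec c (S d)) as [L|L].
  + rewrite rsum_last by lia; rewrite IH, <- rsum_plus.
    apply rsum_ext; intros; now rewrite rsum_last by lia.
  + rewrite rsum_empty by lia.
    rewrite <- (rsum_zero a b); apply rsum_ext; intros; now rewrite rsum_empty by lia.
Qed.

Lemma rsum_telescope (g : nat -> R) a b : (a <= b)%nat ->
  @eq R (sum_n_m (fun l => g (S l) - g l) a (b - 1)) (g b - g a) \/ a = b.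
Proof.
induction b as [|b IH]; intros H; [right; lia|].
destruct (Nat.eq_dec a (S b)) as [->|N]; [now right|left].
replace (S b - 1)%nat with b by lia.
destruct (Nat.eq_dec a b) as [->|N'].
- now rewrite sum_n_n.
- destruct (IH ltac:(lia)) as [E|E]; [|lia].
  destruct b as [|b]; [lia|].
  rewrite rsum_last by lia.
  replace (S b - 1)%nat with b in E by lia; rewrite E; rring.
Qed.

(** The oscillation over a range is at most the total variation. *)
Lemma osc_le_variation (g : nat -> R) p r a b :
  (p <= a <= r)%nat -> (p <= b <= r)%nat ->
  Rabs (g a - g b) <= sum_n_m (fun l => Rabs (g (S l) - g l)) p (r - 1).
Proof.
assert (H : forall a b, (p <= a)%nat -> (a <= b)%nat -> (b <= r)%nat ->
  Rabs (g b - g a) <= sum_n_m (fun l => Rabs (g (S l) - g l)) p (r - 1)).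
{ intros a' b' H1 H2 H3; destruct (rsum_telescope g a' b' H2) as [E| ->].
  - rewrite <- E; eapply Rle_trans; [apply rsum_abs|].
    apply rsum_subrange; try lia; intros; apply Rabs_pos.
  - rewrite Rminus_diag, Rabs_R0; apply rsum_ge0; intros; apply Rabs_pos. }
intros Ha Hb; destruct (le_lt_dec a b) as [L|L].
- rewrite Rabs_minus_sym; apply H; lia.
- apply H; lia.
Qed.

Lemma quadratic_discriminant (a b c : R) :
  (forall t : R, 0 <= a - 2 * t * b + t ^ 2 * c) -> b ^ 2 <= a * c.
Proof.
intros H.
destruct (Req_dec c 0) as [->|Hc].
- destruct (Req_dec b 0) as [->|Hb]; [lra|exfalso].
  specialize (H ((a + 1) / (2 * b))).
  replace (2 * ((a + 1) / (2 * b)) * b) with (a + 1) in H by (field; lra); lra.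
- assert (0 < c).
  { destruct (Rlt_le_dec 0 c) as [|Hn]; [assumption|exfalso].
    assert (Hn' : c < 0) by lra.
    pose (t := (1 + Rabs a + 2 * Rabs b) / - c + 1).
    assert (Ht : t * (- c) = 1 + Rabs a + 2 * Rabs b - c) by (unfold t; field; lra).
    assert (Ht1 : 1 <= t).
    { unfold t; assert (0 <= (1 + Rabs a + 2 * Rabs b) / - c).
      { apply Rdiv_le_0_compat; [|lra]. generalize (Rabs_pos a) (Rabs_pos b); lra. }
      lra. }
    specialize (H t).
    assert (a <= Rabs a) by apply Rle_abs.
    assert (- b <= Rabs b) by (rewrite <- Rabs_Ropp; apply Rle_abs).
    assert (t ^ 2 * c = - t * (t * - c)) by rring.
    rewrite H2, Ht in H. generalize (Rabs_pos a) (Rabs_pos b); intros; nra. }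
  specialize (H (b / c)).
  replace (a - 2 * (b / c) * b + (b / c) ^ 2 * c) with (a - b ^ 2 / c) in H by (field; lra).
  assert (b ^ 2 = (b ^ 2 / c) * c) by (field; lra).
  nra.
Qed.

Lemma rsum_CS (u v : nat -> R) n m :
  (sum_n_m (fun k => u k * v k) n m) ^ 2
  <= sum_n_m (fun k => (u k) ^ 2) n m * sum_n_m (fun k => (v k) ^ 2) n m.
Proof.
apply quadratic_discriminant; intros t.
replace (_ - _ + _) with (sum_n_m (fun k => (u k - t * v k) ^ 2) n m).
- apply rsum_ge0; intros; apply pow2_ge_0.
- rewrite (rsum_ext _ (fun k => (u k) ^ 2 + ((- 2 * t) * (u k * v k) + t ^ 2 * (v k) ^ 2)))
    by (intros; rring).
  rewrite !rsum_plus, !rsum_scal; rring.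
Qed.

Lemma rsum_sq_le (u : nat -> R) n m :
  (sum_n_m u n m) ^ 2 <= INR (S m - n) * sum_n_m (fun k => (u k) ^ 2) n m.
Proof.
rewrite (rsum_ext u (fun k => 1 * u k)) by (intros; rring).
eapply Rle_trans; [apply rsum_CS|].
rewrite (rsum_ext (fun _ => 1 ^ 2) (fun _ => 1)) by (intros; rring).
rewrite sum_n_m_const; apply Req_le.
rewrite Rmult_1_r; f_equal; apply rsum_ext; intros; rring.
Qed.

(** ** Double sums *)

Lemma S2_ext a b F G :
  (forall i j, (1 <= i <= a)%nat -> (1 <= j <= b)%nat -> F i j = G i j) ->
  S2 a b F = S2 a b G.
Proof. intros H; apply rsum_ext; intros; apply rsum_ext; intros; now apply H. Qed.

Lemma S2_le a b F G :
  (forall i j, (1 <= i <= a)%nat -> (1 <= j <= b)%nat -> F i j <= G i j) ->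
  S2 a b F <= S2 a b G.
Proof. intros H; apply rsum_le; intros; apply rsum_le; intros; now apply H. Qed.

Lemma S2_plus a b F G :
  S2 a b (fun i j => F i j + G i j) = S2 a b F + S2 a b G.
Proof.
unfold S2; rewrite <- rsum_plus; apply rsum_ext; intros; apply rsum_plus.
Qed.

Lemma S2_scal a b c F : S2 a b (fun i j => c * F i j) = c * S2 a b F.
Proof.
unfold S2; rewrite <- rsum_scal; apply rsum_ext; intros; apply rsum_scal.
Qed.

Lemma S2_opp a b F : S2 a b (fun i j => - F i j) = - S2 a b F.
Proof.
rewrite (S2_ext a b _ (fun i j => (-1) * F i j)) by (intros; rring).
rewrite S2_scal; rring.
Qed.

Lemma S2_minus a b F G :
  S2 a b (fun i j => F i j - G i j) = S2 a b F - S2 a b G.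
Proof. unfold Rminus; now rewrite S2_plus, S2_opp. Qed.

Lemma S2_ge0 a b F :
  (forall i j, (1 <= i <= a)%nat -> (1 <= j <= b)%nat -> 0 <= F i j) -> 0 <= S2 a b F.
Proof. intros H; apply rsum_ge0; intros; apply rsum_ge0; intros; now apply H. Qed.

Lemma S2_swap a b F : S2 a b F = S2 b a (fun i j => F j i).
Proof. apply rsum_swap. Qed.

Lemma S2_const a b c : S2 a b (fun _ _ => c) = INR a * INR b * c.
Proof.
unfold S2; rewrite !sum_n_m_const.
replace (S a - 1)%nat with a by lia; replace (S b - 1)%nat with b by lia; rring.
Qed.

Lemma S2_CS a b F G :
  (S2 a b (fun i j => F i j * G i j)) ^ 2
  <= S2 a b (fun i j => (F i j) ^ 2) * S2 a b (fun i j => (G i j) ^ 2).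
Proof.
apply quadratic_discriminant; intros t.
replace (_ - _ + _) with (S2 a b (fun i j => (F i j - t * G i j) ^ 2)).
- apply S2_ge0; intros; apply pow2_ge_0.
- rewrite (S2_ext _ _ _ (fun i j => (F i j) ^ 2
     + ((- 2 * t) * (F i j * G i j) + t ^ 2 * (G i j) ^ 2))) by (intros; rring).
  rewrite !S2_plus, !S2_scal; rring.
Qed.

(** ** Summation by parts *)

Lemma sum_by_parts (V g : nat -> R) n : (1 <= n)%nat ->
  V 0%nat = 0 -> V n = 0 ->
  sum_n_m (fun i => (V i - V (i - 1)%nat) * g i) 1 n
  = - sum_n_m (fun i => V i * (g (S i) - g i)) 1 (n - 1).
Proof.
intros Hn H0 Hm.
assert (E : forall m, (1 <= m)%nat ->
  sum_n_m (fun i => (V i - V (i - 1)%nat) * g i) 1 m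
  = V m * g m - sum_n_m (fun i => V i * (g (S i) - g i)) 1 (m - 1)).
{ induction m as [|m IH]; intros Hm'; [lia|].
  destruct m as [|m].
  - rewrite sum_n_n, (rsum_empty _ 1 (1 - 1)) by lia.
    simpl Nat.sub; rewrite H0; rring.
  - rewrite rsum_last by lia; rewrite IH by lia.
    replace (S (S m) - 1)%nat with (S m) by lia.
    replace (S m - 1)%nat with m by lia.
    rewrite (rsum_last (fun i => V i * _) 1 m) by lia; rring. }
rewrite E, Hm by lia; rring.
Qed.

Lemma S2_by_parts_x Nx Ny h V g : (1 <= Nx)%nat ->
  (forall j, (1 <= j <= Ny)%nat -> V 0%nat j = 0 /\ V Nx j = 0) ->
  S2 Nx Ny (fun i j => Dxm h V i j * g i j)
  = - S2 (Nx - 1) Ny (fun i j => V i j * dxm h g i j).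
Proof.
intros HN HV; unfold S2.
rewrite rsum_swap, (rsum_swap _ 1 Ny 1 (Nx - 1)).
rewrite (rsum_ext _ (fun j => (-1) *
  sum_n_m (fun i => V i j * dxm h g i j) 1 (Nx - 1))).
{ rewrite rsum_scal; rring. }
intros j Hj; destruct (HV j Hj) as [V0 V1].
unfold Dxm, dxm, Rdiv.
rewrite (rsum_ext _ (fun i => / h * ((V i j - V (i - 1)%nat j) * g i j))) by (intros; rring).
rewrite (rsum_ext (fun i => V i j * _) (fun i => / h * (V i j * (g (S i) j - g i j))))
  by (intros; rring).
rewrite !rsum_scal, (sum_by_parts (fun i => V i j) (fun i => g i j)) by assumption.
rring.
Qed.

Lemma S2_by_parts_y Nx Ny k V g : (1 <= Ny)%nat ->
  (forall i, (1 <= i <= Nx)%nat -> V i 0%nat = 0 /\ V i Ny = 0) ->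
  S2 Nx Ny (fun i j => Dym k V i j * g i j)
  = - S2 Nx (Ny - 1) (fun i j => V i j * dym k g i j).
Proof.
intros HN HV; rewrite S2_swap, (S2_swap Nx (Ny - 1)).
exact (S2_by_parts_x Ny Nx k (fun i j => V j i) (fun i j => g j i) HN HV).
Qed.

Lemma rsum_restrict (u : nat -> R) p q n : (1 <= p)%nat ->
  @eq R (sum_n_m (fun l => if (p <=? l)%nat && (l <=? q)%nat then u l else 0) 1 n)
  (sum_n_m u p (Nat.min q n)).
Proof.
intros Hp; induction n as [|n IH].
- rewrite !rsum_empty by lia; reflexivity.
- rewrite rsum_last by lia; rewrite IH.
  destruct (Nat.leb_spec p (S n)), (Nat.leb_spec (S n) q); simpl.
  + replace (Nat.min q (S n)) with (S n) by lia.
    replace (Nat.min q n) with n by lia.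
    rewrite rsum_last by lia; reflexivity.
  + replace (Nat.min q (S n)) with (Nat.min q n) by lia; rring.
  + rewrite !rsum_empty by lia; rring.
  + rewrite !rsum_empty by lia; rring.
Qed.

(** Each index lies in at most [2 * s] of the windows [S i - s .. i + s]. *)
Lemma window_sum (G : nat -> R) s m n :
  (forall l, (1 <= l <= n)%nat -> 0 <= G l) ->
  sum_n_m (fun i => sum_n_m G (Nat.max 1 (S i - s)) (Nat.min n (i + s))) 1 m
  <= 2 * INR s * sum_n_m G 1 n.
Proof.
intros HG.
rewrite (rsum_ext _ (fun i => sum_n_m (fun l =>
  if (Nat.max 1 (S i - s) <=? l)%nat && (l <=? i + s)%nat then G l else 0) 1 n)).
2:{ intros i Hi; rewrite rsum_restrict by lia; f_equal; lia. }
rewrite rsum_swap, <- rsum_scal; apply rsum_le; intros l Hl.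
rewrite (rsum_ext _ (fun i => G l *
  (if (Nat.max 1 (l - s) <=? i)%nat && (i <=? l + s - 1)%nat then 1 else 0))).
2:{ intros i Hi.
  destruct (Nat.leb_spec (Nat.max 1 (S i - s)) l), (Nat.leb_spec l (i + s)),
    (Nat.leb_spec (Nat.max 1 (l - s)) i), (Nat.leb_spec i (l + s - 1));
  simpl; try rring; lia. }
rewrite rsum_scal, rsum_restrict by lia.
rewrite sum_n_m_const, Rmult_1_r, (Rmult_comm (2 * INR s)).
apply Rmult_le_compat_l; [now apply HG|].
change 2 with (INR 2); rewrite <- mult_INR; apply le_INR; lia.
Qed.

Lemma window_size s i n :
  INR (S (Nat.min n (i + s)) - Nat.max 1 (S i - s)) <= 2 * INR s.
Proof. change 2 with (INR 2); rewrite <- mult_INR; apply le_INR; lia. Qed.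

(** * Interpolation along grid lines *)

(** The properties of an interpolation operator from cells to x-edges on which
    the stability analysis rests.  [si_osc] and [si_sup] say that the interpolated
    value differs from the two-point average by differences of neighbours only. *)
Record stable_interp (K : R) (Nx Ny : nat) (Pi : gridfun -> gridfun) : Prop := {
  si_lin : forall (a : R) (g1 g2 : gridfun) i j, is_xedge Nx Ny i j ->
    Pi (fun i j => g1 i j + a * g2 i j) i j = Pi g1 i j + a * Pi g2 i j;
  si_L2 : forall g : gridfun,
    S2 (Nx - 1) Ny (fun i j => (Pi g i j) ^ 2) <= K * S2 Nx Ny (fun i j => (g i j) ^ 2);
  si_osc : forall g : gridfun,
    S2 (Nx - 1) Ny (fun i j => (Pi g i j - (g i j + g (S i) j) / 2) ^ 2)
    <= K * S2 (Nx - 1) Ny (fun i j => (g (S i) j - g i j) ^ 2);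
  si_sup : forall (g : gridfun) (d : R) j, (1 <= j <= Ny)%nat ->
    (forall i, (1 <= i < Nx)%nat -> Rabs (g (S i) j - g i j) <= d) ->
    forall i, (1 <= i < Nx)%nat ->
      Rabs (Pi g i j - (g i j + g (S i) j) / 2) <= K * d
}.

Lemma Rabs_le_sq a b : Rabs a <= b -> a ^ 2 <= b ^ 2.
Proof. intros H; rewrite <- (pow2_abs a); apply pow_incr; split; [apply Rabs_pos|exact H]. Qed.

(** An operator whose values are bounded combinations of nearby values, and which
    reproduces constants, is stable: subtracting the average of the two neighbours turns
    the remaining combination into one of differences of neighbours.  The weights need
    not be positive. *)
Lemma weighted_sum_stable (s : nat) (M : R) (w : nat -> nat -> nat -> R)
    (Nx Ny : nat) (Pi : gridfun -> gridfun) :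
  (forall i j l, Rabs (w i j l) <= M) ->
  (forall (g : gridfun) i j, is_xedge Nx Ny i j ->
     Pi g i j = sum_n_m (fun l => w i j l * g l j)
                  (Nat.max 1 (S i - s)) (Nat.min Nx (i + s))) ->
  (forall i j, is_xedge Nx Ny i j -> Pi (fun _ _ => 1) i j = 1) ->
  stable_interp ((2 * INR s * M) ^ 2 * (1 + (2 * INR s) ^ 2)
                 + (2 * INR s * M) * (2 * INR s)) Nx Ny Pi.
Proof.
intros HM HPi H1.
assert (M0 : 0 <= M) by (eapply Rle_trans; [apply Rabs_pos|apply (HM 0 0 0)%nat]).
assert (s0 : 0 <= 2 * INR s) by (generalize (pos_INR s); lra).
assert (Hbd : forall (g : gridfun) i j, is_xedge Nx Ny i j ->
  Rabs (Pi g i j) <= sum_n_m (fun l => M * Rabs (g l j))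
      (Nat.max 1 (S i - s)) (Nat.min Nx (i + s))).
{ intros g i j Hij; rewrite HPi by assumption.
  eapply Rle_trans; [apply rsum_abs|apply rsum_le; intros l Hl].
  rewrite Rabs_mult; apply Rmult_le_compat_r; [apply Rabs_pos|apply HM]. }
assert (Hlin : forall (a : R) (g1 g2 : gridfun) i j, is_xedge Nx Ny i j ->
    Pi (fun i j => g1 i j + a * g2 i j) i j = Pi g1 i j + a * Pi g2 i j).
{ intros a g1 g2 i j Hij; rewrite !HPi by assumption.
  rewrite (rsum_ext _ (fun l => w i j l * g1 l j + a * (w i j l * g2 l j)))
    by (intros; rring).
  now rewrite rsum_plus, rsum_scal. }
assert (Hosc : forall (g : gridfun) i j, is_xedge Nx Ny i j ->
  Rabs (Pi g i j - (g i j + g (S i) j) / 2) <= 2 * INR s * M *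
    sum_n_m (fun l => Rabs (g (S l) j - g l j))
      (Nat.max 1 (S i - s)) (Nat.min (Nx - 1) (i + s))).
{ intros g i j Hij; destruct Hij as [Hi Hj].
  assert (Hij : is_xedge Nx Ny i j) by (split; assumption).
  set (m := (g i j + g (S i) j) / 2).
  assert (E : Pi (fun a b => g a b + (- m) * 1) i j = Pi g i j - m).
  { rewrite (Hlin (- m) g (fun _ _ => 1)) by assumption.
    rewrite H1 by assumption; ring. }
  rewrite <- E.
  eapply Rle_trans; [apply Hbd; assumption|].
  set (V := sum_n_m (fun l => Rabs (g (S l) j - g l j)) _ _).
  apply Rle_trans with (sum_n_m (fun _ => M * V)
    (Nat.max 1 (S i - s)) (Nat.min Nx (i + s))).
  - apply rsum_le; intros l Hl; apply Rmult_le_compat_l; [assumption|].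
    assert (Hv : forall a b, (Nat.max 1 (S i - s) <= a <= Nat.min Nx (i + s))%nat ->
       (Nat.max 1 (S i - s) <= b <= Nat.min Nx (i + s))%nat ->
       Rabs (g a j - g b j) <= V).
    { intros a b Ha Hb.
      eapply Rle_trans; [apply (osc_le_variation (fun a => g a j) _ _ a b Ha Hb)|].
      apply rsum_subrange; try lia; intros; apply Rabs_pos. }
    assert (Hs : (1 <= s)%nat) by lia.
    generalize (Hv l i ltac:(lia) ltac:(lia)) (Hv l (S i) ltac:(lia) ltac:(lia)).
    unfold m; intros A1 A2; apply Rabs_le_between in A1; apply Rabs_le_between in A2.
    apply Rabs_le_between; lra.
  - rewrite sum_n_m_const.
    assert (0 <= V) by (apply rsum_ge0; intros; apply Rabs_pos).
    rewrite Rmult_assoc; apply Rmult_le_compat_r; [now apply Rmult_le_pos|].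
    apply window_size. }
assert (C1 : 0 <= (2 * INR s * M) ^ 2) by apply pow2_ge_0.
assert (C2 : 0 <= (2 * INR s) ^ 2) by apply pow2_ge_0.
assert (C3 : 0 <= 2 * INR s * M * (2 * INR s)).
{ apply Rmult_le_pos; [now apply Rmult_le_pos|assumption]. }
assert (C4 : 0 <= (2 * INR s * M) ^ 2 * (2 * INR s) ^ 2) by now apply Rmult_le_pos.
(* the sum over all edges of the squared window sums *)
assert (Hsq : forall (G : gridfun) n, (forall i j, 0 <= G i j) ->
  S2 (Nx - 1) Ny (fun i j => (sum_n_m (fun l => G l j)
      (Nat.max 1 (S i - s)) (Nat.min n (i + s))) ^ 2)
  <= (2 * INR s) ^ 2 * S2 n Ny (fun i j => (G i j) ^ 2)).
{ intros G n HG.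
  apply Rle_trans with (S2 (Nx - 1) Ny (fun i j => 2 * INR s *
    sum_n_m (fun l => (G l j) ^ 2) (Nat.max 1 (S i - s)) (Nat.min n (i + s)))).
  - apply S2_le; intros i j Hi Hj.
    eapply Rle_trans; [apply rsum_sq_le|].
    apply Rmult_le_compat_r; [apply rsum_ge0; intros; apply pow2_ge_0|].
    apply window_size.
  - rewrite S2_scal; replace ((2 * INR s) ^ 2) with (2 * INR s * (2 * INR s)) by ring.
    rewrite (Rmult_assoc (2 * INR s) (2 * INR s)).
    apply Rmult_le_compat_l; [assumption|].
    rewrite (S2_swap (Nx - 1)), (S2_swap n); unfold S2; rewrite <- rsum_scal.
    apply rsum_le; intros j Hj.
    apply (window_sum (fun l => G l j ^ 2)); intros; apply pow2_ge_0. }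
split.
- exact Hlin.
- intros g.
  apply Rle_trans with ((2 * INR s * M) ^ 2 * S2 Nx Ny (fun i j => (g i j) ^ 2)).
  2:{ apply Rmult_le_compat_r.
      - apply S2_ge0; intros; apply pow2_ge_0.
      - revert C1 C2 C3 C4; generalize ((2 * INR s * M) ^ 2) ((2 * INR s) ^ 2)
          (2 * INR s * M * (2 * INR s)); clear; intros; lra. }
  apply Rle_trans with (S2 (Nx - 1) Ny (fun i j => M ^ 2 * (sum_n_m
     (fun l => Rabs (g l j)) (Nat.max 1 (S i - s)) (Nat.min Nx (i + s))) ^ 2)).
  + apply S2_le; intros i j Hi Hj.
    rewrite <- Rpow_mult_distr; apply Rabs_le_sq; rewrite <- rsum_scal.
    apply Hbd; split; lia.
  + rewrite S2_scal.
    replace ((2 * INR s * M) ^ 2) with (M ^ 2 * (2 * INR s) ^ 2) by ring.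
    rewrite (Rmult_assoc (M ^ 2)); apply Rmult_le_compat_l; [apply pow2_ge_0|].
    eapply Rle_trans; [apply (Hsq (fun l j => Rabs (g l j))); intros; apply Rabs_pos|].
    apply Req_le; f_equal; apply S2_ext; intros; apply pow2_abs.
- intros g.
  apply Rle_trans with ((2 * INR s * M) ^ 2 * (2 * INR s) ^ 2 *
    S2 (Nx - 1) Ny (fun i j => (g (S i) j - g i j) ^ 2)).
  2:{ apply Rmult_le_compat_r.
      - apply S2_ge0; intros; apply pow2_ge_0.
      - revert C1 C2 C3 C4; generalize ((2 * INR s * M) ^ 2) ((2 * INR s) ^ 2)
          (2 * INR s * M * (2 * INR s)); clear; intros; lra. }
  apply Rle_trans with (S2 (Nx - 1) Ny (fun i j => (2 * INR s * M) ^ 2 * (sum_n_m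
     (fun l => Rabs (g (S l) j - g l j)) (Nat.max 1 (S i - s)) (Nat.min (Nx - 1) (i + s))) ^ 2)).
  + apply S2_le; intros i j Hi Hj.
    rewrite <- Rpow_mult_distr; apply Rabs_le_sq; apply Hosc; split; lia.
  + rewrite S2_scal, (Rmult_assoc ((2 * INR s * M) ^ 2)).
    apply Rmult_le_compat_l; [assumption|].
    eapply Rle_trans; [apply (Hsq (fun l j => Rabs (g (S l) j - g l j))); intros; apply Rabs_pos|].
    apply Req_le; f_equal; apply S2_ext; intros; apply pow2_abs.
- intros g d j Hj Hd i Hi.
  assert (d0 : 0 <= d) by (eapply Rle_trans; [apply Rabs_pos|apply (Hd i Hi)]).
  apply Rle_trans with (2 * INR s * M * (2 * INR s) * d).
  2:{ apply Rmult_le_compat_r; [assumption|].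
      assert (0 <= (2 * INR s * M) ^ 2 * (1 + (2 * INR s) ^ 2)) by (apply Rmult_le_pos; lra).
      lra. }
  eapply Rle_trans; [apply Hosc; split; assumption|].
  rewrite (Rmult_assoc (2 * INR s * M)); apply Rmult_le_compat_l.
  { now apply Rmult_le_pos. }
  apply Rle_trans with (sum_n_m (fun _ => d) (Nat.max 1 (S i - s)) (Nat.min (Nx - 1) (i + s))).
  + apply rsum_le; intros l Hl; apply Hd; lia.
  + rewrite sum_n_m_const; apply Rmult_le_compat_r; [assumption|apply window_size].
Qed.

(** * Discrete Sobolev inequalities *)

(** Neighbouring values differ by no more than the discrete H^1 seminorm, with a
    constant that involves neither the mesh sizes nor their ratio.  On a mesh that is
    much finer in y than in x, the difference at one height is compared with its mean
    over a column of cells of total height about [h]; moving within the column costs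
    at most the y-differences. *)
Lemma neighbour_oscillation Nx Ny (h k : R) (g : gridfun) i j :
  0 < h -> 0 < k -> h <= INR Ny * k -> is_xedge Nx Ny i j ->
  (g (S i) j - g i j) ^ 2
  <= 6 * (h * k) * (S2 (Nx - 1) Ny (fun i j => (dxm h g i j) ^ 2)
                    + S2 Nx (Ny - 1) (fun i j => (dym k g i j) ^ 2)).
Proof.
intros Hh Hk HL [Hi Hj].
(* [m] is the least number of cells of height [k] that reach height [h] *)
assert (Hm : exists m : nat, (1 <= m <= Ny)%nat /\ h <= INR m * k /\ (INR m - 1) * k <= h).
{ clear - Hh Hk HL. induction Ny as [|n IH].
  - simpl in HL; lra.
  - destruct (Rle_lt_dec h (INR n * k)) as [L|L].
    + destruct (IH L) as (m & Hm & Hm'); exists m; split; [lia|exact Hm'].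
    + exists (S n); split; [lia|split; [assumption|]].
      rewrite S_INR; lra. }
destruct Hm as (m & Hm & Hm1 & Hm2).
set (j0 := Nat.min (j - 1) (Ny - m)).
assert (J : (j0 + 1 <= j <= j0 + m)%nat /\ (j0 + m <= Ny)%nat) by (unfold j0; lia).
clearbody j0; destruct J as [J1 J2].
set (X := S2 (Nx - 1) Ny (fun i j => (dxm h g i j) ^ 2)).
set (Y := S2 Nx (Ny - 1) (fun i j => (dym k g i j) ^ 2)).
assert (X0 : 0 <= X) by (apply S2_ge0; intros; apply pow2_ge_0).
assert (Y0 : 0 <= Y) by (apply S2_ge0; intros; apply pow2_ge_0).
assert (Hmpos : 1 <= INR m) by (replace 1 with (INR 1) by reflexivity; apply le_INR; lia).
(* moving within the column *)
assert (Hcol : forall a b, (j0 + 1 <= b <= j0 + m)%nat -> (1 <= a <= Nx)%nat ->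
   (g a j - g a b) ^ 2 <= h * k * sum_n_m (fun l => (dym k g a l) ^ 2) 1 (Ny - 1)).
{ intros a b Hb Ha.
  assert (H := osc_le_variation (fun l => g a l) (j0 + 1) (j0 + m) j b J1 Hb).
  apply Rabs_le_sq in H; eapply Rle_trans; [exact H|].
  eapply Rle_trans; [apply rsum_sq_le|].
  replace (INR (S (j0 + m - 1) - (j0 + 1))) with (INR m - 1)
    by (replace (S (j0 + m - 1) - (j0 + 1))%nat with (m - 1)%nat by lia;
        rewrite minus_INR by lia; reflexivity).
  rewrite (rsum_ext _ (fun l => k * k * (dym k g a l) ^ 2)).
  2:{ intros l Hl; rewrite pow2_abs; unfold dym; field; lra. }
  rewrite rsum_scal.
  assert (Hs : sum_n_m (fun l => (dym k g a l) ^ 2) (j0 + 1) (j0 + m - 1)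
          <= sum_n_m (fun l => (dym k g a l) ^ 2) 1 (Ny - 1)).
  { apply rsum_subrange; try lia; intros; apply pow2_ge_0. }
  clear H; set (s1 := sum_n_m _ (j0 + 1) _) in *; set (s2 := sum_n_m _ 1 _) in *.
  assert (0 <= s1) by (apply rsum_ge0; intros; apply pow2_ge_0).
  replace ((INR m - 1) * (k * k * s1)) with (((INR m - 1) * k) * (k * s1)) by ring.
  rewrite (Rmult_assoc h k); apply Rmult_le_compat; try assumption.
  - apply Rmult_le_pos; lra.
  - apply Rmult_le_pos; lra.
  - apply Rmult_le_compat_l; lra. }
assert (HY2 : sum_n_m (fun l => (dym k g i l) ^ 2) 1 (Ny - 1)
            + sum_n_m (fun l => (dym k g (S i) l) ^ 2) 1 (Ny - 1) <= Y).
{ unfold Y, S2.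
  apply Rle_trans with (sum_n_m (fun a =>
    sum_n_m (fun l => (dym k g a l) ^ 2) 1 (Ny - 1)) i (S i)).
  - rewrite rsum_last by lia; rewrite sum_n_n; apply Rle_refl.
  - apply rsum_subrange; try lia; intros; apply rsum_ge0; intros; apply pow2_ge_0. }
assert (Hpt : forall b, (j0 + 1 <= b <= j0 + m)%nat ->
  (g (S i) j - g i j) ^ 2 <= 3 * h ^ 2 * (dxm h g i b) ^ 2 + 3 * (h * k) * Y).
{ intros b Hb.
  generalize (Hcol i b Hb ltac:(lia)) (Hcol (S i) b Hb ltac:(lia)); intros A1 A2.
  replace (3 * h ^ 2 * dxm h g i b ^ 2) with (3 * (g (S i) b - g i b) ^ 2)
    by (unfold dxm; field; lra).
  set (u := g i j - g i b) in *; set (v := g (S i) j - g (S i) b) in *.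
  replace (g (S i) j - g i j) with ((g (S i) b - g i b) + v - u) by (unfold u, v; ring).
  set (d := g (S i) b - g i b).
  assert (B : (d + v - u) ^ 2 <= 3 * d ^ 2 + 3 * v ^ 2 + 3 * u ^ 2).
  { generalize (pow2_ge_0 (d - v)) (pow2_ge_0 (d + u)) (pow2_ge_0 (v + u)); nra. }
  assert (0 < h * k) by now apply Rmult_lt_0_compat.
  nra. }
assert (Hsum : INR m * (g (S i) j - g i j) ^ 2 <=
  sum_n_m (fun b => 3 * h ^ 2 * (dxm h g i b) ^ 2 + 3 * (h * k) * Y) (j0 + 1) (j0 + m)).
{ replace (INR m) with (INR (S (j0 + m) - (j0 + 1))) by (f_equal; lia).
  rewrite <- sum_n_m_const; apply rsum_le; intros; now apply Hpt. }
rewrite rsum_plus, rsum_scal, sum_n_m_const in Hsum.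
replace (S (j0 + m) - (j0 + 1))%nat with m in Hsum by lia.
assert (HX : sum_n_m (fun b => (dxm h g i b) ^ 2) (j0 + 1) (j0 + m) <= X).
{ apply Rle_trans with (sum_n_m (fun b => (dxm h g i b) ^ 2) 1 Ny).
  - apply rsum_subrange; try lia; intros; apply pow2_ge_0.
  - apply (rsum_term (fun a => sum_n_m (fun b => (dxm h g a b) ^ 2) 1 Ny) 1 (Nx - 1) i).
    + intros; apply rsum_ge0; intros; apply pow2_ge_0.
    + lia. }
set (D := (g (S i) j - g i j) ^ 2) in *.
assert (h2 : 0 <= 3 * h ^ 2) by nra.
assert (INR m * D <= 3 * h ^ 2 * X + INR m * (3 * (h * k) * Y)).
{ eapply Rle_trans; [exact Hsum|]; apply Rplus_le_compat_r.
  now apply Rmult_le_compat_l. }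
assert (3 * h ^ 2 * X <= INR m * (3 * (h * k) * X)).
{ replace (3 * h ^ 2 * X) with (h * (3 * h * X)) by ring.
  replace (INR m * (3 * (h * k) * X)) with ((INR m * k) * (3 * h * X)) by ring.
  apply Rmult_le_compat_r; [|assumption]. apply Rmult_le_pos; [lra|assumption]. }
apply Rmult_le_reg_l with (INR m); [lra|].
assert (0 <= INR m * (3 * (h * k) * (X + Y))).
{ apply Rmult_le_pos; [lra|]. apply Rmult_le_pos; [|lra]. apply Rmult_le_pos; [lra|nra]. }
nra.
Qed.

(** A value differs from the mean by no more than the total variation. *)
Lemma sq_le_mean_plus_variation (u : nat -> R) n j : (1 <= j <= n)%nat ->
  (u j) ^ 2 <= / INR n * sum_n_m (fun l => (u l) ^ 2) 1 n
             + sum_n_m (fun l => Rabs ((u (S l)) ^ 2 - (u l) ^ 2)) 1 (n - 1).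
Proof.
intros Hj.
assert (Hn : 0 < INR n) by (apply lt_0_INR; lia).
set (V := sum_n_m _ 1 (n - 1)).
assert (H : INR n * (u j) ^ 2 <= sum_n_m (fun l => (u l) ^ 2 + V) 1 n).
{ replace (INR n) with (INR (S n - 1)) by (f_equal; lia).
  rewrite <- sum_n_m_const; apply rsum_le; intros l Hl.
  assert (A := osc_le_variation (fun l => u l ^ 2) 1 n j l Hj Hl).
  simpl in A; change (Rabs (u j ^ 2 - u l ^ 2) <= V) in A.
  apply Rabs_le_between in A; lra. }
rewrite rsum_plus, sum_n_m_const in H.
replace (S n - 1)%nat with n in H by lia.
apply Rmult_le_reg_l with (INR n); [assumption|].
rewrite Rmult_plus_distr_l, <- Rmult_assoc, Rinv_r by lra; lra.
Qed.

(** The sum over the lines of the largest squared value on each line.  A product of two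
    such sums, one for each direction, dominates the sum of the fourth powers. *)
Lemma line_maxima Nx Ny (h k : R) (g : gridfun) :
  0 < h -> 0 < k -> (1 <= Ny)%nat ->
  exists Y : nat -> R,
    (forall i j, (1 <= i <= Nx)%nat -> (1 <= j <= Ny)%nat -> (g i j) ^ 2 <= Y i) /\
    (sum_n_m Y 1 Nx) ^ 2
    <= 2 * (/ INR Ny * S2 Nx Ny (fun i j => (g i j) ^ 2)) ^ 2
     + 8 * k ^ 2 * S2 Nx Ny (fun i j => (g i j) ^ 2)
         * S2 Nx (Ny - 1) (fun i j => (dym k g i j) ^ 2).
Proof.
intros Hh Hk HNy.
exists (fun i => / INR Ny * sum_n_m (fun l => (g i l) ^ 2) 1 Ny
   + sum_n_m (fun l => Rabs ((g i (S l)) ^ 2 - (g i l) ^ 2)) 1 (Ny - 1)).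
split; [intros i j Hi Hj; now apply (sq_le_mean_plus_variation (fun l => g i l))|].
rewrite rsum_plus, rsum_scal.
change (sum_n_m (fun i => sum_n_m (fun l => g i l ^ 2) 1 Ny) 1 Nx)
  with (S2 Nx Ny (fun i j => (g i j) ^ 2)).
set (N := S2 Nx Ny (fun i j => (g i j) ^ 2)).
set (V := sum_n_m (fun k0 => sum_n_m _ 1 (Ny - 1)) 1 Nx).
set (D := S2 Nx (Ny - 1) (fun i j => (dym k g i j) ^ 2)).
assert (HV : V ^ 2 <= 4 * k ^ 2 * N * D).
{ unfold V; change (sum_n_m _ 1 Nx) with
    (S2 Nx (Ny - 1) (fun i l => Rabs (g i (S l) ^ 2 - g i l ^ 2))).
  rewrite (S2_ext _ _ _ (fun i l =>
    (Rabs (g i (S l) + g i l)) * (k * Rabs (dym k g i l)))).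
  2:{ intros i l _ _; unfold dym.
      rewrite <- (Rabs_pos_eq k) at 1 by lra; rewrite <- !Rabs_mult; f_equal; field; lra. }
  eapply Rle_trans; [apply S2_CS|].
  rewrite (S2_ext _ _ (fun i j => (k * Rabs (dym k g i j)) ^ 2) (fun i j => k ^ 2 * (dym k g i j) ^ 2))
    by (intros; rewrite <- (pow2_abs (dym k g i j)); rring).
  rewrite S2_scal; fold D.
  assert (HN : S2 Nx (Ny - 1) (fun i l => (Rabs (g i (S l) + g i l)) ^ 2) <= 4 * N).
  { apply Rle_trans with (S2 Nx (Ny - 1) (fun i l => 2 * (g i (S l)) ^ 2 + 2 * (g i l) ^ 2)).
    - apply S2_le; intros; rewrite pow2_abs.
      generalize (pow2_ge_0 (g i (S j) - g i j)); nra.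
    - rewrite S2_plus, !S2_scal.
      assert (S2 Nx (Ny - 1) (fun i l => g i (S l) ^ 2) <= N).
      { unfold N, S2; apply rsum_le; intros i Hi.
        rewrite (sum_n_m_S (fun l => g i l ^ 2)).
        apply rsum_subrange; try lia; intros; apply pow2_ge_0. }
      assert (S2 Nx (Ny - 1) (fun i l => g i l ^ 2) <= N).
      { unfold N, S2; apply rsum_le; intros i Hi.
        apply rsum_subrange; try lia; intros; apply pow2_ge_0. }
      lra. }
  assert (D0 : 0 <= D) by (apply S2_ge0; intros; apply pow2_ge_0).
  assert (0 <= k ^ 2 * D) by (apply Rmult_le_pos; [apply pow2_ge_0|assumption]).
  nra. }
generalize (pow2_ge_0 (/ INR Ny * N - V)); nra.
Qed.

(** Ladyzhenskaya's inequality in two dimensions: the square of a value is at most the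
    maximum along its column and at most the maximum along its row, so the sum of the
    fourth powers is bounded by the product of two sums over lines. *)
Lemma ladyzhenskaya Nx Ny (h k : R) (g : gridfun) :
  0 < h -> 0 < k -> (1 <= Nx)%nat -> (1 <= Ny)%nat ->
  h * k * S2 Nx Ny (fun i j => (g i j) ^ 4)
  <= (/ (INR Nx * h) ^ 2 + / (INR Ny * k) ^ 2)
       * (h * k * S2 Nx Ny (fun i j => (g i j) ^ 2)) ^ 2
   + 4 * (h * k * S2 Nx Ny (fun i j => (g i j) ^ 2))
     * (h * k * S2 (Nx - 1) Ny (fun i j => (dxm h g i j) ^ 2)
        + h * k * S2 Nx (Ny - 1) (fun i j => (dym k g i j) ^ 2)).
Proof.
intros Hh Hk HNx HNy.
destruct (line_maxima Nx Ny h k g Hh Hk HNy) as (Y & HY & HY2).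
destruct (line_maxima Ny Nx k h (fun i j => g j i) Hk Hh HNx) as (X & HX & HX2).
rewrite (S2_swap Ny Nx) in HX2.
rewrite (S2_swap Ny (Nx - 1)) in HX2.
change (S2 (Nx - 1) Ny (fun i j => dym h (fun i0 j0 => g j0 i0) j i ^ 2))
  with (S2 (Nx - 1) Ny (fun i j => dxm h g i j ^ 2)) in HX2.
set (N := S2 Nx Ny (fun i j => (g i j) ^ 2)) in *.
set (Dx := S2 (Nx - 1) Ny _) in *; set (Dy := S2 Nx (Ny - 1) _) in *.
assert (H : S2 Nx Ny (fun i j => g i j ^ 4) <= sum_n_m Y 1 Nx * sum_n_m X 1 Ny).
{ apply Rle_trans with (S2 Nx Ny (fun i j => Y i * X j)).
  - apply S2_le; intros i j Hi Hj.
    replace (g i j ^ 4) with ((g i j) ^ 2 * (g i j) ^ 2) by ring.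
    apply Rmult_le_compat; try apply pow2_ge_0; [now apply HY|now apply HX].
  - unfold S2; apply Req_le.
    rewrite (rsum_ext _ (fun i => sum_n_m X 1 Ny * Y i)).
    + rewrite rsum_scal; apply Rmult_comm.
    + intros i Hi; rewrite rsum_scal; apply Rmult_comm. }
set (sy := sum_n_m Y 1 Nx) in *; set (sx := sum_n_m X 1 Ny) in *.
assert (HNx' : 0 < INR Nx) by (apply lt_0_INR; lia).
assert (HNy' : 0 < INR Ny) by (apply lt_0_INR; lia).
assert (hk : 0 < h * k) by now apply Rmult_lt_0_compat.
apply Rle_trans with (h * k * (sy * sx)); [apply Rmult_le_compat_l; lra|].
(* the two factors are balanced with the weights [h] and [k] of their sums *)
apply Rle_trans with ((h ^ 2 * sy ^ 2 + k ^ 2 * sx ^ 2) / 2).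
{ generalize (pow2_ge_0 (h * sy - k * sx)); lra. }
assert (Ey : h ^ 2 * sy ^ 2 <= h ^ 2 * (2 * (/ INR Ny * N) ^ 2 + 8 * k ^ 2 * N * Dy)).
{ apply Rmult_le_compat_l; [apply pow2_ge_0|exact HY2]. }
assert (Ex : k ^ 2 * sx ^ 2 <= k ^ 2 * (2 * (/ INR Nx * N) ^ 2 + 8 * h ^ 2 * N * Dx)).
{ apply Rmult_le_compat_l; [apply pow2_ge_0|exact HX2]. }
apply Rle_trans with ((h ^ 2 * (2 * (/ INR Ny * N) ^ 2 + 8 * k ^ 2 * N * Dy)
  + k ^ 2 * (2 * (/ INR Nx * N) ^ 2 + 8 * h ^ 2 * N * Dx)) / 2); [lra|].
apply Req_le; field; repeat split; lra.
Qed.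

(** * Functions of class C^r *)

Lemma MVT_everywhere (f : R -> R) (a b : R) : (forall x, ex_derive f x) ->
  exists c, Rmin a b <= c <= Rmax a b /\ f b - f a = Derive f c * (b - a).
Proof.
intros H; apply (MVT_gen f a b (Derive f)).
- intros x _; apply Derive_correct, H.
- intros x _; apply continuity_pt_filterlim.
  apply (ex_derive_continuous (V := R_NormedModule)), H.
Qed.

Lemma increment_bound (f : R -> R) (a b M : R) : (forall x, ex_derive f x) ->
  (forall x, Rmin a b <= x <= Rmax a b -> Rabs (Derive f x) <= M) ->
  Rabs (f b - f a) <= M * Rabs (b - a).
Proof.
intros H HM; destruct (MVT_everywhere f a b H) as (c & Hc & ->).
rewrite Rabs_mult; apply Rmult_le_compat_r; [apply Rabs_pos|now apply HM].
Qed.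

Definition in_box (ax bx ay bly at_ bt x y t : R) : Prop :=
  (ax <= x <= bx /\ ay <= y <= bly) /\ at_ <= t <= bt.

Lemma list_bound (T : Type) (F : T -> R) (l : list T) :
  exists M, forall t, In t l -> F t <= M.
Proof.
induction l as [|a l [M HM]].
- exists 0; intros t [].
- exists (Rmax (F a) M); intros t [<-|Ht]; [apply Rmax_l|].
  eapply Rle_trans; [now apply HM|apply Rmax_r].
Qed.

Lemma continuous_bounded_on_box (g : field) ax bx ay bly at_ bt : Cclass 0 g ->
  exists M, forall x y t, in_box ax bx ay bly at_ bt x y t -> Rabs (g x y t) <= M.
Proof.
intros Hg.
set (G := fun q : Compactness.Tn 3 R => g (fst q) (fst (snd q)) (fst (snd (snd q)))).
assert (Hd : forall q : Compactness.Tn 3 R, exists d : posreal,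
   forall q', close_n 3 d q' q -> Rabs (G q' - G q) < 1).
{ intros (x & y & t & []).
  generalize (proj1 (filterlim_locally _ _) (Hg x y t) (mkposreal 1 Rlt_0_1)).
  intros [d Hd]; exists d; intros (x' & y' & t' & []) (Hx & Hy & Ht & _).
  refine (Hd ((x', y'), t') _).
  repeat split; assumption. }
set (delta := fun q => proj1_sig (constructive_indefinite_description _ (Hd q))).
assert (Hdelta : forall q q', close_n 3 (delta q) q' q -> Rabs (G q' - G q) < 1).
{ intros q; exact (proj2_sig (constructive_indefinite_description _ (Hd q))). }
destruct (NNPP _ (compactness_list 3 (ax, (ay, (at_, tt))) (bx, (bly, (bt, tt))) delta))
  as [l Hl].
destruct (list_bound _ (fun q => Rabs (G q)) l) as [M HM].
exists (M + 1); intros x y t [[Hx Hy] Ht].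
destruct (Hl (x, (y, (t, tt)))) as (q & Hq & _ & Hc); [repeat split; lra|].
generalize (Hdelta q _ Hc) (HM q Hq); unfold G at 1; simpl.
intros A1 A2; replace (g x y t) with ((g x y t - G q) + G q) by ring.
eapply Rle_trans; [apply Rabs_triang|lra].
Qed.

(** A function with continuous partial derivatives is continuous: the derivatives are
    bounded near the point, and the increment is split into three increments along the
    axes. *)
Lemma Cclass_pred r g : Cclass (S r) g -> Cclass r g.
Proof.
revert g; induction r as [|r IH]; intros g (Hd & Hx & Hy & Ht).
- intros x y t.
  destruct (continuous_bounded_on_box _ (x - 1) (x + 1) (y - 1) (y + 1) (t - 1) (t + 1) Hx)
    as [Mx HMx].
  destruct (continuous_bounded_on_box _ (x - 1) (x + 1) (y - 1) (y + 1) (t - 1) (t + 1) Hy)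
    as [My HMy].
  destruct (continuous_bounded_on_box _ (x - 1) (x + 1) (y - 1) (y + 1) (t - 1) (t + 1) Ht)
    as [Mt HMt].
  set (M := 1 + Rabs Mx + Rabs My + Rabs Mt).
  assert (HM : 1 <= M) by
    (unfold M; generalize (Rabs_pos Mx) (Rabs_pos My) (Rabs_pos Mt); lra).
  assert (Ax := Rle_abs Mx); assert (Ay := Rle_abs My); assert (At := Rle_abs Mt).
  assert (Px := Rabs_pos Mx); assert (Py := Rabs_pos My); assert (Pt := Rabs_pos Mt).

  apply filterlim_locally; intros [eps Heps].
  assert (Hd' : 0 < Rmin 1 (eps / (3 * M))).
  { apply Rmin_pos; [lra|apply Rdiv_lt_0_compat; lra]. }
  exists (mkposreal _ Hd'); intros [[x' y'] t'] [[Bx By] Bt]; simpl in *.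
  change (Rabs (x' - x) < Rmin 1 (eps / (3 * M))) in Bx.
  change (Rabs (y' - y) < Rmin 1 (eps / (3 * M))) in By.
  change (Rabs (t' - t) < Rmin 1 (eps / (3 * M))) in Bt.
  change (Rabs (g x' y' t' - g x y t) < eps).
  assert (m1 := Rmin_l 1 (eps / (3 * M))); assert (m2 := Rmin_r 1 (eps / (3 * M))).
  assert (Cx := Bx); assert (Cy := By); assert (Ct := Bt).
  apply Rabs_lt_between in Cx; apply Rabs_lt_between in Cy; apply Rabs_lt_between in Ct.
  assert (E1 : Rabs (g x' y' t' - g x y' t') <= M * Rabs (x' - x)).
  { apply (increment_bound (fun s => g s y' t') x x' M); [intros z; exact (proj1 (Hd z y' t'))|].
    intros s Hs; eapply Rle_trans; [apply (HMx s y' t')|unfold M; lra].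
    revert Hs; unfold Rmin, Rmax; destruct (Rle_dec x x'); intros;
      repeat split; lra. }
  assert (E2 : Rabs (g x y' t' - g x y t') <= M * Rabs (y' - y)).
  { apply (increment_bound (fun s => g x s t') y y' M); [intros z; exact (proj1 (proj2 (Hd x z t')))|].
    intros s Hs; eapply Rle_trans; [apply (HMy x s t')|unfold M; lra].
    revert Hs; unfold Rmin, Rmax; destruct (Rle_dec y y'); intros;
      repeat split; lra. }
  assert (E3 : Rabs (g x y t' - g x y t) <= M * Rabs (t' - t)).
  { apply (increment_bound (fun s => g x y s) t t' M); [intros z; exact (proj2 (proj2 (Hd x y z)))|].
    intros s Hs; eapply Rle_trans; [apply (HMt x y s)|unfold M; lra].
    revert Hs; unfold Rmin, Rmax; destruct (Rle_dec t t'); intros;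
      repeat split; lra. }
  replace (g x' y' t' - g x y t) with
    ((g x' y' t' - g x y' t') + ((g x y' t' - g x y t') + (g x y t' - g x y t))) by ring.
  eapply Rle_lt_trans; [apply Rabs_triang|].
  eapply Rle_lt_trans; [apply Rplus_le_compat_l, Rabs_triang|].
  assert (Hm : forall u, u < Rmin 1 (eps / (3 * M)) -> M * u < eps / 3).
  { intros u Hu; apply Rlt_le_trans with (M * (eps / (3 * M))).
    - apply Rmult_lt_compat_l; lra.
    - apply Req_le; field; lra. }
  generalize (Hm _ Bx) (Hm _ By) (Hm _ Bt); lra.
- split; [exact Hd|repeat split; now apply IH].
Qed.

Lemma Cclass_le r s g : (s <= r)%nat -> Cclass r g -> Cclass s g.
Proof.
induction 1 as [|r H IH]; [easy|]; intros Hg; apply IH, Cclass_pred, Hg.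
Qed.

Lemma Cclass_bounded r g ax bx ay bly at_ bt : Cclass r g ->
  exists M, forall x y t, in_box ax bx ay bly at_ bt x y t -> Rabs (g x y t) <= M.
Proof.
intros H; apply continuous_bounded_on_box, (Cclass_le r); [lia|exact H].
Qed.

Lemma field_ext (f g : field) : (forall x y t, f x y t = g x y t) -> f = g.
Proof.
intros H; do 3 (apply functional_extensionality; intro); apply H.
Qed.

Lemma Cclass_const r c : Cclass r (fun _ _ _ => c).
Proof.
revert c; induction r as [|r IH]; intros c.
- intros x y t; apply continuous_const.
- split; [intros; repeat split; apply ex_derive_const|].
  replace (px _) with (fun _ _ _ : R => 0)
    by (apply field_ext; intros; unfold px; now rewrite Derive_const).
  replace (py _) with (fun _ _ _ : R => 0)
    by (apply field_ext; intros; unfold py; now rewrite Derive_const).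
  replace (pt _) with (fun _ _ _ : R => 0)
    by (apply field_ext; intros; unfold pt; now rewrite Derive_const).
  repeat split; apply IH.
Qed.

Lemma Cclass_plus r f g :
  Cclass r f -> Cclass r g -> Cclass r (fun x y t => f x y t + g x y t).
Proof.
revert f g; induction r as [|r IH]; intros f g Hf Hg.
- intros x y t; apply (continuous_plus (V := R_NormedModule)); [apply Hf|apply Hg].
- destruct Hf as (Df & Fx & Fy & Ft), Hg as (Dg & Gx & Gy & Gt); split; [|split; [|split]].
  + intros x y t; destruct (Df x y t) as (a1 & a2 & a3), (Dg x y t) as (b1 & b2 & b3).
    repeat split.
    * exact (ex_derive_plus (V := R_NormedModule) _ _ _ a1 b1).
    * exact (ex_derive_plus (V := R_NormedModule) _ _ _ a2 b2).
    * exact (ex_derive_plus (V := R_NormedModule) _ _ _ a3 b3).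
  + replace (px _) with (fun x y t => px f x y t + px g x y t); [now apply IH|].
    apply field_ext; intros x y t; symmetry.
    exact (Derive_plus _ _ _ (proj1 (Df x y t)) (proj1 (Dg x y t))).
  + replace (py _) with (fun x y t => py f x y t + py g x y t); [now apply IH|].
    apply field_ext; intros x y t; symmetry.
    exact (Derive_plus _ _ _ (proj1 (proj2 (Df x y t))) (proj1 (proj2 (Dg x y t)))).
  + replace (pt _) with (fun x y t => pt f x y t + pt g x y t); [now apply IH|].
    apply field_ext; intros x y t; symmetry.
    exact (Derive_plus _ _ _ (proj2 (proj2 (Df x y t))) (proj2 (proj2 (Dg x y t)))).
Qed.

Lemma Cclass_mult r f g :
  Cclass r f -> Cclass r g -> Cclass r (fun x y t => f x y t * g x y t).
Proof.
revert f g; induction r as [|r IH]; intros f g Hf Hg.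
- intros x y t; apply (continuous_mult (K := R_AbsRing)); [apply Hf|apply Hg].
- assert (F := Cclass_pred _ _ Hf); assert (G := Cclass_pred _ _ Hg).
  destruct Hf as (Df & Fx & Fy & Ft), Hg as (Dg & Gx & Gy & Gt); split; [|split; [|split]].
  + intros x y t; destruct (Df x y t) as (a1 & a2 & a3), (Dg x y t) as (b1 & b2 & b3).
    repeat split.
    * exact (ex_derive_mult _ _ _ a1 b1).
    * exact (ex_derive_mult _ _ _ a2 b2).
    * exact (ex_derive_mult _ _ _ a3 b3).
  + replace (px _) with (fun x y t => px f x y t * g x y t + f x y t * px g x y t);
      [apply Cclass_plus; now apply IH|].
    apply field_ext; intros x y t; symmetry.
    exact (Derive_mult _ _ _ (proj1 (Df x y t)) (proj1 (Dg x y t))).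
  + replace (py _) with (fun x y t => py f x y t * g x y t + f x y t * py g x y t);
      [apply Cclass_plus; now apply IH|].
    apply field_ext; intros x y t; symmetry.
    exact (Derive_mult _ _ _ (proj1 (proj2 (Df x y t))) (proj1 (proj2 (Dg x y t)))).
  + replace (pt _) with (fun x y t => pt f x y t * g x y t + f x y t * pt g x y t);
      [apply Cclass_plus; now apply IH|].
    apply field_ext; intros x y t; symmetry.
    exact (Derive_mult _ _ _ (proj2 (proj2 (Df x y t))) (proj2 (proj2 (Dg x y t)))).
Qed.

(** Constant in its own time variable, so that bounds for truncation errors in space apply
    to increments in time. *)
Definition tdiff (g : field) (t' t : R) : field := fun x y _ => g x y t' - g x y t.

Lemma Cclass_slice r g t0 : Cclass r g -> Cclass r (fun x y _ => g x y t0).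
Proof.
revert g; induction r as [|r IH]; intros g Hg.
- intros x y t.
  apply (continuous_comp (fun q : R * R * R => (fst q, t0))
           (fun q : R * R * R => g (fst (fst q)) (snd (fst q)) (snd q))).
  + apply (continuous_comp_2 (fun q : R * R * R => fst q) (fun _ => t0) (fun a b => (a, b))).
    * apply continuous_fst.
    * apply continuous_const.
    * apply (continuous_ext (fun q => q)); [intros []; reflexivity|apply continuous_id].
  + apply Hg.
- destruct Hg as (D & Gx & Gy & Gt); split; [|split; [|split]].
  + intros x y t; destruct (D x y t0) as (D1 & D2 & _); repeat split; try assumption.
    apply ex_derive_const.
  + exact (IH (px g) Gx).
  + exact (IH (py g) Gy).
  + replace (pt _) with (fun _ _ _ : R => 0); [apply Cclass_const|].
    apply field_ext; intros; unfold pt; now rewrite Derive_const.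
Qed.

Lemma Cclass_tdiff r g t' t : Cclass r g -> Cclass r (tdiff g t' t).
Proof.
intros Hg; unfold tdiff.
replace (fun x y _ => g x y t' - g x y t) with
  (fun x y s : R => (fun x y _ => g x y t') x y s
     + (fun _ _ _ => -1) x y s * (fun x y _ => g x y t) x y s)
  by (apply field_ext; intros; ring).
apply (Cclass_plus _ (fun x y _ => g x y t')); [now apply Cclass_slice|].
apply (Cclass_mult _ (fun _ _ _ => -1)); [apply Cclass_const|now apply Cclass_slice].
Qed.

Lemma px_tdiff g t' t : Cclass 1 g -> px (tdiff g t' t) = tdiff (px g) t' t.
Proof.
intros (D & _); apply field_ext; intros x y t0; unfold px, tdiff.
exact (Derive_minus (fun s => g s y t') (fun s => g s y t) x
  (proj1 (D x y t')) (proj1 (D x y t))).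
Qed.

Lemma py_tdiff g t' t : Cclass 1 g -> py (tdiff g t' t) = tdiff (py g) t' t.
Proof.
intros (D & _); apply field_ext; intros x y t0; unfold py, tdiff.
exact (Derive_minus (fun s => g x s t') (fun s => g x s t) y
  (proj1 (proj2 (D x y t'))) (proj1 (proj2 (D x y t)))).
Qed.

Lemma Cclass_minus r f g :
  Cclass r f -> Cclass r g -> Cclass r (fun x y t => f x y t - g x y t).
Proof.
intros Hf Hg.
replace (fun x y t => f x y t - g x y t) with
  (fun x y t => f x y t + (fun x y t => (fun _ _ _ => -1) x y t * g x y t) x y t)
  by (apply field_ext; intros; ring).
apply Cclass_plus; [assumption|]. apply Cclass_mult; [apply Cclass_const|assumption].
Qed.

Lemma Cclass_affine r a b f : Cclass r f -> Cclass r (fun x y t => a + b * f x y t).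
Proof.
intros Hf; apply (Cclass_plus r (fun _ _ _ => a)); [apply Cclass_const|].
apply (Cclass_mult r (fun _ _ _ => b)); [apply Cclass_const|assumption].
Qed.

Lemma px_minus f g x y t : Cclass 1 f -> Cclass 1 g ->
  px (fun x y t => f x y t - g x y t) x y t = px f x y t - px g x y t.
Proof.
intros (Df & _) (Dg & _).
exact (Derive_minus (fun s => f s y t) (fun s => g s y t) x (proj1 (Df x y t)) (proj1 (Dg x y t))).
Qed.

Lemma py_minus f g x y t : Cclass 1 f -> Cclass 1 g ->
  py (fun x y t => f x y t - g x y t) x y t = py f x y t - py g x y t.
Proof.
intros (Df & _) (Dg & _).
exact (Derive_minus (fun s => f x s t) (fun s => g x s t) y
  (proj1 (proj2 (Df x y t))) (proj1 (proj2 (Dg x y t)))).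
Qed.

(** * Truncation errors *)

Lemma midpoint_difference (f : R -> R) (x s M : R) :
  (forall z, ex_derive f z) -> (forall z, ex_derive (Derive f) z) ->
  (forall z, ex_derive (Derive (Derive f)) z) ->
  0 < s -> (forall z, x - s <= z <= x + s -> Rabs (Derive (Derive (Derive f)) z) <= M) ->
  Rabs ((f (x + s) - f (x - s)) / (2 * s) - Derive f x) <= M * s ^ 2.
Proof.
intros H1 H2 H3 Hs HM.
assert (M0 : 0 <= M) by (eapply Rle_trans; [apply Rabs_pos|apply (HM x); lra]).
set (G := fun u => f (x + u) - f (x - u) - 2 * u * Derive f x).
assert (HG : forall u, is_derive G u (Derive f (x + u) + Derive f (x - u) - 2 * Derive f x)).
{ intros u; unfold G; auto_derive.
  - repeat split; try apply H1.
  - change (fun x0 => f x0) with f; unfold Rminus; ring. }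
assert (HG' : forall u, 0 <= u <= s ->
  Rabs (Derive f (x + u) + Derive f (x - u) - 2 * Derive f x) <= 2 * M * s ^ 2).
{ intros u Hu.
  destruct (MVT_everywhere (Derive f) x (x + u) H2) as (c1 & Hc1 & E1).
  destruct (MVT_everywhere (Derive f) (x - u) x H2) as (c2 & Hc2 & E2).
  rewrite Rmin_left, Rmax_right in Hc1, Hc2 by lra.
  replace (Derive f (x + u) + Derive f (x - u) - 2 * Derive f x)
    with (u * (Derive (Derive f) c1 - Derive (Derive f) c2)) by lra.
  rewrite Rabs_mult, (Rabs_pos_eq u) by lra.
  assert (E := increment_bound (Derive (Derive f)) c2 c1 M H3).
  rewrite Rmin_left, Rmax_right in E by lra.
  rewrite (Rabs_pos_eq (c1 - c2)) in E by lra.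
  assert (E' : Rabs (Derive (Derive f) c1 - Derive (Derive f) c2) <= M * (2 * s)).
  { eapply Rle_trans; [apply E; intros; apply HM; lra|].
    apply Rmult_le_compat_l; lra. }
  apply Rle_trans with (s * (M * (2 * s))); [|apply Req_le; ring].
  apply Rmult_le_compat; try lra; apply Rabs_pos. }
assert (E := MVT_gen G 0 s (fun u => Derive f (x + u) + Derive f (x - u) - 2 * Derive f x)).
rewrite Rmin_left, Rmax_right in E by lra.
destruct E as (c & Hc & E).
- intros; apply HG.
- intros u _; apply continuity_pt_filterlim.
  apply (ex_derive_continuous (V := R_NormedModule)); eexists; apply HG.
- assert (E0 : G 0 = 0) by (unfold G; rewrite Rplus_0_r, Rminus_0_r; ring).
  rewrite E0, !Rminus_0_r in E.
  replace ((f (x + s) - f (x - s)) / (2 * s) - Derive f x) with (G s / (2 * s))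
    by (unfold G; field; lra).
  rewrite E; replace (_ * s / (2 * s)) with
    ((Derive f (x + c) + Derive f (x - c) - 2 * Derive f x) / 2) by (field; lra).
  specialize (HG' c Hc); unfold Rdiv; rewrite Rabs_mult, (Rabs_pos_eq (/ 2)) by lra; lra.
Qed.

Lemma backward_difference (f : R -> R) (t s M : R) :
  (forall z, ex_derive f z) -> (forall z, ex_derive (Derive f) z) ->
  0 < s -> (forall z, t - s <= z <= t -> Rabs (Derive (Derive f) z) <= M) ->
  Rabs ((f t - f (t - s)) / s - Derive f t) <= M * s.
Proof.
intros H1 H2 Hs HM.
destruct (MVT_everywhere f (t - s) t H1) as (c & Hc & E).
rewrite Rmin_left, Rmax_right in Hc by lra.
rewrite E; replace (Derive f c * (t - (t - s)) / s) with (Derive f c) by (field; lra).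
assert (M0 : 0 <= M) by (eapply Rle_trans; [apply Rabs_pos|apply (HM t); lra]).
eapply Rle_trans; [apply (increment_bound (Derive f) t c M H2)|].
- intros z; rewrite Rmin_right, Rmax_left by lra; intros; apply HM; lra.
- apply Rmult_le_compat_l; [assumption|].
  rewrite <- Rabs_Ropp, Rabs_pos_eq; lra.
Qed.

(** Stability of increments under a C^2 function: the increments of [F] along two
    segments differ by the difference of the steps, plus a step times the distance
    between the segments. *)
Lemma increment_difference (F F1 F2 : R -> R) (lo hi M a a' b b' : R) :
  (forall z, lo <= z <= hi -> is_derive F z (F1 z)) ->
  (forall z, lo <= z <= hi -> is_derive F1 z (F2 z)) ->
  (forall z, lo <= z <= hi -> Rabs (F1 z) <= M /\ Rabs (F2 z) <= M) ->
  lo <= a <= hi -> lo <= a' <= hi -> lo <= b <= hi -> lo <= b' <= hi ->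
  Rabs ((F a' - F a) - (F b' - F b))
  <= M * Rabs ((a' - a) - (b' - b)) + M * Rabs (b' - b) * (Rabs (a - b) + Rabs (a' - b')).
Proof.
intros H1 H2 HM Ha Ha' Hb Hb'.
set (A := fun s => a + s * (a' - a)); set (B := fun s => b + s * (b' - b)).
assert (RA : forall s, 0 <= s <= 1 -> lo <= A s <= hi) by (intros; unfold A; nra).
assert (RB : forall s, 0 <= s <= 1 -> lo <= B s <= hi) by (intros; unfold B; nra).
assert (HD : forall s, 0 <= s <= 1 -> is_derive (fun s => F (A s) - F (B s)) s
   ((a' - a) * F1 (A s) - (b' - b) * F1 (B s))).
{ intros s Hs; apply (is_derive_minus (V := R_NormedModule)).
  - apply (is_derive_comp F A); [now apply H1, RA|unfold A; auto_derive; [trivial|ring]].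
  - apply (is_derive_comp F B); [now apply H1, RB|unfold B; auto_derive; [trivial|ring]]. }
assert (E := MVT_gen (fun s => F (A s) - F (B s)) 0 1
   (fun s => (a' - a) * F1 (A s) - (b' - b) * F1 (B s))).
rewrite Rmin_left, Rmax_right in E by lra.
destruct E as (s & Hs & E).
- intros; apply HD; lra.
- intros s Hs; apply continuity_pt_filterlim.
  apply (ex_derive_continuous (V := R_NormedModule) (fun s => F (A s) - F (B s)) s).
  exact (ex_intro _ _ (HD s Hs)).
- assert (A1 : A 1 = a') by (unfold A; ring); assert (A0 : A 0 = a) by (unfold A; ring).
  assert (B1 : B 1 = b') by (unfold B; ring); assert (B0 : B 0 = b) by (unfold B; ring).
  rewrite A1, A0, B1, B0 in E.
  replace (F a' - F a - (F b' - F b)) with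
    (((a' - a) - (b' - b)) * F1 (A s) + (b' - b) * (F1 (A s) - F1 (B s))) by lra.
  eapply Rle_trans; [apply Rabs_triang|]; rewrite !Rabs_mult.
  assert (EB : Rabs (F1 (A s) - F1 (B s)) <= M * (Rabs (a - b) + Rabs (a' - b'))).
  { assert (E2 := MVT_gen F1 (B s) (A s) F2).
    assert (R2 : forall z, Rmin (B s) (A s) <= z <= Rmax (B s) (A s) -> lo <= z <= hi).
    { specialize (RA s Hs); specialize (RB s Hs); intros z.
      unfold Rmin, Rmax; destruct (Rle_dec (B s) (A s)); lra. }
    destruct E2 as (c & Hc & ->).
    - intros z Hz; apply H2, R2; lra.
    - intros z Hz; apply continuity_pt_filterlim.
      apply (ex_derive_continuous (V := R_NormedModule) F1 z).
      exact (ex_intro _ _ (H2 z (R2 z Hz))).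
    - rewrite Rabs_mult.
      assert (Rabs (A s - B s) <= Rabs (a - b) + Rabs (a' - b')).
      { replace (A s - B s) with ((1 - s) * (a - b) + s * (a' - b')) by (unfold A, B; ring).
        eapply Rle_trans; [apply Rabs_triang|].
        rewrite !Rabs_mult, (Rabs_pos_eq (1 - s)), (Rabs_pos_eq s) by lra.
        generalize (Rabs_pos (a - b)) (Rabs_pos (a' - b')); nra. }
      apply Rmult_le_compat; try apply Rabs_pos; [apply HM, R2, Hc|assumption]. }
  assert (E1 : Rabs (F1 (A s)) <= M) by apply HM, RA, Hs.
  generalize (Rabs_pos (a' - a - (b' - b))) (Rabs_pos (b' - b)); intros P1 P2.
  assert (Rabs (a' - a - (b' - b)) * Rabs (F1 (A s)) <= M * Rabs (a' - a - (b' - b)))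
    by (rewrite Rmult_comm; now apply Rmult_le_compat_r).
  assert (Rabs (b' - b) * Rabs (F1 (A s) - F1 (B s))
     <= M * Rabs (b' - b) * (Rabs (a - b) + Rabs (a' - b'))).
  { replace (M * Rabs (b' - b) * (Rabs (a - b) + Rabs (a' - b')))
      with (Rabs (b' - b) * (M * (Rabs (a - b) + Rabs (a' - b')))) by ring.
    now apply Rmult_le_compat_l. }
  lra.
Qed.

(** * Weighted sums *)

(** With [w = h * k] this is the integral of a grid function. *)
Definition I2 (w : R) (a b : nat) (F : gridfun) : R := S2 a b (fun i j => w * F i j).

Lemma I2_S2 w a b F : I2 w a b F = w * S2 a b F.
Proof. apply S2_scal. Qed.

Lemma I2_le w a b F G : 0 <= w ->
  (forall i j, (1 <= i <= a)%nat -> (1 <= j <= b)%nat -> F i j <= G i j) ->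
  I2 w a b F <= I2 w a b G.
Proof. intros Hw H; apply S2_le; intros; apply Rmult_le_compat_l; auto. Qed.

Lemma I2_ext w a b F G :
  (forall i j, (1 <= i <= a)%nat -> (1 <= j <= b)%nat -> F i j = G i j) ->
  I2 w a b F = I2 w a b G.
Proof. intros H; apply S2_ext; intros; f_equal; auto. Qed.

Lemma I2_ge0 w a b F : 0 <= w ->
  (forall i j, (1 <= i <= a)%nat -> (1 <= j <= b)%nat -> 0 <= F i j) -> 0 <= I2 w a b F.
Proof. intros Hw H; apply S2_ge0; intros; apply Rmult_le_pos; auto. Qed.

Lemma I2_plus w a b F G :
  I2 w a b (fun i j => F i j + G i j) = I2 w a b F + I2 w a b G.
Proof. rewrite !I2_S2, S2_plus; ring. Qed.

Lemma I2_minus w a b F G :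
  I2 w a b (fun i j => F i j - G i j) = I2 w a b F - I2 w a b G.
Proof. rewrite !I2_S2, S2_minus; ring. Qed.

Lemma I2_scal w a b c F : I2 w a b (fun i j => c * F i j) = c * I2 w a b F.
Proof. rewrite !I2_S2, S2_scal; ring. Qed.

Lemma I2_swap w a b F : I2 w a b F = I2 w b a (fun i j => F j i).
Proof. rewrite !I2_S2; f_equal; apply S2_swap. Qed.

Lemma I2_sq_ge0 w a b F : 0 <= w -> 0 <= I2 w a b (fun i j => (F i j) ^ 2).
Proof. intros; apply I2_ge0; intros; [assumption|apply pow2_ge_0]. Qed.

Lemma I2_by_parts_x w Nx Ny h V g : (1 <= Nx)%nat ->
  (forall j, (1 <= j <= Ny)%nat -> V 0%nat j = 0 /\ V Nx j = 0) ->
  I2 w Nx Ny (fun i j => Dxm h V i j * g i j)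
  = - I2 w (Nx - 1) Ny (fun i j => V i j * dxm h g i j).
Proof. intros; rewrite !I2_S2, S2_by_parts_x by assumption; ring. Qed.

Lemma I2_by_parts_y w Nx Ny k V g : (1 <= Ny)%nat ->
  (forall i, (1 <= i <= Nx)%nat -> V i 0%nat = 0 /\ V i Ny = 0) ->
  I2 w Nx Ny (fun i j => Dym k V i j * g i j)
  = - I2 w Nx (Ny - 1) (fun i j => V i j * dym k g i j).
Proof. intros; rewrite !I2_S2, S2_by_parts_y by assumption; ring. Qed.

Lemma I2_xedges_le w a b F : 0 <= w -> (forall i j, 0 <= F i j) ->
  I2 w (a - 1) b F <= I2 w a b F.
Proof.
intros Hw HF; rewrite !I2_S2; apply Rmult_le_compat_l; [assumption|].
apply rsum_subrange; try lia; intros; apply rsum_ge0; intros; apply HF.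
Qed.

Ltac I2_push := repeat first [rewrite I2_plus | rewrite I2_minus | rewrite I2_scal].

(** * Energy estimate for the pressure *)

(** Backward differencing of the weighted square of the flux error [Y], whose relation
    to the pressure gradient error [dq] is [rho Y = - (dq + theta)]. *)
Lemma darcy_increment (rho rho' Y Y' dq dq' th th' tau K T : R) :
  0 < rho -> 0 < tau -> 0 <= K ->
  rho * Y = - (dq + th) -> rho' * Y' = - (dq' + th') ->
  Rabs (rho' - rho) <= K * tau -> Rabs (th' - th) <= tau * T ->
  / 2 * (rho' * Y' ^ 2) - / 2 * (rho * Y ^ 2)
  - tau * (K + 1) * (Y' ^ 2 + T ^ 2) <= - (Y' * (dq' - dq)).
Proof.
intros Hr Ht HK E E' Hrho Hth.
replace (- (Y' * (dq' - dq))) with (Y' * (rho' * Y' - rho * Y) + Y' * (th' - th))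
  by (rewrite E, E'; ring).
assert (A : - (tau * (Y' ^ 2 + T ^ 2)) / 2 <= Y' * (th' - th)).
{ assert (B : Rabs (Y' * (th' - th)) <= Rabs Y' * (tau * T)).
  { rewrite Rabs_mult; apply Rmult_le_compat_l; [apply Rabs_pos|assumption]. }
  apply Rabs_le_between in B.
  assert (Rabs Y' * T <= (Y' ^ 2 + T ^ 2) / 2)
    by (generalize (pow2_ge_0 (Rabs Y' - T)); rewrite <- (pow2_abs Y'); lra).
  nra. }
assert (B : - (K * tau * Y' ^ 2) <= (rho' - rho) * Y' ^ 2).
{ apply Rabs_le_between in Hrho; generalize (pow2_ge_0 Y'); nra. }
assert (0 <= rho * (Y' - Y) ^ 2) by (apply Rmult_le_pos; [lra|apply pow2_ge_0]).
assert (0 <= K * tau * Y' ^ 2) by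
  (apply Rmult_le_pos; [apply Rmult_le_pos; lra|apply pow2_ge_0]).
assert (0 <= K * tau * T ^ 2) by
  (apply Rmult_le_pos; [apply Rmult_le_pos; lra|apply pow2_ge_0]).
assert (0 <= tau * Y' ^ 2) by (apply Rmult_le_pos; [lra|apply pow2_ge_0]).
assert (0 <= tau * T ^ 2) by (apply Rmult_le_pos; [lra|apply pow2_ge_0]).
lra.
Qed.

(** The test function is the time increment of the pressure error, not the pressure error:
    summation by parts then produces the increments of the pressure gradient error, which
    [darcy_increment] compares with the velocity energy.  The data [d] and [r] stand for
    the time increment of the porosity error and the truncation error, [Tx] and [Ty] bound
    the rate of change of the consistency error of Darcy's law. *)
Lemma pressure_step (Nx Ny : nat) (h k tau w gam K eps : R)
   (q q' d r : gridfun)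
   (rx rx' Yx Yx' thx thx' Tx ry ry' Yy Yy' thy thy' Ty : gridfun) :
  (1 <= Nx)%nat -> (1 <= Ny)%nat -> 0 < h -> 0 < k -> 0 < tau -> 0 < w -> 0 < gam -> 0 <= K ->
  (forall i j, is_cell Nx Ny i j ->
     gam * ((q' i j - q i j) / tau) + d i j + Dxm h Yx' i j + Dym k Yy' i j = r i j /\
     Rabs (r i j) <= K * eps) ->
  (forall j, (1 <= j <= Ny)%nat -> Yx' 0%nat j = 0 /\ Yx' Nx j = 0) ->
  (forall i, (1 <= i <= Nx)%nat -> Yy' i 0%nat = 0 /\ Yy' i Ny = 0) ->
  (forall i j, is_xedge Nx Ny i j ->
     0 < rx i j /\ rx i j * Yx i j = - (dxm h q i j + thx i j) /\
     rx' i j * Yx' i j = - (dxm h q' i j + thx' i j) /\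
     Rabs (rx' i j - rx i j) <= K * tau /\ Rabs (thx' i j - thx i j) <= tau * Tx i j) ->
  (forall i j, is_yedge Nx Ny i j ->
     0 < ry i j /\ ry i j * Yy i j = - (dym k q i j + thy i j) /\
     ry' i j * Yy' i j = - (dym k q' i j + thy' i j) /\
     Rabs (ry' i j - ry i j) <= K * tau /\ Rabs (thy' i j - thy i j) <= tau * Ty i j) ->
  / 2 * (I2 w (Nx - 1) Ny (fun i j => rx' i j * Yx' i j ^ 2)
         + I2 w Nx (Ny - 1) (fun i j => ry' i j * Yy' i j ^ 2))
  + I2 w Nx Ny (fun i j => q' i j ^ 2)
  + tau * (gam / 4) * I2 w Nx Ny (fun i j => ((q' i j - q i j) / tau) ^ 2)
  <= / 2 * (I2 w (Nx - 1) Ny (fun i j => rx i j * Yx i j ^ 2)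
         + I2 w Nx (Ny - 1) (fun i j => ry i j * Yy i j ^ 2))
  + I2 w Nx Ny (fun i j => q i j ^ 2)
  + tau * (K + 1 + (5 + K ^ 2) / gam) *
    (I2 w (Nx - 1) Ny (fun i j => Yx' i j ^ 2) + I2 w Nx (Ny - 1) (fun i j => Yy' i j ^ 2)
     + I2 w (Nx - 1) Ny (fun i j => Tx i j ^ 2) + I2 w Nx (Ny - 1) (fun i j => Ty i j ^ 2)
     + I2 w Nx Ny (fun i j => q' i j ^ 2) + I2 w Nx Ny (fun i j => d i j ^ 2)
     + I2 w Nx Ny (fun _ _ => eps ^ 2)).
Proof.
intros HNx HNy Hh Hk Ht Hw Hg HK Hcell Bx By Hx Hy.
set (s := fun i j => (q' i j - q i j) / tau).
(* the equation tested with the increment of the pressure error *)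
assert (E : I2 w Nx Ny (fun i j => Dxm h Yx' i j * (q' i j - q i j))
          + I2 w Nx Ny (fun i j => Dym k Yy' i j * (q' i j - q i j))
          = I2 w Nx Ny (fun i j => (r i j - d i j - gam * s i j) * (tau * s i j))).
{ rewrite <- I2_plus; apply I2_ext; intros i j Hi Hj.
  destruct (Hcell i j (conj Hi Hj)) as [<- _]; unfold s; field; lra. }
rewrite I2_by_parts_x, I2_by_parts_y in E by assumption.
assert (Ex : I2 w (Nx - 1) Ny (fun i j => / 2 * (rx' i j * Yx' i j ^ 2)
     - / 2 * (rx i j * Yx i j ^ 2) - tau * (K + 1) * (Yx' i j ^ 2 + Tx i j ^ 2))
  <= I2 w (Nx - 1) Ny (fun i j =>
       (-1) * (Yx' i j * dxm h (fun i j => q' i j - q i j) i j))).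
{ apply I2_le; [lra|]; intros i j Hi Hj.
  destruct (Hx i j) as (A1 & A2 & A3 & A4 & A5); [split; lia|].
  replace (_ * (Yx' i j * _)) with (- (Yx' i j * (dxm h q' i j - dxm h q i j)))
    by (unfold dxm; field; lra).
  now apply darcy_increment with (thx i j) (thx' i j). }
assert (Ey : I2 w Nx (Ny - 1) (fun i j => / 2 * (ry' i j * Yy' i j ^ 2)
     - / 2 * (ry i j * Yy i j ^ 2) - tau * (K + 1) * (Yy' i j ^ 2 + Ty i j ^ 2))
  <= I2 w Nx (Ny - 1) (fun i j =>
       (-1) * (Yy' i j * dym k (fun i j => q' i j - q i j) i j))).
{ apply I2_le; [lra|]; intros i j Hi Hj.
  destruct (Hy i j) as (A1 & A2 & A3 & A4 & A5); [split; lia|].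
  replace (_ * (Yy' i j * _)) with (- (Yy' i j * (dym k q' i j - dym k q i j)))
    by (unfold dym; field; lra).
  now apply darcy_increment with (thy i j) (thy' i j). }
assert (Ec : I2 w Nx Ny (fun i j => (r i j - d i j - gam * s i j) * (tau * s i j))
  <= I2 w Nx Ny (fun i j => tau * ((1 + K ^ 2) / gam) * (d i j ^ 2 + eps ^ 2)
       - tau * (gam / 2) * s i j ^ 2)).
{ apply I2_le; [lra|]; intros i j Hi Hj.
  destruct (Hcell i j (conj Hi Hj)) as [_ Hr].
  apply Rabs_le_sq in Hr; rewrite Rpow_mult_distr in Hr.
  assert (A : (r i j - d i j) * s i j <= gam / 2 * s i j ^ 2 + (r i j ^ 2 + d i j ^ 2) / gam).
  { assert (B : 0 <= (gam * s i j - (r i j - d i j)) ^ 2 / (2 * gam))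
      by (apply Rdiv_le_0_compat; [apply pow2_ge_0|lra]).
    assert (B' : 0 <= (r i j + d i j) ^ 2 / (2 * gam))
      by (apply Rdiv_le_0_compat; [apply pow2_ge_0|lra]).
    replace ((gam * s i j - (r i j - d i j)) ^ 2 / (2 * gam)) with
      (gam / 2 * s i j ^ 2 - (r i j - d i j) * s i j + (r i j - d i j) ^ 2 / (2 * gam)) in B
      by (field; lra).
    replace ((r i j ^ 2 + d i j ^ 2) / gam) with
      ((r i j - d i j) ^ 2 / (2 * gam) + (r i j + d i j) ^ 2 / (2 * gam)) by (field; lra).
    lra. }
  assert (B : (r i j ^ 2 + d i j ^ 2) / gam <= (1 + K ^ 2) / gam * (d i j ^ 2 + eps ^ 2)).
  { unfold Rdiv; rewrite (Rmult_comm (1 + K ^ 2)), Rmult_assoc, (Rmult_comm _ (/ gam)).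
    apply Rmult_le_compat_l; [apply Rlt_le, Rinv_0_lt_compat, Hg|].
    generalize (pow2_ge_0 (d i j)) (pow2_ge_0 eps) (pow2_ge_0 K); nra. }
  assert (tau * ((r i j - d i j) * s i j) <= tau * (gam / 2 * s i j ^ 2 +
     (1 + K ^ 2) / gam * (d i j ^ 2 + eps ^ 2))) by (apply Rmult_le_compat_l; lra).
  lra. }
assert (Eq : I2 w Nx Ny (fun i j => q' i j ^ 2 - q i j ^ 2)
  <= I2 w Nx Ny (fun i j => tau * (gam / 4) * s i j ^ 2 + tau * (4 / gam) * q' i j ^ 2)).
{ apply I2_le; [lra|]; intros i j Hi Hj.
  assert (A : 2 * (q' i j * s i j) <= gam / 4 * s i j ^ 2 + 4 / gam * q' i j ^ 2).
  { assert (B : 0 <= (gam * s i j - 4 * q' i j) ^ 2 / (4 * gam))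
      by (apply Rdiv_le_0_compat; [apply pow2_ge_0|lra]).
    replace ((gam * s i j - 4 * q' i j) ^ 2 / (4 * gam)) with
      (gam / 4 * s i j ^ 2 - 2 * (q' i j * s i j) + 4 / gam * q' i j ^ 2) in B
      by (field; lra).
    lra. }
  assert (B : q' i j ^ 2 - q i j ^ 2 <= 2 * q' i j * (tau * s i j)).
  { replace (tau * s i j) with (q' i j - q i j) by (unfold s; field; lra).
    generalize (pow2_ge_0 (q' i j - q i j)); lra. }
  apply Rmult_le_compat_l with (r := tau) in A; lra. }
revert E Ex Ey Ec Eq; I2_push; fold s.
change (I2 w Nx Ny (fun i j => ((q' i j - q i j) / tau) ^ 2))
  with (I2 w Nx Ny (fun i j => s i j ^ 2)).
generalize (I2_sq_ge0 w (Nx - 1) Ny Yx' (Rlt_le _ _ Hw))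
  (I2_sq_ge0 w Nx (Ny - 1) Yy' (Rlt_le _ _ Hw))
  (I2_sq_ge0 w (Nx - 1) Ny Tx (Rlt_le _ _ Hw))
  (I2_sq_ge0 w Nx (Ny - 1) Ty (Rlt_le _ _ Hw))
  (I2_sq_ge0 w Nx Ny q' (Rlt_le _ _ Hw))
  (I2_sq_ge0 w Nx Ny d (Rlt_le _ _ Hw))
  (I2_sq_ge0 w Nx Ny (fun _ _ => eps) (Rlt_le _ _ Hw)); cbv beta.
set (a1 := I2 w (Nx - 1) Ny (fun i j => Yx' i j ^ 2)).
set (a2 := I2 w Nx (Ny - 1) (fun i j => Yy' i j ^ 2)).
set (a3 := I2 w (Nx - 1) Ny (fun i j => Tx i j ^ 2)).
set (a4 := I2 w Nx (Ny - 1) (fun i j => Ty i j ^ 2)).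
set (a5 := I2 w Nx Ny (fun i j => q' i j ^ 2)).
set (a6 := I2 w Nx Ny (fun i j => d i j ^ 2)).
set (a7 := I2 w Nx Ny (fun i j => eps ^ 2)).
intros P1 P2 P3 P4 P5 P6 P7 E Ex Ey Ec Eq.
assert (G1 : 0 <= (5 + K ^ 2) / gam)
  by (apply Rdiv_le_0_compat; [generalize (pow2_ge_0 K); lra|assumption]).
assert (Q1 : 0 <= tau * ((5 + K ^ 2) / gam) * (a1 + a2 + a3 + a4))
  by (apply Rmult_le_pos; [apply Rmult_le_pos; lra|lra]).
assert (Q2 : 0 <= tau * (K + 1) * (a5 + a6 + a7))
  by (apply Rmult_le_pos; [apply Rmult_le_pos; lra|lra]).
assert (Q3 : tau * ((1 + K ^ 2) / gam) * (a6 + a7) <= tau * ((5 + K ^ 2) / gam) * (a6 + a7)).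
{ apply Rmult_le_compat_r; [lra|apply Rmult_le_compat_l; [lra|]].
  apply Rmult_le_compat_r; [apply Rlt_le, Rinv_0_lt_compat, Hg|lra]. }
assert (Q4 : tau * (4 / gam) * a5 <= tau * ((5 + K ^ 2) / gam) * a5).
{ apply Rmult_le_compat_r; [lra|apply Rmult_le_compat_l; [lra|]].
  apply Rmult_le_compat_r; [apply Rlt_le, Rinv_0_lt_compat, Hg|].
  generalize (pow2_ge_0 K); lra. }
replace (K + 1 + (5 + K ^ 2) / gam) with ((K + 1) + ((5 + K ^ 2) / gam)) by ring.
set (g1 := (5 + K ^ 2) / gam) in *; set (g2 := (1 + K ^ 2) / gam) in *.
lra.
Qed.

(** * Energy estimate for a transported quantity *)

(** By the Cauchy-Schwarz and Ladyzhenskaya inequalities; [a] balances the two factors. *)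
Lemma cubic_term (Nx Ny : nat) (h k a c : R) (t e : gridfun) :
  (1 <= Nx)%nat -> (1 <= Ny)%nat -> 0 < h -> 0 < k -> 0 < a ->
  / (INR Nx * h) ^ 2 + / (INR Ny * k) ^ 2 = c ->
  I2 (h * k) Nx Ny (fun i j => Rabs (t i j) * e i j ^ 2)
  <= a * (I2 (h * k) Nx Ny (fun i j => t i j ^ 2) * I2 (h * k) Nx Ny (fun i j => e i j ^ 2))
   + (c * I2 (h * k) Nx Ny (fun i j => e i j ^ 2)
      + 4 * (I2 (h * k) (Nx - 1) Ny (fun i j => dxm h e i j ^ 2)
             + I2 (h * k) Nx (Ny - 1) (fun i j => dym k e i j ^ 2))) / (4 * a).
Proof.
intros HNx HNy Hh Hk Ha Hc.
assert (hk : 0 < h * k) by now apply Rmult_lt_0_compat.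
assert (hk' := Rlt_le _ _ hk).
assert (HL := ladyzhenskaya Nx Ny h k e Hh Hk HNx HNy).
rewrite Hc in HL; rewrite <- !I2_S2 in HL.
assert (HCS : (I2 (h * k) Nx Ny (fun i j => Rabs (t i j) * e i j ^ 2)) ^ 2
  <= I2 (h * k) Nx Ny (fun i j => t i j ^ 2) * I2 (h * k) Nx Ny (fun i j => e i j ^ 4)).
{ rewrite !I2_S2, Rpow_mult_distr.
  replace (h * k * S2 Nx Ny (fun i j => t i j ^ 2) * (h * k * S2 Nx Ny (fun i j => e i j ^ 4)))
    with ((h * k) ^ 2 * (S2 Nx Ny (fun i j => t i j ^ 2) * S2 Nx Ny (fun i j => e i j ^ 4)))
    by ring.
  apply Rmult_le_compat_l; [apply pow2_ge_0|].
  eapply Rle_trans; [apply S2_CS|]; apply Req_le; f_equal; apply S2_ext; intros.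
  - apply pow2_abs.
  - ring. }
assert (X0 : 0 <= I2 (h * k) Nx Ny (fun i j => Rabs (t i j) * e i j ^ 2)).
{ apply I2_ge0; [assumption|]; intros.
  apply Rmult_le_pos; [apply Rabs_pos|apply pow2_ge_0]. }
assert (P1 := I2_sq_ge0 (h * k) Nx Ny t hk').
assert (P2 := I2_sq_ge0 (h * k) Nx Ny e hk').
assert (P3 := I2_sq_ge0 (h * k) (Nx - 1) Ny (dxm h e) hk').
assert (P4 := I2_sq_ge0 (h * k) Nx (Ny - 1) (dym k e) hk').
set (X := I2 _ _ _ (fun i j => Rabs (t i j) * e i j ^ 2)) in *.
set (T := I2 _ _ _ (fun i j => t i j ^ 2)) in *.
set (N := I2 _ _ _ (fun i j => e i j ^ 2)) in *.
set (D := _ + I2 _ Nx (Ny - 1) (fun i j => dym k e i j ^ 2)) in *.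
assert (D0 : 0 <= D) by (unfold D; lra).
assert (c0 : 0 <= c).
{ rewrite <- Hc; apply Rplus_le_le_0_compat; apply Rlt_le, Rinv_0_lt_compat, pow_lt;
  apply Rmult_lt_0_compat; try assumption; apply lt_0_INR; lia. }
set (F4 := I2 _ _ _ (fun i j => e i j ^ 4)) in *.
assert (H : X ^ 2 <= (T * N) * (c * N + 4 * D)).
{ eapply Rle_trans; [exact HCS|].
  replace (T * N * (c * N + 4 * D)) with (T * (c * N ^ 2 + 4 * N * D)) by ring.
  now apply Rmult_le_compat_l. }
set (A := a * (T * N)); set (B := (c * N + 4 * D) / (4 * a)).
assert (A0 : 0 <= A) by (apply Rmult_le_pos; [lra|now apply Rmult_le_pos]).
assert (B0 : 0 <= B).
{ apply Rdiv_le_0_compat; [|lra].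
  apply Rplus_le_le_0_compat; [now apply Rmult_le_pos|lra]. }
assert (E : (T * N) * (c * N + 4 * D) = 4 * A * B) by (unfold A, B; field; lra).
rewrite E in H.
apply Rsqr_incr_0_var; [rewrite !Rsqr_pow2|lra].
generalize (pow2_ge_0 (A - B)); lra.
Qed.

(** The test function is the error at the new level.  The flux error [EW] is split into
    convection by the two-point average, which is skew-symmetric up to the divergence of
    [U], diffusion, and a remainder [g] of which a part may be absorbed by diffusion; [t]
    is the rate of change of the pressure error.  The constant does not depend on the
    mesh. *)
Lemma transport_step (Nx Ny : nat) (h k tau gam K v lam0 c Gs : R)
   (e e' t kap kap' r : gridfun)
   (Ux Uy EWx EWy lamx lamy gx gy : gridfun) :
  (1 <= Nx)%nat -> (1 <= Ny)%nat -> 0 < h -> 0 < k -> 0 < tau -> 0 < gam -> 0 <= K ->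
  0 <= v -> 0 < lam0 -> / (INR Nx * h) ^ 2 + / (INR Ny * k) ^ 2 = c ->
  (forall i j, is_cell Nx Ny i j ->
     (kap' i j * e' i j - kap i j * e i j) / tau + Dxm h EWx i j + Dym k EWy i j = r i j /\
     0 <= kap i j /\ Rabs (kap' i j - kap i j) <= K * tau /\
     Rabs (Dxm h Ux i j + Dym k Uy i j + gam * t i j) <= K) ->
  (forall j, (1 <= j <= Ny)%nat ->
     (EWx 0%nat j = 0 /\ EWx Nx j = 0) /\ (Ux 0%nat j = 0 /\ Ux Nx j = 0)) ->
  (forall i, (1 <= i <= Nx)%nat ->
     (EWy i 0%nat = 0 /\ EWy i Ny = 0) /\ (Uy i 0%nat = 0 /\ Uy i Ny = 0)) ->
  (forall i j, is_xedge Nx Ny i j -> lam0 <= lamx i j /\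
     EWx i j = v * (Ux i j * ((e' i j + e' (S i) j) / 2)) - lamx i j * dxm h e' i j + gx i j) ->
  (forall i j, is_yedge Nx Ny i j -> lam0 <= lamy i j /\
     EWy i j = v * (Uy i j * ((e' i j + e' i (S j)) / 2)) - lamy i j * dym k e' i j + gy i j) ->
  I2 (h * k) (Nx - 1) Ny (fun i j => gx i j ^ 2)
  + I2 (h * k) Nx (Ny - 1) (fun i j => gy i j ^ 2)
  <= lam0 ^ 2 / 4 * (I2 (h * k) (Nx - 1) Ny (fun i j => dxm h e' i j ^ 2)
                     + I2 (h * k) Nx (Ny - 1) (fun i j => dym k e' i j ^ 2)) + Gs ->
  0 <= Gs ->
  / 2 * I2 (h * k) Nx Ny (fun i j => kap' i j * e' i j ^ 2)
  + tau * (lam0 / 4) * (I2 (h * k) (Nx - 1) Ny (fun i j => dxm h e' i j ^ 2)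
                        + I2 (h * k) Nx (Ny - 1) (fun i j => dym k e' i j ^ 2))
  <= / 2 * I2 (h * k) Nx Ny (fun i j => kap i j * e i j ^ 2)
  + tau * (1 + K + v * K + v * gam * c + / lam0 + v * gam * (1 + 4 * v * gam / lam0)) *
    (I2 (h * k) Nx Ny (fun i j => e' i j ^ 2) + I2 (h * k) Nx Ny (fun i j => r i j ^ 2) + Gs
     + I2 (h * k) Nx Ny (fun i j => t i j ^ 2) * I2 (h * k) Nx Ny (fun i j => e' i j ^ 2)).
Proof.
intros HNx HNy Hh Hk Ht Hg HK Hv Hl Hc Hcell Bx By Hx Hy HG HGs.
assert (hk : 0 < h * k) by now apply Rmult_lt_0_compat.
assert (hk' := Rlt_le _ _ hk).
set (a := 1 + 4 * v * gam / lam0).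
assert (vg : 0 <= v * gam) by (apply Rmult_le_pos; lra).
assert (Ha1 : 0 <= 4 * v * gam / lam0) by (apply Rdiv_le_0_compat; lra).
assert (Ha : 0 < a) by (unfold a; lra).
assert (HC := cubic_term Nx Ny h k a c t e' HNx HNy Hh Hk Ha Hc).
(* the equation tested with the error *)
assert (E : I2 (h * k) Nx Ny (fun i j => Dxm h EWx i j * e' i j)
          + I2 (h * k) Nx Ny (fun i j => Dym k EWy i j * e' i j)
          = I2 (h * k) Nx Ny (fun i j =>
              (r i j - (kap' i j * e' i j - kap i j * e i j) / tau) * e' i j)).
{ rewrite <- I2_plus; apply I2_ext; intros i j Hi Hj.
  destruct (Hcell i j (conj Hi Hj)) as [<- _]; ring. }
rewrite I2_by_parts_x, I2_by_parts_y in E; try assumption;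
  try (intros; first [now apply Bx|now apply By]).
(* convection with the averaged error is skew-symmetric up to the divergence *)
assert (Ux2 := I2_by_parts_x (h * k) Nx Ny h Ux (fun i j => e' i j ^ 2 / 2) HNx
   (fun j Hj => proj2 (Bx j Hj))).
assert (Uy2 := I2_by_parts_y (h * k) Nx Ny k Uy (fun i j => e' i j ^ 2 / 2) HNy
   (fun j Hj => proj2 (By j Hj))).
assert (Ex : I2 (h * k) (Nx - 1) Ny (fun i j =>
     (- v) * (Ux i j * dxm h (fun i j => e' i j ^ 2 / 2) i j)
     + 3 / 4 * lam0 * dxm h e' i j ^ 2 - / lam0 * gx i j ^ 2)
  <= I2 (h * k) (Nx - 1) Ny (fun i j => (-1) * (EWx i j * dxm h e' i j))).
{ apply I2_le; [assumption|]; intros i j Hi Hj.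
  destruct (Hx i j) as (A1 & ->); [split; lia|].
  replace (dxm h (fun i j => e' i j ^ 2 / 2) i j) with
    ((e' i j + e' (S i) j) / 2 * dxm h e' i j) by (unfold dxm; field; lra).
  set (m := (e' i j + e' (S i) j) / 2); set (de := dxm h e' i j).
  assert (B : 0 <= (lam0 / 2 * de - gx i j) ^ 2 / lam0)
    by (apply Rdiv_le_0_compat; [apply pow2_ge_0|lra]).
  replace ((lam0 / 2 * de - gx i j) ^ 2 / lam0) with
    (/ 4 * lam0 * de ^ 2 - gx i j * de + / lam0 * gx i j ^ 2) in B by (field; lra).
  assert (lam0 * de ^ 2 <= lamx i j * de ^ 2)
    by (apply Rmult_le_compat_r; [apply pow2_ge_0|assumption]).
  lra. }
assert (Ey : I2 (h * k) Nx (Ny - 1) (fun i j =>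
     (- v) * (Uy i j * dym k (fun i j => e' i j ^ 2 / 2) i j)
     + 3 / 4 * lam0 * dym k e' i j ^ 2 - / lam0 * gy i j ^ 2)
  <= I2 (h * k) Nx (Ny - 1) (fun i j => (-1) * (EWy i j * dym k e' i j))).
{ apply I2_le; [assumption|]; intros i j Hi Hj.
  destruct (Hy i j) as (A1 & ->); [split; lia|].
  replace (dym k (fun i j => e' i j ^ 2 / 2) i j) with
    ((e' i j + e' i (S j)) / 2 * dym k e' i j) by (unfold dym; field; lra).
  set (m := (e' i j + e' i (S j)) / 2); set (de := dym k e' i j).
  assert (B : 0 <= (lam0 / 2 * de - gy i j) ^ 2 / lam0)
    by (apply Rdiv_le_0_compat; [apply pow2_ge_0|lra]).
  replace ((lam0 / 2 * de - gy i j) ^ 2 / lam0) with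
    (/ 4 * lam0 * de ^ 2 - gy i j * de + / lam0 * gy i j ^ 2) in B by (field; lra).
  assert (lam0 * de ^ 2 <= lamy i j * de ^ 2)
    by (apply Rmult_le_compat_r; [apply pow2_ge_0|assumption]).
  lra. }
assert (Ec : I2 (h * k) Nx Ny (fun i j =>
     tau * ((r i j - (kap' i j * e' i j - kap i j * e i j) / tau) * e' i j))
  <= I2 (h * k) Nx Ny (fun i j => tau * (1 + K) * e' i j ^ 2 + tau * r i j ^ 2
       + / 2 * (kap i j * e i j ^ 2) - / 2 * (kap' i j * e' i j ^ 2))).
{ apply I2_le; [assumption|]; intros i j Hi Hj.
  destruct (Hcell i j (conj Hi Hj)) as (_ & A1 & A2 & _).
  apply Rabs_le_between in A2.
  replace (tau * ((r i j - (kap' i j * e' i j - kap i j * e i j) / tau) * e' i j))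
    with (tau * (r i j * e' i j) - (kap' i j * e' i j - kap i j * e i j) * e' i j)
    by (field; lra).
  assert (B1 : r i j * e' i j <= e' i j ^ 2 + r i j ^ 2)
    by (generalize (pow2_ge_0 (r i j - e' i j)) (pow2_ge_0 (r i j + e' i j)); lra).
  apply Rmult_le_compat_l with (r := tau) in B1; [|lra].
  assert (B2 : - (K * tau * e' i j ^ 2) <= (kap' i j - kap i j) * e' i j ^ 2).
  { rewrite Ropp_mult_distr_l; apply Rmult_le_compat_r; [apply pow2_ge_0|lra]. }
  assert (B3 : 0 <= kap i j * (e' i j - e i j) ^ 2)
    by (apply Rmult_le_pos; [assumption|apply pow2_ge_0]).
  assert (0 <= K * tau * e' i j ^ 2)
    by (apply Rmult_le_pos; [apply Rmult_le_pos; lra|apply pow2_ge_0]).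
  lra. }
assert (Ed : I2 (h * k) Nx Ny (fun i j =>
    (- (K / 2)) * e' i j ^ 2 + (- (gam / 2)) * (Rabs (t i j) * e' i j ^ 2))
  <= I2 (h * k) Nx Ny (fun i j => Dxm h Ux i j * (e' i j ^ 2 / 2)
       + Dym k Uy i j * (e' i j ^ 2 / 2))).
{ apply I2_le; [assumption|]; intros i j Hi Hj.
  destruct (Hcell i j (conj Hi Hj)) as (_ & _ & _ & A).
  apply Rabs_le_between in A.
  assert (B : gam * t i j <= gam * Rabs (t i j))
    by (apply Rmult_le_compat_l; [lra|apply Rle_abs]).
  assert (- K - gam * Rabs (t i j) <= Dxm h Ux i j + Dym k Uy i j) by lra.
  generalize (pow2_ge_0 (e' i j)); nra. }
revert E Ux2 Uy2 Ex Ey Ec Ed HC HG; I2_push.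
assert (P1 := I2_sq_ge0 (h * k) Nx Ny t hk').
assert (P2 := I2_sq_ge0 (h * k) Nx Ny e' hk').
assert (P3 := I2_sq_ge0 (h * k) (Nx - 1) Ny (dxm h e') hk').
assert (P4 := I2_sq_ge0 (h * k) Nx (Ny - 1) (dym k e') hk').
assert (P5 := I2_sq_ge0 (h * k) Nx Ny r hk').
set (T := I2 _ _ _ (fun i j => t i j ^ 2)) in *.
set (N := I2 _ _ _ (fun i j => e' i j ^ 2)) in *.
set (Rr := I2 _ _ _ (fun i j => r i j ^ 2)) in *.
set (D1 := I2 _ _ _ (fun i j => dxm h e' i j ^ 2)) in *.
set (D2 := I2 _ _ _ (fun i j => dym k e' i j ^ 2)) in *.
set (X := I2 _ _ _ (fun i j => Rabs (t i j) * e' i j ^ 2)).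
set (gx2 := I2 _ _ _ (fun i j => gx i j ^ 2)).
set (gy2 := I2 _ _ _ (fun i j => gy i j ^ 2)).
set (k1 := I2 _ _ _ (fun i j => kap i j * e i j ^ 2)).
set (k2 := I2 _ _ _ (fun i j => kap' i j * e' i j ^ 2)).
set (ux := I2 _ _ _ (fun i j => Ux i j * dxm h _ i j)).
set (uy := I2 _ _ _ (fun i j => Uy i j * dym k _ i j)).
set (dx := I2 _ _ _ (fun i j => Dxm h Ux i j * _)).
set (dy := I2 _ _ _ (fun i j => Dym k Uy i j * _)).
set (wx := I2 _ _ _ (fun i j => EWx i j * _)).
set (wy := I2 _ _ _ (fun i j => EWy i j * _)).
set (Q := I2 _ _ _ (fun i j => (r i j - _) * _)).
intros E Ux2 Uy2 Ex Ey Ec Ed HC HG.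
assert (T0 : 0 <= T * N) by now apply Rmult_le_pos.
assert (c0 : 0 <= c).
{ rewrite <- Hc; apply Rplus_le_le_0_compat; apply Rlt_le, Rinv_0_lt_compat, pow_lt;
  apply Rmult_lt_0_compat; try assumption; apply lt_0_INR; lia. }
(* the choice of [a] leaves an eighth of the dissipation for the cubic term *)
assert (F1 : v * gam / 2 * X <= v * gam * a * (T * N) + v * gam * c * N
   + lam0 / 8 * (D1 + D2)).
{ assert (A1 : v * gam / 2 * X <= v * gam / 2 *
    (a * (T * N) + (c * N + 4 * (D1 + D2)) / (4 * a)))
    by (apply Rmult_le_compat_l; lra).
  replace (v * gam / 2 * (a * (T * N) + (c * N + 4 * (D1 + D2)) / (4 * a)))
    with (v * gam * a * (T * N) / 2 + v * gam * c * N * (/ a / 8)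
          + (v * gam / (2 * a)) * (D1 + D2)) in A1 by (field; lra).
  assert (A2 : v * gam / (2 * a) <= lam0 / 8).
  { apply Rmult_le_reg_r with (2 * a); [lra|].
    replace (v * gam / (2 * a) * (2 * a)) with (v * gam) by (field; lra).
    replace (lam0 / 8 * (2 * a)) with (lam0 / 4 + v * gam) by (unfold a; field; lra).
    lra. }
  assert (A3 : / a <= 1) by (rewrite <- Rinv_1; apply Rinv_le_contravar; unfold a; lra).
  assert (A3' : 0 < / a) by now apply Rinv_0_lt_compat.
  assert (A4 : v * gam / (2 * a) * (D1 + D2) <= lam0 / 8 * (D1 + D2))
    by (apply Rmult_le_compat_r; lra).
  assert (A5 : 0 <= v * gam * c * N) by (repeat apply Rmult_le_pos; lra).
  assert (A6 : v * gam * c * N * (/ a / 8) <= v * gam * c * N * 1)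
    by (apply Rmult_le_compat_l; lra).
  assert (A7 : 0 <= v * gam * a * (T * N)) by (repeat apply Rmult_le_pos; lra).
  lra. }
assert (F2 : / lam0 * (gx2 + gy2) <= lam0 / 4 * (D1 + D2) + / lam0 * Gs).
{ replace (lam0 / 4 * (D1 + D2) + / lam0 * Gs) with
   (/ lam0 * (lam0 ^ 2 / 4 * (D1 + D2) + Gs)) by (field; lra).
  apply Rmult_le_compat_l; [apply Rlt_le, Rinv_0_lt_compat, Hl|assumption]. }
assert (F3 : v * (- ux - uy) >= v * (- (K / 2) * N - gam / 2 * X)).
{ apply Rle_ge, Rmult_le_compat_l; lra. }
assert (HI : 0 < / lam0) by now apply Rinv_0_lt_compat.
assert (Hmain : / 2 * k2 + tau * (lam0 / 4) * (D1 + D2) <= / 2 * k1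
  + tau * ((1 + K) * N + Rr + v * K * N + v * gam * a * (T * N) + v * gam * c * N + / lam0 * Gs)).
{ assert (tau * (- v * (ux + uy) + 3 / 4 * lam0 * (D1 + D2) - / lam0 * (gx2 + gy2)) <= tau * Q)
    by (apply Rmult_le_compat_l; lra).
  assert (0 <= tau * (v * K * N)) by (repeat apply Rmult_le_pos; lra).
  assert (0 <= tau * (lam0 * (D1 + D2))) by (repeat apply Rmult_le_pos; lra).
  assert (tau * (lam0 / 2 * (D1 + D2) - / lam0 * Gs - v * (K / 2) * N - v * gam / 2 * X)
    <= tau * (- v * (ux + uy) + 3 / 4 * lam0 * (D1 + D2) - / lam0 * (gx2 + gy2)))
    by (apply Rmult_le_compat_l; lra).
  assert (tau * (v * gam / 2 * X) <= tau * (v * gam * a * (T * N) + v * gam * c * N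
   + lam0 / 8 * (D1 + D2))) by (apply Rmult_le_compat_l; lra).
  lra. }
eapply Rle_trans; [exact Hmain|]; apply Rplus_le_compat_l.
fold a.
match goal with |- _ <= tau * ?C * ?X => rewrite (Rmult_assoc tau C X) end.
apply Rmult_le_compat_l; [lra|].
set (C := 1 + K + v * K + v * gam * c + / lam0 + v * gam * a).
assert (z1 : 0 <= v * K) by (apply Rmult_le_pos; lra).
assert (z2 : 0 <= v * gam * c) by (apply Rmult_le_pos; lra).
assert (z3 : 0 <= v * gam * a) by (apply Rmult_le_pos; lra).
assert (y1 : 0 <= (/ lam0 + v * gam * a) * N) by (apply Rmult_le_pos; lra).
assert (y2 : 0 <= (C - 1) * Rr) by (apply Rmult_le_pos; unfold C; lra).
assert (y3 : 0 <= (C - / lam0) * Gs) by (apply Rmult_le_pos; unfold C; lra).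
assert (y4 : 0 <= (C - v * gam * a) * (T * N)) by (apply Rmult_le_pos; unfold C; lra).
unfold C in *; lra.
Qed.

(** * Bounds for the exact solution on the grid *)

Definition Box (A : problem) (x y t : R) : Prop :=
  Omega_closure A x y /\ 0 <= t <= Qend A.

Fixpoint Bd (A : problem) (r : nat) (K : R) (g : field) : Prop :=
  (forall x y t, Box A x y t -> Rabs (g x y t) <= K) /\
  match r with
  | O => True
  | S r' => Bd A r' K (px g) /\ Bd A r' K (py g) /\ Bd A r' K (pt g)
  end.

Lemma Bd_mono A r K K' g : K <= K' -> Bd A r K g -> Bd A r K' g.
Proof.
intros HK; revert g; induction r as [|r IH]; intros g [H1 H2]; split; try exact I.
- intros; eapply Rle_trans; [now apply H1|assumption].
- intros; eapply Rle_trans; [now apply H1|assumption].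
- destruct H2 as (a & b & c); repeat split; now apply IH.
Qed.

Lemma Cclass_Bd A r g : Cclass r g -> exists K, 0 <= K /\ Bd A r K g.
Proof.
revert g; induction r as [|r IH]; intros g Hg;
  destruct (Cclass_bounded _ g (Llx A) (Lrx A) (Lly A) (Lry A) 0 (Qend A) Hg) as [M HM].
- exists (Rabs M); split; [apply Rabs_pos|split; [|exact I]].
  intros x y t H; eapply Rle_trans; [apply HM, H|apply Rle_abs].
- destruct Hg as (_ & Gx & Gy & Gt).
  destruct (IH _ Gx) as (K1 & P1 & B1), (IH _ Gy) as (K2 & P2 & B2),
    (IH _ Gt) as (K3 & P3 & B3).
  assert (PM := Rabs_pos M).
  exists (Rabs M + K1 + K2 + K3); split; [lra|split; [|split; [|split]]].
  + intros x y t H; eapply Rle_trans; [apply HM, H|].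
    generalize (Rle_abs M); lra.
  + apply Bd_mono with K1; [lra|assumption].
  + apply Bd_mono with K2; [lra|assumption].
  + apply Bd_mono with K3; [lra|assumption].
Qed.

Definition Csm (A : problem) (r : nat) (K : R) (g : field) : Prop :=
  Cclass r g /\ Bd A r K g.

Lemma Csm_px A r K g : Csm A (S r) K g -> Csm A r K (px g).
Proof. intros [H1 H2]; split; [apply H1|apply H2]. Qed.
Lemma Csm_py A r K g : Csm A (S r) K g -> Csm A r K (py g).
Proof. intros [H1 H2]; split; [apply H1|apply H2]. Qed.
Lemma Csm_pt A r K g : Csm A (S r) K g -> Csm A r K (pt g).
Proof. intros [H1 H2]; split; [apply H1|apply H2]. Qed.

Lemma Csm_pred A r K g : Csm A (S r) K g -> Csm A r K g.
Proof.
intros [H1 H2]; split; [now apply Cclass_pred|clear H1].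
revert g H2; induction r as [|r IH]; intros g [H1 H2]; split; try exact I; try exact H1.
destruct H2 as (a & b & c); repeat split; now apply IH.
Qed.

Lemma Csm_le A r s K g : (s <= r)%nat -> Csm A r K g -> Csm A s K g.
Proof.
induction 1 as [|r H IH]; [easy|]; intros Hg; apply IH, Csm_pred, Hg.
Qed.

Lemma Csm_bound A r K g x y t : Csm A r K g -> Box A x y t -> Rabs (g x y t) <= K.
Proof. intros [_ H2] H; destruct r; now apply H2. Qed.

(** ** Exchange of the two space variables *)

(** Exchange of [x] and [y] turns edges in the y-direction into edges in the x-direction,
    so each estimate on edges is proved for the x-direction only and applied twice. *)
Definition swapf (g : field) : field := fun x y t => g y x t.
Definition swapP (A : problem) : problem :=
  Problem (Lly A) (Lry A) (Llx A) (Lrx A) (Qend A) (gamma A) (mu A) (kc A) (alpha A)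
    (a0 A) (K0 A) (rho_s A) (rho_f A) (theta_s A) (theta_f A) (lambda_s A) (lambda_f A)
    (dmol A) (ks A) (Hr A) (swapf (fI A)) (swapf (fP A)) (swapf (cI A))
    (fun x y => p0 A y x) (fun x y => cf0 A y x) (fun x y => phi0 A y x)
    (fun x y => T0 A y x).

Lemma Cclass_swap r g : Cclass r g -> Cclass r (swapf g).
Proof.
revert g; induction r as [|r IH]; intros g Hg.
- intros x y t.
  apply (continuous_comp (fun q : R * R * R => ((snd (fst q), fst (fst q)), snd q))
           (fun q : R * R * R => g (fst (fst q)) (snd (fst q)) (snd q))); [|apply Hg].
  apply filterlim_locally; intros eps; exists eps.
  intros [[x' y'] t'] [[Bx By] Bt]; repeat split; assumption.
- destruct Hg as (D & Gx & Gy & Gt); split; [|split; [|split]].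
  + intros x y t; destruct (D y x t) as (D1 & D2 & D3); repeat split; assumption.
  + exact (IH (py g) Gy).
  + exact (IH (px g) Gx).
  + exact (IH (pt g) Gt).
Qed.

Lemma Bd_swap A r K g : Bd A r K g -> Bd (swapP A) r K (swapf g).
Proof.
revert g; induction r as [|r IH]; intros g [H1 H2]; split; try exact I.
- intros x y t [[a b] c]; apply H1; repeat split; first [apply a|apply b|apply c].
- intros x y t [[a b] c]; apply H1; repeat split; first [apply a|apply b|apply c].
- destruct H2 as (a & b & c); split; [exact (IH _ b)|split; [exact (IH _ a)|exact (IH _ c)]].
Qed.

Lemma Csm_swap A r K g : Csm A r K g -> Csm (swapP A) r K (swapf g).
Proof. intros [H1 H2]; split; [now apply Cclass_swap|now apply Bd_swap]. Qed.

(** ** The grid *)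

Definition nonempty_domain (A : problem) : Prop :=
  Llx A < Lrx A /\ Lly A < Lry A /\ 0 < Qend A.

Lemma hx_pos A Nx : nonempty_domain A -> (1 <= Nx)%nat -> 0 < hx A Nx.
Proof.
intros (H & _) HN; unfold hx; apply Rdiv_lt_0_compat; [lra|apply lt_0_INR; lia].
Qed.

Lemma ky_pos A Ny : nonempty_domain A -> (1 <= Ny)%nat -> 0 < ky A Ny.
Proof.
intros (_ & H & _) HN; unfold ky; apply Rdiv_lt_0_compat; [lra|apply lt_0_INR; lia].
Qed.

Lemma dt_pos A N : nonempty_domain A -> (1 <= N)%nat -> 0 < dt A N.
Proof.
intros (_ & _ & H) HN; unfold dt; apply Rdiv_lt_0_compat; [lra|apply lt_0_INR; lia].
Qed.

Lemma xc_left A Nx i : (1 <= i)%nat -> xc A Nx i = xe A Nx i - hx A Nx / 2.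
Proof. intros H; unfold xc, xe; rewrite minus_INR by lia; simpl (INR 1); field. Qed.

Lemma xc_right A Nx i : xc A Nx (S i) = xe A Nx i + hx A Nx / 2.
Proof. rewrite xc_left by lia; unfold xe; rewrite S_INR; field. Qed.

Lemma xe_pred A Nx i : (1 <= i)%nat -> xe A Nx (i - 1) = xc A Nx i - hx A Nx / 2.
Proof. intros H; unfold xc, xe; rewrite minus_INR by lia; simpl (INR 1); field. Qed.

Lemma xe_bounds A Nx i : nonempty_domain A -> (1 <= Nx)%nat -> (i <= Nx)%nat ->
  Llx A <= xe A Nx i <= Lrx A.
Proof.
intros HA HN Hi; assert (Hh := hx_pos A Nx HA HN); unfold xe.
assert (E : INR Nx * hx A Nx = Lrx A - Llx A)
  by (unfold hx; field; apply not_0_INR; lia).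
assert (H1 := pos_INR i); assert (H2 : INR i <= INR Nx) by (apply le_INR; lia).
split; nra.
Qed.

Lemma xe_interior A Nx i : nonempty_domain A -> (1 <= i < Nx)%nat ->
  Llx A < xe A Nx i < Lrx A.
Proof.
intros HA Hi; assert (HN : (1 <= Nx)%nat) by lia.
assert (Hh := hx_pos A Nx HA HN); unfold xe.
assert (E : INR Nx * hx A Nx = Lrx A - Llx A)
  by (unfold hx; field; apply not_0_INR; lia).
assert (H1 : 0 < INR i) by (apply lt_0_INR; lia).
assert (H2 : INR i < INR Nx) by (apply lt_INR; lia).
split; nra.
Qed.

Lemma xc_interior A Nx i : nonempty_domain A -> (1 <= i <= Nx)%nat ->
  Llx A < xc A Nx i < Lrx A.
Proof.
intros HA Hi; assert (HN : (1 <= Nx)%nat) by lia.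
assert (Hh := hx_pos A Nx HA HN).
assert (H1 := xe_bounds A Nx i HA HN ltac:(lia)).
assert (H2 := xe_bounds A Nx (i - 1) HA HN ltac:(lia)).
rewrite xe_pred in H2 by lia; rewrite xc_left in * by lia; lra.
Qed.

Lemma yc_interior A Ny j : nonempty_domain A -> (1 <= j <= Ny)%nat ->
  Lly A < yc A Ny j < Lry A.
Proof.
intros (H1 & H2 & H3); apply (xc_interior (swapP A)); repeat split; assumption.
Qed.

Lemma tn_S A N n : tn A N (S n) = tn A N n + dt A N.
Proof. unfold tn; rewrite S_INR; ring. Qed.

Lemma tn_bounds A N n : nonempty_domain A -> (1 <= N)%nat -> (n <= N)%nat ->
  0 <= tn A N n <= Qend A.
Proof.
intros HA HN Hn; assert (Ht := dt_pos A N HA HN); unfold tn.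
assert (E : INR N * dt A N = Qend A) by (unfold dt; field; apply not_0_INR; lia).
assert (H1 := pos_INR n); assert (H2 : INR n <= INR N) by (apply le_INR; lia).
split; nra.
Qed.

Lemma tn_pos A N n : nonempty_domain A -> (1 <= N)%nat -> (n < N)%nat ->
  0 < tn A N (S n) <= Qend A.
Proof.
intros HA HN Hn; assert (Ht := dt_pos A N HA HN).
split; [|now apply tn_bounds].
rewrite tn_S; destruct (tn_bounds A N n HA HN); [lia|lra].
Qed.

Definition good_grid (A : problem) (Nx Ny N : nat) : Prop :=
  nonempty_domain A /\ (1 <= Nx)%nat /\ (1 <= Ny)%nat /\ (1 <= N)%nat.

(** ** Consistency in the x-direction *)

Section Consistency.

Variables (A : problem) (Nx Ny N : nat).
Hypothesis (HG : good_grid A Nx Ny N).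

Let h := hx A Nx.
Let tau := dt A N.

Lemma center_in_box i j n : is_cell Nx Ny i j -> (n <= N)%nat ->
  Box A (xc A Nx i) (yc A Ny j) (tn A N n).
Proof.
assert (HG0 := HG); destruct HG0 as (HA & HNx & HNy & HN).
intros [Hi Hj] Hn; split; [split|].
- generalize (xc_interior A Nx i HA Hi); lra.
- generalize (yc_interior A Ny j HA Hj); lra.
- now apply tn_bounds.
Qed.

Lemma center_in_Omega i j : is_cell Nx Ny i j -> Omega A (xc A Nx i) (yc A Ny j).
Proof.
assert (HG0 := HG); destruct HG0 as (HA & HNx & HNy & HN).
intros [Hi Hj]; split; [now apply xc_interior|now apply yc_interior].
Qed.

Lemma xedge_in_box i j n : (i <= Nx)%nat -> (1 <= j <= Ny)%nat -> (n <= N)%nat ->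
  Box A (xe A Nx i) (yc A Ny j) (tn A N n).
Proof.
assert (HG0 := HG); destruct HG0 as (HA & HNx & HNy & HN).
intros Hi Hj Hn; split; [split|].
- now apply xe_bounds.
- generalize (yc_interior A Ny j HA Hj); lra.
- now apply tn_bounds.
Qed.

Lemma xedge_in_Omega i j : is_xedge Nx Ny i j -> Omega A (xe A Nx i) (yc A Ny j).
Proof.
assert (HG0 := HG); destruct HG0 as (HA & HNx & HNy & HN).
intros [Hi Hj]; split; [now apply xe_interior|now apply yc_interior].
Qed.

Lemma time_lipschitz g K x y n : Csm A 1 K g -> Omega_closure A x y -> (n < N)%nat ->
  Rabs (g x y (tn A N (S n)) - g x y (tn A N n)) <= K * tau.
Proof.
assert (HG0 := HG); destruct HG0 as (HA & HNx & HNy & HN).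
intros Hg Ho Hn; assert (Ht := dt_pos A N HA HN).
assert (B1 := tn_bounds A N n HA HN ltac:(lia)).
assert (B2 := tn_bounds A N (S n) HA HN ltac:(lia)).
assert (E := increment_bound (fun s => g x y s) (tn A N n) (tn A N (S n)) K
  (fun s => proj2 (proj2 (proj1 (proj1 Hg) x y s)))).
replace (Rabs (tn A N (S n) - tn A N n)) with tau in E
  by (rewrite tn_S, Rabs_pos_eq; unfold tau; lra).
apply E; intros s Hs; apply (Csm_bound A 0 K (pt g)); [now apply Csm_pt|].
split; [assumption|]. rewrite tn_S in *; rewrite Rmin_left, Rmax_right in Hs by lra; lra.
Qed.

Lemma dxm_truncation (g : field) K t i j : Cclass 3 g -> is_xedge Nx Ny i j ->
  (forall x y, Omega_closure A x y -> Rabs (px (px (px g)) x y t) <= K) ->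
  Rabs (dxm h (at_centers A Nx Ny (fun x y => g x y t)) i j
        - px g (xe A Nx i) (yc A Ny j) t) <= K * h ^ 2.
Proof.
assert (HG0 := HG); destruct HG0 as (HA & HNx & HNy & HN).
intros (D1 & (D2 & (D3 & _) & _) & _) [Hi Hj] HK; assert (Hh := hx_pos A Nx HA HNx).
assert (H := midpoint_difference (fun s => g s (yc A Ny j) t) (xe A Nx i) (h / 2) K
  (fun z => proj1 (D1 z _ t)) (fun z => proj1 (D2 z _ t)) (fun z => proj1 (D3 z _ t))
  ltac:(unfold h; lra)).
unfold dxm, at_centers; rewrite xc_right, (xc_left A Nx i) by lia.
replace (2 * (h / 2)) with h in H by field.
eapply Rle_trans; [apply H|].
- intros z Hz; apply (HK z (yc A Ny j)); split.
  + assert (B1 := xc_interior A Nx i HA ltac:(lia)).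
    assert (B2 := xc_interior A Nx (S i) HA ltac:(lia)).
    rewrite xc_right in B2; rewrite xc_left in B1 by lia; unfold h in Hz; lra.
  + generalize (yc_interior A Ny j HA Hj); lra.
- assert (K0 : 0 <= K).
  { eapply Rle_trans; [apply Rabs_pos|apply (HK (xe A Nx i) (yc A Ny j))].
    split; [apply xe_bounds; trivial; lia|generalize (yc_interior A Ny j HA Hj); lra]. }
  apply Rmult_le_compat_l; [assumption|]. unfold h; nra.
Qed.

Lemma Dxm_truncation (g : field) K n i j : Csm A 3 K g -> is_cell Nx Ny i j -> (n <= N)%nat ->
  Rabs (Dxm h (at_xedges A Nx Ny (fun x y => g x y (tn A N n))) i j
        - px g (xc A Nx i) (yc A Ny j) (tn A N n)) <= K * h ^ 2.
Proof.
assert (HG0 := HG); destruct HG0 as (HA & HNx & HNy & HN).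
intros Hg [Hi Hj] Hn; assert (Hh := hx_pos A Nx HA HNx).
destruct (proj1 Hg) as (D1 & (D2 & (D3 & _) & _) & _).
assert (H := midpoint_difference (fun s => g s (yc A Ny j) (tn A N n)) (xc A Nx i) (h / 2) K
  (fun z => proj1 (D1 z _ _)) (fun z => proj1 (D2 z _ _)) (fun z => proj1 (D3 z _ _))
  ltac:(unfold h; lra)).
unfold Dxm, at_xedges; rewrite xe_pred by lia.
replace (xe A Nx i) with (xc A Nx i + h / 2) by (rewrite xc_left by lia; unfold h; ring).
replace (2 * (h / 2)) with h in H by field.
assert (HK : forall z, Llx A <= z <= Lrx A ->
  Rabs (px (px (px g)) z (yc A Ny j) (tn A N n)) <= K).
{ intros z Hz; apply (Csm_bound A 0 K (px (px (px g)))); [now do 3 apply Csm_px|].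
  split; [split; [assumption|]|now apply tn_bounds].
  generalize (yc_interior A Ny j HA Hj); lra. }
eapply Rle_trans; [apply H|].
- intros z Hz; apply HK.
  assert (B1 := xe_bounds A Nx i HA HNx ltac:(lia)).
  assert (B2 := xe_bounds A Nx (i - 1) HA HNx ltac:(lia)).
  rewrite xe_pred in B2 by lia; unfold h in Hz.
  replace (xe A Nx i) with (xc A Nx i + hx A Nx / 2) in B1 by (rewrite xc_left by lia; ring).
  lra.
- assert (K0 : 0 <= K).
  { eapply Rle_trans; [apply Rabs_pos|apply (HK (xc A Nx i))].
    generalize (xc_interior A Nx i HA Hi); lra. }
  apply Rmult_le_compat_l; [assumption|]. unfold h; nra.
Qed.

Lemma dtm_truncation (g : field) K n i j : Csm A 2 K g -> is_cell Nx Ny i j -> (n < N)%nat ->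
  Rabs (dtm tau (sample A Nx Ny N g) (S n) i j
        - pt g (xc A Nx i) (yc A Ny j) (tn A N (S n))) <= K * tau.
Proof.
assert (HG0 := HG); destruct HG0 as (HA & HNx & HNy & HN).
intros Hg Hij Hn; assert (Ht := dt_pos A N HA HN).
destruct (proj1 Hg) as (D1 & _ & _ & (D2 & _)).
assert (Hc := center_in_box i j n Hij ltac:(lia)).
assert (B1 := tn_bounds A N n HA HN ltac:(lia)).
assert (B2 := tn_bounds A N (S n) HA HN ltac:(lia)).
unfold dtm, sample, at_centers; replace (S n - 1)%nat with n by lia.
replace (tn A N n) with (tn A N (S n) - tau) by (rewrite tn_S; unfold tau; ring).
apply (backward_difference (fun s => g (xc A Nx i) (yc A Ny j) s)).
- intros z; apply D1.
- intros z; apply D2.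
- assumption.
- intros z Hz; apply (Csm_bound A 0 K (pt (pt g))); [now do 2 apply Csm_pt|].
  split; [apply Hc|]. rewrite tn_S in *; unfold tau in Hz; lra.
Qed.

Lemma sample_neighbours (g : field) K n i j : Csm A 1 K g -> is_xedge Nx Ny i j ->
  (n <= N)%nat ->
  Rabs (sample A Nx Ny N g n (S i) j - sample A Nx Ny N g n i j) <= K * h.
Proof.
assert (HG0 := HG); destruct HG0 as (HA & HNx & HNy & HN).
intros Hg [Hi Hj] Hn; assert (Hh := hx_pos A Nx HA HNx).
assert (E := increment_bound (fun s => g s (yc A Ny j) (tn A N n)) (xc A Nx i) (xc A Nx (S i)) K
  (fun s => proj1 (proj1 (proj1 Hg) s _ _))).
assert (B1 := xc_interior A Nx i HA ltac:(lia)).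
assert (B2 := xc_interior A Nx (S i) HA ltac:(lia)).
assert (X : xc A Nx (S i) = xc A Nx i + h).
{ rewrite xc_right, (xc_left A Nx i) by lia; unfold h; field. }
replace (Rabs (xc A Nx (S i) - xc A Nx i)) with h in E
  by (rewrite X, Rabs_pos_eq; unfold h; lra).
apply E; intros s Hs; apply (Csm_bound A 0 K (px g)); [now apply Csm_px|].
fold h in Hh; rewrite X in *; rewrite Rmin_left, Rmax_right in Hs by lra.
split; [split; [lra|]|now apply tn_bounds].
generalize (yc_interior A Ny j HA Hj); lra.
Qed.

Lemma dxm_sample_bound (g : field) K n i j : Csm A 1 K g -> is_xedge Nx Ny i j ->
  (n <= N)%nat -> Rabs (dxm h (sample A Nx Ny N g n) i j) <= K.
Proof.
assert (HG0 := HG); destruct HG0 as (HA & HNx & HNy & HN).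
intros Hg Hij Hn; assert (Hh := hx_pos A Nx HA HNx : 0 < h).
unfold dxm, Rdiv; rewrite Rabs_mult, Rabs_inv, (Rabs_pos_eq h) by lra.
apply Rmult_le_reg_r with h; [assumption|].
rewrite Rmult_assoc, Rinv_l, Rmult_1_r by lra; now apply sample_neighbours.
Qed.

(** The increment in time of the truncation error is the truncation error of the increment
    in time, whose derivatives are of the order of the time step. *)
Lemma dxm_truncation_increment (g : field) K n i j : Csm A 4 K g -> is_xedge Nx Ny i j ->
  (n < N)%nat ->
  Rabs ((dxm h (sample A Nx Ny N g (S n)) i j
          - px g (xe A Nx i) (yc A Ny j) (tn A N (S n)))
      - (dxm h (sample A Nx Ny N g n) i j
          - px g (xe A Nx i) (yc A Ny j) (tn A N n))) <= K * tau * h ^ 2.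
Proof.
assert (HG0 := HG); destruct HG0 as (HA & HNx & HNy & HN).
intros Hg Hij Hn.
assert (C1 : Cclass 1 g) by (apply (Cclass_le 4); [lia|apply Hg]).
assert (C2 : Cclass 1 (px g)) by (apply (Cclass_le 3); [lia|apply Hg]).
assert (C3 : Cclass 1 (px (px g))) by (apply (Cclass_le 2); [lia|apply Hg]).
set (G := tdiff g (tn A N (S n)) (tn A N n)).
assert (HG3 : Cclass 3 G) by (apply Cclass_tdiff, (Cclass_le 4); [lia|apply Hg]).
assert (E := dxm_truncation G (K * tau) 0 i j HG3 Hij).
replace (_ - _ - _) with (dxm h (at_centers A Nx Ny (fun x y => G x y 0)) i j
  - px G (xe A Nx i) (yc A Ny j) 0).
- apply E; intros x y Hxy; unfold G.
  rewrite (px_tdiff g), (px_tdiff (px g)), (px_tdiff (px (px g))) by assumption.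
  apply (time_lipschitz (px (px (px g)))); [now do 3 apply Csm_px|assumption|assumption].
- unfold G; rewrite px_tdiff by assumption.
  unfold tdiff, dxm, sample, at_centers; field.
  apply Rgt_not_eq, hx_pos; assumption.
Qed.

(** ** The interpolation operator *)

(** The mixed derivative is bounded in both orders, so that the condition is invariant
    under exchange of the variables. *)
Definition interp_consistent (C : R) (Pi : gridfun -> gridfun) : Prop :=
  forall (g : field) (B t : R), Cclass 2 g ->
    (forall x y, Omega_closure A x y ->
        Rabs (px (px g) x y t) <= B /\ Rabs (px (py g) x y t) <= B /\
        Rabs (py (px g) x y t) <= B /\ Rabs (py (py g) x y t) <= B) ->
    forall i j, is_xedge Nx Ny i j ->
      Rabs (Pi (at_centers A Nx Ny (fun x y => g x y t)) i j
            - at_xedges A Nx Ny (fun x y => g x y t) i j)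
      <= C * B * (hx A Nx ^ 2 + ky A Ny ^ 2).

Lemma interp_sample C Pi (g : field) K n i j : interp_consistent C Pi -> Csm A 2 K g ->
  is_xedge Nx Ny i j -> (n <= N)%nat ->
  Rabs (Pi (sample A Nx Ny N g n) i j - g (xe A Nx i) (yc A Ny j) (tn A N n))
  <= C * K * (hx A Nx ^ 2 + ky A Ny ^ 2).
Proof.
assert (HG0 := HG); destruct HG0 as (HA & HNx & HNy & HN).
intros HP Hg Hij Hn; apply (HP g K (tn A N n)); [apply Hg| |assumption].
intros x y Hxy.
assert (B : Box A x y (tn A N n)) by (split; [assumption|now apply tn_bounds]).
repeat split.
- apply (Csm_bound A 0 K (px (px g))); [now do 2 apply Csm_px|assumption].
- apply (Csm_bound A 0 K (px (py g))); [now apply Csm_px, Csm_py|assumption].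
- apply (Csm_bound A 0 K (py (px g))); [now apply Csm_py, Csm_px|assumption].
- apply (Csm_bound A 0 K (py (py g))); [now do 2 apply Csm_py|assumption].
Qed.

Lemma interp_increment C Pi (g : field) K n i j : interp_consistent C Pi -> Csm A 3 K g ->
  is_xedge Nx Ny i j -> (n < N)%nat ->
  Rabs (Pi (fun i j => sample A Nx Ny N g (S n) i j - sample A Nx Ny N g n i j) i j
    - (g (xe A Nx i) (yc A Ny j) (tn A N (S n)) - g (xe A Nx i) (yc A Ny j) (tn A N n)))
  <= C * (K * tau) * (hx A Nx ^ 2 + ky A Ny ^ 2).
Proof.
assert (HG0 := HG); destruct HG0 as (HA & HNx & HNy & HN).
intros HP Hg Hij Hn.
set (G := tdiff g (tn A N (S n)) (tn A N n)).
assert (C1 : Cclass 1 g) by (apply (Cclass_le 3); [lia|apply Hg]).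
assert (C2 : Cclass 1 (px g)) by (apply (Cclass_le 2); [lia|apply Hg]).
assert (C3 : Cclass 1 (py g)) by (apply (Cclass_le 2); [lia|apply Hg]).
apply (HP G (K * tau) 0); [|intros x y Hxy; unfold G|assumption].
- apply Cclass_tdiff, (Cclass_le 3); [lia|apply Hg].
- rewrite (px_tdiff g), (px_tdiff (px g)), (py_tdiff g), (px_tdiff (py g)),
    (py_tdiff (px g)), (py_tdiff (py g)) by assumption.
  repeat split.
  + apply (time_lipschitz (px (px g))); [now do 2 apply Csm_px|assumption|assumption].
  + apply (time_lipschitz (px (py g))); [now apply Csm_px, Csm_py|assumption|assumption].
  + apply (time_lipschitz (py (px g))); [now apply Csm_py, Csm_px|assumption|assumption].
  + apply (time_lipschitz (py (py g))); [now do 2 apply Csm_py|assumption|assumption].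
Qed.

End Consistency.

(** * The nonlinear coefficients *)

(** Flow resistance, the reciprocal of the mobility [K(phi) / mu]. *)
Definition resist (A : problem) (f0 f : R) : R := mu A / perm A f0 f.

Lemma resist_formula A f0 f : 0 < mu A -> 0 < K0 A -> 0 < f0 < 1 -> 0 < f < 1 ->
  resist A f0 f = mu A * f0 ^ 3 / (K0 A * (1 - f0) ^ 2) * ((1 - f) ^ 2 / f ^ 3).
Proof.
intros; unfold resist, perm; field; repeat split; lra.
Qed.

Lemma perm_pos A f0 f : 0 < K0 A -> 0 < f0 < 1 -> 0 < f < 1 -> 0 < perm A f0 f.
Proof.
intros HK H0 Hf; unfold perm; apply Rmult_lt_0_compat; [assumption|].
apply Rmult_lt_0_compat; [apply Rdiv_lt_0_compat; lra|].
apply pow_lt, Rdiv_lt_0_compat; apply Rmult_lt_0_compat; lra.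
Qed.

Lemma inv_pow_le lo f n : 0 < lo -> lo <= f -> / f ^ n <= / lo ^ n.
Proof.
intros Hlo Hf; apply Rinv_le_contravar; [now apply pow_lt|].
apply pow_incr; lra.
Qed.

(** On a compact part of the interval from 0 to 1 the resistance is a C^2 function of the
    porosity, with bounds that are uniform in the initial porosity: the latter only enters
    through a factor. *)
Lemma resist_bounds A lo hi : 0 < mu A -> 0 < K0 A -> 0 < lo -> hi < 1 ->
  exists K, 1 <= K /\
  (forall f0 a, lo <= f0 <= hi -> lo <= a <= hi -> / K <= resist A f0 a <= K) /\
  (forall f0 a b, lo <= f0 <= hi -> lo <= a <= hi -> lo <= b <= hi ->
     Rabs (resist A f0 a - resist A f0 b) <= K * Rabs (a - b)) /\
  (forall f0 a a' b b', lo <= f0 <= hi -> lo <= a <= hi -> lo <= a' <= hi ->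
     lo <= b <= hi -> lo <= b' <= hi ->
     Rabs ((resist A f0 a' - resist A f0 a) - (resist A f0 b' - resist A f0 b))
     <= K * Rabs ((a' - a) - (b' - b))
      + K * Rabs (b' - b) * (Rabs (a - b) + Rabs (a' - b'))).
Proof.
intros Hmu HK Hlo Hhi.
set (r0 := fun f => (1 - f) ^ 2 / f ^ 3).
set (r1 := fun f => - 2 * (1 - f) / f ^ 3 - 3 * (1 - f) ^ 2 / f ^ 4).
set (r2 := fun f => 2 / f ^ 3 + 12 * (1 - f) / f ^ 4 + 12 * (1 - f) ^ 2 / f ^ 5).
assert (D0 : forall f, 0 < f -> is_derive r0 f (r1 f)).
{ intros f Hf; unfold r0, r1; auto_derive.
  - apply Rgt_not_eq; repeat apply Rmult_lt_0_compat; lra.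
  - field; lra. }
assert (D1 : forall f, 0 < f -> is_derive r1 f (r2 f)).
{ intros f Hf; unfold r1, r2; auto_derive.
  - split; [|split; [|exact I]]; apply Rgt_not_eq; repeat apply Rmult_lt_0_compat; lra.
  - field; lra. }
set (M := 2 * / lo ^ 3 + 12 * / lo ^ 4 + 12 * / lo ^ 5).
assert (i3 : 0 < / lo ^ 3) by (apply Rinv_0_lt_compat, pow_lt, Hlo).
assert (i4 : 0 < / lo ^ 4) by (apply Rinv_0_lt_compat, pow_lt, Hlo).
assert (i5 : 0 < / lo ^ 5) by (apply Rinv_0_lt_compat, pow_lt, Hlo).
assert (B : forall f, lo <= f <= hi -> Rabs (r1 f) <= M /\ Rabs (r2 f) <= M).
{ intros f Hf.
  assert (j3 := inv_pow_le lo f 3 Hlo (proj1 Hf)).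
  assert (j4 := inv_pow_le lo f 4 Hlo (proj1 Hf)).
  assert (j5 := inv_pow_le lo f 5 Hlo (proj1 Hf)).
  assert (p3 : 0 < / f ^ 3) by (apply Rinv_0_lt_compat, pow_lt; lra).
  assert (p4 : 0 < / f ^ 4) by (apply Rinv_0_lt_compat, pow_lt; lra).
  assert (p5 : 0 < / f ^ 5) by (apply Rinv_0_lt_compat, pow_lt; lra).
  unfold r1, r2, M, Rdiv; clear D0 D1.
  revert j3 j4 j5 p3 p4 p5 i3 i4 i5.
  generalize (/ f ^ 3) (/ f ^ 4) (/ f ^ 5) (/ lo ^ 3) (/ lo ^ 4) (/ lo ^ 5); intros.
  assert (s1 : 0 <= (1 - f) ^ 2 <= 1) by nra.
  assert (s2 : 0 <= 1 - f <= 1) by lra.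
  set (u := (1 - f) ^ 2) in *; set (v := 1 - f) in *; clearbody u v.
  assert (0 <= v * r <= r) by nra.
  assert (0 <= u * r3 <= r3) by nra.
  assert (0 <= v * r3 <= r3) by nra.
  assert (0 <= u * r4 <= r4) by nra.
  split; apply Rabs_le_between; split; lra. }
set (c := fun f0 => mu A * f0 ^ 3 / (K0 A * (1 - f0) ^ 2)).
set (Cm := mu A * lo ^ 3 / K0 A).
set (CM := mu A / (K0 A * (1 - hi) ^ 2)).
assert (Hc : forall f0, lo <= f0 <= hi -> Cm <= c f0 <= CM).
{ intros f0 H0.
  assert (q1 : lo ^ 3 <= f0 ^ 3 <= 1).
  { split; [apply pow_incr; lra|rewrite <- (pow1 3); apply pow_incr; lra]. }
  assert (q0 : 0 < lo ^ 3) by now apply pow_lt.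
  assert (q2 : (1 - hi) ^ 2 <= (1 - f0) ^ 2 <= 1).
  { split; [apply pow_incr; lra|rewrite <- (pow1 2); apply pow_incr; lra]. }
  assert (q3 : 0 < (1 - hi) ^ 2) by (apply pow_lt; lra).
  unfold Cm, c, CM, Rdiv; rewrite Rinv_mult, Rinv_mult.
  assert (q4 : 1 <= / (1 - f0) ^ 2) by (rewrite <- Rinv_1 at 1; apply Rinv_le_contravar; lra).
  assert (q5 : / (1 - f0) ^ 2 <= / (1 - hi) ^ 2) by (apply Rinv_le_contravar; lra).
  assert (q6 : 0 < / K0 A) by now apply Rinv_0_lt_compat.
  set (w := / K0 A) in *; set (v := / (1 - f0) ^ 2) in *; set (z := / (1 - hi) ^ 2) in *.
  assert (q7 : lo ^ 3 * 1 <= f0 ^ 3 * v) by (apply Rmult_le_compat; lra).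
  assert (q8 : f0 ^ 3 * v <= 1 * z) by (apply Rmult_le_compat; lra).
  assert (q9 : 0 < mu A * w) by now apply Rmult_lt_0_compat.
  split.
  - replace (mu A * lo ^ 3 * w) with (mu A * w * (lo ^ 3 * 1)) by ring.
    replace (mu A * f0 ^ 3 * (w * v)) with (mu A * w * (f0 ^ 3 * v)) by ring.
    apply Rmult_le_compat_l; lra.
  - replace (mu A * (w * z)) with (mu A * w * (1 * z)) by ring.
    replace (mu A * f0 ^ 3 * (w * v)) with (mu A * w * (f0 ^ 3 * v)) by ring.
    apply Rmult_le_compat_l; lra. }
assert (Cm0 : 0 < Cm).
{ apply Rdiv_lt_0_compat; [|assumption]. apply Rmult_lt_0_compat; [assumption|now apply pow_lt]. }
assert (Hr : forall f0 a, lo <= f0 <= hi -> lo <= a <= hi -> resist A f0 a = c f0 * r0 a).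
{ intros; unfold c, r0; apply resist_formula; lra. }
assert (hi' : 0 < (1 - hi) ^ 2) by (apply pow_lt; lra).
assert (Hr0 : forall a, lo <= a <= hi -> (1 - hi) ^ 2 <= r0 a <= M).
{ intros a Ha; unfold r0, Rdiv.
  assert (j3 := inv_pow_le lo a 3 Hlo (proj1 Ha)).
  assert (a3 : 0 < a ^ 3 <= 1).
  { split; [apply pow_lt; lra|rewrite <- (pow1 3); apply pow_incr; lra]. }
  assert (k3 : 1 <= / a ^ 3) by (rewrite <- Rinv_1 at 1; apply Rinv_le_contravar; lra).
  assert (q2 : (1 - hi) ^ 2 <= (1 - a) ^ 2 <= 1).
  { split; [apply pow_incr; lra|rewrite <- (pow1 2); apply pow_incr; lra]. }
  split.
  - rewrite <- (Rmult_1_r ((1 - hi) ^ 2)); apply Rmult_le_compat; lra.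
  - apply Rle_trans with (1 * / lo ^ 3); [apply Rmult_le_compat; lra|unfold M; lra]. }
assert (M0 : 0 <= M) by (unfold M; lra).
destruct (Rle_lt_dec lo hi) as [Hlh|Hlh].
2:{ exists 1; split; [lra|]; repeat split; intros; lra. }
assert (CM0 : 0 < CM) by (specialize (Hc lo ltac:(lra)); lra).
assert (m0 : 0 < Cm * (1 - hi) ^ 2) by now apply Rmult_lt_0_compat.
assert (i0 : 0 < / (Cm * (1 - hi) ^ 2)) by now apply Rinv_0_lt_compat.
assert (CMM : 0 <= CM * M) by (apply Rmult_le_pos; lra).
exists (1 + CM * M + / (Cm * (1 - hi) ^ 2)); split; [lra|].
set (K := 1 + CM * M + / (Cm * (1 - hi) ^ 2)).
repeat split.
- rewrite Hr by assumption.
  apply Rle_trans with (Cm * (1 - hi) ^ 2).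
  + rewrite <- (Rinv_inv (Cm * (1 - hi) ^ 2)); apply Rinv_le_contravar; [assumption|].
    unfold K; lra.
  + specialize (Hc f0 H); specialize (Hr0 a H0); apply Rmult_le_compat; lra.
- rewrite Hr by assumption.
  specialize (Hc f0 H); specialize (Hr0 a H0).
  apply Rle_trans with (CM * M); [apply Rmult_le_compat; lra|unfold K; lra].
- intros f0 a b H0 Ha Hb; rewrite !Hr by assumption.
  rewrite <- Rmult_minus_distr_l, Rabs_mult.
  specialize (Hc f0 H0); rewrite (Rabs_pos_eq (c f0)) by lra.
  assert (E := MVT_gen r0 b a r1).
  assert (Hz : forall z, Rmin b a <= z <= Rmax b a -> lo <= z <= hi)
    by (intros z; unfold Rmin, Rmax; destruct (Rle_dec b a); lra).
  destruct E as (z & Hz' & ->).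
  + intros x Hx; apply D0; specialize (Hz x); lra.
  + intros x Hx; apply continuity_pt_filterlim.
    apply (ex_derive_continuous (V := R_NormedModule) r0 x).
    exists (r1 x); apply D0; specialize (Hz x Hx); lra.
  + rewrite Rabs_mult, <- Rmult_assoc; apply Rmult_le_compat_r; [apply Rabs_pos|].
    apply Rle_trans with (CM * M); [|unfold K; lra].
    apply Rmult_le_compat; [lra|apply Rabs_pos|lra|apply B, Hz, Hz'].
- intros f0 a a' b b' H0 Ha Ha' Hb Hb'; rewrite !Hr by assumption.
  replace (c f0 * r0 a' - c f0 * r0 a - (c f0 * r0 b' - c f0 * r0 b))
    with (c f0 * (r0 a' - r0 a - (r0 b' - r0 b))) by ring.
  specialize (Hc f0 H0); rewrite Rabs_mult, (Rabs_pos_eq (c f0)) by lra.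
  assert (E := increment_difference r0 r1 r2 lo hi M a a' b b'
    (fun z Hz => D0 z (Rlt_le_trans _ _ _ Hlo (proj1 Hz)))
    (fun z Hz => D1 z (Rlt_le_trans _ _ _ Hlo (proj1 Hz))) B Ha Ha' Hb Hb').
  set (X := Rabs (a' - a - (b' - b))) in *.
  set (Y := Rabs (b' - b) * (Rabs (a - b) + Rabs (a' - b'))).
  assert (X0 : 0 <= X) by apply Rabs_pos.
  assert (Y0 : 0 <= Y).
  { apply Rmult_le_pos; [apply Rabs_pos|].
    apply Rplus_le_le_0_compat; apply Rabs_pos. }
  apply Rle_trans with (CM * (M * X + M * Y)).
  + apply Rmult_le_compat; [lra|apply Rabs_pos|lra|unfold Y; rewrite <- Rmult_assoc; exact E].
  + replace (K * X + K * Rabs (b' - b) * (Rabs (a - b) + Rabs (a' - b')))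
      with (K * (X + Y)) by (unfold Y; ring).
    replace (CM * (M * X + M * Y)) with (CM * M * (X + Y)) by ring.
    apply Rmult_le_compat_r; [lra|unfold K; lra].
Qed.

(** ** Reaction *)

Lemma cutoff_range c : 0 <= cutoff c <= 1.
Proof.
unfold cutoff; split; [apply Rmax_l|]. apply Rmax_lub; [lra|apply Rmin_r].
Qed.

Lemma cutoff_id c : 0 <= c <= 1 -> cutoff c = c.
Proof. intros H; unfold cutoff; rewrite Rmin_left, Rmax_right by lra; reflexivity. Qed.

Lemma cutoff_lipschitz c d : Rabs (cutoff c - cutoff d) <= Rabs (c - d).
Proof.
unfold cutoff, Rmax, Rmin.
destruct (Rle_dec c 1), (Rle_dec d 1); repeat destruct (Rle_dec _ _);
  unfold Rabs; repeat destruct (Rcase_abs _); lra.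
Qed.

(** The relative excess of the concentration [c_f] over its value [c_s] at the rock
    surface. *)
Definition react (A : problem) (T : R) : R := 1 - 1 / (1 + ks A T / kc A).

Lemma react_props (A : problem) : standing_assumptions A ->
  (forall T, 0 <= react A T <= 1) /\
  exists L, 0 <= L /\ forall T T', Rabs (react A T - react A T') <= L * Rabs (T - T').
Proof.
intros HA; destruct (ks_bounds A HA) as (k1 & k2 & Hk1 & Hk).
assert (Hkc := kc_pos A HA).
assert (P : forall T, 0 < ks A T / kc A).
{ intros T; apply Rdiv_lt_0_compat; [|assumption]. specialize (Hk T); lra. }
assert (Q : forall T, 0 < 1 / (1 + ks A T / kc A) <= 1).
{ intros T; specialize (P T); split; [apply Rdiv_lt_0_compat; lra|].
  apply Rmult_le_reg_r with (1 + ks A T / kc A); [lra|].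
  unfold Rdiv at 1; rewrite Rmult_assoc, Rinv_l by lra; lra. }
split.
- intros T; unfold react; specialize (Q T); lra.
- destruct (ks_lipschitz A HA) as [L HL].
  exists (Rabs L / kc A); split; [apply Rdiv_le_0_compat; [apply Rabs_pos|assumption]|].
  intros T T'; unfold react.
  assert (E : 1 - 1 / (1 + ks A T / kc A) - (1 - 1 / (1 + ks A T' / kc A))
    = (1 / (1 + ks A T / kc A)) * (1 / (1 + ks A T' / kc A)) * ((ks A T - ks A T') / kc A)).
  { generalize (Hk T) (Hk T'); intros; field; repeat split; try lra. }
  rewrite E, !Rabs_mult.
  rewrite (Rabs_pos_eq (1 / (1 + ks A T / kc A))) by (specialize (Q T); lra).
  rewrite (Rabs_pos_eq (1 / (1 + ks A T' / kc A))) by (specialize (Q T'); lra).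
  assert (Hdiv : Rabs ((ks A T - ks A T') / kc A) = Rabs (ks A T - ks A T') * / kc A).
  { unfold Rdiv; rewrite Rabs_mult, (Rabs_pos_eq (/ kc A)); [reflexivity|].
    apply Rlt_le, Rinv_0_lt_compat, Hkc. }
  rewrite Hdiv; clear Hdiv.
  assert (Rabs (ks A T - ks A T') <= Rabs L * Rabs (T - T')).
  { eapply Rle_trans; [apply HL|]. apply Rmult_le_compat_r; [apply Rabs_pos|apply Rle_abs]. }
  assert (I0 : 0 < / kc A) by now apply Rinv_0_lt_compat.
  replace (Rabs L / kc A * Rabs (T - T')) with (1 * 1 * (Rabs L * Rabs (T - T') * / kc A))
    by (unfold Rdiv; ring).
  assert (Q1 := Q T); assert (Q2 := Q T').
  apply Rmult_le_compat.
  + apply Rmult_le_pos; lra.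
  + apply Rmult_le_pos; [apply Rabs_pos|lra].
  + apply Rmult_le_compat; lra.
  + apply Rmult_le_compat_r; lra.
Qed.

(** ** Porosity along a solution of its evolution equation *)

(** The solid fraction obeys [g' = - k g] with a bounded non-negative rate. *)
Lemma decay_range (g k : R -> R) (Q kmax : R) :
  0 < Q -> 0 < g 0 -> (forall t, ex_derive g t) ->
  (forall t, 0 < t <= Q -> 0 <= k t <= kmax /\ Derive g t = - k t * g t) ->
  forall t, 0 <= t <= Q -> g 0 * exp (- kmax * Q) <= g t <= g 0.
Proof.
intros HQ Hg0 Hd Hk.
assert (K0 : 0 <= kmax) by (destruct (Hk Q); lra).
(* [t |-> g t ^ 2 * exp (2 * s * t)] is monotone for [s = kmax] and for [s = 0] *)
assert (DG : forall s t, is_derive (fun t => (g t) ^ 2 * exp (2 * s * t)) t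
   (2 * (Derive g t + s * g t) * g t * exp (2 * s * t))).
{ intros s t; auto_derive; [apply Hd|].
  change (fun x => g x) with g; ring. }
assert (HM : forall s t, 0 < t <= Q -> exists r, 0 <= r /\
   exists c, 0 <= c <= kmax /\
   (g t) ^ 2 * exp (2 * s * t) - (g 0) ^ 2 = (s - c) * r).
{ intros s t Ht.
  destruct (MVT_gen (fun t => (g t) ^ 2 * exp (2 * s * t)) 0 t (fun c =>
    if Rlt_dec 0 c then 2 * (Derive g c + s * g c) * g c * exp (2 * s * c) else 0))
    as (c & Hc & E).
  - intros x; rewrite Rmin_left, Rmax_right by lra; intros Hx.
    destruct (Rlt_dec 0 x); [apply DG|lra].
  - intros x _; apply continuity_pt_filterlim.
    apply (ex_derive_continuous (V := R_NormedModule)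
      (fun t => (g t) ^ 2 * exp (2 * s * t)) x); exact (ex_intro _ _ (DG s x)).
  - rewrite Rmin_left, Rmax_right in Hc by lra.
    rewrite Rmult_0_r, exp_0, Rmult_1_r in E.
    destruct (Rlt_dec 0 c) as [P|P].
    + exists (2 * g c ^ 2 * exp (2 * s * c) * (t - 0)); split.
      * assert (G0 := pow2_ge_0 (g c)); assert (E0 := exp_pos (2 * s * c)).
        apply Rmult_le_pos; [apply Rmult_le_pos; lra|lra].
      * exists (k c); split; [apply Hk; lra|].
        rewrite E; destruct (Hk c) as [_ ->]; [lra|ring].
    + exists 0; split; [lra|]. exists 0; split; [lra|]. rewrite E; ring. }
assert (LB : forall t, 0 <= t <= Q -> (g 0 * exp (- kmax * t)) ^ 2 <= (g t) ^ 2).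
{ intros t Ht; destruct (Req_dec t 0) as [->|N].
  - rewrite Rmult_0_r, exp_0, Rmult_1_r; lra.
  - destruct (HM kmax t) as (r & Hr & c & Hc & E); [lra|].
    assert (E1 : exp (- kmax * t) ^ 2 * exp (2 * kmax * t) = 1).
    { simpl; rewrite Rmult_1_r, <- !exp_plus.
      replace (- kmax * t + - kmax * t + 2 * kmax * t) with 0 by ring; apply exp_0. }
    apply Rmult_le_reg_r with (exp (2 * kmax * t)); [apply exp_pos|].
    rewrite Rpow_mult_distr, Rmult_assoc, E1, Rmult_1_r.
    assert (0 <= (kmax - c) * r) by (apply Rmult_le_pos; lra); lra. }
assert (NZ : forall t, 0 <= t <= Q -> g t <> 0).
{ intros t Ht E; specialize (LB t Ht); rewrite E in LB.
  assert (0 < (g 0 * exp (- kmax * t)) ^ 2)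
    by (apply pow_lt, Rmult_lt_0_compat; [assumption|apply exp_pos]).
  simpl in LB; simpl in H; lra. }
assert (Cg : continuity g).
{ intros t; apply continuity_pt_filterlim.
  apply (ex_derive_continuous (V := R_NormedModule) g t), Hd. }
assert (P : forall t, 0 <= t <= Q -> 0 < g t).
{ intros t Ht; destruct (Rlt_le_dec 0 (g t)) as [|L]; [assumption|exfalso].
  destruct (Req_dec t 0) as [->|N]; [lra|].
  assert (L' : g t < 0) by (specialize (NZ t Ht); lra).
  destruct (IVT (fun s => - g s) 0 t) as (z & Hz & Ez); try lra.
  - intros s; apply continuity_pt_opp, Cg.
  - apply (NZ z); lra. }
intros t Ht; assert (Pt := P t Ht); split.
- apply Rle_trans with (g 0 * exp (- kmax * t)).
  + apply Rmult_le_compat_l; [lra|].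
    destruct (Req_dec (- kmax * Q) (- kmax * t)) as [->|N]; [lra|].
    apply Rlt_le, exp_increasing; nra.
  + apply Rsqr_incr_0_var; [rewrite !Rsqr_pow2; now apply LB|lra].
- destruct (Req_dec t 0) as [->|N]; [lra|].
  destruct (HM 0 t) as (r & Hr & c & Hc & E); [lra|].
  replace (2 * 0 * t) with 0 in E by ring; rewrite exp_0, Rmult_1_r in E.
  apply Rsqr_incr_0_var; [rewrite !Rsqr_pow2|lra].
  assert (0 <= c * r) by (apply Rmult_le_pos; lra); lra.
Qed.

(** * The error equations on edges *)

Section Edge.

(** [Pi] interpolates to x-edges; [u] is the component of the velocity across them. *)
Variables (A : problem) (Nx Ny N : nat) (Pi : gridfun -> gridfun)
  (phi u p : field) (Psi : nat -> gridfun).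

Let h := hx A Nx.
Let tau := dt A N.
Let e2 := hx A Nx ^ 2 + ky A Ny ^ 2.

Definition edge_rho (n : nat) : gridfun := fun i j =>
  resist A (phi0 A (xe A Nx i) (yc A Ny j)) (Pi (Psi n) i j).

(** The consistency error of Darcy's law in the form [resist * u = - p_x]. *)
Definition edge_theta (n : nat) : gridfun := fun i j =>
  dxm (hx A Nx) (sample A Nx Ny N p n) i j
  - px p (xe A Nx i) (yc A Ny j) (tn A N n)
  + u (xe A Nx i) (yc A Ny j) (tn A N n)
    * (edge_rho n i j - resist A (phi0 A (xe A Nx i) (yc A Ny j))
         (phi (xe A Nx i) (yc A Ny j) (tn A N n))).

Definition edge_range (lo hi : R) (n : nat) : Prop :=
  forall i j, is_xedge Nx Ny i j -> lo <= Pi (Psi n) i j <= hi.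

Record edge_data (K lo hi : R) : Prop := {
  ed_K : 1 <= K;
  ed_grid : good_grid A Nx Ny N;
  ed_phi : Csm A 5 K phi;
  ed_u : Csm A 5 K u;
  ed_p : Csm A 5 K p;
  ed_stable : stable_interp K Nx Ny Pi;
  ed_cons : interp_consistent A Nx Ny K Pi;
  ed_phi0 : forall x y, Omega A x y -> lo <= phi0 A x y <= hi;
  ed_range : forall x y t, Omega A x y -> 0 <= t <= Qend A -> lo <= phi x y t <= hi;
  ed_resist_bounds : forall f0 a, lo <= f0 <= hi -> lo <= a <= hi ->
    / K <= resist A f0 a <= K;
  ed_resist_lip : forall f0 a b, lo <= f0 <= hi -> lo <= a <= hi -> lo <= b <= hi ->
    Rabs (resist A f0 a - resist A f0 b) <= K * Rabs (a - b);
  ed_resist_incr : forall f0 a a' b b', lo <= f0 <= hi -> lo <= a <= hi -> lo <= a' <= hi ->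
     lo <= b <= hi -> lo <= b' <= hi ->
     Rabs ((resist A f0 a' - resist A f0 a) - (resist A f0 b' - resist A f0 b))
     <= K * Rabs ((a' - a) - (b' - b))
      + K * Rabs (b' - b) * (Rabs (a - b) + Rabs (a' - b'));
  ed_darcy : forall x y t, Omega A x y -> 0 < t <= Qend A ->
    resist A (phi0 A x y) (phi x y t) * u x y t = - px p x y t;
  ed_step : forall n i j, (n < N)%nat -> is_cell Nx Ny i j ->
    Rabs (Psi (S n) i j - Psi n i j) <= K * dt A N
}.

Variables (K lo hi : R) (HD : edge_data K lo hi).

Let f n := err_center A Nx Ny N Psi phi n.

Lemma e2_ge0 : 0 <= e2.
Proof. unfold e2; generalize (pow2_ge_0 (hx A Nx)) (pow2_ge_0 (ky A Ny)); lra. Qed.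

Lemma pow_K_le m : (m <= 5)%nat -> 1 <= K ^ m <= K ^ 5.
Proof.
intros Hm; split; [apply pow_R1_Rle, HD|apply Rle_pow; [apply HD|assumption]].
Qed.

Lemma interp_split n i j : is_xedge Nx Ny i j ->
  Pi (Psi n) i j = Pi (sample A Nx Ny N phi n) i j + Pi (f n) i j.
Proof.
intros Hij; rewrite <- (Rmult_1_l (Pi (f n) i j)), <- (si_lin _ _ _ _ (ed_stable _ _ _ HD))
  by assumption.
f_equal; do 2 (apply functional_extensionality; intro); unfold f, err_center; ring.
Qed.

Lemma interp_porosity_error n i j : is_xedge Nx Ny i j -> (n <= N)%nat ->
  Rabs (Pi (Psi n) i j - phi (xe A Nx i) (yc A Ny j) (tn A N n))
  <= Rabs (Pi (f n) i j) + K ^ 2 * e2.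
Proof.
intros Hij Hn; rewrite interp_split by assumption.
assert (E := interp_sample A Nx Ny N (ed_grid _ _ _ HD) K Pi phi K n i j
  (ed_cons _ _ _ HD) (Csm_le A 5 2 K phi ltac:(lia) (ed_phi _ _ _ HD)) Hij Hn).
fold e2 in E; replace (K * K) with (K ^ 2) in E by ring.
set (a := Pi (sample A Nx Ny N phi n) i j) in *; set (b := Pi (f n) i j).
set (c := phi _ _ _) in *.
replace (a + b - c) with (b + (a - c)) by ring.
eapply Rle_trans; [apply Rabs_triang|lra].
Qed.

Lemma interp_step n i j : is_xedge Nx Ny i j -> (n < N)%nat ->
  Rabs (Pi (Psi (S n)) i j - Pi (Psi n) i j) <= 3 * K ^ 2 * tau.
Proof.
intros [Hi Hj] Hn.
assert (HG := ed_grid _ _ _ HD); assert (HG0 := HG); destruct HG0 as (HA & HNx & HNy & HN).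
assert (H1 := ed_K _ _ _ HD); assert (Ht := dt_pos A N HA HN).
assert (HS := ed_stable _ _ _ HD); assert (Hst := ed_step _ _ _ HD).
assert (E := si_lin _ _ _ _ HS (-1) (Psi (S n)) (Psi n) i j (conj Hi Hj)).
set (g := fun i j => Psi (S n) i j + -1 * Psi n i j) in E.
assert (G : forall a, (1 <= a <= Nx)%nat -> Rabs (g a j) <= K * tau).
{ intros a Ha; unfold g; replace (Psi (S n) a j + -1 * Psi n a j)
    with (Psi (S n) a j - Psi n a j) by ring.
  apply Hst; [assumption|split; assumption]. }
assert (B := si_sup _ _ _ _ HS g (2 * (K * tau)) j Hj).
assert (B' : Rabs (Pi g i j - (g i j + g (S i) j) / 2) <= K * (2 * (K * tau))).
{ apply B; [|assumption]. intros a Ha.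
  generalize (G a ltac:(lia)) (G (S a) ltac:(lia)); intros B1 B2.
  apply Rabs_le_between in B1; apply Rabs_le_between in B2; apply Rabs_le_between; lra. }
replace (Pi (Psi (S n)) i j - Pi (Psi n) i j) with (Pi g i j) by (rewrite E; ring).
generalize (G i ltac:(lia)) (G (S i) ltac:(lia)); intros B1 B2.
apply Rabs_le_between in B1; apply Rabs_le_between in B2; apply Rabs_le_between in B'.
assert (K * tau <= K ^ 2 * tau).
{ apply Rmult_le_compat_r; [unfold tau; lra|nra]. }
apply Rabs_le_between; nra.
Qed.

Lemma edge_rho_step n i j : is_xedge Nx Ny i j -> (n < N)%nat ->
  edge_range lo hi n -> edge_range lo hi (S n) ->
  Rabs (edge_rho (S n) i j - edge_rho n i j) <= 3 * K ^ 3 * tau.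
Proof.
intros Hij Hn R0 R1; unfold edge_rho.
eapply Rle_trans; [apply (ed_resist_lip _ _ _ HD); [|now apply R1|now apply R0]|].
- apply (ed_phi0 _ _ _ HD).
  apply (xedge_in_Omega A Nx Ny N (ed_grid _ _ _ HD)); assumption.
- replace (3 * K ^ 3 * tau) with (K * (3 * K ^ 2 * tau)) by ring.
  apply Rmult_le_compat_l; [generalize (ed_K _ _ _ HD); lra|now apply interp_step].
Qed.

(** Time increments of the consistency error are controlled by the porosity error and
    by its time increment.  Two increments of the resistance are compared, which is where
    its second derivative enters. *)
Lemma edge_theta_step n i j : is_xedge Nx Ny i j -> (n < N)%nat ->
  edge_range lo hi n -> edge_range lo hi (S n) ->
  Rabs (edge_theta (S n) i j - edge_theta n i j)
  <= tau * (5 * K ^ 5 * (Rabs (Pi (f (S n)) i j) + Rabs (Pi (f n) i j)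
        + Rabs (Pi (dtm tau f (S n)) i j) + e2)).
Proof.
intros Hij Hn R0 R1.
assert (HG := ed_grid _ _ _ HD); assert (HG0 := HG); destruct HG0 as (HA & HNx & HNy & HN).
assert (H1 := ed_K _ _ _ HD); assert (Ht := dt_pos A N HA HN : 0 < tau).
assert (HO := xedge_in_Omega A Nx Ny N HG i j Hij).
assert (HB := xedge_in_box A Nx Ny N HG i j n ltac:(destruct Hij; lia) (proj2 Hij) ltac:(lia)).
assert (HB' := xedge_in_box A Nx Ny N HG i j (S n) ltac:(destruct Hij; lia) (proj2 Hij) ltac:(lia)).
assert (E0 := interp_porosity_error n i j Hij ltac:(lia)).
assert (E1 := interp_porosity_error (S n) i j Hij ltac:(lia)).
(* increments of the interpolated porosity error *)
assert (Ed : Rabs (Pi (Psi (S n)) i j - Pi (Psi n) i j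
   - (phi (xe A Nx i) (yc A Ny j) (tn A N (S n)) - phi (xe A Nx i) (yc A Ny j) (tn A N n)))
   <= tau * (Rabs (Pi (dtm tau f (S n)) i j) + K ^ 2 * e2)).
{ assert (E := interp_increment A Nx Ny N HG K Pi phi K n i j (ed_cons _ _ _ HD)
    (Csm_le A 5 3 K phi ltac:(lia) (ed_phi _ _ _ HD)) Hij Hn).
  fold e2 tau in E.
  assert (L : Pi (Psi (S n)) i j - Pi (Psi n) i j
    = Pi (fun i j => sample A Nx Ny N phi (S n) i j - sample A Nx Ny N phi n i j) i j
      + tau * Pi (dtm tau f (S n)) i j).
  { rewrite <- (si_lin _ _ _ _ (ed_stable _ _ _ HD)) by assumption.
    replace (Pi (Psi (S n)) i j - Pi (Psi n) i j)
      with (Pi (Psi (S n)) i j + -1 * Pi (Psi n) i j) by ring.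
    rewrite <- (si_lin _ _ _ _ (ed_stable _ _ _ HD)) by assumption.
    f_equal; do 2 (apply functional_extensionality; intro).
    unfold dtm, f, err_center; replace (S n - 1)%nat with n by lia; field; lra. }
  rewrite L; set (a := Pi (fun i j => _ - _) i j) in *.
  set (b := Pi (dtm tau f (S n)) i j); set (c := phi _ _ (tn A N (S n)) - _) in *.
  replace (a + tau * b - c) with (tau * b + (a - c)) by ring.
  eapply Rle_trans; [apply Rabs_triang|]; rewrite Rabs_mult, (Rabs_pos_eq tau) by lra.
  replace (K * (K * tau) * e2) with (tau * (K ^ 2 * e2)) in E by ring; lra. }
assert (Ephi := time_lipschitz A Nx Ny N HG phi K (xe A Nx i) (yc A Ny j) n
  (Csm_le A 5 1 K phi ltac:(lia) (ed_phi _ _ _ HD)) (proj1 HB) Hn); fold tau in Ephi.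
assert (Eu := time_lipschitz A Nx Ny N HG u K (xe A Nx i) (yc A Ny j) n
  (Csm_le A 5 1 K u ltac:(lia) (ed_u _ _ _ HD)) (proj1 HB) Hn); fold tau in Eu.
assert (Bu := Csm_bound A 5 K u _ _ _ (ed_u _ _ _ HD) HB).
assert (Ep := dxm_truncation_increment A Nx Ny N HG p K n i j
  (Csm_le A 5 4 K p ltac:(lia) (ed_p _ _ _ HD)) Hij Hn); fold h tau in Ep.
assert (Rphi := ed_range _ _ _ HD _ _ _ HO (proj2 HB)).
assert (Rphi' := ed_range _ _ _ HD _ _ _ HO (proj2 HB')).
assert (R00 := ed_phi0 _ _ _ HD _ _ HO).
specialize (R0 i j Hij); specialize (R1 i j Hij).
assert (Lip := ed_resist_lip _ _ _ HD _ _ _ R00 R1 Rphi').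
assert (Inc := ed_resist_incr _ _ _ HD _ _ _ _ _ R00 R0 R1 Rphi Rphi').
unfold edge_theta, edge_rho; fold h.
set (g1 := dxm h (sample A Nx Ny N p (S n)) i j - px p _ _ _) in *.
set (g0 := dxm h (sample A Nx Ny N p n) i j - px p _ _ _) in *.
set (u1 := u _ _ (tn A N (S n))) in *; set (u0 := u _ _ (tn A N n)) in *.
set (b1 := phi _ _ (tn A N (S n))) in *; set (b0 := phi _ _ (tn A N n)) in *.
set (a1 := Pi (Psi (S n)) i j) in *; set (a0 := Pi (Psi n) i j) in *.
set (r := resist A _) in *.
set (x1 := Rabs (Pi (f (S n)) i j)) in *; set (x0 := Rabs (Pi (f n) i j)) in *.
set (xd := Rabs (Pi (dtm tau f (S n)) i j)) in *.
assert (X1 : 0 <= x1) by apply Rabs_pos; assert (X0 : 0 <= x0) by apply Rabs_pos.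
assert (Xd : 0 <= xd) by apply Rabs_pos; assert (Xe := e2_ge0).
replace (g1 + u1 * (r a1 - r b1) - (g0 + u0 * (r a0 - r b0)))
  with ((g1 - g0) + ((u1 - u0) * (r a1 - r b1) + u0 * (r a1 - r a0 - (r b1 - r b0)))) by ring.
assert (P2 := pow_K_le 2 ltac:(lia)); assert (P3 := pow_K_le 3 ltac:(lia)).
assert (P4 := pow_K_le 4 ltac:(lia)); assert (P1 := pow_K_le 1 ltac:(lia)).
rewrite pow_1 in P1.
assert (S1 : Rabs (g1 - g0) <= tau * (K * e2)).
{ eapply Rle_trans; [exact Ep|]. replace (tau * (K * e2)) with (K * tau * e2) by ring.
  apply Rmult_le_compat_l; [apply Rmult_le_pos; lra|].
  unfold e2, h; generalize (pow2_ge_0 (ky A Ny)); lra. }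
assert (S2 : Rabs ((u1 - u0) * (r a1 - r b1)) <= tau * (K ^ 2 * x1 + K ^ 4 * e2)).
{ rewrite Rabs_mult; apply Rle_trans with ((K * tau) * (K * (x1 + K ^ 2 * e2))).
  - apply Rmult_le_compat; try apply Rabs_pos; [assumption|].
    eapply Rle_trans; [exact Lip|]. apply Rmult_le_compat_l; [lra|exact E1].
  - apply Req_le; ring. }
assert (S3 : Rabs (r a1 - r a0 - (r b1 - r b0))
   <= tau * (K * xd + K ^ 3 * e2 + K ^ 2 * (x0 + x1 + 2 * K ^ 2 * e2))).
{ eapply Rle_trans; [exact Inc|].
  assert (T1 : K * Rabs (a1 - a0 - (b1 - b0)) <= K * (tau * (xd + K ^ 2 * e2)))
    by (apply Rmult_le_compat_l; lra).
  assert (T2 : K * Rabs (b1 - b0) * (Rabs (a0 - b0) + Rabs (a1 - b1))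
    <= K * (K * tau) * (x0 + x1 + 2 * K ^ 2 * e2)).
  { apply Rmult_le_compat.
    - apply Rmult_le_pos; [lra|apply Rabs_pos].
    - apply Rplus_le_le_0_compat; apply Rabs_pos.
    - apply Rmult_le_compat_l; lra.
    - lra. }
  replace (tau * (K * xd + K ^ 3 * e2 + K ^ 2 * (x0 + x1 + 2 * K ^ 2 * e2))) with
    (K * (tau * (xd + K ^ 2 * e2)) + K * (K * tau) * (x0 + x1 + 2 * K ^ 2 * e2)) by ring.
  lra. }
assert (S4 : Rabs (u0 * (r a1 - r a0 - (r b1 - r b0)))
   <= tau * (K ^ 2 * xd + K ^ 4 * e2 + K ^ 3 * (x0 + x1) + 2 * K ^ 5 * e2)).
{ rewrite Rabs_mult; eapply Rle_trans.
  - apply Rmult_le_compat; [apply Rabs_pos|apply Rabs_pos|exact Bu|exact S3].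
  - apply Req_le; ring. }
eapply Rle_trans; [apply Rabs_triang|].
eapply Rle_trans; [apply Rplus_le_compat_l, Rabs_triang|].
apply Rle_trans with (tau * ((K * e2) + (K ^ 2 * x1 + K ^ 4 * e2)
  + (K ^ 2 * xd + K ^ 4 * e2 + K ^ 3 * (x0 + x1) + 2 * K ^ 5 * e2))); [lra|].
apply Rmult_le_compat_l; [lra|].
assert (K * e2 <= K ^ 5 * e2) by (apply Rmult_le_compat_r; lra).
assert (K ^ 4 * e2 <= K ^ 5 * e2) by (apply Rmult_le_compat_r; lra).
assert (K ^ 2 * x1 <= K ^ 5 * x1) by (apply Rmult_le_compat_r; lra).
assert (K ^ 3 * x1 <= K ^ 5 * x1) by (apply Rmult_le_compat_r; lra).
assert (K ^ 3 * x0 <= K ^ 5 * x0) by (apply Rmult_le_compat_r; lra).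
assert (K ^ 2 * xd <= K ^ 5 * xd) by (apply Rmult_le_compat_r; lra).
assert (0 <= K ^ 5 * x1) by (apply Rmult_le_pos; lra).
assert (0 <= K ^ 5 * x0) by (apply Rmult_le_pos; lra).
assert (0 <= K ^ 5 * xd) by (apply Rmult_le_pos; lra).
lra.
Qed.

Lemma edge_theta_bound n i j : is_xedge Nx Ny i j -> (n <= N)%nat -> edge_range lo hi n ->
  Rabs (edge_theta n i j) <= 2 * K ^ 4 * (Rabs (Pi (f n) i j) + e2).
Proof.
intros Hij Hn R0.
assert (HG := ed_grid _ _ _ HD); assert (HG0 := HG); destruct HG0 as (HA & HNx & HNy & HN).
assert (H1 := ed_K _ _ _ HD).
assert (HO := xedge_in_Omega A Nx Ny N HG i j Hij).
assert (HB := xedge_in_box A Nx Ny N HG i j n ltac:(destruct Hij; lia) (proj2 Hij) Hn).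
assert (E0 := interp_porosity_error n i j Hij Hn).
assert (Bu := Csm_bound A 5 K u _ _ _ (ed_u _ _ _ HD) HB).
assert (Ep := dxm_truncation A Nx Ny N HG p K (tn A N n) i j
  (Cclass_le 5 3 p ltac:(lia) (proj1 (ed_p _ _ _ HD))) Hij).
assert (Rphi := ed_range _ _ _ HD _ _ _ HO (proj2 HB)).
assert (R00 := ed_phi0 _ _ _ HD _ _ HO).
assert (Lip := ed_resist_lip _ _ _ HD _ _ _ R00 (R0 i j Hij) Rphi).
unfold edge_theta, edge_rho, sample.
set (g := dxm _ _ i j - px p _ _ _) in *.
set (u0 := u _ _ _) in *; set (r := resist A _) in *.
set (x0 := Rabs (Pi (f n) i j)) in *.
assert (X0 : 0 <= x0) by apply Rabs_pos; assert (Xe := e2_ge0).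
assert (G : Rabs g <= K * e2).
{ eapply Rle_trans; [apply Ep|].
  - intros x y Hxy; apply (Csm_bound A 2 K (px (px (px p)))).
    + do 3 apply Csm_px; apply HD.
    + split; [assumption|apply HB].
  - apply Rmult_le_compat_l; [lra|]. unfold e2; generalize (pow2_ge_0 (ky A Ny)); lra. }
eapply Rle_trans; [apply Rabs_triang|]; rewrite Rabs_mult.
assert (Rabs u0 * Rabs (r (Pi (Psi n) i j) - r (phi (xe A Nx i) (yc A Ny j) (tn A N n)))
  <= K * (K * (x0 + K ^ 2 * e2))).
{ apply Rmult_le_compat; try apply Rabs_pos; [assumption|].
  eapply Rle_trans; [exact Lip|]. apply Rmult_le_compat_l; lra. }
assert (K * e2 <= K ^ 4 * e2).
{ apply Rmult_le_compat_r; [lra|]. rewrite <- (pow_1 K) at 1; apply Rle_pow; [lra|lia]. }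
assert (K ^ 2 * x0 <= K ^ 4 * x0).
{ apply Rmult_le_compat_r; [lra|]. apply Rle_pow; [lra|lia]. }
assert (0 <= K ^ 4 * x0) by (apply Rmult_le_pos; [apply pow_le; lra|lra]).
lra.
Qed.

(** ** Darcy's law *)

Lemma edge_rho_pos n i j : is_xedge Nx Ny i j -> edge_range lo hi n ->
  0 < / K <= edge_rho n i j /\ edge_rho n i j <= K.
Proof.
intros Hij R0; assert (H1 := ed_K _ _ _ HD); unfold edge_rho.
destruct (ed_resist_bounds _ _ _ HD (phi0 A (xe A Nx i) (yc A Ny j)) (Pi (Psi n) i j)) as [a b].
- apply (ed_phi0 _ _ _ HD), (xedge_in_Omega A Nx Ny N (ed_grid _ _ _ HD)), Hij.
- now apply R0.
- repeat split; try assumption. apply Rinv_0_lt_compat; lra.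
Qed.

Lemma discrete_darcy n (U : gridfun) (Pd_ : gridfun) i j :
  is_xedge Nx Ny i j -> edge_range lo hi n ->
  U i j = - (perm A (at_xedges A Nx Ny (phi0 A) i j) (Pi (Psi n) i j) / mu A) * dxm h Pd_ i j ->
  edge_rho n i j * U i j = - dxm h Pd_ i j.
Proof.
intros Hij R0 ->; destruct (edge_rho_pos n i j Hij R0) as [[a b] _].
unfold edge_rho, resist in *; unfold at_xedges.
assert (Hp : perm A (phi0 A (xe A Nx i) (yc A Ny j)) (Pi (Psi n) i j) <> 0).
{ intros E; rewrite E in b; unfold Rdiv in b; rewrite Rinv_0, Rmult_0_r in b; lra. }
assert (Hm : mu A <> 0).
{ intros E; rewrite E in b; unfold Rdiv in b; rewrite Rmult_0_l in b; lra. }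
field; split; assumption.
Qed.

(** The error relation that [pressure_step] assumes. *)
Lemma darcy_error n (U : gridfun) (Pd_ : nat -> gridfun) i j :
  is_xedge Nx Ny i j -> edge_range lo hi n -> 0 < tn A N n <= Qend A ->
  U i j = - (perm A (at_xedges A Nx Ny (phi0 A) i j) (Pi (Psi n) i j) / mu A)
    * dxm h (Pd_ n) i j ->
  edge_rho n i j * (U i j - u (xe A Nx i) (yc A Ny j) (tn A N n))
  = - (dxm h (err_center A Nx Ny N Pd_ p n) i j + edge_theta n i j).
Proof.
intros Hij R0 Hn HU.
assert (HG := ed_grid _ _ _ HD); assert (HG0 := HG); destruct HG0 as (HA & HNx & HNy & HN).
assert (Hh := hx_pos A Nx HA HNx : 0 < h).
assert (E := discrete_darcy n U (Pd_ n) i j Hij R0 HU).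
assert (D := ed_darcy _ _ _ HD _ _ _ (xedge_in_Omega A Nx Ny N HG i j Hij) Hn).
rewrite Rmult_minus_distr_l, E; unfold edge_theta; fold h.
assert (S : dxm h (Pd_ n) i j = dxm h (sample A Nx Ny N p n) i j
   + dxm h (err_center A Nx Ny N Pd_ p n) i j) by (unfold dxm, err_center; field; lra).
rewrite S, Rmult_minus_distr_l.
rewrite (Rmult_comm _ (resist _ _ _)), D; ring.
Qed.

Lemma velocity_bound n (U : gridfun) (Pd_ : nat -> gridfun) i j :
  is_xedge Nx Ny i j -> edge_range lo hi n -> (n <= N)%nat ->
  U i j = - (perm A (at_xedges A Nx Ny (phi0 A) i j) (Pi (Psi n) i j) / mu A)
    * dxm h (Pd_ n) i j ->
  h * Rabs (U i j) <= K * (K * h + Rabs (err_center A Nx Ny N Pd_ p n (S i) j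
                                         - err_center A Nx Ny N Pd_ p n i j)).
Proof.
intros Hij R0 Hn HU.
assert (HG := ed_grid _ _ _ HD); assert (HG0 := HG); destruct HG0 as (HA & HNx & HNy & HN).
assert (Hh := hx_pos A Nx HA HNx : 0 < h); assert (H1 := ed_K _ _ _ HD).
assert (E := discrete_darcy n U (Pd_ n) i j Hij R0 HU).
destruct (edge_rho_pos n i j Hij R0) as [[a b] _].
assert (B := sample_neighbours A Nx Ny N HG p K n i j (Csm_le A 5 1 K p ltac:(lia) (ed_p _ _ _ HD))
  Hij Hn); fold h in B.
set (dq := err_center A Nx Ny N Pd_ p n (S i) j - err_center A Nx Ny N Pd_ p n i j).
assert (E2 : h * Rabs (edge_rho n i j * U i j) <= K * h + Rabs dq).
{ rewrite E, Rabs_Ropp.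
  replace (h * Rabs (dxm h (Pd_ n) i j)) with (Rabs (h * dxm h (Pd_ n) i j))
    by (rewrite Rabs_mult, (Rabs_pos_eq h) by lra; reflexivity).
  replace (h * dxm h (Pd_ n) i j) with
    ((sample A Nx Ny N p n (S i) j - sample A Nx Ny N p n i j) + dq)
    by (unfold dq, dxm, err_center; field; lra).
  eapply Rle_trans; [apply Rabs_triang|lra]. }
rewrite Rabs_mult, (Rabs_pos_eq (edge_rho n i j)) in E2 by lra.
assert (x0 : 0 <= h * Rabs (U i j)) by (apply Rmult_le_pos; [lra|apply Rabs_pos]).
assert (E3 : / K * (h * Rabs (U i j)) <= K * h + Rabs dq).
{ apply Rle_trans with (edge_rho n i j * (h * Rabs (U i j))); [apply Rmult_le_compat_r; lra|lra]. }
apply Rmult_le_compat_l with (r := K) in E3; [|lra].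
rewrite <- Rmult_assoc, Rinv_r, Rmult_1_l in E3 by lra; exact E3.
Qed.

(** ** Sums over all edges *)

Lemma interp_L2 w g : 0 <= w ->
  I2 w (Nx - 1) Ny (fun i j => Pi g i j ^ 2) <= K * I2 w Nx Ny (fun i j => g i j ^ 2).
Proof.
intros Hw; rewrite !I2_S2.
replace (K * (w * S2 Nx Ny (fun i j => g i j ^ 2))) with
  (w * (K * S2 Nx Ny (fun i j => g i j ^ 2))) by ring.
apply Rmult_le_compat_l; [assumption|apply (si_L2 _ _ _ _ (ed_stable _ _ _ HD))].
Qed.

Definition edge_theta_rate (n : nat) : gridfun := fun i j =>
  5 * K ^ 5 * (Rabs (Pi (f (S n)) i j) + Rabs (Pi (f n) i j)
        + Rabs (Pi (dtm tau f (S n)) i j) + e2).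

Lemma edge_theta_rate_sum w n : 0 <= w ->
  I2 w (Nx - 1) Ny (fun i j => edge_theta_rate n i j ^ 2)
  <= 100 * K ^ 11 * (I2 w Nx Ny (fun i j => f (S n) i j ^ 2)
      + I2 w Nx Ny (fun i j => f n i j ^ 2)
      + I2 w Nx Ny (fun i j => dtm tau f (S n) i j ^ 2) + I2 w Nx Ny (fun _ _ => e2 ^ 2)).
Proof.
intros Hw; assert (H1 := ed_K _ _ _ HD).
assert (A1 := interp_L2 w (f (S n)) Hw); assert (A2 := interp_L2 w (f n) Hw).
assert (A3 := interp_L2 w (dtm tau f (S n)) Hw).
assert (A4 := I2_xedges_le w Nx Ny (fun _ _ => e2 ^ 2) Hw (fun _ _ => pow2_ge_0 e2)).
assert (P4 := I2_sq_ge0 w Nx Ny (fun _ _ => e2) Hw).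
apply Rle_trans with (I2 w (Nx - 1) Ny (fun i j => 100 * K ^ 10 * (Pi (f (S n)) i j ^ 2
  + Pi (f n) i j ^ 2 + Pi (dtm tau f (S n)) i j ^ 2 + e2 ^ 2))).
- apply I2_le; [assumption|]; intros i j _ _; unfold edge_theta_rate.
  rewrite <- (pow2_abs (Pi (f (S n)) i j)), <- (pow2_abs (Pi (f n) i j)),
    <- (pow2_abs (Pi (dtm tau f (S n)) i j)).
  set (a := Rabs (Pi (f (S n)) i j)); set (b := Rabs (Pi (f n) i j)).
  set (c := Rabs (Pi (dtm tau f (S n)) i j)).
  rewrite Rpow_mult_distr.
  replace ((5 * K ^ 5) ^ 2) with (25 * K ^ 10) by ring.
  replace (100 * K ^ 10 * (a ^ 2 + b ^ 2 + c ^ 2 + e2 ^ 2)) with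
    (25 * K ^ 10 * (4 * (a ^ 2 + b ^ 2 + c ^ 2 + e2 ^ 2))) by ring.
  apply Rmult_le_compat_l.
  + assert (0 <= K ^ 10) by (apply pow_le; lra); lra.
  + generalize (pow2_ge_0 (a - b)) (pow2_ge_0 (a - c)) (pow2_ge_0 (a - e2))
      (pow2_ge_0 (b - c)) (pow2_ge_0 (b - e2)) (pow2_ge_0 (c - e2)); lra.
- I2_push.
  replace (100 * K ^ 11) with (100 * K ^ 10 * K) by ring.
  rewrite (Rmult_assoc (100 * K ^ 10) K); apply Rmult_le_compat_l.
  + assert (0 <= K ^ 10) by (apply pow_le; lra); lra.
  + assert (1 * I2 w Nx Ny (fun _ _ => e2 ^ 2) <= K * I2 w Nx Ny (fun _ _ => e2 ^ 2))
      by (apply Rmult_le_compat_r; lra).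
    lra.
Qed.

Lemma edge_theta_sum w n : 0 <= w -> (n <= N)%nat -> edge_range lo hi n ->
  I2 w (Nx - 1) Ny (fun i j => edge_theta n i j ^ 2)
  <= 8 * K ^ 9 * (I2 w Nx Ny (fun i j => f n i j ^ 2) + I2 w Nx Ny (fun _ _ => e2 ^ 2)).
Proof.
intros Hw Hn Hr; assert (H1 := ed_K _ _ _ HD).
assert (A1 := interp_L2 w (f n) Hw).
assert (A4 := I2_xedges_le w Nx Ny (fun _ _ => e2 ^ 2) Hw (fun _ _ => pow2_ge_0 e2)).
assert (P4 := I2_sq_ge0 w Nx Ny (fun _ _ => e2) Hw).
assert (K8 : 0 <= K ^ 8) by (apply pow_le; lra).
apply Rle_trans with (I2 w (Nx - 1) Ny (fun i j => 8 * K ^ 8 * (Pi (f n) i j ^ 2 + e2 ^ 2))).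
- apply I2_le; [assumption|]; intros i j Hi Hj.
  assert (B := edge_theta_bound n i j ltac:(split; lia) Hn Hr).
  apply Rabs_le_sq in B; eapply Rle_trans; [exact B|].
  rewrite <- (pow2_abs (Pi (f n) i j)); set (a := Rabs (Pi (f n) i j)).
  rewrite Rpow_mult_distr; replace ((2 * K ^ 4) ^ 2) with (4 * K ^ 8) by ring.
  replace (8 * K ^ 8 * (a ^ 2 + e2 ^ 2)) with (4 * K ^ 8 * (2 * (a ^ 2 + e2 ^ 2))) by ring.
  apply Rmult_le_compat_l; [lra|]. generalize (pow2_ge_0 (a - e2)); lra.
- I2_push; replace (8 * K ^ 9) with (8 * K ^ 8 * K) by ring.
  rewrite (Rmult_assoc (8 * K ^ 8) K); apply Rmult_le_compat_l; [lra|].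
  assert (1 * I2 w Nx Ny (fun _ _ => e2 ^ 2) <= K * I2 w Nx Ny (fun _ _ => e2 ^ 2))
    by (apply Rmult_le_compat_r; lra).
  lra.
Qed.

(** ** The flux of a transported quantity *)

Variables (c : field) (Cd : nat -> gridfun) (v l0 l1 : R).
Hypotheses (Hc : Csm A 5 K c) (Hv : 0 <= v).

Let e n := err_center A Nx Ny N Cd c n.

(** The remainder [g] of [transport_step].  The difference between the interpolation and
    the average has the factor [U], which may be of the order of [eta / h]; all other
    terms are of first order in the errors. *)
Lemma edge_flux_remainder (n : nat) (U W lam g : gridfun) eta i j :
  is_xedge Nx Ny i j -> (n <= N)%nat -> e2 <= 1 -> 0 < h ->
  W i j = v * U i j * Pi (Cd n) i j - (l0 + l1 * Pi (Psi n) i j) * dxm h (Cd n) i j ->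
  lam i j = l0 + l1 * Pi (Psi n) i j ->
  g i j = (W i j - (v * u (xe A Nx i) (yc A Ny j) (tn A N n)
              * c (xe A Nx i) (yc A Ny j) (tn A N n)
            - (l0 + l1 * phi (xe A Nx i) (yc A Ny j) (tn A N n))
              * px c (xe A Nx i) (yc A Ny j) (tn A N n)))
          - (v * (U i j * ((e n i j + e n (S i) j) / 2)) - lam i j * dxm h (e n) i j) ->
  h * Rabs (U i j) <= eta ->
  Rabs (g i j) <= v * eta / h * Rabs (Pi (e n) i j - (e n i j + e n (S i) j) / 2)
   + 2 * K ^ 3 * (v + Rabs l0 + Rabs l1) *
      (Rabs (U i j - u (xe A Nx i) (yc A Ny j) (tn A N n)) + Rabs (Pi (f n) i j) + e2).
Proof.
intros Hij Hn He2 Hh EW El Eg HU.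
assert (HG := ed_grid _ _ _ HD); assert (HG0 := HG); destruct HG0 as (HA & HNx & HNy & HN).
assert (H1 := ed_K _ _ _ HD).
assert (HB := xedge_in_box A Nx Ny N HG i j n ltac:(destruct Hij; lia) (proj2 Hij) Hn).
assert (E0 := interp_porosity_error n i j Hij Hn).
assert (Bu := Csm_bound A 5 K u _ _ _ (ed_u _ _ _ HD) HB).
assert (Bphi := Csm_bound A 5 K phi _ _ _ (ed_phi _ _ _ HD) HB).
assert (Bc := Csm_bound A 5 K c _ _ _ Hc HB).
assert (Ec := dxm_truncation A Nx Ny N HG c K (tn A N n) i j
  (Cclass_le 5 3 c ltac:(lia) (proj1 Hc)) Hij).
assert (Ei := interp_sample A Nx Ny N HG K Pi c K n i j
  (ed_cons _ _ _ HD) (Csm_le A 5 2 K c ltac:(lia) Hc) Hij Hn).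
assert (Bd := dxm_sample_bound A Nx Ny N HG c K n i j
  (Csm_le A 5 1 K c ltac:(lia) Hc) Hij Hn).
assert (SC : Pi (Cd n) i j = Pi (sample A Nx Ny N c n) i j + Pi (e n) i j).
{ rewrite <- (Rmult_1_l (Pi (e n) i j)), <- (si_lin _ _ _ _ (ed_stable _ _ _ HD)) by assumption.
  f_equal; do 2 (apply functional_extensionality; intro); unfold e, err_center; ring. }
assert (SD : dxm h (Cd n) i j = dxm h (sample A Nx Ny N c n) i j + dxm h (e n) i j)
  by (unfold dxm, e, err_center; field; lra).
fold h in Ec, Bd; fold e2 in Ei.
change (at_centers A Nx Ny (fun x y => c x y (tn A N n))) with (sample A Nx Ny N c n) in Ec.
assert (Ec' : Rabs (dxm h (sample A Nx Ny N c n) i j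
   - px c (xe A Nx i) (yc A Ny j) (tn A N n)) <= K * e2).
{ eapply Rle_trans; [apply Ec|].
  - intros x y Hxy; apply (Csm_bound A 2 K (px (px (px c)))).
    + do 3 apply Csm_px; apply Hc.
    + split; [assumption|apply HB].
  - apply Rmult_le_compat_l; [lra|]. unfold e2, h; generalize (pow2_ge_0 (ky A Ny)); lra. }
clear Ec; rewrite Eg, EW, El, SC, SD; clear Eg EW El SC SD.
set (ue := u _ _ _) in *; set (ce := c _ _ _) in *; set (pe := phi _ _ _) in *.
set (cx := px c _ _ _) in *; set (dc := dxm h (sample A Nx Ny N c n) i j) in *.
set (de := dxm h (e n) i j); set (pc := Pi (sample A Nx Ny N c n) i j) in *.
set (r := Pi (e n) i j - (e n i j + e n (S i) j) / 2).
set (a := Pi (Psi n) i j) in *; set (Y := U i j - ue).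
set (x0 := Rabs (Pi (f n) i j)) in *.
replace (v * U i j * (pc + Pi (e n) i j) - (l0 + l1 * a) * (dc + de)
  - (v * ue * ce - (l0 + l1 * pe) * cx)
  - (v * (U i j * ((e n i j + e n (S i) j) / 2)) - (l0 + l1 * a) * de))
  with (v * (U i j * r) + (v * ((ue + Y) * (pc - ce)) + (v * (Y * ce)
     + (- (l1 * ((a - pe) * dc)) + - ((l0 + l1 * pe) * (dc - cx))))))
  by (unfold Y, r; ring).
assert (X0 : 0 <= x0) by apply Rabs_pos; assert (Xe := e2_ge0).
assert (XY : 0 <= Rabs Y) by apply Rabs_pos.
assert (L0 := Rabs_pos l0); assert (L1 := Rabs_pos l1).
assert (K2 : 1 <= K ^ 2) by (apply pow_R1_Rle; lra).
assert (K23 : K ^ 2 <= K ^ 3) by (apply Rle_pow; [lra|lia]).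
assert (K13 : K <= K ^ 3) by (rewrite <- (pow_1 K) at 1; apply Rle_pow; [lra|lia]).
assert (T1 : Rabs (v * (U i j * r)) <= v * eta / h * Rabs r).
{ rewrite !Rabs_mult, (Rabs_pos_eq v) by lra; rewrite <- Rmult_assoc.
  apply Rmult_le_compat_r; [apply Rabs_pos|]. unfold Rdiv; rewrite Rmult_assoc.
  apply Rmult_le_compat_l; [assumption|].
  apply Rmult_le_reg_l with h; [assumption|].
  replace (h * (eta * / h)) with eta by (field; lra); assumption. }
assert (T2 : Rabs (v * ((ue + Y) * (pc - ce))) <= v * (K ^ 3 * (e2 + Rabs Y))).
{ rewrite Rabs_mult, (Rabs_pos_eq v) by lra; apply Rmult_le_compat_l; [assumption|].
  rewrite Rabs_mult; apply Rle_trans with ((K + Rabs Y) * (K * K * e2)).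
  - apply Rmult_le_compat; try apply Rabs_pos; [|assumption].
    eapply Rle_trans; [apply Rabs_triang|lra].
  - replace ((K + Rabs Y) * (K * K * e2)) with (K ^ 3 * e2 + K ^ 2 * (Rabs Y * e2)) by ring.
    assert (Rabs Y * e2 <= Rabs Y * 1) by (apply Rmult_le_compat_l; lra).
    assert (K ^ 2 * (Rabs Y * e2) <= K ^ 3 * Rabs Y).
    { apply Rmult_le_compat; try lra. now apply Rmult_le_pos. }
    lra. }
assert (T3 : Rabs (v * (Y * ce)) <= v * (K ^ 3 * Rabs Y)).
{ rewrite !Rabs_mult, (Rabs_pos_eq v) by lra; apply Rmult_le_compat_l; [assumption|].
  rewrite Rmult_comm; apply Rmult_le_compat_r; lra. }
assert (T4 : Rabs (- (l1 * ((a - pe) * dc))) <= Rabs l1 * (K ^ 3 * (x0 + e2))).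
{ rewrite Rabs_Ropp, !Rabs_mult; apply Rmult_le_compat_l; [assumption|].
  apply Rle_trans with ((x0 + K ^ 2 * e2) * K).
  - apply Rmult_le_compat; try apply Rabs_pos; assumption.
  - assert (K * x0 <= K ^ 3 * x0) by (apply Rmult_le_compat_r; lra).
    replace ((x0 + K ^ 2 * e2) * K) with (K * x0 + K ^ 3 * e2) by ring; lra. }
assert (T5 : Rabs (- ((l0 + l1 * pe) * (dc - cx))) <= (Rabs l0 + Rabs l1) * (K ^ 3 * e2)).
{ rewrite Rabs_Ropp, Rabs_mult; apply Rle_trans with (((Rabs l0 + Rabs l1) * K) * (K * e2)).
  - apply Rmult_le_compat; try apply Rabs_pos; [|assumption].
    eapply Rle_trans; [apply Rabs_triang|]; rewrite Rabs_mult.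
    assert (Rabs l1 * Rabs pe <= Rabs l1 * K) by (apply Rmult_le_compat_l; lra).
    assert (Rabs l0 * 1 <= Rabs l0 * K) by (apply Rmult_le_compat_l; lra).
    lra.
  - rewrite Rmult_assoc; apply Rmult_le_compat_l; [lra|].
    rewrite <- Rmult_assoc; apply Rmult_le_compat_r; [lra|]. simpl in K23; nra. }
eapply Rle_trans; [apply Rabs_triang|]; apply Rplus_le_compat; [exact T1|].
eapply Rle_trans; [apply Rabs_triang|].
eapply Rle_trans; [apply Rplus_le_compat_l, Rabs_triang|].
eapply Rle_trans; [apply Rplus_le_compat_l, Rplus_le_compat_l, Rabs_triang|].
set (k3 := K ^ 3) in *; set (y := Rabs Y) in *.
assert (0 <= v * (k3 * y)) by (repeat apply Rmult_le_pos; lra).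
assert (0 <= v * (k3 * e2)) by (repeat apply Rmult_le_pos; lra).
assert (0 <= v * (k3 * x0)) by (repeat apply Rmult_le_pos; lra).
assert (0 <= Rabs l0 * (k3 * y)) by (repeat apply Rmult_le_pos; lra).
assert (0 <= Rabs l0 * (k3 * x0)) by (repeat apply Rmult_le_pos; lra).
assert (0 <= Rabs l0 * (k3 * e2)) by (repeat apply Rmult_le_pos; lra).
assert (0 <= Rabs l1 * (k3 * y)) by (repeat apply Rmult_le_pos; lra).
assert (0 <= Rabs l1 * (k3 * x0)) by (repeat apply Rmult_le_pos; lra).
lra.
Qed.

Lemma edge_flux_sum w (n : nat) (U W lam g : gridfun) eta :
  0 <= w -> (n <= N)%nat -> e2 <= 1 ->
  (forall i j, is_xedge Nx Ny i j ->
    W i j = v * U i j * Pi (Cd n) i j - (l0 + l1 * Pi (Psi n) i j) * dxm h (Cd n) i j /\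
    lam i j = l0 + l1 * Pi (Psi n) i j /\
    g i j = (W i j - (v * u (xe A Nx i) (yc A Ny j) (tn A N n)
              * c (xe A Nx i) (yc A Ny j) (tn A N n)
            - (l0 + l1 * phi (xe A Nx i) (yc A Ny j) (tn A N n))
              * px c (xe A Nx i) (yc A Ny j) (tn A N n)))
          - (v * (U i j * ((e n i j + e n (S i) j) / 2)) - lam i j * dxm h (e n) i j) /\
    h * Rabs (U i j) <= eta) ->
  I2 w (Nx - 1) Ny (fun i j => g i j ^ 2)
  <= 2 * v ^ 2 * eta ^ 2 * K * I2 w (Nx - 1) Ny (fun i j => dxm h (e n) i j ^ 2)
   + 24 * K ^ 7 * (v + Rabs l0 + Rabs l1) ^ 2 *
     (I2 w (Nx - 1) Ny (fun i j => (U i j - u (xe A Nx i) (yc A Ny j) (tn A N n)) ^ 2)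
      + I2 w Nx Ny (fun i j => f n i j ^ 2) + I2 w Nx Ny (fun _ _ => e2 ^ 2)).
Proof.
intros Hw Hn He2 Hyp.
assert (HG := ed_grid _ _ _ HD); assert (HG0 := HG); destruct HG0 as (HA & HNx & HNy & HN).
assert (H1 := ed_K _ _ _ HD); assert (Hh := hx_pos A Nx HA HNx : 0 < h).
set (V := v + Rabs l0 + Rabs l1).
assert (V0 : 0 <= V) by (unfold V; generalize (Rabs_pos l0) (Rabs_pos l1); lra).
set (r := fun i j => Pi (e n) i j - (e n i j + e n (S i) j) / 2).
set (Y := fun i j => U i j - u (xe A Nx i) (yc A Ny j) (tn A N n)).
assert (K3 : 0 <= K ^ 3) by (apply pow_le; lra).
assert (K6 : 0 <= K ^ 6) by (apply pow_le; lra).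
assert (V2 := pow2_ge_0 V).
assert (VK : 0 <= 24 * K ^ 6 * V ^ 2) by (apply Rmult_le_pos; lra).
assert (Pt : I2 w (Nx - 1) Ny (fun i j => g i j ^ 2) <= I2 w (Nx - 1) Ny (fun i j =>
  2 * (v * eta / h) ^ 2 * r i j ^ 2
  + 24 * K ^ 6 * V ^ 2 * (Y i j ^ 2 + Pi (f n) i j ^ 2 + e2 ^ 2))).
{ apply I2_le; [assumption|]; intros i j Hi Hj.
  assert (Hij : is_xedge Nx Ny i j) by (split; lia).
  destruct (Hyp i j Hij) as (a1 & a2 & a3 & a4).
  assert (B := edge_flux_remainder n U W lam g eta i j Hij Hn He2 Hh a1 a2 a3 a4).
  apply Rabs_le_sq in B; eapply Rle_trans; [exact B|].
  change (U i j - u (xe A Nx i) (yc A Ny j) (tn A N n)) with (Y i j).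
  change (Pi (e n) i j - (e n i j + e n (S i) j) / 2) with (r i j); fold V.
  rewrite <- (pow2_abs (r i j)), <- (pow2_abs (Y i j)), <- (pow2_abs (Pi (f n) i j)).
  set (ra := Rabs (r i j)); set (ya := Rabs (Y i j)); set (fa := Rabs (Pi (f n) i j)).
  set (p1 := v * eta / h * ra); set (p2 := 2 * K ^ 3 * V * (ya + fa + e2)).
  apply Rle_trans with (2 * p1 ^ 2 + 2 * p2 ^ 2); [generalize (pow2_ge_0 (p1 - p2)); lra|].
  assert (E1 : 2 * p1 ^ 2 = 2 * (v * eta / h) ^ 2 * ra ^ 2) by (unfold p1; ring).
  assert (E2 : 2 * p2 ^ 2 = 8 * K ^ 6 * V ^ 2 * (ya + fa + e2) ^ 2) by (unfold p2; ring).
  rewrite E1, E2; apply Rplus_le_compat_l.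
  replace (24 * K ^ 6 * V ^ 2 * (ya ^ 2 + fa ^ 2 + e2 ^ 2)) with
    (8 * K ^ 6 * V ^ 2 * (3 * (ya ^ 2 + fa ^ 2 + e2 ^ 2))) by ring.
  apply Rmult_le_compat_l; [lra|].
  generalize (pow2_ge_0 (ya - fa)) (pow2_ge_0 (ya - e2)) (pow2_ge_0 (fa - e2)); lra. }
eapply Rle_trans; [exact Pt|]; I2_push; clear Pt.
assert (A1 := interp_L2 w (f n) Hw).
assert (A4 := I2_xedges_le w Nx Ny (fun _ _ => e2 ^ 2) Hw (fun _ _ => pow2_ge_0 e2)).
assert (P4 := I2_sq_ge0 w Nx Ny (fun _ _ => e2) Hw).
assert (P5 := I2_sq_ge0 w (Nx - 1) Ny Y Hw).
assert (A2 : I2 w (Nx - 1) Ny (fun i j => r i j ^ 2)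
   <= K * h ^ 2 * I2 w (Nx - 1) Ny (fun i j => dxm h (e n) i j ^ 2)).
{ assert (B := si_osc _ _ _ _ (ed_stable _ _ _ HD) (e n)).
  rewrite (S2_ext _ _ (fun i j => (e n (S i) j - e n i j) ^ 2)
    (fun i j => h ^ 2 * (dxm h (e n) i j) ^ 2)) in B
    by (intros; unfold dxm; field; lra).
  rewrite S2_scal in B; rewrite !I2_S2.
  apply Rmult_le_compat_l with (r := w) in B; [|assumption].
  unfold r; lra. }
apply Rplus_le_compat.
- apply Rle_trans with (2 * (v * eta / h) ^ 2 *
    (K * h ^ 2 * I2 w (Nx - 1) Ny (fun i j => dxm h (e n) i j ^ 2))).
  + apply Rmult_le_compat_l; [generalize (pow2_ge_0 (v * eta / h)); lra|assumption].
  + apply Req_le; field; lra.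
- replace (24 * K ^ 7 * V ^ 2) with (24 * K ^ 6 * V ^ 2 * K) by ring.
  rewrite (Rmult_assoc (24 * K ^ 6 * V ^ 2) K); apply Rmult_le_compat_l; [assumption|].
  fold Y; change (fun i j => (U i j - u (xe A Nx i) (yc A Ny j) (tn A N n)) ^ 2)
    with (fun i j => Y i j ^ 2).
  assert (1 * I2 w Nx Ny (fun _ _ => e2 ^ 2) <= K * I2 w Nx Ny (fun _ _ => e2 ^ 2))
    by (apply Rmult_le_compat_r; lra).
  assert (1 * I2 w (Nx - 1) Ny (fun i j => Y i j ^ 2)
    <= K * I2 w (Nx - 1) Ny (fun i j => Y i j ^ 2)) by (apply Rmult_le_compat_r; lra).
  lra.
Qed.

End Edge.

(** * Porosity *)

Fixpoint psum (u : nat -> R) (n : nat) : R :=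
  match n with O => 0 | S n' => psum u n' + u n' end.

Lemma psum_le u v n : (forall m, (m < n)%nat -> u m <= v m) -> psum u n <= psum v n.
Proof.
induction n as [|n IH]; simpl; intros H; [lra|].
apply Rplus_le_compat; [apply IH; intros; apply H; lia|apply H; lia].
Qed.

Lemma psum_ge0 u n : (forall m, (m < n)%nat -> 0 <= u m) -> 0 <= psum u n.
Proof.
induction n as [|n IH]; simpl; intros H; [lra|].
apply Rplus_le_le_0_compat; [apply IH; intros; apply H; lia|apply H; lia].
Qed.

Lemma psum_plus u v n : psum (fun m => u m + v m) n = psum u n + psum v n.
Proof. induction n as [|n IH]; simpl; [ring|rewrite IH; ring]. Qed.

Lemma psum_scal a u n : psum (fun m => a * u m) n = a * psum u n.
Proof. induction n as [|n IH]; simpl; [ring|rewrite IH; ring]. Qed.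

Lemma psum_const a n : psum (fun _ => a) n = INR n * a.
Proof. induction n as [|n IH]; [simpl; ring|simpl psum; rewrite IH, S_INR; ring]. Qed.

Lemma Rmult_le_1 a b : 0 <= a <= 1 -> 0 <= b <= 1 -> a * b <= 1.
Proof. intros; nra. Qed.

(** The implicit Euler scheme for [v' = - s v]. *)
Section Decay.

Variables (tau smax : R) (N : nat).
Hypothesis (Ht : 0 < tau).

Definition decay (s v : nat -> R) : Prop :=
  v 0%nat = 1 /\
  forall n, (n < N)%nat -> 0 <= s n <= smax /\ v (S n) * (1 + tau * s n) = v n.

Lemma decay_bounds s v n : decay s v -> (n <= N)%nat ->
  exp (- (smax * (INR n * tau))) <= v n <= 1.
Proof.
intros [H0 H] Hn; induction n as [|n IH].
- simpl; rewrite H0, Rmult_0_l, Rmult_0_r, Ropp_0, exp_0; lra.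
- destruct (H n ltac:(lia)) as [Hs E]; specialize (IH ltac:(lia)).
  assert (P : 0 <= tau * s n) by (apply Rmult_le_pos; lra).
  assert (P' : tau * s n <= tau * smax) by (apply Rmult_le_compat_l; lra).
  assert (Ev : v (S n) = v n * / (1 + tau * s n)) by (rewrite <- E; field; lra).
  assert (I1 : / (1 + tau * s n) <= 1)
    by (rewrite <- Rinv_1; apply Rinv_le_contravar; lra).
  assert (I0 : exp (- (tau * smax)) <= / (1 + tau * s n)).
  { rewrite exp_Ropp; apply Rinv_le_contravar; [lra|].
    apply Rle_trans with (1 + tau * smax); [lra|].
    destruct (Req_dec (tau * smax) 0) as [->|N0]; [rewrite exp_0; lra|].
    apply Rlt_le, exp_ineq1; assumption. }
  assert (E0 := exp_pos (- (smax * (INR n * tau)))).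
  assert (E1 := exp_pos (- (tau * smax))).
  rewrite Ev; split.
  + rewrite S_INR; replace (- (smax * ((INR n + 1) * tau)))
      with (- (smax * (INR n * tau)) + - (tau * smax)) by ring.
    rewrite exp_plus; apply Rmult_le_compat; lra.
  + apply Rmult_le_1; lra.
Qed.

(** Damping by a non-negative rate does not amplify differences, so perturbations of the
    rate only add up. *)
Lemma decay_stable s v s' v' n : decay s v -> decay s' v' -> (n <= N)%nat ->
  Rabs (v n - v' n) <= psum (fun m => tau * Rabs (s m - s' m)) n.
Proof.
intros D D' Hn; induction n as [|n IH].
- destruct D as [-> _], D' as [-> _]; simpl; rewrite Rminus_diag, Rabs_R0; lra.
- specialize (IH ltac:(lia)).
  assert (B := decay_bounds s v (S n) D Hn); assert (B' := decay_bounds s' v' (S n) D' Hn).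
  assert (X0 := exp_pos (- (smax * (INR (S n) * tau)))).
  destruct D as [_ D], D' as [_ D'].
  destruct (D n ltac:(lia)) as [Hs E], (D' n ltac:(lia)) as [Hs' E'].
  simpl psum; set (a := Rabs (v (S n) - v' (S n))).
  assert (P : 0 <= tau * s n) by (apply Rmult_le_pos; lra).
  assert (Q : (v (S n) - v' (S n)) * (1 + tau * s n)
     = (v n - v' n) + tau * ((s' n - s n) * v' (S n))) by (rewrite <- E, <- E'; ring).
  assert (A1 : a * 1 <= a * (1 + tau * s n))
    by (apply Rmult_le_compat_l; [apply Rabs_pos|lra]).
  assert (A2 : a * (1 + tau * s n) = Rabs ((v (S n) - v' (S n)) * (1 + tau * s n)))
    by (rewrite Rabs_mult, (Rabs_pos_eq (1 + tau * s n)) by lra; reflexivity).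
  rewrite Q in A2.
  assert (A3 := Rabs_triang (v n - v' n) (tau * ((s' n - s n) * v' (S n)))).
  rewrite !Rabs_mult, (Rabs_pos_eq tau), (Rabs_pos_eq (v' (S n))),
    (Rabs_minus_sym (s' n)) in A3 by lra.
  assert (A4 : tau * (Rabs (s n - s' n) * v' (S n)) <= tau * Rabs (s n - s' n)).
  { apply Rmult_le_compat_l; [lra|]. rewrite <- (Rmult_1_r (Rabs (s n - s' n))) at 2.
    apply Rmult_le_compat_l; [apply Rabs_pos|lra]. }
  lra.
Qed.

End Decay.

Section Porosity.

Variables (A : problem) (phi0_lo phi0_hi L : R).
Hypotheses (HA : standing_assumptions A)
  (Hlo : 0 < phi0_lo) (Hhi : phi0_hi < 1)
  (Hphi0 : forall x y, Omega A x y -> phi0_lo <= phi0 A x y <= phi0_hi)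
  (HL0 : 0 <= L) (HL : forall T T', Rabs (react A T - react A T') <= L * Rabs (T - T')).

(** The coefficient of the reaction term in the equation for the porosity. *)
Definition rate : R := alpha A * kc A * a0 A / rho_s A.
Let smax := rate / (1 - phi0_hi).

(** The solid fraction at the final time when the rock dissolves at the maximal rate gives
    the upper bound. *)
Definition porosity_max : R := 1 - (1 - phi0_hi) * exp (- (smax * Qend A)).

Lemma rate_pos : 0 < rate.
Proof.
unfold rate; apply Rdiv_lt_0_compat; [|apply (rho_pos A HA)].
repeat apply Rmult_lt_0_compat; apply HA.
Qed.

Lemma smax_pos : 0 < smax.
Proof. unfold smax; apply Rdiv_lt_0_compat; [apply rate_pos|lra]. Qed.

Lemma porosity_max_bounds : phi0_hi <= porosity_max < 1.
Proof.
unfold porosity_max; assert (E := exp_pos (- (smax * Qend A))).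
assert (exp (- (smax * Qend A)) <= 1).
{ rewrite <- exp_0; assert (P := smax_pos).
  destruct (domain_nonempty A HA) as (_ & _ & HQ).
  apply Rlt_le, exp_increasing; nra. }
split; nra.
Qed.

Lemma react_range T : 0 <= react A T <= 1.
Proof. now apply react_props. Qed.

Lemma exact_porosity_range (Sol : state) : exact_solution A Sol -> Cclass 1 (phi Sol) ->
  forall x y t, Omega A x y -> 0 <= t <= Qend A ->
  phi0_lo <= phi Sol x y t <= porosity_max.
Proof.
intros HS Hsm x y t HO Ht.
destruct (domain_nonempty A HA) as (_ & _ & HQ).
destruct (initial_data A Sol HS x y HO) as (_ & _ & I & _).
assert (R0 := Hphi0 x y HO).
assert (Dphi : forall s, ex_derive (fun s => phi Sol x y s) s)
  by (intros s; exact (proj2 (proj2 (proj1 Hsm x y s)))).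
assert (D := decay_range (fun s => 1 - phi Sol x y s)
  (fun s => rate * react A (Tf Sol x y s) * cf Sol x y s / (1 - phi0 A x y))
  (Qend A) smax HQ).
assert (E : 1 - phi Sol x y 0 = 1 - phi0 A x y) by (rewrite I; reflexivity).
cbv beta in D; rewrite E in D.
destruct (D ltac:(lra)) with (t := t) as [D1 D2]; [| |assumption|].
- intros s; apply (ex_derive_minus (V := R_NormedModule) (fun _ => 1) (fun s => phi Sol x y s));
    [apply ex_derive_const|apply Dphi].
- intros s Hs; split.
  + assert (C := concentration_range A Sol HS x y s HO ltac:(lra)).
    assert (Q := react_range (Tf Sol x y s)); assert (P := rate_pos).
    assert (B : 0 <= react A (Tf Sol x y s) * cf Sol x y s <= 1).
    { split; [apply Rmult_le_pos; lra|].
      apply Rmult_le_1; lra. }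
    rewrite Rmult_assoc; split; [apply Rdiv_le_0_compat; [apply Rmult_le_pos; lra|lra]|].
    unfold smax, Rdiv; apply Rmult_le_compat.
    * apply Rmult_le_pos; lra.
    * apply Rlt_le, Rinv_0_lt_compat; lra.
    * rewrite <- (Rmult_1_r rate) at 2; apply Rmult_le_compat_l; lra.
    * apply Rinv_le_contravar; lra.
  + assert (PE := porosity_eq A Sol HS x y s HO Hs).
    assert (ED : Derive (fun s => 1 - phi Sol x y s) s = 0 - pt (phi Sol) x y s).
    { rewrite (Derive_minus (fun _ => 1) (fun s => phi Sol x y s) s
        (ex_derive_const _ _) (Dphi s)), Derive_const; reflexivity. }
    rewrite ED, PE; clear ED PE.
    destruct (ks_bounds A HA) as (k1 & k2 & Hk1 & Hk); specialize (Hk (Tf Sol x y s)).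
    assert (Hkc := kc_pos A HA); assert (Hrs := proj1 (rho_pos A HA)).
    unfold Rreact, csurf, av, rate, react; field; repeat split; lra.
- unfold porosity_max.
  assert (E0 := exp_pos (- smax * Qend A)).
  replace (- (smax * Qend A)) with (- smax * Qend A) by ring.
  assert ((1 - phi0_hi) * exp (- smax * Qend A) <= (1 - phi0 A x y) * exp (- smax * Qend A))
    by (apply Rmult_le_compat_r; lra).
  lra.
Qed.

Variables (Nx Ny N : nat) (Psi C Z : nat -> gridfun).
Hypotheses (HG : good_grid A Nx Ny N)
  (Hinit : forall i j, is_cell Nx Ny i j -> Psi 0%nat i j = at_centers A Nx Ny (phi0 A) i j)
  (Hsch : forall n i j, (n < N)%nat -> is_cell Nx Ny i j ->
    dtm (dt A N) Psi (S n) i j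
    = alpha A * kc A * a0 A / rho_s A * (1 - 1 / (1 + ks A (Z n i j) / kc A))
      * ((1 - Psi (S n) i j) / (1 - Psi 0%nat i j)) * cutoff (C n i j)).

Let tau := dt A N.
Let s n i j := rate * react A (Z n i j) * cutoff (C n i j) / (1 - Psi 0%nat i j).
Let v n i j := (1 - Psi n i j) / (1 - Psi 0%nat i j).

Lemma initial_range i j : is_cell Nx Ny i j -> phi0_lo <= Psi 0%nat i j <= phi0_hi.
Proof.
intros Hij; rewrite Hinit by assumption; unfold at_centers.
apply Hphi0, (center_in_Omega A Nx Ny N HG), Hij.
Qed.

Lemma rate_product_range n i j : 0 <= rate * react A (Z n i j) * cutoff (C n i j) <= rate.
Proof.
assert (Q := react_range (Z n i j)); assert (P := rate_pos).
assert (B := cutoff_range (C n i j)); split.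
- apply Rmult_le_pos; [apply Rmult_le_pos; lra|lra].
- rewrite Rmult_assoc; rewrite <- (Rmult_1_r rate) at 2; apply Rmult_le_compat_l; [lra|].
  apply Rmult_le_1; lra.
Qed.

Lemma porosity_decay i j : is_cell Nx Ny i j ->
  decay tau smax N (fun n => s n i j) (fun n => v n i j).
Proof.
intros Hij; assert (R0 := initial_range i j Hij).
assert (HG0 := HG); destruct HG0 as (HA' & HNx & HNy & HN).
assert (Ht := dt_pos A N HA' HN : 0 < tau).
split; [unfold v; field; lra|].
intros n Hn; assert (E := Hsch n i j Hn Hij).
split.
- assert (B := rate_product_range n i j); unfold s, smax, Rdiv.
  assert (0 < / (1 - Psi 0%nat i j)) by (apply Rinv_0_lt_compat; lra).
  split; [apply Rmult_le_pos; lra|].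
  apply Rmult_le_compat; try lra. apply Rinv_le_contravar; lra.
- unfold dtm in E; replace (S n - 1)%nat with n in E by lia.
  fold tau rate in E; fold (react A (Z n i j)) in E.
  assert (E' : Psi (S n) i j - Psi n i j = tau * (rate * react A (Z n i j)
    * ((1 - Psi (S n) i j) / (1 - Psi 0%nat i j)) * cutoff (C n i j)))
    by (rewrite <- E; field; lra).
  unfold v, s.
  replace ((1 - Psi n i j) / (1 - Psi 0%nat i j)) with
    ((1 - Psi (S n) i j + (Psi (S n) i j - Psi n i j)) / (1 - Psi 0%nat i j)) by (field; lra).
  rewrite E'; field; lra.
Qed.

Lemma porosity_range n i j : is_cell Nx Ny i j -> (n <= N)%nat ->
  phi0_lo <= Psi n i j <= porosity_max.
Proof.
intros Hij Hn; assert (R0 := initial_range i j Hij).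
assert (HG0 := HG); destruct HG0 as (HA' & HNx & HNy & HN).
assert (Ht := dt_pos A N HA' HN : 0 < tau).
assert (D := decay_bounds tau smax N Ht _ _ n (porosity_decay i j Hij) Hn).
cbv beta in D.
assert (E : 1 - Psi n i j = v n i j * (1 - Psi 0%nat i j)) by (unfold v; field; lra).
assert (T := tn_bounds A N n HA' HN Hn); unfold tn in T; fold tau in T.
assert (X : exp (- (smax * Qend A)) <= exp (- (smax * (INR n * tau)))).
{ assert (P := smax_pos).
  destruct (Req_dec (Qend A) (INR n * tau)) as [<-|N0]; [lra|].
  apply Rlt_le, exp_increasing, Ropp_lt_contravar, Rmult_lt_compat_l; lra. }
assert (X0 := exp_pos (- (smax * Qend A))).
unfold porosity_max; split.
- assert (v n i j * (1 - Psi 0%nat i j) <= 1 * (1 - Psi 0%nat i j))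
    by (apply Rmult_le_compat_r; lra).
  lra.
- assert ((1 - phi0_hi) * exp (- (smax * Qend A)) <= v n i j * (1 - Psi 0%nat i j))
    by (rewrite Rmult_comm; apply Rmult_le_compat; lra).
  lra.
Qed.

Lemma porosity_increment n i j : is_cell Nx Ny i j -> (n < N)%nat ->
  Rabs (Psi (S n) i j - Psi n i j) <= smax * tau.
Proof.
intros Hij Hn; assert (R0 := initial_range i j Hij).
assert (HG0 := HG); destruct HG0 as (HA' & HNx & HNy & HN).
assert (Ht := dt_pos A N HA' HN : 0 < tau).
assert (D := porosity_decay i j Hij).
assert (B := decay_bounds tau smax N Ht _ _ (S n) D ltac:(lia)).
destruct D as [_ D]; destruct (D n Hn) as [S1 S2]; cbv beta in *.
assert (X0 := exp_pos (- (smax * (INR (S n) * tau)))).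
assert (E : Psi (S n) i j - Psi n i j = tau * (s n i j * (v (S n) i j * (1 - Psi 0%nat i j)))).
{ assert (E1 : 1 - Psi n i j = v n i j * (1 - Psi 0%nat i j)) by (unfold v; field; lra).
  assert (E2 : 1 - Psi (S n) i j = v (S n) i j * (1 - Psi 0%nat i j)) by (unfold v; field; lra).
  rewrite <- S2 in E1; lra. }
assert (0 <= v (S n) i j * (1 - Psi 0%nat i j) <= 1).
{ split; [apply Rmult_le_pos; lra|].
  apply Rmult_le_1; lra. }
assert (0 <= s n i j * (v (S n) i j * (1 - Psi 0%nat i j)) <= smax).
{ split; [apply Rmult_le_pos; lra|].
  rewrite <- (Rmult_1_r smax); apply Rmult_le_compat; lra. }
rewrite E, Rabs_pos_eq by (apply Rmult_le_pos; lra).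
rewrite Rmult_comm; apply Rmult_le_compat_r; lra.
Qed.

(** Differences of the porosity between two cells are controlled by the history of
    the differences of concentration and temperature between these cells. *)
Lemma porosity_difference n i j i' j' :
  is_cell Nx Ny i j -> is_cell Nx Ny i' j' -> (n <= N)%nat ->
  Rabs (Psi n i' j' - Psi n i j)
  <= (1 + Qend A * (smax / (1 - phi0_hi))) * Rabs (Psi 0%nat i' j' - Psi 0%nat i j)
   + smax * (1 + L) *
     psum (fun m => tau * (Rabs (C m i' j' - C m i j) + Rabs (Z m i' j' - Z m i j))) n.
Proof.
intros Hij Hij' Hn.
assert (R0 := initial_range i j Hij); assert (R0' := initial_range i' j' Hij').
assert (HG0 := HG); destruct HG0 as (HA' & HNx & HNy & HN).
assert (Ht := dt_pos A N HA' HN : 0 < tau); assert (Sm := smax_pos).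
assert (D := porosity_decay i j Hij); assert (D' := porosity_decay i' j' Hij').
assert (B := decay_bounds tau smax N Ht _ _ n D Hn); cbv beta in B.
assert (X0 := exp_pos (- (smax * (INR n * tau)))).
assert (Dst := decay_stable tau smax N Ht _ _ _ _ n D' D Hn); cbv beta in Dst.
set (d0 := Rabs (Psi 0%nat i' j' - Psi 0%nat i j)).
assert (Hs : forall m, Rabs (s m i' j' - s m i j) <=
  smax / (1 - phi0_hi) * d0
  + smax * (1 + L) * (Rabs (C m i' j' - C m i j) + Rabs (Z m i' j' - Z m i j))).
{ intros m; assert (P := rate_pos).
  set (w := 1 - Psi 0%nat i j) in *; set (w' := 1 - Psi 0%nat i' j') in *.
  assert (W : 1 - phi0_hi <= w) by (unfold w; lra).
  assert (W' : 1 - phi0_hi <= w') by (unfold w'; lra).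
  assert (I : 0 < / w <= / (1 - phi0_hi))
    by (split; [apply Rinv_0_lt_compat; lra|apply Rinv_le_contravar; lra]).
  assert (I' : 0 < / w' <= / (1 - phi0_hi))
    by (split; [apply Rinv_0_lt_compat; lra|apply Rinv_le_contravar; lra]).
  assert (Q := rate_product_range m i' j').
  assert (q1 := react_range (Z m i j)).
  assert (q2 := cutoff_range (C m i' j')).
  assert (LZ := HL (Z m i' j') (Z m i j)).
  assert (LC := cutoff_lipschitz (C m i' j') (C m i j)).
  set (a' := react A (Z m i' j')) in *; set (a := react A (Z m i j)) in *.
  set (c' := cutoff (C m i' j')) in *; set (c := cutoff (C m i j)) in *.
  assert (E : s m i' j' - s m i j = rate * a' * c' * (/ w' * / w * (w - w'))
    + rate * / w * ((a' - a) * c' + a * (c' - c))).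
  { unfold s; fold a a' c c' w w'; field; lra. }
  assert (ww : w - w' = Psi 0%nat i' j' - Psi 0%nat i j) by (unfold w, w'; ring).
  rewrite E, ww; eapply Rle_trans; [apply Rabs_triang|]; apply Rplus_le_compat.
  - assert (P2 : 0 <= / w' * / w) by (apply Rmult_le_pos; lra).
    rewrite (Rabs_mult (rate * a' * c')), (Rabs_mult (/ w' * / w)),
      (Rabs_pos_eq (rate * a' * c')), (Rabs_pos_eq (/ w' * / w)) by lra.
    rewrite <- Rmult_assoc; apply Rmult_le_compat_r; [apply Rabs_pos|].
    unfold smax, Rdiv; rewrite (Rmult_assoc rate (/ (1 - phi0_hi))); apply Rmult_le_compat; try lra.
    apply Rmult_le_compat; lra.
  - rewrite Rabs_mult, (Rabs_pos_eq (rate * / w)) by (apply Rmult_le_pos; lra).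
    rewrite (Rmult_assoc smax); unfold smax, Rdiv; apply Rmult_le_compat.
    + apply Rmult_le_pos; lra.
    + apply Rabs_pos.
    + apply Rmult_le_compat_l; lra.
    + eapply Rle_trans; [apply Rabs_triang|]; rewrite !Rabs_mult, (Rabs_pos_eq c'), (Rabs_pos_eq a) by lra.
      assert (pz := Rabs_pos (Z m i' j' - Z m i j)); assert (pc := Rabs_pos (C m i' j' - C m i j)).
      assert (Rabs (a' - a) * c' <= (L * Rabs (Z m i' j' - Z m i j)) * 1)
        by (apply Rmult_le_compat; try lra; apply Rabs_pos).
      assert (a * Rabs (c' - c) <= 1 * Rabs (C m i' j' - C m i j))
        by (apply Rmult_le_compat; try lra; apply Rabs_pos).
      assert (0 <= L * Rabs (C m i' j' - C m i j)) by (apply Rmult_le_pos; lra).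
      lra. }
assert (Hsum : psum (fun m => tau * Rabs (s m i' j' - s m i j)) n <=
  Qend A * (smax / (1 - phi0_hi) * d0) + smax * (1 + L) *
  psum (fun m => tau * (Rabs (C m i' j' - C m i j) + Rabs (Z m i' j' - Z m i j))) n).
{ assert (T := tn_bounds A N n HA' HN Hn); unfold tn in T; fold tau in T.
  eapply Rle_trans; [apply psum_le|].
  - intros m Hm; apply Rmult_le_compat_l; [lra|apply Hs].
  - rewrite <- psum_scal.
    set (y := smax / (1 - phi0_hi) * d0).
    assert (y0 : 0 <= y).
    { apply Rmult_le_pos; [apply Rdiv_le_0_compat; lra|apply Rabs_pos]. }
    apply Rle_trans with (psum (fun _ => tau * y) n + psum (fun m => smax * (1 + L) *
      (tau * (Rabs (C m i' j' - C m i j) + Rabs (Z m i' j' - Z m i j)))) n).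
    + rewrite <- psum_plus; apply psum_le; intros; apply Req_le; ring.
    + rewrite psum_const; apply Rplus_le_compat_r; rewrite <- Rmult_assoc.
      apply Rmult_le_compat_r; lra. }
assert (E : Psi n i' j' - Psi n i j = v n i j * (Psi 0%nat i' j' - Psi 0%nat i j)
   + (1 - Psi 0%nat i' j') * (v n i j - v n i' j')) by (unfold v; field; lra).
rewrite E; eapply Rle_trans; [apply Rabs_triang|]; rewrite !Rabs_mult.
rewrite (Rabs_pos_eq (v n i j)), (Rabs_pos_eq (1 - _)) by lra; fold d0.
assert (d00 : 0 <= d0) by apply Rabs_pos.
assert (v n i j * d0 <= 1 * d0) by (apply Rmult_le_compat_r; lra).
assert ((1 - Psi 0%nat i' j') * Rabs (v n i j - v n i' j')
   <= 1 * psum (fun m => tau * Rabs (s m i' j' - s m i j)) n).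
{ apply Rmult_le_compat; try lra; [apply Rabs_pos|]. rewrite Rabs_minus_sym; exact Dst. }
lra.
Qed.

(** The reaction is evaluated at the preceding level; the time step in the bound accounts
    for that and for the truncation error. *)
Lemma porosity_error (Sol : state) (K : R) : exact_solution A Sol -> 1 <= K ->
  Csm A 5 K (phi Sol) -> Csm A 5 K (cf Sol) -> Csm A 5 K (Tf Sol) ->
  forall n i j, is_cell Nx Ny i j -> (n < N)%nat ->
  Rabs (dtm tau (err_center A Nx Ny N Psi (phi Sol)) (S n) i j)
  <= (K + smax * (1 + L) * (1 + 2 * K)) *
     (Rabs (err_center A Nx Ny N Psi (phi Sol) (S n) i j)
      + Rabs (err_center A Nx Ny N C (cf Sol) n i j)
      + Rabs (err_center A Nx Ny N Z (Tf Sol) n i j) + tau).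
Proof.
intros HS HK Hphi Hc HT n i j Hij Hn.
assert (R0 := initial_range i j Hij).
assert (HG0 := HG); destruct HG0 as (HA' & HNx & HNy & HN).
assert (Ht := dt_pos A N HA' HN : 0 < tau); assert (Sm := smax_pos).
assert (HO := center_in_Omega A Nx Ny N HG i j Hij).
assert (HB' := center_in_box A Nx Ny N HG i j (S n) Hij ltac:(lia)).
assert (Tr := dtm_truncation A Nx Ny N HG (phi Sol) K n i j
  (Csm_le A 5 2 K _ ltac:(lia) Hphi) Hij Hn); fold tau in Tr.
assert (Lc := time_lipschitz A Nx Ny N HG (cf Sol) K _ _ n
  (Csm_le A 5 1 K _ ltac:(lia) Hc) (proj1 HB') Hn); fold tau in Lc.
assert (LT := time_lipschitz A Nx Ny N HG (Tf Sol) K _ _ n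
  (Csm_le A 5 1 K _ ltac:(lia) HT) (proj1 HB') Hn); fold tau in LT.
assert (PE := porosity_eq A Sol HS _ _ _ HO (tn_pos A N n HA' HN Hn)).
assert (Cr := concentration_range A Sol HS _ _ _ HO (proj2 HB')).
assert (E := Hsch n i j Hn Hij); fold rate in E; fold (react A (Z n i j)) in E.
assert (Rg := porosity_range (S n) i j Hij ltac:(lia)).
assert (I0 : Psi 0%nat i j = phi0 A (xc A Nx i) (yc A Ny j)) by (apply Hinit; assumption).
assert (PM := porosity_max_bounds).
assert (PE' : pt (phi Sol) (xc A Nx i) (yc A Ny j) (tn A N (S n)) =
  rate / (1 - Psi 0%nat i j) * (react A (Tf Sol (xc A Nx i) (yc A Ny j) (tn A N (S n)))
    * cf Sol (xc A Nx i) (yc A Ny j) (tn A N (S n))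
    * (1 - phi Sol (xc A Nx i) (yc A Ny j) (tn A N (S n))))).
{ rewrite PE, I0; rewrite I0 in R0.
  destruct (ks_bounds A HA) as (k1 & k2 & Hk1 & Hk).
  specialize (Hk (Tf Sol (xc A Nx i) (yc A Ny j) (tn A N (S n)))).
  assert (Hkc := kc_pos A HA); assert (Hrs := proj1 (rho_pos A HA)).
  unfold Rreact, csurf, av, rate, react; field; repeat split; lra. }
assert (Ed : dtm tau (err_center A Nx Ny N Psi (phi Sol)) (S n) i j
  = dtm tau Psi (S n) i j - dtm tau (sample A Nx Ny N (phi Sol)) (S n) i j)
  by (unfold dtm, err_center; field; lra).
rewrite PE' in Tr; rewrite Ed; fold tau in E; rewrite E.
unfold err_center; unfold sample at 2 3 4; unfold at_centers.
set (ph := phi Sol _ _ _) in *; set (c1 := cf Sol _ _ (tn A N (S n))) in *.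
set (c0 := cf Sol _ _ (tn A N n)) in *; set (T1 := Tf Sol _ _ (tn A N (S n))) in *.
set (T0 := Tf Sol _ _ (tn A N n)) in *; set (w := 1 - Psi 0%nat i j) in *.
set (dp := dtm tau (sample A Nx Ny N (phi Sol)) (S n) i j) in *.
assert (q1 := react_range (Z n i j)); assert (q2 := react_range T1).
assert (q3 := cutoff_range (C n i j)).
assert (LZ := HL (Z n i j) T1).
assert (LC := cutoff_lipschitz (C n i j) c1).
rewrite (cutoff_id c1) in LC by assumption.
assert (RW : 0 <= rate / w <= smax).
{ assert (P := rate_pos); unfold smax; split; [apply Rdiv_le_0_compat; unfold w; lra|].
  apply Rmult_le_compat_l; [lra|apply Rinv_le_contravar; unfold w; lra]. }
set (a := react A (Z n i j)) in *; set (a1 := react A T1) in *.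
set (b := cutoff (C n i j)) in *; set (P1 := Psi (S n) i j) in *.
replace (rate * a * ((1 - P1) / w) * b - dp) with
  (rate / w * ((a - a1) * (b * (1 - P1)) + (a1 * (1 - P1) * (b - c1) + a1 * c1 * (ph - P1)))
   - (dp - rate / w * (a1 * c1 * (1 - ph)))) by (unfold w; field; lra).
assert (xf := Rabs_pos (P1 - ph)); assert (xc_ := Rabs_pos (C n i j - c0)).
assert (xz := Rabs_pos (Z n i j - T0)).
assert (ZT : Rabs (Z n i j - T1) <= Rabs (Z n i j - T0) + K * tau).
{ replace (Z n i j - T1) with ((Z n i j - T0) - (T1 - T0)) by ring.
  eapply Rle_trans; [apply Rabs_triang|]; rewrite Rabs_Ropp; lra. }
assert (CC : Rabs (C n i j - c1) <= Rabs (C n i j - c0) + K * tau).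
{ replace (C n i j - c1) with ((C n i j - c0) - (c1 - c0)) by ring.
  eapply Rle_trans; [apply Rabs_triang|]; rewrite Rabs_Ropp; lra. }
assert (G1 : Rabs ((a - a1) * (b * (1 - P1))) <= L * (Rabs (Z n i j - T0) + K * tau)).
{ rewrite Rabs_mult, (Rabs_pos_eq (b * (1 - P1))) by (apply Rmult_le_pos; lra).
  rewrite <- (Rmult_1_r (L * _)); apply Rmult_le_compat.
  - apply Rabs_pos.
  - apply Rmult_le_pos; lra.
  - eapply Rle_trans; [exact LZ|apply Rmult_le_compat_l; lra].
  - apply Rmult_le_1; lra. }
assert (G2 : Rabs (a1 * (1 - P1) * (b - c1)) <= Rabs (C n i j - c0) + K * tau).
{ rewrite Rabs_mult, (Rabs_pos_eq (a1 * (1 - P1))) by (apply Rmult_le_pos; lra).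
  rewrite <- (Rmult_1_l (_ + _)); apply Rmult_le_compat.
  - apply Rmult_le_pos; lra.
  - apply Rabs_pos.
  - apply Rmult_le_1; lra.
  - lra. }
assert (G3 : Rabs (a1 * c1 * (ph - P1)) <= Rabs (P1 - ph)).
{ rewrite Rabs_mult, (Rabs_pos_eq (a1 * c1)), (Rabs_minus_sym ph) by (apply Rmult_le_pos; lra).
  rewrite <- (Rmult_1_l (Rabs (P1 - ph))) at 2; apply Rmult_le_compat_r; [assumption|].
  apply Rmult_le_1; lra. }
eapply Rle_trans; [apply Rabs_triang|]; rewrite Rabs_Ropp, Rabs_mult, (Rabs_pos_eq (rate / w)) by lra.
set (X := Rabs (_ + _)).
assert (HX : X <= L * (Rabs (Z n i j - T0) + K * tau) + ((Rabs (C n i j - c0) + K * tau)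
   + Rabs (P1 - ph))).
{ unfold X; eapply Rle_trans; [apply Rabs_triang|].
  eapply Rle_trans; [apply Rplus_le_compat_l, Rabs_triang|lra]. }
set (zz := Rabs (Z n i j - T0)) in *; set (cc := Rabs (C n i j - c0)) in *.
set (ff := Rabs (P1 - ph)) in *.
assert (HX' : X <= (1 + L) * (1 + 2 * K) * (ff + cc + zz + tau)).
{ eapply Rle_trans; [exact HX|].
  assert (0 <= L * ff) by (apply Rmult_le_pos; lra).
  assert (0 <= L * cc) by (apply Rmult_le_pos; lra).
  assert (0 <= L * zz) by (apply Rmult_le_pos; lra).
  assert (0 <= L * tau) by (apply Rmult_le_pos; lra).
  assert (0 <= K * (L * tau)) by (apply Rmult_le_pos; lra).
  assert (0 <= K * tau) by (apply Rmult_le_pos; lra).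
  assert (0 <= K * (1 + L) * (ff + cc + zz)) by (repeat apply Rmult_le_pos; lra).
  lra. }
assert (HX'' : rate / w * X <= smax * ((1 + L) * (1 + 2 * K) * (ff + cc + zz + tau)))
  by (apply Rmult_le_compat; try lra; apply Rabs_pos).
assert (0 <= K * (ff + cc + zz)) by (apply Rmult_le_pos; lra).
lra.
Qed.

End Porosity.

(** * The constants of a problem *)

Definition trI (Pi : gridfun -> gridfun) : gridfun -> gridfun :=
  fun g i j => Pi (fun a b => g b a) j i.

Lemma stable_interp_mono K K' Nx Ny Pi : K <= K' ->
  stable_interp K Nx Ny Pi -> stable_interp K' Nx Ny Pi.
Proof.
intros HK [H1 H2 H3 H4]; split.
- exact H1.
- intros g; eapply Rle_trans; [apply H2|apply Rmult_le_compat_r; [|assumption]].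
  apply S2_ge0; intros; apply pow2_ge_0.
- intros g; eapply Rle_trans; [apply H3|apply Rmult_le_compat_r; [|assumption]].
  apply S2_ge0; intros; apply pow2_ge_0.
- intros g d j Hj Hd i Hi; eapply Rle_trans; [apply (H4 g d j Hj Hd i Hi)|].
  apply Rmult_le_compat_r; [|assumption].
  eapply Rle_trans; [apply Rabs_pos|apply (Hd i Hi)].
Qed.

(** Second-order accuracy yields that constants are reproduced, since their second
    derivatives vanish. *)
Lemma interp_constants A P : nonempty_domain A -> interpolation_operator A P ->
  exists K, forall Nx Ny,
    stable_interp K Nx Ny (Pix P Nx Ny) /\ stable_interp K Ny Nx (trI (Piy P Nx Ny)) /\
    interp_consistent A Nx Ny K (Pix P Nx Ny) /\
    interp_consistent (swapP A) Ny Nx K (trI (Piy P Nx Ny)).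
Proof.
intros HA [(s & M & wx & wy & Hw & Hx & Hy) [C HC]].
set (K1 := (2 * INR s * M) ^ 2 * (1 + (2 * INR s) ^ 2) + (2 * INR s * M) * (2 * INR s)).
assert (Hone := HC (fun _ _ => 1) 0 (Cclass_const 2 1)).
destruct Hone as [Ox Oy].
{ intros x y _.
  assert (Zx : px (fun _ _ _ => 1) = fun _ _ _ => 0)
    by (apply field_ext; intros; apply (Derive_const 1)).
  assert (Zy : py (fun _ _ _ => 1) = fun _ _ _ => 0)
    by (apply field_ext; intros; apply (Derive_const 1)).
  rewrite Zx, Zy; unfold px, py; rewrite !Derive_const, Rabs_R0; lra. }
assert (Hmono : forall B z, 0 <= B -> 0 <= z -> C * B * z <= (Rabs K1 + Rabs C) * B * z).
{ intros B z HB Hz; apply Rmult_le_compat_r; [assumption|apply Rmult_le_compat_r; [assumption|]].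
  generalize (Rabs_pos K1) (Rle_abs C); lra. }
assert (HK1 : K1 <= Rabs K1 + Rabs C) by (generalize (Rle_abs K1) (Rabs_pos C); lra).
assert (Hcl : Omega_closure A (Llx A) (Lly A)).
{ destruct HA as (a & b & _); split; lra. }
exists (Rabs K1 + Rabs C); intros Nx Ny; split; [|split; [|split]].
- apply (stable_interp_mono K1); [assumption|].
  apply (weighted_sum_stable s M (wx Nx Ny)).
  + intros; apply Hw.
  + intros g i j [Hi Hj]; now apply Hx.
  + intros i j [Hi Hj]; specialize (Ox Nx Ny i j Hi Hj).
    rewrite Rmult_0_r, Rmult_0_l in Ox; apply Rabs_le_between in Ox.
    unfold at_centers, at_xedges in Ox; lra.
- apply (stable_interp_mono K1); [assumption|].
  apply (weighted_sum_stable s M (fun i j l => wy Nx Ny j i l)).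
  + intros; apply Hw.
  + intros g i j [Hi Hj]; unfold trI; now rewrite Hy.
  + intros i j [Hi Hj]; specialize (Oy Nx Ny j i Hj Hi).
    rewrite Rmult_0_r, Rmult_0_l in Oy; apply Rabs_le_between in Oy.
    unfold at_centers, at_yedges in Oy; unfold trI; lra.
- intros g B t Hg HB i j [Hi Hj].
  assert (B0 : 0 <= B) by (eapply Rle_trans; [apply Rabs_pos|apply (proj1 (HB _ _ Hcl))]).
  destruct (HC (fun x y => g x y t) B (Cclass_slice 2 g t Hg)) as [Q _].
  { intros x y Hxy; destruct (HB x y Hxy) as (a & b & _ & c); repeat split; assumption. }
  eapply Rle_trans; [apply Q; assumption|apply Hmono; [assumption|]].
  generalize (pow2_ge_0 (hx A Nx)) (pow2_ge_0 (ky A Ny)); lra.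
- intros g B t Hg HB i j [Hi Hj].
  assert (Hcl' : Omega_closure (swapP A) (Lly A) (Llx A)) by (destruct Hcl; split; assumption).
  assert (B0 : 0 <= B) by (eapply Rle_trans; [apply Rabs_pos|apply (proj1 (HB _ _ Hcl'))]).
  destruct (HC (fun x y => g y x t) B (Cclass_slice 2 (swapf g) t (Cclass_swap 2 g Hg))) as [_ Q].
  { intros x y [Hxy Hxy']; destruct (HB y x (conj Hxy' Hxy)) as (a & b & b' & c).
    repeat split; assumption. }
  eapply Rle_trans; [apply (Q Nx Ny j i); assumption|].
  replace (hx (swapP A) Ny ^ 2 + ky (swapP A) Nx ^ 2) with (hx A Nx ^ 2 + ky A Ny ^ 2).
  2:{ change (hx (swapP A) Ny) with (ky A Ny); change (ky (swapP A) Nx) with (hx A Nx); ring. }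
  apply Hmono; [assumption|].
  generalize (pow2_ge_0 (hx A Nx)) (pow2_ge_0 (ky A Ny)); lra.
Qed.

Definition tr (g : nat -> gridfun) : nat -> gridfun := fun n i j => g n j i.

(** What the estimates need to know about a problem, a solution of it and an
    interpolation operator: bounds with one constant [K], the interval [lo, hi] of
    admissible porosities and the bound for the discrete porosity. *)
Record setting (A : problem) (Sol : state) (P : interp) (K lo hi lo0 hi1 : R) : Prop := {
  st_K : 1 <= K;
  st_lo : 0 < lo; st_hi : hi < 1;
  st_lo0 : lo < lo0; st_hi1 : hi1 < hi; st_range : lo0 <= hi1;
  st_domain : nonempty_domain A;
  st_c : Csm A 5 K (cf Sol);
  st_T : Csm A 5 K (Tf Sol);
  st_phi : Csm A 5 K (phi Sol);
  st_p : Csm A 5 K (p Sol);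
  st_ux : Csm A 5 K (ux Sol);
  st_uy : Csm A 5 K (uy Sol);
  st_grid : forall Nx Ny N X, good_grid A Nx Ny N -> scheme A P Nx Ny N X ->
    edge_data A Nx Ny N (Pix P Nx Ny) (phi Sol) (ux Sol) (p Sol) (Psi X) K lo hi /\
    edge_data (swapP A) Ny Nx N (trI (Piy P Nx Ny)) (swapf (phi Sol)) (swapf (uy Sol))
      (swapf (p Sol)) (tr (Psi X)) K lo hi /\
    (forall n i j, is_cell Nx Ny i j -> (n <= N)%nat -> lo0 <= Psi X n i j <= hi1) /\
    (forall n i j i' j', is_cell Nx Ny i j -> is_cell Nx Ny i' j' -> (n <= N)%nat ->
      Rabs (Psi X n i' j' - Psi X n i j)
      <= K * (Rabs (Psi X 0%nat i' j' - Psi X 0%nat i j) +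
       psum (fun m => dt A N * (Rabs (Cf X m i' j' - Cf X m i j)
                                + Rabs (Z X m i' j' - Z X m i j))) n)) /\
    (forall n i j, is_cell Nx Ny i j -> (n < N)%nat ->
      Rabs (dtm (dt A N) (err_center A Nx Ny N (Psi X) (phi Sol)) (S n) i j)
      <= K * (Rabs (err_center A Nx Ny N (Psi X) (phi Sol) (S n) i j)
           + Rabs (err_center A Nx Ny N (Cf X) (cf Sol) n i j)
           + Rabs (err_center A Nx Ny N (Z X) (Tf Sol) n i j) + dt A N))
}.

Lemma setting_exists A Sol P : standing_assumptions A -> exact_solution A Sol ->
  smooth 5 Sol -> interpolation_operator A P ->
  exists K lo hi lo0 hi1, setting A Sol P K lo hi lo0 hi1.
Proof.
intros HA HS (S1 & S2 & S3 & S4 & S5 & S6) HP.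
assert (HD : nonempty_domain A) by apply (domain_nonempty A HA).
destruct (phi0_bounds A HA) as (l0 & h0 & Hl0 & Hh0 & Hphi0).
destruct (react_props A HA) as [_ (L & HL0 & HL)].
assert (Hlh : l0 <= h0).
{ destruct HD as (a & b & c).
  destruct (Hphi0 ((Llx A + Lrx A) / 2) ((Lly A + Lry A) / 2)); [split; lra|lra]. }
set (hm := porosity_max A h0).
assert (Hm : h0 <= hm < 1) by (apply porosity_max_bounds; assumption).
set (lo := l0 / 2); set (hi := (1 + hm) / 2).
destruct (resist_bounds A lo hi (mu_pos A HA) (K0_pos A HA)) as (Kr & Kr1 & R1 & R2 & R3);
  [unfold lo; lra|unfold hi; lra|].
destruct (Cclass_Bd A 5 _ S1) as (k1 & P1 & B1), (Cclass_Bd A 5 _ S2) as (k2 & P2 & B2),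
  (Cclass_Bd A 5 _ S3) as (k3 & P3 & B3), (Cclass_Bd A 5 _ S4) as (k4 & P4 & B4),
  (Cclass_Bd A 5 _ S5) as (k5 & P5 & B5), (Cclass_Bd A 5 _ S6) as (k6 & P6 & B6).
destruct (interp_constants A P HD HP) as [Ki HKi].
set (sm := rate A / (1 - h0)).
assert (Hsm : 0 < sm) by (apply smax_pos; assumption).
set (K0 := Kr + k1 + k2 + k3 + k4 + k5 + k6 + Rabs Ki + sm).
assert (aKi := Rabs_pos Ki); assert (bKi := Rle_abs Ki).
assert (K01 : 1 <= K0) by (unfold K0; lra).
set (kd := (1 + Qend A * (sm / (1 - h0))) + sm * (1 + L)).
assert (Q0 : 0 <= Qend A * (sm / (1 - h0))).
{ apply Rmult_le_pos; [destruct HD as (_ & _ & HQ); lra|apply Rdiv_le_0_compat; lra]. }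
assert (Q1 : 0 <= sm * (1 + L)) by (apply Rmult_le_pos; lra).
set (ke := K0 + sm * (1 + L) * (1 + 2 * K0)).
assert (Q2 : 0 <= sm * (1 + L) * (1 + 2 * K0)) by (apply Rmult_le_pos; lra).
set (K := K0 + kd + ke).
assert (KK0 : K0 <= K) by (unfold K, kd, ke; lra).
assert (K1 : 1 <= K) by lra.
exists K, lo, hi, l0, hm.
assert (Cphi : Csm A 5 K (phi Sol)) by
  (split; [assumption|apply Bd_mono with k1; [unfold K0 in KK0; lra|assumption]]).
assert (Cp : Csm A 5 K (p Sol)) by
  (split; [assumption|apply Bd_mono with k2; [unfold K0 in KK0; lra|assumption]]).
assert (Cux : Csm A 5 K (ux Sol)) by
  (split; [assumption|apply Bd_mono with k3; [unfold K0 in KK0; lra|assumption]]).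
assert (Cuy : Csm A 5 K (uy Sol)) by
  (split; [assumption|apply Bd_mono with k4; [unfold K0 in KK0; lra|assumption]]).
assert (Cc : Csm A 5 K (cf Sol)) by
  (split; [assumption|apply Bd_mono with k5; [unfold K0 in KK0; lra|assumption]]).
assert (CT : Csm A 5 K (Tf Sol)) by
  (split; [assumption|apply Bd_mono with k6; [unfold K0 in KK0; lra|assumption]]).
assert (Rphi0 : forall x y, Omega A x y -> lo <= phi0 A x y <= hi).
{ intros x y Hxy; specialize (Hphi0 x y Hxy); unfold lo, hi; lra. }
assert (Rphi : forall x y t, Omega A x y -> 0 <= t <= Qend A -> lo <= phi Sol x y t <= hi).
{ intros x y t Hxy Ht.
  assert (E := exact_porosity_range A l0 h0 HA Hh0 Hphi0 Sol HS
    (Cclass_le 5 1 _ ltac:(lia) S1) x y t Hxy Ht).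
  fold hm in E; unfold lo, hi; lra. }
assert (RR1 : forall f0 a, lo <= f0 <= hi -> lo <= a <= hi -> / K <= resist A f0 a <= K).
{ intros f0 a H0 Ha; destruct (R1 f0 a H0 Ha) as [r1 r2].
  assert (/ K <= / Kr) by (apply Rinv_le_contravar; unfold K0 in KK0; lra).
  unfold K0 in KK0; lra. }
assert (KrK : Kr <= K) by (unfold K0 in KK0; lra).
assert (RR2 : forall f0 a b, lo <= f0 <= hi -> lo <= a <= hi -> lo <= b <= hi ->
    Rabs (resist A f0 a - resist A f0 b) <= K * Rabs (a - b)).
{ intros f0 a b H0 Ha Hb; eapply Rle_trans; [now apply R2|].
  apply Rmult_le_compat_r; [apply Rabs_pos|assumption]. }
assert (RR3 : forall f0 a a' b b', lo <= f0 <= hi -> lo <= a <= hi -> lo <= a' <= hi ->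
     lo <= b <= hi -> lo <= b' <= hi ->
     Rabs ((resist A f0 a' - resist A f0 a) - (resist A f0 b' - resist A f0 b))
     <= K * Rabs ((a' - a) - (b' - b))
      + K * Rabs (b' - b) * (Rabs (a - b) + Rabs (a' - b'))).
{ intros f0 a a' b b' H0 Ha Ha' Hb Hb'; eapply Rle_trans; [now apply R3|].
  apply Rplus_le_compat.
  - apply Rmult_le_compat_r; [apply Rabs_pos|assumption].
  - apply Rmult_le_compat_r; [apply Rplus_le_le_0_compat; apply Rabs_pos|].
    apply Rmult_le_compat_r; [apply Rabs_pos|assumption]. }
assert (Pperm : forall x y t, Omega A x y -> 0 < t <= Qend A ->
  0 < perm A (phi0 A x y) (phi Sol x y t)).
{ intros x y t Hxy Ht; apply perm_pos; [apply HA| |].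
  - specialize (Rphi0 x y Hxy); unfold lo, hi in *; lra.
  - specialize (Rphi x y t Hxy ltac:(lra)); unfold lo, hi in *; lra. }
assert (Hmu := mu_pos A HA).
split; try assumption; try (unfold lo, hi; lra).
intros Nx Ny N X HG HX.
destruct (HKi Nx Ny) as (I1 & I2 & I3 & I4).
assert (KiK : Ki <= K) by (unfold K0 in KK0; lra).
assert (Icons : forall B z, 0 <= B -> 0 <= z -> Ki * B * z <= K * B * z).
{ intros B z HB Hz; apply Rmult_le_compat_r; [assumption|now apply Rmult_le_compat_r]. }
assert (Init : forall i j, is_cell Nx Ny i j ->
  Psi X 0%nat i j = at_centers A Nx Ny (phi0 A) i j) by (intros; now apply (sch_init _ _ _ _ _ _ HX)).
assert (Hpor := sch_porosity _ _ _ _ _ _ HX).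
assert (HG0 := HG); destruct HG0 as (_ & HNx & HNy & HN).
assert (Ht := dt_pos A N HD HN).
assert (Step : forall n i j, (n < N)%nat -> is_cell Nx Ny i j ->
    Rabs (Psi X (S n) i j - Psi X n i j) <= K * dt A N).
{ intros n i j Hn Hij.
  eapply Rle_trans; [apply (porosity_increment A l0 h0 HA Hl0 Hh0 Hphi0 Nx Ny N _ _ _ HG Init Hpor);
    assumption|].
  fold sm; apply Rmult_le_compat_r; [lra|unfold K0 in KK0; lra]. }
split; [|split; [|split; [|split]]].
- split; try assumption.
  + now apply (stable_interp_mono Ki).
  + intros g B t Hg HB i j Hij; eapply Rle_trans; [now apply (I3 g B t)|].
    apply Icons.
    * eapply Rle_trans; [apply Rabs_pos|].
      apply (HB (Llx A) (Lly A)); destruct HD as (a & b & _); split; lra.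
    * generalize (pow2_ge_0 (hx A Nx)) (pow2_ge_0 (ky A Ny)); lra.
  + intros x y t Hxy Htt; rewrite (darcy_x A Sol HS x y t Hxy Htt).
    specialize (Pperm x y t Hxy Htt); unfold resist; field; lra.
- split; try assumption.
  + destruct HG as ((a & b & c) & d & e & f); repeat split; assumption.
  + now apply Csm_swap.
  + now apply Csm_swap.
  + now apply Csm_swap.
  + now apply (stable_interp_mono Ki).
  + intros g B t Hg HB i j Hij; eapply Rle_trans; [now apply (I4 g B t)|].
    apply Icons.
    * eapply Rle_trans; [apply Rabs_pos|].
      apply (HB (Lly A) (Llx A)); destruct HD as (a & b & _); split; simpl; lra.
    * generalize (pow2_ge_0 (hx (swapP A) Ny)) (pow2_ge_0 (ky (swapP A) Nx)); lra.
  + intros x y [a b]; apply Rphi0; split; assumption.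
  + intros x y t [a b]; apply Rphi; split; assumption.
  + intros x y t [a b] Htt; assert (HO : Omega A y x) by (split; assumption).
    assert (E := darcy_y A Sol HS y x t HO Htt).
    specialize (Pperm y x t HO Htt).
    change (resist A (phi0 A y x) (phi Sol y x t) * uy Sol y x t = - py (p Sol) y x t).
    rewrite E; unfold resist; field; lra.
  + intros n i j Hn [a b]; apply Step; [assumption|split; assumption].
- intros n i j Hij Hn.
  apply (porosity_range A l0 h0 HA Hh0 Hphi0 Nx Ny N _ _ _ HG Init Hpor); assumption.
- intros n i j i' j' Hij Hij' Hn.
  eapply Rle_trans; [apply (porosity_difference A l0 h0 L HA Hl0 Hh0 Hphi0 HL0 HL
    Nx Ny N _ _ _ HG Init Hpor); assumption|].
  fold sm; set (d := Rabs (Psi X 0%nat i' j' - Psi X 0%nat i j)).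
  set (q := psum _ n).
  assert (d0 : 0 <= d) by apply Rabs_pos.
  assert (q0 : 0 <= q).
  { apply psum_ge0; intros; apply Rmult_le_pos; [lra|].
    apply Rplus_le_le_0_compat; apply Rabs_pos. }
  rewrite (Rmult_plus_distr_l K); apply Rplus_le_compat; apply Rmult_le_compat_r; trivial;
    unfold K, kd, ke; lra.
- intros n i j Hij Hn.
  assert (Cphi0 : Csm A 5 K0 (phi Sol)) by
    (split; [assumption|apply Bd_mono with k1; [unfold K0; lra|assumption]]).
  assert (Cc0 : Csm A 5 K0 (cf Sol)) by
    (split; [assumption|apply Bd_mono with k5; [unfold K0; lra|assumption]]).
  assert (CT0 : Csm A 5 K0 (Tf Sol)) by
    (split; [assumption|apply Bd_mono with k6; [unfold K0; lra|assumption]]).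
  eapply Rle_trans; [apply (porosity_error A l0 h0 L HA Hl0 Hh0 Hphi0 HL0 HL
    Nx Ny N (Psi X) (Cf X) (Z X) HG Init Hpor Sol K0 HS K01 Cphi0 Cc0 CT0 n i j Hij Hn)|].
  fold sm; fold ke; apply Rmult_le_compat_r; [|unfold K, kd; lra].
  repeat apply Rplus_le_le_0_compat; try apply Rabs_pos; lra.
Qed.

(** * Transported quantities of the problem *)

(** Concentration and temperature share one form, with affine coefficients: capacity
    [c0 + c1 phi] and diffusivity [l0 + l1 phi]. *)
Definition fluxx (v l0 l1 : R) (phi u c : field) : field := fun x y t =>
  v * u x y t * c x y t - (l0 + l1 * phi x y t) * px c x y t.
Definition fluxy (v l0 l1 : R) (phi u c : field) : field := fun x y t =>
  v * u x y t * c x y t - (l0 + l1 * phi x y t) * py c x y t.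
Definition content (c0 c1 : R) (phi c : field) : field := fun x y t =>
  (c0 + c1 * phi x y t) * c x y t.

Lemma good_grid_swap A Nx Ny N : good_grid A Nx Ny N -> good_grid (swapP A) Ny Nx N.
Proof. intros ((a & b & c) & d & e & f); repeat split; assumption. Qed.

(** Squared norms: over cells, over edges (of an edge function), and of the gradient. *)
Definition nM (A : problem) (Nx Ny : nat) (g : gridfun) : R :=
  I2 (hx A Nx * ky A Ny) Nx Ny (fun i j => g i j ^ 2).
Definition nE (A : problem) (Nx Ny : nat) (gx gy : gridfun) : R :=
  I2 (hx A Nx * ky A Ny) (Nx - 1) Ny (fun i j => gx i j ^ 2)
  + I2 (hx A Nx * ky A Ny) Nx (Ny - 1) (fun i j => gy i j ^ 2).
Definition nD (A : problem) (Nx Ny : nat) (g : gridfun) : R :=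
  nE A Nx Ny (dxm (hx A Nx) g) (dym (ky A Ny) g).

Definition eps (A : problem) (Nx Ny N : nat) : R :=
  dt A N + (hx A Nx ^ 2 + ky A Ny ^ 2).

Definition area (A : problem) : R := (Lrx A - Llx A) * (Lry A - Lly A).

Lemma I2_const_area A Nx Ny N c : good_grid A Nx Ny N ->
  I2 (hx A Nx * ky A Ny) Nx Ny (fun _ _ => c) = area A * c.
Proof.
intros (HA & HNx & HNy & _); rewrite I2_S2, S2_const; unfold hx, ky, area; field.
split; apply not_0_INR; lia.
Qed.

Lemma cell_weight_pos A Nx Ny N : good_grid A Nx Ny N -> 0 < hx A Nx * ky A Ny.
Proof.
intros (HA & HNx & HNy & _); apply Rmult_lt_0_compat; [now apply hx_pos|now apply ky_pos].
Qed.

Lemma nM_ge0 A Nx Ny N g : good_grid A Nx Ny N -> 0 <= nM A Nx Ny g.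
Proof. intros H; apply I2_sq_ge0, Rlt_le, (cell_weight_pos _ _ _ _ H). Qed.

Lemma nE_ge0 A Nx Ny N g g' : good_grid A Nx Ny N -> 0 <= nE A Nx Ny g g'.
Proof.
intros H; assert (W := Rlt_le _ _ (cell_weight_pos _ _ _ _ H)).
apply Rplus_le_le_0_compat; now apply I2_sq_ge0.
Qed.

Lemma area_pos A : nonempty_domain A -> 0 < area A.
Proof. intros (a & b & _); unfold area; apply Rmult_lt_0_compat; lra. Qed.

Lemma inverse_lengths A Nx Ny N : good_grid A Nx Ny N ->
  / (INR Nx * hx A Nx) ^ 2 + / (INR Ny * ky A Ny) ^ 2
  = / (Lrx A - Llx A) ^ 2 + / (Lry A - Lly A) ^ 2.
Proof.
intros ((a & b & _) & HNx & HNy & _); unfold hx, ky.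
replace (INR Nx * ((Lrx A - Llx A) / INR Nx)) with (Lrx A - Llx A)
  by (field; apply not_0_INR; lia).
replace (INR Ny * ((Lry A - Lly A) / INR Ny)) with (Lry A - Lly A)
  by (field; apply not_0_INR; lia).
reflexivity.
Qed.

(** The scheme minus the exact equation is an instance of [transport_step].  The remainders
    of the fluxes are estimated on edges of either direction by [edge_flux_sum]; their
    part with the factor [eta] is what diffusion absorbs. *)
Lemma transported_step (A : problem) (Sol : state) (P : interp) (K lo hi lo0 hi1 : R)
   (c : field) (v l0 l1 c0 c1 lam0 eta Ku K1 : R) :
  setting A Sol P K lo hi lo0 hi1 -> 0 < gamma A -> Csm A 5 K c ->
  0 <= v -> 0 < lam0 -> 0 <= Ku -> 0 <= K1 ->
  (forall s, lo <= s <= hi -> lam0 <= l0 + l1 * s) ->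
  (forall s, lo0 <= s <= hi1 -> 0 <= c0 + c1 * s) ->
  2 * v ^ 2 * eta ^ 2 * K <= lam0 ^ 2 / 4 ->
  Csm A 3 K1 (fluxx v l0 l1 (phi Sol) (ux Sol) c) ->
  Csm A 3 K1 (fluxy v l0 l1 (phi Sol) (uy Sol) c) ->
  Csm A 2 K1 (content c0 c1 (phi Sol) c) ->
  exists C, 0 <= C /\
  forall (Nx Ny N : nat) (X : discrete) (Cd Wx_ Wy_ : nat -> gridfun)
     (Rs Rex Sb : gridfun) (n : nat),
  let f := err_center A Nx Ny N (Psi X) (phi Sol) in
  let q := err_center A Nx Ny N (Pd X) (p Sol) in
  let e := err_center A Nx Ny N Cd c in
  good_grid A Nx Ny N -> scheme A P Nx Ny N X -> (n < N)%nat ->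
  eps A Nx Ny N <= 1 ->
  edge_range Nx Ny (Pix P Nx Ny) (Psi X) lo hi (S n) ->
  edge_range Ny Nx (trI (Piy P Nx Ny)) (tr (Psi X)) lo hi (S n) ->
  (forall i j, is_cell Nx Ny i j ->
    dtm (dt A N) (fun m i j => (c0 + c1 * Psi X m i j) * Cd m i j) (S n) i j
    + Dxm (hx A Nx) (Wx_ (S n)) i j + Dym (ky A Ny) (Wy_ (S n)) i j = Rs i j /\
    pt (content c0 c1 (phi Sol) c) (xc A Nx i) (yc A Ny j) (tn A N (S n))
    + px (fluxx v l0 l1 (phi Sol) (ux Sol) c) (xc A Nx i) (yc A Ny j) (tn A N (S n))
    + py (fluxy v l0 l1 (phi Sol) (uy Sol) c) (xc A Nx i) (yc A Ny j) (tn A N (S n))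
      = Rex i j /\
    Rabs (Rs i j - Rex i j) <= Sb i j /\
    Rabs (Dxm (hx A Nx) (Ux X (S n)) i j + Dym (ky A Ny) (Uy X (S n)) i j
          + gamma A * ((q (S n) i j - q n i j) / dt A N)) <= Ku) ->
  (forall i j, is_xedge Nx Ny i j ->
    Wx_ (S n) i j = v * Ux X (S n) i j * Pix P Nx Ny (Cd (S n)) i j
      - (l0 + l1 * Pix P Nx Ny (Psi X (S n)) i j) * dxm (hx A Nx) (Cd (S n)) i j /\
    hx A Nx * Rabs (Ux X (S n) i j) <= eta) ->
  (forall i j, is_yedge Nx Ny i j ->
    Wy_ (S n) i j = v * Uy X (S n) i j * Piy P Nx Ny (Cd (S n)) i j
      - (l0 + l1 * Piy P Nx Ny (Psi X (S n)) i j) * dym (ky A Ny) (Cd (S n)) i j /\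
    ky A Ny * Rabs (Uy X (S n) i j) <= eta) ->
  (forall i j, i = 0%nat \/ i = Nx -> (1 <= j <= Ny)%nat -> Wx_ (S n) i j = 0 /\
     fluxx v l0 l1 (phi Sol) (ux Sol) c (xe A Nx i) (yc A Ny j) (tn A N (S n)) = 0) ->
  (forall i j, j = 0%nat \/ j = Ny -> (1 <= i <= Nx)%nat -> Wy_ (S n) i j = 0 /\
     fluxy v l0 l1 (phi Sol) (uy Sol) c (xc A Nx i) (ye A Ny j) (tn A N (S n)) = 0) ->
  / 2 * I2 (hx A Nx * ky A Ny) Nx Ny
      (fun i j => (c0 + c1 * Psi X (S n) i j) * e (S n) i j ^ 2)
  + dt A N * (lam0 / 4) * nD A Nx Ny (e (S n))
  <= / 2 * I2 (hx A Nx * ky A Ny) Nx Ny (fun i j => (c0 + c1 * Psi X n i j) * e n i j ^ 2)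
  + dt A N * C *
    (nM A Nx Ny (e (S n)) + nM A Nx Ny Sb
     + nE A Nx Ny (err_xedge A Nx Ny N (Ux X) (ux Sol) (S n))
                  (err_yedge A Nx Ny N (Uy X) (uy Sol) (S n))
     + nM A Nx Ny (f (S n)) + nM A Nx Ny (f n) + nM A Nx Ny (dtm (dt A N) f (S n))
     + eps A Nx Ny N ^ 2
     + nM A Nx Ny (fun i j => (q (S n) i j - q n i j) / dt A N) * nM A Nx Ny (e (S n))).
Proof.
intros ST Hgam Hc Hv Hlam HKu HK1 Hlamb Hcap Heta Fx Fy Fc.
assert (HK := st_K _ _ _ _ _ _ _ _ ST).
assert (HA := st_domain _ _ _ _ _ _ _ _ ST).
assert (Har := area_pos A HA).
set (cc := / (Lrx A - Llx A) ^ 2 + / (Lry A - Lly A) ^ 2).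
set (Kt := Rabs c1 * K + Ku).
assert (Kt0 : 0 <= Kt) by (unfold Kt; generalize (Rabs_pos c1); nra).
set (Ct := 1 + Kt + v * Kt + v * gamma A * cc + / lam0
           + v * gamma A * (1 + 4 * v * gamma A / lam0)).
set (V := v + Rabs l0 + Rabs l1).
set (G0 := 24 * K ^ 7 * V ^ 2).
set (R0 := 4 * (1 + K1 ^ 2 * area A + Rabs c1 ^ 2 * K ^ 2)).
assert (G00 : 0 <= G0).
{ assert (0 <= K ^ 7) by (apply pow_le; lra).
  unfold G0; apply Rmult_le_pos; [lra|apply pow2_ge_0]. }
assert (R00 : 4 <= R0).
{ unfold R0; generalize (pow2_ge_0 K1) (pow2_ge_0 (Rabs c1)) (pow2_ge_0 K); intros.
  assert (0 <= K1 ^ 2 * area A) by (apply Rmult_le_pos; lra).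
  assert (0 <= Rabs c1 ^ 2 * K ^ 2) by (apply Rmult_le_pos; lra). lra. }
assert (cc0 : 0 < cc).
{ destruct HA as (a & b & _); unfold cc.
  apply Rplus_lt_0_compat; apply Rinv_0_lt_compat, pow_lt; lra. }
assert (Ct0 : 1 <= Ct).
{ unfold Ct; assert (0 <= v * Kt) by (apply Rmult_le_pos; lra).
  assert (vg : 0 <= v * gamma A) by (apply Rmult_le_pos; lra).
  assert (0 <= v * gamma A * cc) by (apply Rmult_le_pos; lra).
  assert (0 < / lam0) by now apply Rinv_0_lt_compat.
  assert (0 <= 4 * v * gamma A / lam0) by (apply Rdiv_le_0_compat; lra).
  assert (0 <= v * gamma A * (1 + 4 * v * gamma A / lam0)) by (apply Rmult_le_pos; lra).
  lra. }
exists (Ct * (1 + R0 + G0 * (2 + 2 * area A))); split.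
{ apply Rmult_le_pos; [lra|].
  assert (0 <= G0 * (2 + 2 * area A)) by (apply Rmult_le_pos; lra). lra. }
intros Nx Ny N X Cd Wx_ Wy_ Rs Rex Sb n f q e HG HX Hn Heps RX RY Hcell Hx Hy Bx By.
assert (HG0 := HG); destruct HG0 as (_ & HNx & HNy & HN).
assert (HG' := good_grid_swap A Nx Ny N HG).
destruct (st_grid _ _ _ _ _ _ _ _ ST Nx Ny N X HG HX) as (HDx & HDy & HPsi & _).
assert (Hh := hx_pos A Nx HA HNx); assert (Hk := ky_pos A Ny HA HNy).
assert (Ht := dt_pos A N HA HN).
assert (Hw := cell_weight_pos A Nx Ny N HG).
unfold nD, nE, nM.
set (h := hx A Nx) in *; set (k := ky A Ny) in *; set (tau := dt A N) in *.
set (lamx := fun i j => l0 + l1 * Pix P Nx Ny (Psi X (S n)) i j).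
set (lamy := fun i j => l0 + l1 * Piy P Nx Ny (Psi X (S n)) i j).
set (EWx := fun i j => Wx_ (S n) i j
  - fluxx v l0 l1 (phi Sol) (ux Sol) c (xe A Nx i) (yc A Ny j) (tn A N (S n))).
set (EWy := fun i j => Wy_ (S n) i j
  - fluxy v l0 l1 (phi Sol) (uy Sol) c (xc A Nx i) (ye A Ny j) (tn A N (S n))).
set (gx := fun i j => EWx i j - (v * (Ux X (S n) i j * ((e (S n) i j + e (S n) (S i) j) / 2))
    - lamx i j * dxm h (e (S n)) i j)).
set (gy := fun i j => EWy i j - (v * (Uy X (S n) i j * ((e (S n) i j + e (S n) i (S j)) / 2))
    - lamy i j * dym k (e (S n)) i j)).
set (t := fun i j => (q (S n) i j - q n i j) / tau).
set (kap := fun m i j => c0 + c1 * Psi X m i j).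
set (r := fun i j => (kap (S n) i j * e (S n) i j - kap n i j * e n i j) / tau
   + Dxm h EWx i j + Dym k EWy i j).
set (e2 := hx A Nx ^ 2 + ky A Ny ^ 2).
assert (He2 : 0 <= e2) by (unfold e2; generalize (pow2_ge_0 (hx A Nx)) (pow2_ge_0 (ky A Ny)); lra).
assert (He2' : e2 <= eps A Nx Ny N) by (unfold eps; fold e2 tau; lra).
set (NY1 := I2 (h * k) (Nx - 1) Ny (fun i j => err_xedge A Nx Ny N (Ux X) (ux Sol) (S n) i j ^ 2)).
set (NY2 := I2 (h * k) Nx (Ny - 1) (fun i j => err_yedge A Nx Ny N (Uy X) (uy Sol) (S n) i j ^ 2)).
set (Nf' := I2 (h * k) Nx Ny (fun i j => f (S n) i j ^ 2)).
set (Gs := G0 * (NY1 + NY2 + 2 * Nf' + 2 * I2 (h * k) Nx Ny (fun _ _ => e2 ^ 2))).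
(* what remains of the fluxes is small or dissipated, direction by direction *)
assert (Sx := edge_flux_sum A Nx Ny N (Pix P Nx Ny) (phi Sol) (ux Sol) (p Sol) (Psi X) K lo hi
  HDx c Cd v l0 l1 Hc Hv (h * k) (S n) (Ux X (S n)) (Wx_ (S n)) lamx gx eta
  (Rlt_le _ _ Hw) Hn ltac:(fold e2; lra)).
fold V G0 in Sx.
assert (Sx' : I2 (h * k) (Nx - 1) Ny (fun i j => gx i j ^ 2)
  <= lam0 ^ 2 / 4 * I2 (h * k) (Nx - 1) Ny (fun i j => dxm h (e (S n)) i j ^ 2)
   + G0 * (NY1 + Nf' + I2 (h * k) Nx Ny (fun _ _ => e2 ^ 2))).
{ eapply Rle_trans; [apply Sx|].
  - intros i j Hij; destruct (Hx i j Hij) as [a b].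
    repeat split; assumption.
  - apply Rplus_le_compat_r, Rmult_le_compat_r; [apply I2_sq_ge0; lra|exact Heta]. }
assert (Sy := edge_flux_sum (swapP A) Ny Nx N (trI (Piy P Nx Ny)) (swapf (phi Sol))
  (swapf (uy Sol)) (swapf (p Sol)) (tr (Psi X)) K lo hi
  HDy (swapf c) (tr Cd) v l0 l1 (Csm_swap A 5 K c Hc) Hv (h * k) (S n)
  (tr (Uy X) (S n)) (tr Wy_ (S n)) (fun i j => lamy j i) (fun i j => gy j i) eta
  (Rlt_le _ _ Hw) Hn).
fold V G0 in Sy.
assert (Sy' : I2 (h * k) Nx (Ny - 1) (fun i j => gy i j ^ 2)
  <= lam0 ^ 2 / 4 * I2 (h * k) Nx (Ny - 1) (fun i j => dym k (e (S n)) i j ^ 2)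
   + G0 * (NY2 + Nf' + I2 (h * k) Nx Ny (fun _ _ => e2 ^ 2))).
{ unfold NY2, Nf'.
  rewrite (I2_swap _ Nx (Ny - 1) (fun i j => gy i j ^ 2)),
    (I2_swap _ Nx (Ny - 1) (fun i j => dym k _ i j ^ 2)),
    (I2_swap _ Nx (Ny - 1) (fun i j => err_yedge _ _ _ _ _ _ _ i j ^ 2)),
    (I2_swap _ Nx Ny (fun i j => f (S n) i j ^ 2)),
    (I2_swap _ Nx Ny (fun i j => e2 ^ 2)).
  replace e2 with (hx (swapP A) Ny ^ 2 + ky (swapP A) Nx ^ 2)
    by (change (hx (swapP A) Ny) with (ky A Ny); change (ky (swapP A) Nx) with (hx A Nx);
        unfold e2; ring).
  eapply Rle_trans; [apply Sy|].
  - change (hx (swapP A) Ny) with (ky A Ny); change (ky (swapP A) Nx) with (hx A Nx).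
    rewrite Rplus_comm; fold e2; lra.
  - intros i j [Hi Hj]; destruct (Hy j i (conj Hj Hi)) as [a b].
    repeat split; assumption.
  - apply Rplus_le_compat_r, Rmult_le_compat_r; [apply I2_sq_ge0; lra|exact Heta]. }
(* the residual of the error equation *)
assert (Hr : forall i j, is_cell Nx Ny i j -> Rabs (r i j) <=
  Sb i j + K1 * eps A Nx Ny N
  + Rabs c1 * K * (Rabs (dtm tau f (S n) i j) + Rabs (f n i j))).
{ intros i j Hij; destruct (Hcell i j Hij) as (E1 & E2 & E3 & _).
  assert (T1 := dtm_truncation A Nx Ny N HG _ K1 n i j Fc Hij Hn).
  assert (T2 := Dxm_truncation A Nx Ny N HG _ K1 (S n) i j Fx Hij Hn).
  assert (T3 := Dxm_truncation (swapP A) Ny Nx N HG' _ K1 (S n) j i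
    (Csm_swap A 3 K1 _ Fy) (conj (proj2 Hij) (proj1 Hij)) Hn).
  assert (Bc : Rabs (sample A Nx Ny N c (S n) i j) <= K)
    by (apply (Csm_bound A 5 K c); [assumption|now apply (center_in_box A Nx Ny N HG)]).
  assert (Lc := time_lipschitz A Nx Ny N HG c K (xc A Nx i) (yc A Ny j) n
    (Csm_le A 5 1 K c ltac:(lia) Hc) (proj1 (center_in_box A Nx Ny N HG i j n Hij ltac:(lia))) Hn).
  change (hx (swapP A) Ny) with k in T3.
  change (Dxm k (at_xedges (swapP A) Ny Nx (fun x y =>
      swapf (fluxy v l0 l1 (phi Sol) (uy Sol) c) x y (tn (swapP A) N (S n)))) j i)
   with (Dym k (at_yedges A Nx Ny (fun x y =>
      fluxy v l0 l1 (phi Sol) (uy Sol) c x y (tn A N (S n)))) i j) in T3.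
  change (px (swapf (fluxy v l0 l1 (phi Sol) (uy Sol) c)) (xc (swapP A) Ny j)
     (yc (swapP A) Nx i) (tn (swapP A) N (S n)))
   with (py (fluxy v l0 l1 (phi Sol) (uy Sol) c) (xc A Nx i) (yc A Ny j) (tn A N (S n))) in T3.
  fold h tau in T1, T2; fold tau in Lc.
  change (Rabs (sample A Nx Ny N c (S n) i j - sample A Nx Ny N c n i j) <= K * tau) in Lc.
  set (tc := pt (content c0 c1 (phi Sol) c) _ _ _) in *.
  set (tx := px (fluxx _ _ _ _ _ _) _ _ _) in *.
  set (ty := py (fluxy _ _ _ _ _ _) _ _ _) in *.
  set (sc := dtm tau (sample A Nx Ny N (content c0 c1 (phi Sol) c)) (S n) i j) in *.
  set (sx := Dxm h (at_xedges A Nx Ny _) i j) in *.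
  set (sy := Dym k (at_yedges A Nx Ny _) i j) in *.
  assert (Er : r i j = (Rs i j - Rex i j) + (- (sc - tc) + (- (sx - tx) + (- (sy - ty)
    + (- (c1 * (dtm tau f (S n) i j * sample A Nx Ny N c (S n) i j))
       + - (c1 * (f n i j * ((sample A Nx Ny N c (S n) i j - sample A Nx Ny N c n i j) / tau)))))))).
  { rewrite <- E1, <- E2; unfold r, sc, sx, sy, EWx, EWy, kap, dtm, Dxm, Dym, f, e, err_center,
      at_xedges, at_yedges, sample, at_centers, content.
    replace (S n - 1)%nat with n by lia; field; repeat split; lra. }
  rewrite Er.
  assert (L1 : Rabs ((sample A Nx Ny N c (S n) i j - sample A Nx Ny N c n i j) / tau) <= K).
  { unfold Rdiv; rewrite Rabs_mult, Rabs_inv, (Rabs_pos_eq tau) by lra.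
    apply Rmult_le_reg_r with tau; [assumption|]. rewrite Rmult_assoc, Rinv_l by lra; lra. }
  assert (M1 : Rabs (c1 * (dtm tau f (S n) i j * sample A Nx Ny N c (S n) i j))
    <= Rabs c1 * K * Rabs (dtm tau f (S n) i j)).
  { rewrite !Rabs_mult, (Rmult_assoc (Rabs c1)), (Rmult_comm K).
    apply Rmult_le_compat_l; [apply Rabs_pos|]. apply Rmult_le_compat_l; [apply Rabs_pos|assumption]. }
  assert (M2 : Rabs (c1 * (f n i j * ((sample A Nx Ny N c (S n) i j - sample A Nx Ny N c n i j) / tau)))
    <= Rabs c1 * K * Rabs (f n i j)).
  { rewrite (Rabs_mult c1), (Rabs_mult (f n i j)), (Rmult_assoc (Rabs c1)), (Rmult_comm K).
    apply Rmult_le_compat_l; [apply Rabs_pos|]. apply Rmult_le_compat_l; [apply Rabs_pos|assumption]. }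
  eapply Rle_trans; [apply Rabs_triang|].
  eapply Rle_trans; [apply Rplus_le_compat_l, Rabs_triang|].
  eapply Rle_trans; [apply Rplus_le_compat_l, Rplus_le_compat_l, Rabs_triang|].
  eapply Rle_trans; [apply Rplus_le_compat_l, Rplus_le_compat_l, Rplus_le_compat_l, Rabs_triang|].
  eapply Rle_trans; [apply Rplus_le_compat_l, Rplus_le_compat_l, Rplus_le_compat_l,
    Rplus_le_compat_l, Rabs_triang|].
  rewrite !Rabs_Ropp; unfold eps; fold h k tau.
  rewrite (Rmult_plus_distr_l K1), (Rmult_plus_distr_l K1); lra. }
assert (Hr2 : I2 (h * k) Nx Ny (fun i j => r i j ^ 2) <=
  R0 * (I2 (h * k) Nx Ny (fun i j => Sb i j ^ 2) + eps A Nx Ny N ^ 2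
   + I2 (h * k) Nx Ny (fun i j => dtm tau f (S n) i j ^ 2)
   + I2 (h * k) Nx Ny (fun i j => f n i j ^ 2))).
{ apply Rle_trans with (I2 (h * k) Nx Ny (fun i j =>
    4 * Sb i j ^ 2 + 4 * K1 ^ 2 * eps A Nx Ny N ^ 2
    + 4 * (Rabs c1 ^ 2 * K ^ 2) * dtm tau f (S n) i j ^ 2
    + 4 * (Rabs c1 ^ 2 * K ^ 2) * f n i j ^ 2)).
  - apply I2_le; [lra|]; intros i j Hi Hj.
    assert (B := Hr i j (conj Hi Hj)); apply Rabs_le_sq in B; eapply Rle_trans; [exact B|].
    rewrite <- (pow2_abs (dtm tau f (S n) i j)), <- (pow2_abs (f n i j)).
    set (a := Sb i j); set (b := K1 * eps A Nx Ny N).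
    set (d1 := Rabs c1 * K * Rabs (dtm tau f (S n) i j)); set (d2 := Rabs c1 * K * Rabs (f n i j)).
    replace (a + b + Rabs c1 * K * (Rabs (dtm tau f (S n) i j) + Rabs (f n i j)))
      with (a + b + d1 + d2) by (unfold d1, d2; ring).
    replace (4 * a ^ 2 + 4 * K1 ^ 2 * eps A Nx Ny N ^ 2
      + 4 * (Rabs c1 ^ 2 * K ^ 2) * Rabs (dtm tau f (S n) i j) ^ 2
      + 4 * (Rabs c1 ^ 2 * K ^ 2) * Rabs (f n i j) ^ 2) with
      (4 * (a ^ 2 + b ^ 2 + d1 ^ 2 + d2 ^ 2)) by (unfold d1, d2, b; ring).
    generalize (pow2_ge_0 (a - b)) (pow2_ge_0 (a - d1)) (pow2_ge_0 (a - d2))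
      (pow2_ge_0 (b - d1)) (pow2_ge_0 (b - d2)) (pow2_ge_0 (d1 - d2)); lra.
  - I2_push.
    assert (EA : I2 (h * k) Nx Ny (fun _ _ => eps A Nx Ny N ^ 2) = area A * eps A Nx Ny N ^ 2)
      by (apply (I2_const_area A Nx Ny N _ HG)).
    rewrite EA.
    assert (p1 := I2_sq_ge0 (h * k) Nx Ny Sb (Rlt_le _ _ Hw)).
    assert (p2 := I2_sq_ge0 (h * k) Nx Ny (dtm tau f (S n)) (Rlt_le _ _ Hw)).
    assert (p3 := I2_sq_ge0 (h * k) Nx Ny (f n) (Rlt_le _ _ Hw)).
    assert (p4 := pow2_ge_0 (eps A Nx Ny N)).
    set (x1 := I2 _ _ _ (fun i j => Sb i j ^ 2)) in *.
    set (x2 := I2 _ _ _ (fun i j => dtm tau f (S n) i j ^ 2)) in *.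
    set (x3 := I2 _ _ _ (fun i j => f n i j ^ 2)) in *.
    assert (a1 : 0 <= K1 ^ 2 * area A) by (apply Rmult_le_pos; [apply pow2_ge_0|lra]).
    assert (a2 : 0 <= Rabs c1 ^ 2 * K ^ 2) by (apply Rmult_le_pos; apply pow2_ge_0).
    unfold R0 in *; set (y1 := K1 ^ 2 * area A) in *; set (y2 := Rabs c1 ^ 2 * K ^ 2) in *.
    replace (4 * K1 ^ 2 * (area A * eps A Nx Ny N ^ 2)) with (4 * y1 * eps A Nx Ny N ^ 2)
      by (unfold y1; ring).
    set (ee := eps A Nx Ny N ^ 2) in *.
    assert (0 <= (y1 + y2) * x1) by (apply Rmult_le_pos; lra).
    assert (0 <= (1 + y2) * ee) by (apply Rmult_le_pos; lra).
    assert (0 <= (1 + y1) * x2) by (apply Rmult_le_pos; lra).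
    assert (0 <= (1 + y1) * x3) by (apply Rmult_le_pos; lra).
    lra. }
assert (P1 := I2_sq_ge0 (h * k) (Nx - 1) Ny
  (err_xedge A Nx Ny N (Ux X) (ux Sol) (S n)) (Rlt_le _ _ Hw)); fold NY1 in P1.
assert (P2 := I2_sq_ge0 (h * k) Nx (Ny - 1)
  (err_yedge A Nx Ny N (Uy X) (uy Sol) (S n)) (Rlt_le _ _ Hw)); fold NY2 in P2.
assert (P3 := I2_sq_ge0 (h * k) Nx Ny (f (S n)) (Rlt_le _ _ Hw)); fold Nf' in P3.
assert (P4 := I2_sq_ge0 (h * k) Nx Ny (fun _ _ => e2) (Rlt_le _ _ Hw)); cbv beta in P4.
assert (Gs0 : 0 <= Gs) by (apply Rmult_le_pos; [assumption|lra]).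
assert (MAIN := transport_step Nx Ny h k tau (gamma A) Kt v lam0 cc Gs
  (e n) (e (S n)) t (kap n) (kap (S n)) r (Ux X (S n)) (Uy X (S n)) EWx EWy lamx lamy gx gy
  HNx HNy Hh Hk Ht Hgam Kt0 Hv Hlam (inverse_lengths A Nx Ny N HG)).
fold Ct in MAIN.
assert (Hmain : / 2 * I2 (h * k) Nx Ny (fun i j => kap (S n) i j * e (S n) i j ^ 2)
  + tau * (lam0 / 4) * (I2 (h * k) (Nx - 1) Ny (fun i j => dxm h (e (S n)) i j ^ 2)
       + I2 (h * k) Nx (Ny - 1) (fun i j => dym k (e (S n)) i j ^ 2))
  <= / 2 * I2 (h * k) Nx Ny (fun i j => kap n i j * e n i j ^ 2)
  + tau * Ct * (I2 (h * k) Nx Ny (fun i j => e (S n) i j ^ 2)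
     + I2 (h * k) Nx Ny (fun i j => r i j ^ 2) + Gs
     + I2 (h * k) Nx Ny (fun i j => t i j ^ 2) * I2 (h * k) Nx Ny (fun i j => e (S n) i j ^ 2))).
{ apply MAIN; clear MAIN.
  - intros i j Hij; destruct (Hcell i j Hij) as (_ & _ & _ & E4).
    split; [reflexivity|split; [|split]].
    + apply Hcap, HPsi; [assumption|lia].
    + unfold kap; replace (c0 + c1 * Psi X (S n) i j - (c0 + c1 * Psi X n i j))
        with (c1 * (Psi X (S n) i j - Psi X n i j)) by ring.
      rewrite Rabs_mult; assert (St := ed_step _ _ _ _ _ _ _ _ _ _ _ _ HDx n i j Hn Hij).
      fold tau in St; apply Rle_trans with (Rabs c1 * (K * tau)).
      * apply Rmult_le_compat_l; [apply Rabs_pos|assumption].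
      * rewrite <- Rmult_assoc; apply Rmult_le_compat_r; [lra|unfold Kt; lra].
    + eapply Rle_trans; [exact E4|]. unfold Kt.
      assert (0 <= Rabs c1 * K) by (apply Rmult_le_pos; [apply Rabs_pos|lra]). lra.
  - intros j Hj.
    destruct (Bx 0%nat j (or_introl eq_refl) Hj) as [a1 a2], (Bx Nx j (or_intror eq_refl) Hj) as [b1 b2].
    destruct (sch_bdry_x _ _ _ _ _ _ HX n 0 j Hn (or_introl eq_refl) Hj) as (u0 & _).
    destruct (sch_bdry_x _ _ _ _ _ _ HX n Nx j Hn (or_intror eq_refl) Hj) as (u1 & _).
    unfold EWx; rewrite a1, a2, b1, b2; repeat split; try assumption; ring.
  - intros i Hi.
    destruct (By i 0%nat (or_introl eq_refl) Hi) as [a1 a2], (By i Ny (or_intror eq_refl) Hi) as [b1 b2].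
    destruct (sch_bdry_y _ _ _ _ _ _ HX n i 0 Hn (or_introl eq_refl) Hi) as (u0 & _).
    destruct (sch_bdry_y _ _ _ _ _ _ HX n i Ny Hn (or_intror eq_refl) Hi) as (u1 & _).
    unfold EWy; rewrite a1, a2, b1, b2; repeat split; try assumption; ring.
  - intros i j Hij; split; [apply Hlamb, RX, Hij|unfold gx; ring].
  - intros i j [Hi Hj]; split; [|unfold gy; ring].
    apply Hlamb; exact (RY j i (conj Hj Hi)).
  - unfold Gs; lra.
  - exact Gs0. }
clear MAIN.
eapply Rle_trans; [exact Hmain|].
change (I2 (h * k) Nx Ny (fun i j => ((q (S n) i j - q n i j) / tau) ^ 2))
  with (I2 (h * k) Nx Ny (fun i j => t i j ^ 2)).
change (fun i j => (c0 + c1 * Psi X n i j) * e n i j ^ 2) with (fun i j => kap n i j * e n i j ^ 2).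
apply Rplus_le_compat_l.
rewrite <- (Rmult_assoc tau Ct), !(Rmult_assoc (tau * Ct)).
apply Rmult_le_compat_l; [apply Rmult_le_pos; lra|].
assert (Ee : I2 (h * k) Nx Ny (fun _ _ => e2 ^ 2) <= area A * eps A Nx Ny N ^ 2).
{ assert (EA : I2 (h * k) Nx Ny (fun _ _ => e2 ^ 2) = area A * e2 ^ 2)
    by (apply (I2_const_area A Nx Ny N _ HG)).
  rewrite EA; apply Rmult_le_compat_l; [lra|]. apply pow_incr; lra. }
assert (p1 := I2_sq_ge0 (h * k) Nx Ny Sb (Rlt_le _ _ Hw)).
assert (p2 := I2_sq_ge0 (h * k) Nx Ny (dtm tau f (S n)) (Rlt_le _ _ Hw)).
assert (p3 := I2_sq_ge0 (h * k) Nx Ny (f n) (Rlt_le _ _ Hw)).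
assert (p4 := pow2_ge_0 (eps A Nx Ny N)).
assert (p5 := I2_sq_ge0 (h * k) Nx Ny (e (S n)) (Rlt_le _ _ Hw)).
assert (p6 := I2_sq_ge0 (h * k) Nx Ny t (Rlt_le _ _ Hw)).
fold NY1 NY2 Nf'.
set (x1 := I2 _ _ _ (fun i j => Sb i j ^ 2)) in *.
set (x2 := I2 _ _ _ (fun i j => dtm tau f (S n) i j ^ 2)) in *.
set (x3 := I2 _ _ _ (fun i j => f n i j ^ 2)) in *.
set (x5 := I2 _ _ _ (fun i j => e (S n) i j ^ 2)) in *.
set (x6 := I2 _ _ _ (fun i j => t i j ^ 2)) in *.
set (ee := eps A Nx Ny N ^ 2) in *.
assert (p7 : 0 <= x6 * x5) by now apply Rmult_le_pos.
assert (EG : Gs <= G0 * (2 + 2 * area A) * (NY1 + NY2 + Nf' + ee)).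
{ unfold Gs; rewrite Rmult_assoc; apply Rmult_le_compat_l; [assumption|].
  assert (0 <= area A * (NY1 + NY2 + Nf')) by (apply Rmult_le_pos; lra).
  assert (0 <= area A * ee) by (apply Rmult_le_pos; lra). lra. }
set (G1 := G0 * (2 + 2 * area A)) in *.
assert (G10 : 0 <= G1) by (apply Rmult_le_pos; lra).
assert (0 <= (R0 + G1) * x5) by (apply Rmult_le_pos; lra).
assert (0 <= (1 + G1) * x1) by (apply Rmult_le_pos; lra).
assert (0 <= (1 + R0) * (NY1 + NY2 + Nf')) by (apply Rmult_le_pos; lra).
assert (0 <= (1 + G1) * (x3 + x2)) by (apply Rmult_le_pos; lra).
assert (0 <= (1) * ee) by (apply Rmult_le_pos; lra).
assert (0 <= (R0 + G1) * (x6 * x5)) by (apply Rmult_le_pos; lra).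
lra.
Qed.

(** * Pressure and porosity *)

Section Run.

Variables (A : problem) (Sol : state) (P : interp) (K lo hi lo0 hi1 : R).
Hypotheses (ST : setting A Sol P K lo hi lo0 hi1) (HA : standing_assumptions A)
  (HS : exact_solution A Sol).
Variables (Nx Ny N : nat) (X : discrete).
Hypotheses (HG : good_grid A Nx Ny N) (HX : scheme A P Nx Ny N X).

Let h := hx A Nx.
Let k := ky A Ny.
Let tau := dt A N.
Let w := hx A Nx * ky A Ny.

Definition err_phi := err_center A Nx Ny N (Psi X) (phi Sol).
Definition err_p := err_center A Nx Ny N (Pd X) (p Sol).
Definition err_c := err_center A Nx Ny N (Cf X) (cf Sol).
Definition err_T := err_center A Nx Ny N (Z X) (Tf Sol).

Definition rhox (n : nat) : gridfun := edge_rho A Nx Ny (Pix P Nx Ny) (Psi X) n.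
Definition rhoy (n : nat) : gridfun := fun i j =>
  edge_rho (swapP A) Ny Nx (trI (Piy P Nx Ny)) (tr (Psi X)) n j i.
Definition thetax (n : nat) : gridfun :=
  edge_theta A Nx Ny N (Pix P Nx Ny) (phi Sol) (ux Sol) (p Sol) (Psi X) n.
Definition thetay (n : nat) : gridfun := fun i j =>
  edge_theta (swapP A) Ny Nx N (trI (Piy P Nx Ny)) (swapf (phi Sol)) (swapf (uy Sol))
    (swapf (p Sol)) (tr (Psi X)) n j i.

(** The velocity error.  The scheme has no velocity at the initial level; there the
    value required by Darcy's law is taken. *)
Definition err_ux (n : nat) : gridfun :=
  match n with
  | O => fun i j => - (dxm h (err_p 0%nat) i j + thetax 0%nat i j) / rhox 0%nat i j
  | S _ => err_xedge A Nx Ny N (Ux X) (ux Sol) n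
  end.
Definition err_uy (n : nat) : gridfun :=
  match n with
  | O => fun i j => - (dym k (err_p 0%nat) i j + thetay 0%nat i j) / rhoy 0%nat i j
  | S _ => err_yedge A Nx Ny N (Uy X) (uy Sol) n
  end.

(** The interpolated porosities lie in the interval where the coefficients are regular. *)
Definition in_range (n : nat) : Prop :=
  edge_range Nx Ny (Pix P Nx Ny) (Psi X) lo hi n /\
  edge_range Ny Nx (trI (Piy P Nx Ny)) (tr (Psi X)) lo hi n.

Lemma rho_pos_xy n : in_range n ->
  (forall i j, is_xedge Nx Ny i j -> 0 < / K <= rhox n i j /\ rhox n i j <= K) /\
  (forall i j, is_yedge Nx Ny i j -> 0 < / K <= rhoy n i j /\ rhoy n i j <= K).
Proof.
intros [R1 R2]; destruct (st_grid _ _ _ _ _ _ _ _ ST Nx Ny N X HG HX) as (HDx & HDy & _).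
split.
- intros i j Hij; exact (edge_rho_pos _ _ _ _ _ _ _ _ _ _ _ _ HDx n i j Hij R1).
- intros i j [Hi Hj].
  exact (edge_rho_pos _ _ _ _ _ _ _ _ _ _ _ _ HDy n j i (conj Hj Hi) R2).
Qed.

Lemma darcy_error_xy n : in_range n -> (n <= N)%nat ->
  (forall i j, is_xedge Nx Ny i j ->
     rhox n i j * err_ux n i j = - (dxm h (err_p n) i j + thetax n i j)) /\
  (forall i j, is_yedge Nx Ny i j ->
     rhoy n i j * err_uy n i j = - (dym k (err_p n) i j + thetay n i j)).
Proof.
intros HR Hn; destruct (rho_pos_xy n HR) as [Px Py].
destruct (st_grid _ _ _ _ _ _ _ _ ST Nx Ny N X HG HX) as (HDx & HDy & _).
destruct HR as [R1 R2]; assert (HD := st_domain _ _ _ _ _ _ _ _ ST).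
assert (HN : (1 <= N)%nat) by apply HG.
destruct n as [|n].
- split; intros i j Hij.
  + specialize (Px i j Hij); unfold err_ux; field; lra.
  + specialize (Py i j Hij); unfold err_uy; field; lra.
- assert (Ht := tn_pos A N n HD HN Hn); split; intros i j Hij.
  + apply (darcy_error _ _ _ _ _ _ _ _ _ _ _ _ HDx (S n) (Ux X (S n)) (Pd X) i j Hij R1 Ht).
    apply (sch_darcy_x _ _ _ _ _ _ HX n i j); [lia|assumption].
  + destruct Hij as [Hi Hj].
    apply (darcy_error _ _ _ _ _ _ _ _ _ _ _ _ HDy (S n) (tr (Uy X) (S n)) (tr (Pd X)) j i
      (conj Hj Hi) R2 Ht).
    apply (sch_darcy_y _ _ _ _ _ _ HX n i j); [lia|split; assumption].
Qed.

Definition energy_u (n : nat) : R :=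
  / 2 * (I2 w (Nx - 1) Ny (fun i j => rhox n i j * err_ux n i j ^ 2)
         + I2 w Nx (Ny - 1) (fun i j => rhoy n i j * err_uy n i j ^ 2)).
Definition energy_flow (n : nat) : R :=
  energy_u n + nM A Nx Ny (err_p n) + nM A Nx Ny (err_phi n).
Definition rate_p (n : nat) : R :=
  nM A Nx Ny (fun i j => (err_p n i j - err_p (n - 1)%nat i j) / tau).

Let HK : 1 <= K := st_K _ _ _ _ _ _ _ _ ST.
Let Hw : 0 < w := cell_weight_pos A Nx Ny N HG.

Lemma velocity_energy n : in_range n ->
  nE A Nx Ny (err_ux n) (err_uy n) <= 2 * K * energy_u n.
Proof.
intros HR; destruct (rho_pos_xy n HR) as [Px Py].
assert (K0 : 0 < K) by lra.
unfold nE, energy_u; fold w.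
rewrite <- Rmult_assoc; replace (2 * K * / 2) with K by field.
rewrite Rmult_plus_distr_l, <- !I2_scal; apply Rplus_le_compat.
- apply I2_le; [lra|]; intros i j Hi Hj; destruct (Px i j) as [[a b] _]; [split; lia|].
  rewrite <- (Rmult_1_l (err_ux n i j ^ 2)), <- (Rinv_r K) at 1 by lra.
  rewrite Rmult_assoc; apply Rmult_le_compat_l; [lra|].
  apply Rmult_le_compat_r; [apply pow2_ge_0|assumption].
- apply I2_le; [lra|]; intros i j Hi Hj; destruct (Py i j) as [[a b] _]; [split; lia|].
  rewrite <- (Rmult_1_l (err_uy n i j ^ 2)), <- (Rinv_r K) at 1 by lra.
  rewrite Rmult_assoc; apply Rmult_le_compat_l; [lra|].
  apply Rmult_le_compat_r; [apply pow2_ge_0|assumption].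
Qed.

Lemma energy_u_ge0 n : in_range n -> 0 <= energy_u n.
Proof.
intros HR; assert (E := velocity_energy n HR).
assert (E0 := nE_ge0 A Nx Ny N (err_ux n) (err_uy n) HG).
assert (0 < K) by lra. nra.
Qed.

Let e2 := hx A Nx ^ 2 + ky A Ny ^ 2.

Lemma e2_le_eps : 0 <= e2 <= eps A Nx Ny N /\ tau <= eps A Nx Ny N /\ 0 < tau.
Proof.
assert (HG0 := HG); destruct HG0 as (HD & _ & _ & HN).
assert (Ht := dt_pos A N HD HN); fold tau in Ht.
unfold eps; fold e2 tau.
assert (0 <= e2) by (unfold e2; generalize (pow2_ge_0 (hx A Nx)) (pow2_ge_0 (ky A Ny)); lra).
lra.
Qed.

Lemma e2_norm : I2 w Nx Ny (fun _ _ => e2 ^ 2) <= area A * eps A Nx Ny N ^ 2.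
Proof.
unfold w; rewrite (I2_const_area A Nx Ny N _ HG); destruct e2_le_eps as (a & _).
apply Rmult_le_compat_l; [|apply pow_incr; lra].
apply Rlt_le, area_pos, (st_domain _ _ _ _ _ _ _ _ ST).
Qed.

Lemma e2_swap : hx (swapP A) Ny ^ 2 + ky (swapP A) Nx ^ 2 = e2.
Proof.
change (hx (swapP A) Ny) with (ky A Ny); change (ky (swapP A) Nx) with (hx A Nx).
unfold e2; ring.
Qed.

Lemma theta_norm n : in_range n -> (n <= N)%nat ->
  nE A Nx Ny (thetax n) (thetay n)
  <= 16 * K ^ 9 * (nM A Nx Ny (err_phi n) + area A * eps A Nx Ny N ^ 2).
Proof.
intros [R1 R2] Hn.
destruct (st_grid _ _ _ _ _ _ _ _ ST Nx Ny N X HG HX) as (HDx & HDy & _).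
assert (Ex := edge_theta_sum _ _ _ _ _ _ _ _ _ _ _ _ HDx w n (Rlt_le _ _ Hw) Hn R1).
assert (Ey := edge_theta_sum _ _ _ _ _ _ _ _ _ _ _ _ HDy w n (Rlt_le _ _ Hw) Hn R2).
rewrite e2_swap in Ey; fold e2 in Ex.
assert (Sy : I2 w Nx (Ny - 1) (fun i j => thetay n i j ^ 2)
  <= 8 * K ^ 9 * (nM A Nx Ny (err_phi n) + I2 w Nx Ny (fun _ _ => e2 ^ 2))).
{ unfold nM; fold w; rewrite (I2_swap w Nx (Ny - 1)), (I2_swap w Nx Ny (fun i j => err_phi n i j ^ 2)),
    (I2_swap w Nx Ny (fun i j => e2 ^ 2)); exact Ey. }
assert (K9 : 0 <= K ^ 9) by (apply pow_le; lra).
assert (E2 := e2_norm).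
unfold nE; fold w.
change (I2 w (Nx - 1) Ny (fun i j => thetax n i j ^ 2)
  <= 8 * K ^ 9 * (nM A Nx Ny (err_phi n) + I2 w Nx Ny (fun _ _ => e2 ^ 2))) in Ex.
assert (8 * K ^ 9 * I2 w Nx Ny (fun _ _ => e2 ^ 2) <= 8 * K ^ 9 * (area A * eps A Nx Ny N ^ 2))
  by (apply Rmult_le_compat_l; lra).
lra.
Qed.

(** Darcy's law for the errors, read as an equation for the pressure gradient. *)
Lemma pressure_gradient n : in_range n -> (n <= N)%nat ->
  nD A Nx Ny (err_p n) <= (4 * K ^ 3 + 32 * K ^ 9 * (1 + area A))
    * (energy_flow n + eps A Nx Ny N ^ 2).
Proof.
intros HR Hn; destruct (rho_pos_xy n HR) as [Px Py].
destruct (darcy_error_xy n HR Hn) as [Dx Dy].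
assert (T := theta_norm n HR Hn); assert (V := velocity_energy n HR).
assert (V0 := energy_u_ge0 n HR).
assert (A0 := area_pos A (st_domain _ _ _ _ _ _ _ _ ST)).
assert (Hpt : forall r y d t, 0 < / K <= r /\ r <= K -> r * y = - (d + t) ->
  d ^ 2 <= 2 * K ^ 2 * y ^ 2 + 2 * t ^ 2).
{ intros r y d t [r1 r2] E; replace d with (- (r * y) - t) by lra.
  assert (r ^ 2 <= K ^ 2) by (apply pow_incr; lra).
  assert (r ^ 2 * y ^ 2 <= K ^ 2 * y ^ 2) by (apply Rmult_le_compat_r; [apply pow2_ge_0|lra]).
  generalize (pow2_ge_0 (r * y - t)); nra. }
assert (E : nD A Nx Ny (err_p n) <= 2 * K ^ 2 * nE A Nx Ny (err_ux n) (err_uy n)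
   + 2 * nE A Nx Ny (thetax n) (thetay n)).
{ unfold nD, nE; fold w h k.
  assert (Ex : I2 w (Nx - 1) Ny (fun i j => dxm h (err_p n) i j ^ 2) <=
    I2 w (Nx - 1) Ny (fun i j => 2 * K ^ 2 * err_ux n i j ^ 2 + 2 * thetax n i j ^ 2)).
  { apply I2_le; [lra|]; intros i j Hi Hj.
    assert (Hij : is_xedge Nx Ny i j) by (split; lia).
    apply (Hpt (rhox n i j)); [now apply Px|now apply Dx]. }
  assert (Ey : I2 w Nx (Ny - 1) (fun i j => dym k (err_p n) i j ^ 2) <=
    I2 w Nx (Ny - 1) (fun i j => 2 * K ^ 2 * err_uy n i j ^ 2 + 2 * thetay n i j ^ 2)).
  { apply I2_le; [lra|]; intros i j Hi Hj.
    assert (Hij : is_yedge Nx Ny i j) by (split; lia).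
    apply (Hpt (rhoy n i j)); [now apply Py|now apply Dy]. }
  revert Ex Ey; I2_push; intros; lra. }
assert (K2 : 0 <= K ^ 2) by (apply pow_le; lra).
assert (K3 : 0 <= K ^ 3) by (apply pow_le; lra).
assert (K9 : 0 <= K ^ 9) by (apply pow_le; lra).
assert (2 * K ^ 2 * nE A Nx Ny (err_ux n) (err_uy n) <= 2 * K ^ 2 * (2 * K * energy_u n))
  by (apply Rmult_le_compat_l; lra).
replace (2 * K ^ 2 * (2 * K * energy_u n)) with (4 * K ^ 3 * energy_u n) in H by ring.
assert (N1 := nM_ge0 A Nx Ny N (err_p n) HG).
assert (N2 := nM_ge0 A Nx Ny N (err_phi n) HG).
assert (N3 := pow2_ge_0 (eps A Nx Ny N)).
unfold energy_flow.
set (a := energy_u n) in *; set (b := nM A Nx Ny (err_p n)) in *.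
set (c := nM A Nx Ny (err_phi n)) in *; set (d := eps A Nx Ny N ^ 2) in *.
set (K9a := K ^ 9 * area A).
assert (0 <= K9a) by (apply Rmult_le_pos; lra).
replace (16 * K ^ 9 * (c + area A * d)) with (16 * K ^ 9 * c + 16 * K9a * d) in T
  by (unfold K9a; ring).
replace ((4 * K ^ 3 + 32 * K ^ 9 * (1 + area A)) * (a + b + c + d)) with
  ((4 * K ^ 3 + 32 * K ^ 9 + 32 * K9a) * (a + b + c + d)) by (unfold K9a; ring).
assert (0 <= (32 * K ^ 9 + 32 * K9a) * (a + b)) by (apply Rmult_le_pos; lra).
assert (0 <= 4 * K ^ 3 * (b + c + d)) by (apply Rmult_le_pos; lra).
assert (0 <= 32 * K9a * c) by (apply Rmult_le_pos; lra).
assert (0 <= 32 * K ^ 9 * d) by (apply Rmult_le_pos; lra).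
lra.
Qed.

Lemma porosity_rate_norm n : (n < N)%nat ->
  nM A Nx Ny (dtm tau err_phi (S n)) <= 4 * K ^ 2 * (1 + area A) *
    (nM A Nx Ny (err_phi (S n)) + nM A Nx Ny (err_c n) + nM A Nx Ny (err_T n)
     + eps A Nx Ny N ^ 2).
Proof.
intros Hn; destruct (st_grid _ _ _ _ _ _ _ _ ST Nx Ny N X HG HX) as (_ & _ & _ & _ & HE).
assert (A0 := area_pos A (st_domain _ _ _ _ _ _ _ _ ST)).
destruct e2_le_eps as (_ & Te & T0).
assert (E : nM A Nx Ny (dtm tau err_phi (S n)) <= I2 w Nx Ny (fun i j => 4 * K ^ 2 *
  (err_phi (S n) i j ^ 2 + err_c n i j ^ 2 + err_T n i j ^ 2 + eps A Nx Ny N ^ 2))).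
{ apply I2_le; [fold w; lra|]; intros i j Hi Hj.
  assert (B := HE n i j (conj Hi Hj) Hn); fold tau in B.
  fold err_phi err_c err_T in B; apply Rabs_le_sq in B; eapply Rle_trans; [exact B|].
  rewrite Rpow_mult_distr; replace (4 * K ^ 2) with (K ^ 2 * 4) by ring.
  rewrite (Rmult_assoc (K ^ 2)); apply Rmult_le_compat_l; [apply pow2_ge_0|].
  rewrite <- (pow2_abs (err_phi (S n) i j)), <- (pow2_abs (err_c n i j)), <- (pow2_abs (err_T n i j)).
  set (a := Rabs (err_phi (S n) i j)); set (b := Rabs (err_c n i j)); set (c := Rabs (err_T n i j)).
  assert (tau ^ 2 <= eps A Nx Ny N ^ 2) by (apply pow_incr; lra).
  generalize (pow2_ge_0 (a - b)) (pow2_ge_0 (a - c)) (pow2_ge_0 (a - tau))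
      (pow2_ge_0 (b - c)) (pow2_ge_0 (b - tau)) (pow2_ge_0 (c - tau)); lra. }
eapply Rle_trans; [exact E|]; I2_push.
unfold w at 4; rewrite (I2_const_area A Nx Ny N _ HG).
change (I2 w Nx Ny (fun i j => err_phi (S n) i j ^ 2)) with (nM A Nx Ny (err_phi (S n))).
change (I2 w Nx Ny (fun i j => err_c n i j ^ 2)) with (nM A Nx Ny (err_c n)).
change (I2 w Nx Ny (fun i j => err_T n i j ^ 2)) with (nM A Nx Ny (err_T n)).
assert (N1 := nM_ge0 A Nx Ny N (err_phi (S n)) HG).
assert (N2 := nM_ge0 A Nx Ny N (err_c n) HG).
assert (N3 := nM_ge0 A Nx Ny N (err_T n) HG).
assert (N4 := pow2_ge_0 (eps A Nx Ny N)).
rewrite (Rmult_assoc (4 * K ^ 2)); apply Rmult_le_compat_l; [nra|].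
assert (0 <= area A * (nM A Nx Ny (err_phi (S n)) + nM A Nx Ny (err_c n) + nM A Nx Ny (err_T n)))
  by (apply Rmult_le_pos; lra).
lra.
Qed.

Lemma flow_constants :
  let K' := 3 * K ^ 3 + (gamma A + 3) * K in
  let Cp := K' + 1 + (5 + K' ^ 2) / gamma A in 0 <= K' /\ 1 <= Cp.
Proof.
intros K' Cp; assert (G := gamma_pos A HA).
assert (K3 : 0 <= K ^ 3) by (apply pow_le; lra).
assert (0 <= K') by (unfold K'; assert (0 <= (gamma A + 3) * K) by (apply Rmult_le_pos; lra); lra).
assert (0 <= (5 + K' ^ 2) / gamma A)
  by (apply Rdiv_le_0_compat; [generalize (pow2_ge_0 K'); lra|assumption]).
split; [assumption|unfold Cp; lra].
Qed.

Definition Cflow : R :=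
  let K' := 3 * K ^ 3 + (gamma A + 3) * K in
  let Cp := K' + 1 + (5 + K' ^ 2) / gamma A in
  (1 + Cp * (2 * K + (1 + 200 * K ^ 11) * (1 + area A))) * (1 + 4 * K ^ 2 * (1 + area A)).

(** The increment of the velocity and pressure energy comes from [pressure_step]; the
    porosity error is added to the energy because both the consistency error of Darcy's
    law and the mass balance are driven by it. *)
Lemma flow_step n : (n < N)%nat -> in_range n -> in_range (S n) ->
  energy_flow (S n) + tau * (gamma A / 4) * rate_p (S n)
  <= energy_flow n + tau * Cflow *
     (energy_flow (S n) + energy_flow n + nM A Nx Ny (err_c n) + nM A Nx Ny (err_T n)
      + eps A Nx Ny N ^ 2).
Proof.
intros Hn HR HR'.
assert (Gam := gamma_pos A HA).
destruct (st_grid _ _ _ _ _ _ _ _ ST Nx Ny N X HG HX) as (HDx & HDy & _).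
assert (HG0 := HG); destruct HG0 as (HD & HNx & HNy & HN).
assert (Hh := hx_pos A Nx HD HNx : 0 < h); assert (Hk := ky_pos A Ny HD HNy : 0 < k).
assert (A0 := area_pos A HD).
destruct e2_le_eps as (Ee & Te & T0).
destruct flow_constants as [K'0 Cp1].
set (K' := 3 * K ^ 3 + (gamma A + 3) * K) in *.
set (Cp := K' + 1 + (5 + K' ^ 2) / gamma A) in *.
destruct (darcy_error_xy n HR ltac:(lia)) as [Dx Dy].
destruct (darcy_error_xy (S n) HR' ltac:(lia)) as [Dx' Dy'].
destruct (rho_pos_xy n HR) as [Px Py].
set (r := fun i j => gamma A * ((err_p (S n) i j - err_p n i j) / tau)
   + dtm tau err_phi (S n) i j + Dxm h (err_ux (S n)) i j + Dym k (err_uy (S n)) i j).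
set (Tx := edge_theta_rate A Nx Ny N (Pix P Nx Ny) (phi Sol) (Psi X) K n).
set (Ty := fun i j => edge_theta_rate (swapP A) Ny Nx N (trI (Piy P Nx Ny)) (swapf (phi Sol))
   (tr (Psi X)) K n j i).
assert (HG' := good_grid_swap A Nx Ny N HG).
assert (K3 : 0 <= K ^ 3) by (apply pow_le; lra).
assert (Kg : 0 <= (gamma A + 3) * K) by (apply Rmult_le_pos; lra).
assert (MAIN := pressure_step Nx Ny h k tau w (gamma A) K' (eps A Nx Ny N)
  (err_p n) (err_p (S n)) (dtm tau err_phi (S n)) r
  (rhox n) (rhox (S n)) (err_ux n) (err_ux (S n)) (thetax n) (thetax (S n)) Tx
  (rhoy n) (rhoy (S n)) (err_uy n) (err_uy (S n)) (thetay n) (thetay (S n)) Ty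
  HNx HNy Hh Hk T0 Hw Gam K'0).
assert (Hmain : energy_u (S n) + nM A Nx Ny (err_p (S n)) + tau * (gamma A / 4) * rate_p (S n)
  <= energy_u n + nM A Nx Ny (err_p n) + tau * Cp *
    (nE A Nx Ny (err_ux (S n)) (err_uy (S n)) + nE A Nx Ny Tx Ty
     + nM A Nx Ny (err_p (S n)) + nM A Nx Ny (dtm tau err_phi (S n)) + area A * eps A Nx Ny N ^ 2)).
{ unfold energy_u, rate_p, nM, nE; fold w.
  replace (S n - 1)%nat with n by lia.
  replace (area A * eps A Nx Ny N ^ 2) with (I2 w Nx Ny (fun _ _ => eps A Nx Ny N ^ 2))
    by (apply (I2_const_area A Nx Ny N _ HG)).
  eapply Rle_trans; [apply MAIN|]; clear MAIN.
  - intros i j Hij; split; [reflexivity|].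
    assert (Tp := dtm_truncation A Nx Ny N HG (p Sol) K n i j
      (Csm_le A 5 2 K _ ltac:(lia) (st_p _ _ _ _ _ _ _ _ ST)) Hij Hn).
    assert (Tphi := dtm_truncation A Nx Ny N HG (phi Sol) K n i j
      (Csm_le A 5 2 K _ ltac:(lia) (st_phi _ _ _ _ _ _ _ _ ST)) Hij Hn).
    assert (Tx' := Dxm_truncation A Nx Ny N HG (ux Sol) K (S n) i j
      (Csm_le A 5 3 K _ ltac:(lia) (st_ux _ _ _ _ _ _ _ _ ST)) Hij Hn).
    assert (Ty' := Dxm_truncation (swapP A) Ny Nx N HG' (swapf (uy Sol)) K (S n) j i
      (Csm_swap A 3 K _ (Csm_le A 5 3 K _ ltac:(lia) (st_uy _ _ _ _ _ _ _ _ ST)))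
      (conj (proj2 Hij) (proj1 Hij)) Hn).
    change (Rabs (Dym k (at_yedges A Nx Ny (fun x y => uy Sol x y (tn A N (S n)))) i j
      - py (uy Sol) (xc A Nx i) (yc A Ny j) (tn A N (S n))) <= K * k ^ 2) in Ty'.
    assert (M := sch_mass _ _ _ _ _ _ HX n i j Hn Hij).
    assert (ME := mass_eq A Sol HS _ _ _ (center_in_Omega A Nx Ny N HG i j Hij)
      (tn_pos A N n HD HN Hn)); unfold div2 in ME.
    unfold sample at 1, at_centers at 1 in M; rewrite <- ME in M; clear ME.
    fold h k tau in M; fold tau in Tp, Tphi; fold h in Tx'.
    assert (Er : r i j = - (gamma A * (dtm tau (sample A Nx Ny N (p Sol)) (S n) i j
         - pt (p Sol) (xc A Nx i) (yc A Ny j) (tn A N (S n))))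
      + (- (dtm tau (sample A Nx Ny N (phi Sol)) (S n) i j
         - pt (phi Sol) (xc A Nx i) (yc A Ny j) (tn A N (S n)))
      + (- (Dxm h (at_xedges A Nx Ny (fun x y => ux Sol x y (tn A N (S n)))) i j
         - px (ux Sol) (xc A Nx i) (yc A Ny j) (tn A N (S n)))
      + - (Dym k (at_yedges A Nx Ny (fun x y => uy Sol x y (tn A N (S n)))) i j
         - py (uy Sol) (xc A Nx i) (yc A Ny j) (tn A N (S n)))))).
    { transitivity ((gamma A * dtm tau (Pd X) (S n) i j + dtm tau (Psi X) (S n) i j
        + Dxm h (Ux X (S n)) i j + Dym k (Uy X (S n)) i j)
        - gamma A * dtm tau (sample A Nx Ny N (p Sol)) (S n) i j
        - dtm tau (sample A Nx Ny N (phi Sol)) (S n) i j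
        - Dxm h (at_xedges A Nx Ny (fun x y => ux Sol x y (tn A N (S n)))) i j
        - Dym k (at_yedges A Nx Ny (fun x y => uy Sol x y (tn A N (S n)))) i j);
      [|rewrite M; ring].
      unfold r, err_p, err_phi, err_ux, err_uy, err_center, err_xedge, err_yedge, dtm, Dxm, Dym.
      replace (S n - 1)%nat with n by lia; field; repeat split; lra. }
    rewrite Er; clear M Er.
    eapply Rle_trans; [apply Rabs_triang|].
    eapply Rle_trans; [apply Rplus_le_compat_l, Rabs_triang|].
    eapply Rle_trans; [apply Rplus_le_compat_l, Rplus_le_compat_l, Rabs_triang|].
    rewrite !Rabs_Ropp, Rabs_mult, (Rabs_pos_eq (gamma A)) by lra.
    assert (G1 : gamma A * Rabs (dtm tau (sample A Nx Ny N (p Sol)) (S n) i j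
         - pt (p Sol) (xc A Nx i) (yc A Ny j) (tn A N (S n))) <= gamma A * (K * tau))
      by (apply Rmult_le_compat_l; lra).
    assert (G2 : gamma A * (K * tau) <= gamma A * (K * eps A Nx Ny N))
      by (apply Rmult_le_compat_l; [lra|apply Rmult_le_compat_l; lra]).
    assert (G3 : K * tau + (K * h ^ 2 + K * k ^ 2) = K * eps A Nx Ny N)
      by (unfold eps, tau, h, k; ring).
    assert (0 <= (3 * K ^ 3 + 2 * K) * eps A Nx Ny N) by (apply Rmult_le_pos; lra).
    unfold K'; lra.
  - intros j Hj.
    destruct (sch_bdry_x _ _ _ _ _ _ HX n 0 j Hn (or_introl eq_refl) Hj) as (u0 & _).
    destruct (sch_bdry_x _ _ _ _ _ _ HX n Nx j Hn (or_intror eq_refl) Hj) as (u1 & _).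
    assert (X0 : xe A Nx 0 = Llx A) by (unfold xe; simpl; ring).
    assert (X1 : xe A Nx Nx = Lrx A) by (unfold xe, hx; field; apply not_0_INR; lia).
    assert (Ht := tn_pos A N n HD HN Hn); assert (Yj := yc_interior A Ny j HD Hj).
    destruct (no_flow_x A Sol HS (Llx A) _ _ (or_introl eq_refl) Yj Ht) as (z0 & _).
    destruct (no_flow_x A Sol HS (Lrx A) _ _ (or_intror eq_refl) Yj Ht) as (z1 & _).
    unfold err_ux, err_xedge, at_xedges; rewrite u0, u1, X0, X1, z0, z1; split; ring.
  - intros i Hi.
    destruct (sch_bdry_y _ _ _ _ _ _ HX n i 0 Hn (or_introl eq_refl) Hi) as (u0 & _).
    destruct (sch_bdry_y _ _ _ _ _ _ HX n i Ny Hn (or_intror eq_refl) Hi) as (u1 & _).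
    assert (X0 : ye A Ny 0 = Lly A) by (unfold ye; simpl; ring).
    assert (X1 : ye A Ny Ny = Lry A) by (unfold ye, ky; field; apply not_0_INR; lia).
    assert (Ht := tn_pos A N n HD HN Hn); assert (Xi := xc_interior A Nx i HD Hi).
    destruct (no_flow_y A Sol HS _ (Lly A) _ (or_introl eq_refl) Xi Ht) as (z0 & _).
    destruct (no_flow_y A Sol HS _ (Lry A) _ (or_intror eq_refl) Xi Ht) as (z1 & _).
    unfold err_uy, err_yedge, at_yedges; rewrite u0, u1, X0, X1, z0, z1; split; ring.
  - intros i j Hij; split; [specialize (Px i j Hij); lra|split; [now apply Dx|split; [now apply Dx'|split]]].
    + eapply Rle_trans; [apply (edge_rho_step _ _ _ _ _ _ _ _ _ _ _ _ HDx n i j Hij Hn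
        (proj1 HR) (proj1 HR'))|].
      apply Rmult_le_compat_r; [lra|unfold K'; lra].
    + exact (edge_theta_step _ _ _ _ _ _ _ _ _ _ _ _ HDx n i j Hij Hn (proj1 HR) (proj1 HR')).
  - intros i j Hij; assert (Hji : is_xedge Ny Nx j i) by (destruct Hij; split; assumption).
    split; [specialize (Py i j Hij); lra|split; [now apply Dy|split; [now apply Dy'|split]]].
    + eapply Rle_trans; [apply (edge_rho_step _ _ _ _ _ _ _ _ _ _ _ _ HDy n j i Hji Hn
        (proj2 HR) (proj2 HR'))|].
      apply Rmult_le_compat_r; [lra|unfold K'; lra].
    + exact (edge_theta_step _ _ _ _ _ _ _ _ _ _ _ _ HDy n j i Hji Hn (proj2 HR) (proj2 HR')).
  - fold Cp; apply Req_le; unfold Cp; ring. }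
clear MAIN.
assert (HT : nE A Nx Ny Tx Ty <= 200 * K ^ 11 * (nM A Nx Ny (err_phi (S n)) + nM A Nx Ny (err_phi n)
   + nM A Nx Ny (dtm tau err_phi (S n)) + area A * eps A Nx Ny N ^ 2)).
{ assert (Ex := edge_theta_rate_sum _ _ _ _ _ _ _ _ _ _ _ _ HDx w n (Rlt_le _ _ Hw)).
  assert (Ey := edge_theta_rate_sum _ _ _ _ _ _ _ _ _ _ _ _ HDy w n (Rlt_le _ _ Hw)).
  rewrite e2_swap in Ey; fold e2 in Ex.
  assert (K11 : 0 <= K ^ 11) by (apply pow_le; lra).
  assert (E2 := e2_norm).
  assert (Sy : I2 w Nx (Ny - 1) (fun i j => Ty i j ^ 2)
    <= 100 * K ^ 11 * (nM A Nx Ny (err_phi (S n)) + nM A Nx Ny (err_phi n)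
   + nM A Nx Ny (dtm tau err_phi (S n)) + I2 w Nx Ny (fun _ _ => e2 ^ 2))).
  { unfold nM; fold w; rewrite (I2_swap w Nx (Ny - 1)),
      (I2_swap w Nx Ny (fun i j => err_phi (S n) i j ^ 2)),
      (I2_swap w Nx Ny (fun i j => err_phi n i j ^ 2)),
      (I2_swap w Nx Ny (fun i j => dtm tau err_phi (S n) i j ^ 2)),
      (I2_swap w Nx Ny (fun i j => e2 ^ 2)); exact Ey. }
  change (I2 w (Nx - 1) Ny (fun i j => Tx i j ^ 2) <= 100 * K ^ 11 *
    (nM A Nx Ny (err_phi (S n)) + nM A Nx Ny (err_phi n)
     + nM A Nx Ny (dtm tau err_phi (S n)) + I2 w Nx Ny (fun _ _ => e2 ^ 2))) in Ex.
  unfold nE; fold w.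
  assert (100 * K ^ 11 * I2 w Nx Ny (fun _ _ => e2 ^ 2)
    <= 100 * K ^ 11 * (area A * eps A Nx Ny N ^ 2)) by (apply Rmult_le_compat_l; lra).
  lra. }
assert (Hphi : nM A Nx Ny (err_phi (S n)) <= nM A Nx Ny (err_phi n)
   + tau * (nM A Nx Ny (err_phi (S n)) + nM A Nx Ny (dtm tau err_phi (S n)))).
{ unfold nM; fold w; rewrite <- I2_plus, <- I2_scal, <- I2_plus.
  apply I2_le; [lra|]; intros i j Hi Hj.
  set (d := dtm tau err_phi (S n) i j).
  assert (E : err_phi n i j = err_phi (S n) i j - tau * d).
  { unfold d, dtm; replace (S n - 1)%nat with n by lia; field; lra. }
  rewrite E; set (a := err_phi (S n) i j).
  assert (0 <= tau * (a - d) ^ 2) by (apply Rmult_le_pos; [lra|apply pow2_ge_0]).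
  generalize (pow2_ge_0 (tau * d)); lra. }
assert (HV := velocity_energy (S n) HR').
assert (Hd := porosity_rate_norm n Hn).
assert (U0 := energy_u_ge0 n HR); assert (U1 := energy_u_ge0 (S n) HR').
assert (N1 := nM_ge0 A Nx Ny N (err_p n) HG); assert (N2 := nM_ge0 A Nx Ny N (err_p (S n)) HG).
assert (N3 := nM_ge0 A Nx Ny N (err_phi n) HG); assert (N4 := nM_ge0 A Nx Ny N (err_phi (S n)) HG).
assert (N5 := nM_ge0 A Nx Ny N (dtm tau err_phi (S n)) HG).
assert (N6 := nM_ge0 A Nx Ny N (err_c n) HG); assert (N7 := nM_ge0 A Nx Ny N (err_T n) HG).
assert (N8 := pow2_ge_0 (eps A Nx Ny N)).
unfold energy_flow, Cflow; fold K'; fold Cp.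
set (eu := energy_u n) in *; set (eu' := energy_u (S n)) in *.
set (q := nM A Nx Ny (err_p n)) in *; set (q' := nM A Nx Ny (err_p (S n))) in *.
set (f := nM A Nx Ny (err_phi n)) in *; set (f' := nM A Nx Ny (err_phi (S n))) in *.
set (d := nM A Nx Ny (dtm tau err_phi (S n))) in *.
set (c := nM A Nx Ny (err_c n)) in *; set (z := nM A Nx Ny (err_T n)) in *.
set (ee := eps A Nx Ny N ^ 2) in *; set (t := rate_p (S n)) in *.
set (v := nE A Nx Ny (err_ux (S n)) (err_uy (S n))) in *; set (T := nE A Nx Ny Tx Ty) in *.
set (ar := area A) in *.
assert (K11 : 0 <= K ^ 11) by (apply pow_le; lra).
set (M := 200 * K ^ 11) in *; assert (M0 : 0 <= M) by (unfold M; lra).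
set (C1 := 1 + Cp * (2 * K + (1 + M) * (1 + ar))).
assert (Mar : 0 <= (1 + M) * ar) by (apply Rmult_le_pos; lra).
assert (B1 : Cp * (v + T + q' + d + ar * ee) + f' + d <= C1 * (eu' + q' + f' + f + d + ee)).
{ assert (B2 : Cp * (v + T + q' + d + ar * ee) <= Cp * (2 * K * eu' + M * (f' + f + d + ar * ee)
     + q' + d + ar * ee)) by (apply Rmult_le_compat_l; lra).
  assert (B3 : 2 * K * eu' + M * (f' + f + d + ar * ee) + q' + d + ar * ee
    <= (2 * K + (1 + M) * (1 + ar)) * (eu' + q' + f' + f + d + ee)).
  { assert (0 <= (2 * K) * (q' + f' + f + d + ee)) by (apply Rmult_le_pos; lra).
    assert (0 <= (1 + M) * (eu' + ee)) by (apply Rmult_le_pos; lra).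
    assert (0 <= M * q') by (apply Rmult_le_pos; lra).
    assert (0 <= ((1 + M) * ar) * (eu' + q' + f' + f + d)) by (apply Rmult_le_pos; lra).
    lra. }
  assert (B4 : Cp * (2 * K * eu' + M * (f' + f + d + ar * ee) + q' + d + ar * ee)
    <= Cp * ((2 * K + (1 + M) * (1 + ar)) * (eu' + q' + f' + f + d + ee)))
    by (apply Rmult_le_compat_l; lra).
  unfold C1; lra. }
assert (C10 : 0 <= C1).
{ unfold C1; assert (0 <= Cp * (2 * K + (1 + M) * (1 + ar))) by (apply Rmult_le_pos; lra). lra. }
set (D := 4 * K ^ 2 * (1 + ar)) in *.
assert (D0 : 0 <= D) by (unfold D; apply Rmult_le_pos; [nra|lra]).
assert (B5 : eu' + q' + f' + f + d + ee <= (1 + D) * (eu' + q' + f' + (eu + q + f) + c + z + ee)).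
{ assert (0 <= D * (eu' + q' + (eu + q + f))) by (apply Rmult_le_pos; lra). lra. }
assert (B6 : C1 * (eu' + q' + f' + f + d + ee)
  <= C1 * ((1 + D) * (eu' + q' + f' + (eu + q + f) + c + z + ee)))
  by (apply Rmult_le_compat_l; lra).
assert (B7 : tau * (Cp * (v + T + q' + d + ar * ee) + f' + d)
  <= tau * (C1 * ((1 + D) * (eu' + q' + f' + (eu + q + f) + c + z + ee))))
  by (apply Rmult_le_compat_l; lra).
lra.
Qed.

End Run.

(** * Consequences of the discrete Sobolev inequality *)

Lemma oscillation_x A Nx Ny N (g : gridfun) i j : good_grid A Nx Ny N ->
  hx A Nx <= Lry A - Lly A -> is_xedge Nx Ny i j ->
  (g (S i) j - g i j) ^ 2 <= 6 * nD A Nx Ny g.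
Proof.
intros (HD & HNx & HNy & _) HL Hij.
assert (E := neighbour_oscillation Nx Ny (hx A Nx) (ky A Ny) g i j (hx_pos A Nx HD HNx)
  (ky_pos A Ny HD HNy)).
replace (INR Ny * ky A Ny) with (Lry A - Lly A) in E
  by (unfold ky; field; apply not_0_INR; lia).
eapply Rle_trans; [apply E; assumption|].
unfold nD, nE; rewrite !I2_S2; lra.
Qed.

Lemma oscillation_y A Nx Ny N (g : gridfun) i j : good_grid A Nx Ny N ->
  ky A Ny <= Lrx A - Llx A -> is_yedge Nx Ny i j ->
  (g i (S j) - g i j) ^ 2 <= 6 * nD A Nx Ny g.
Proof.
intros HG HL [Hi Hj].
assert (E := oscillation_x (swapP A) Ny Nx N (fun a b => g b a) j i
  (good_grid_swap _ _ _ _ HG) HL (conj Hj Hi)).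
eapply Rle_trans; [exact E|]; apply Req_le; f_equal.
unfold nD, nE; rewrite Rplus_comm; f_equal.
- rewrite (I2_swap _ (Nx - 1) Ny), Rmult_comm; reflexivity.
- rewrite (I2_swap _ Nx (Ny - 1)), Rmult_comm; reflexivity.
Qed.

Lemma pow2_le_abs a b : 0 <= b -> a ^ 2 <= b ^ 2 -> Rabs a <= b.
Proof.
intros Hb H; rewrite <- (Rabs_pos_eq b) by assumption.
apply Rsqr_le_abs_0; rewrite !Rsqr_pow2; exact H.
Qed.

Section Small.

Variables (A : problem) (Sol : state) (P : interp) (K lo hi lo0 hi1 : R).
Hypotheses (ST : setting A Sol P K lo hi lo0 hi1) (HA : standing_assumptions A)
  (HS : exact_solution A Sol).

Let HK : 1 <= K := st_K _ _ _ _ _ _ _ _ ST.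
Let HD : nonempty_domain A := st_domain _ _ _ _ _ _ _ _ ST.

Lemma initial_errors Nx Ny N X : good_grid A Nx Ny N -> scheme A P Nx Ny N X ->
  forall i j, is_cell Nx Ny i j ->
  err_phi A Sol Nx Ny N X 0 i j = 0 /\ err_p A Sol Nx Ny N X 0 i j = 0 /\
  err_c A Sol Nx Ny N X 0 i j = 0 /\ err_T A Sol Nx Ny N X 0 i j = 0.
Proof.
intros HG HX i j Hij.
destruct (sch_init _ _ _ _ _ _ HX i j Hij) as (I1 & I2 & I3 & I4).
destruct (initial_data A Sol HS _ _ (center_in_Omega A Nx Ny N HG i j Hij)) as (J1 & J2 & J3 & J4).
assert (T0 : tn A N 0 = 0) by (unfold tn; simpl; ring).
unfold err_phi, err_p, err_c, err_T, err_center, sample.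
rewrite I1, I2, I3, I4, T0; unfold at_centers; rewrite J1, J2, J3, J4.
repeat split; ring.
Qed.

(** As long as the total dissipation of the concentration and temperature errors
    is small, the porosity varies so little between neighbouring cells that its
    interpolation stays in the admissible interval, whatever the signs of the weights.
    The bound [Rabs a <= zeta / 2 + a ^ 2 / (2 * zeta)] turns the sum of differences over
    the time levels into a sum of squares. *)
Lemma range_of_dissipation : exists delta, 0 < delta /\
  forall Nx Ny N X n, good_grid A Nx Ny N -> scheme A P Nx Ny N X -> (n <= N)%nat ->
  hx A Nx <= delta -> ky A Ny <= delta ->
  psum (fun m => dt A N * (nD A Nx Ny (err_c A Sol Nx Ny N X m)
                           + nD A Nx Ny (err_T A Sol Nx Ny N X m))) n <= delta ->
  in_range P lo hi Nx Ny X n.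
Proof.
set (mg := Rmin (lo0 - lo) (hi - hi1)).
assert (Hmg : 0 < mg).
{ apply Rmin_pos; [generalize (st_lo0 _ _ _ _ _ _ _ _ ST)|generalize (st_hi1 _ _ _ _ _ _ _ _ ST)]; lra. }
assert (HQ : 0 < Qend A) by apply HD.
assert (K2 : 1 <= K ^ 2) by (apply pow_R1_Rle; lra).
assert (K3 : 1 <= K ^ 3) by (apply pow_R1_Rle; lra).
set (zeta := mg / (4 * K ^ 2 * (Qend A + 1))).
assert (Hz0 : 0 < 4 * K ^ 2 * (Qend A + 1)) by (apply Rmult_lt_0_compat; lra).
assert (Hz : 0 < zeta) by (apply Rdiv_lt_0_compat; assumption).
set (d1 := zeta * mg / (12 * K ^ 2)); set (d2 := mg / (4 * K ^ 3 * (1 + 2 * Qend A))).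
assert (Hd2' : 0 < 4 * K ^ 3 * (1 + 2 * Qend A)) by (apply Rmult_lt_0_compat; lra).
assert (Hd1 : 0 < d1) by (apply Rdiv_lt_0_compat; [now apply Rmult_lt_0_compat|lra]).
assert (Hd2 : 0 < d2) by (apply Rdiv_lt_0_compat; lra).
set (L := Rmin (Lrx A - Llx A) (Lry A - Lly A)).
assert (HL : 0 < L) by (destruct HD as (a & b & _); apply Rmin_pos; lra).
exists (Rmin (Rmin d1 d2) L); split; [apply Rmin_pos; [apply Rmin_pos|]; assumption|].
intros Nx Ny N X n HG HX Hn Hh Hk Hsum.
assert (M1 := Rmin_l (Rmin d1 d2) L); assert (M2 := Rmin_r (Rmin d1 d2) L).
assert (M3 := Rmin_l d1 d2); assert (M4 := Rmin_r d1 d2).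
assert (M5 := Rmin_l (Lrx A - Llx A) (Lry A - Lly A)); fold L in M5.
assert (M6 := Rmin_r (Lrx A - Llx A) (Lry A - Lly A)); fold L in M6.
destruct (st_grid _ _ _ _ _ _ _ _ ST Nx Ny N X HG HX) as (HDx & HDy & HPsi & Hdiff & _).
assert (HG0 := HG); destruct HG0 as (_ & HNx & HNy & HN).
assert (Ht := dt_pos A N HD HN); set (tau := dt A N) in *.
assert (Sc := st_c _ _ _ _ _ _ _ _ ST); assert (STT := st_T _ _ _ _ _ _ _ _ ST).
assert (Sphi := st_phi _ _ _ _ _ _ _ _ ST).
set (De := fun m => nD A Nx Ny (err_c A Sol Nx Ny N X m)
                           + nD A Nx Ny (err_T A Sol Nx Ny N X m)) in *.
(* differences between neighbours, for both directions *)
assert (Hnb : forall i j i' j' s, is_cell Nx Ny i j -> is_cell Nx Ny i' j' -> 0 < s -> s <= d2 ->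
  (forall g m, (m <= N)%nat -> Csm A 1 K g ->
     Rabs (sample A Nx Ny N g m i' j' - sample A Nx Ny N g m i j) <= K * s) ->
  (forall g, (g i' j' - g i j) ^ 2 <= 6 * nD A Nx Ny g) ->
  Rabs (Psi X n i' j' - Psi X n i j) <= mg / K).
{ intros i j i' j' s Hij Hij' Hs Hsd Hsm Hosc.
  eapply Rle_trans; [apply (Hdiff n i j i' j' Hij Hij' Hn)|].
  assert (E0 : Rabs (Psi X 0%nat i' j' - Psi X 0%nat i j) <= K * s).
  { destruct (initial_errors Nx Ny N X HG HX i j Hij) as (F & _).
    destruct (initial_errors Nx Ny N X HG HX i' j' Hij') as (F' & _).
    unfold err_phi, err_center in F, F'.
    replace (Psi X 0%nat i' j' - Psi X 0%nat i j) with
      (sample A Nx Ny N (phi Sol) 0 i' j' - sample A Nx Ny N (phi Sol) 0 i j) by lra.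
    apply Hsm; [lia|apply (Csm_le A 5 1); [lia|assumption]]. }
  assert (Hone : forall G (g : field) m, (m <= N)%nat -> Csm A 5 K g ->
    Rabs (G m i' j' - G m i j) <= K * s + zeta / 2 + 3 / zeta *
      nD A Nx Ny (err_center A Nx Ny N G g m)).
  { intros G g m Hm Hg.
    assert (O := Hosc (err_center A Nx Ny N G g m)).
    set (de := err_center A Nx Ny N G g m i' j' - err_center A Nx Ny N G g m i j) in *.
    set (D := nD A Nx Ny (err_center A Nx Ny N G g m)) in *.
    assert (B : Rabs de <= zeta / 2 + 3 / zeta * D).
    { assert (B1 : 0 <= (Rabs de - zeta) ^ 2 / (2 * zeta))
        by (apply Rdiv_le_0_compat; [apply pow2_ge_0|lra]).
      replace ((Rabs de - zeta) ^ 2 / (2 * zeta)) with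
        (Rabs de ^ 2 / (2 * zeta) - Rabs de + zeta / 2) in B1 by (field; lra).
      rewrite pow2_abs in B1.
      assert (B2 : de ^ 2 / (2 * zeta) <= 6 * D / (2 * zeta)).
      { apply Rmult_le_compat_r; [apply Rlt_le, Rinv_0_lt_compat; lra|assumption]. }
      replace (6 * D / (2 * zeta)) with (3 / zeta * D) in B2 by (field; lra). lra. }
    replace (G m i' j' - G m i j) with
      ((sample A Nx Ny N g m i' j' - sample A Nx Ny N g m i j) + de)
      by (unfold de, err_center; ring).
    eapply Rle_trans; [apply Rabs_triang|].
    assert (B3 := Hsm g m Hm (Csm_le A 5 1 K g ltac:(lia) Hg)); lra. }
  assert (Es : psum (fun m => tau * (Rabs (Cf X m i' j' - Cf X m i j)
      + Rabs (Z X m i' j' - Z X m i j))) n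
    <= Qend A * (2 * K * s + zeta) + 3 / zeta * d1).
  { apply Rle_trans with (psum (fun m => tau * (2 * K * s + zeta) + 3 / zeta * (tau * De m)) n).
    - apply psum_le; intros m Hm.
      assert (B1 := Hone (Cf X) (cf Sol) m ltac:(lia) Sc).
      assert (B2 := Hone (Z X) (Tf Sol) m ltac:(lia) STT).
      replace (tau * (2 * K * s + zeta) + 3 / zeta * (tau * De m)) with
        (tau * (2 * K * s + zeta + 3 / zeta * De m)) by ring.
      apply Rmult_le_compat_l; [lra|]. unfold De, err_c, err_T; lra.
    - rewrite psum_plus, psum_const, psum_scal; apply Rplus_le_compat.
      + rewrite <- Rmult_assoc; apply Rmult_le_compat_r.
        * assert (0 <= K * s) by (apply Rmult_le_pos; lra); lra.
        * apply (tn_bounds A N n HD HN Hn).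
      + apply Rmult_le_compat_l; [apply Rdiv_le_0_compat; lra|].
        apply Rle_trans with (2 := Rle_trans _ _ _ M1 M3); exact Hsum. }
  assert (F : K * (K * s + (Qend A * (2 * K * s + zeta) + 3 / zeta * d1)) <= mg / K).
  { apply Rmult_le_reg_r with K; [lra|].
    replace (mg / K * K) with mg by (field; lra).
    assert (F1 : K ^ 3 * (1 + 2 * Qend A) * s <= mg / 4).
    { apply Rle_trans with (K ^ 3 * (1 + 2 * Qend A) * d2).
      - apply Rmult_le_compat_l; [apply Rmult_le_pos; lra|assumption].
      - apply Req_le; unfold d2; field; split; lra. }
    assert (F2 : K ^ 2 * (Qend A * zeta) <= mg / 4).
    { assert (F3 : 4 * K ^ 2 * (Qend A + 1) * zeta = mg) by (unfold zeta; field; split; lra).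
      assert (0 <= K ^ 2 * zeta) by (apply Rmult_le_pos; lra). lra. }
    assert (F3 : K ^ 2 * (3 / zeta * d1) = mg / 4) by (unfold d1; field; split; lra).
    replace (K * (K * s + (Qend A * (2 * K * s + zeta) + 3 / zeta * d1)) * K) with
      (K ^ 3 * (1 + 2 * Qend A) * s + K ^ 2 * (Qend A * zeta) + K ^ 2 * (3 / zeta * d1)) by ring.
    lra. }
  apply Rle_trans with (K * (K * s + (Qend A * (2 * K * s + zeta) + 3 / zeta * d1)));
    [apply Rmult_le_compat_l; lra|exact F]. }
assert (G1 := Rmin_l (lo0 - lo) (hi - hi1)); assert (G2 := Rmin_r (lo0 - lo) (hi - hi1)).
fold mg in G1, G2.
split.
- intros i j [Hi Hj].
  assert (B := si_sup _ _ _ _ (ed_stable _ _ _ _ _ _ _ _ _ _ _ _ HDx) (Psi X n) (mg / K) j Hj).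
  assert (B' : Rabs (Pix P Nx Ny (Psi X n) i j - (Psi X n i j + Psi X n (S i) j) / 2) <= K * (mg / K)).
  { apply B; [|assumption]. intros a Ha.
    apply (Hnb a j (S a) j (hx A Nx)); try (split; lia); try lra.
    - now apply hx_pos.
    - intros g m Hm Hg; apply (sample_neighbours A Nx Ny N HG g K m a j Hg); [split; lia|assumption].
    - intros g; apply (oscillation_x A Nx Ny N); [assumption|lra|split; lia]. }
  replace (K * (mg / K)) with mg in B' by (field; lra).
  apply Rabs_le_between in B'.
  assert (R1 := HPsi n i j ltac:(split; lia) Hn); assert (R2 := HPsi n (S i) j ltac:(split; lia) Hn).
  lra.
- intros j i [Hj Hi].
  assert (B := si_sup _ _ _ _ (ed_stable _ _ _ _ _ _ _ _ _ _ _ _ HDy) (tr (Psi X) n) (mg / K) i Hi).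
  assert (B' : Rabs (trI (Piy P Nx Ny) (tr (Psi X) n) j i
     - (Psi X n i j + Psi X n i (S j)) / 2) <= K * (mg / K)).
  { apply B; [|assumption]. intros b Hb.
    apply (Hnb i b i (S b) (ky A Ny)); try (split; lia); try lra.
    - now apply ky_pos.
    - intros g m Hm Hg.
      apply (sample_neighbours (swapP A) Ny Nx N (good_grid_swap _ _ _ _ HG) (swapf g) K m b i
        (Csm_swap A 1 K g Hg)); [split; lia|assumption].
    - intros g; apply (oscillation_y A Nx Ny N); [assumption|lra|split; lia]. }
  replace (K * (mg / K)) with mg in B' by (field; lra).
  apply Rabs_le_between in B'.
  assert (R1 := HPsi n i j ltac:(split; lia) Hn); assert (R2 := HPsi n i (S j) ltac:(split; lia) Hn).
  lra.
Qed.

Lemma nM_zero Nx Ny g : (forall i j, is_cell Nx Ny i j -> g i j = 0) -> nM A Nx Ny g = 0.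
Proof.
intros H; unfold nM; rewrite (I2_ext _ _ _ _ (fun _ _ => 0 * 0)).
- rewrite I2_scal; ring.
- intros i j Hi Hj; rewrite H by (split; assumption); ring.
Qed.

Lemma nD_zero Nx Ny g : (forall i j, is_cell Nx Ny i j -> g i j = 0) -> nD A Nx Ny g = 0.
Proof.
intros H; unfold nD, nE; rewrite (I2_ext _ (Nx - 1) Ny _ (fun _ _ => 0 * 0)),
  (I2_ext _ Nx (Ny - 1) _ (fun _ _ => 0 * 0)).
- rewrite !I2_scal; ring.
- intros i j Hi Hj; unfold dym; rewrite !H by (split; lia); unfold Rdiv; ring.
- intros i j Hi Hj; unfold dxm; rewrite !H by (split; lia); unfold Rdiv; ring.
Qed.

(** The initial errors at the cells vanish, and the initial velocity error is the
    consistency error of Darcy's law. *)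
Lemma initial_energy Nx Ny N X : good_grid A Nx Ny N -> scheme A P Nx Ny N X ->
  in_range P lo hi Nx Ny X 0 ->
  energy_flow A Sol P Nx Ny N X 0 <= 16 * K ^ 10 * area A * eps A Nx Ny N ^ 2.
Proof.
intros HG HX HR.
assert (HI := initial_errors Nx Ny N X HG HX).
destruct (rho_pos_xy A Sol P K lo hi lo0 hi1 ST Nx Ny N X HG HX 0 HR) as [Px Py].
assert (T := theta_norm A Sol P K lo hi lo0 hi1 ST Nx Ny N X HG HX 0 HR ltac:(lia)).
assert (HG0 := HG); destruct HG0 as (_ & HNx & HNy & HN).
assert (Hh := hx_pos A Nx HD HNx); assert (Hk := ky_pos A Ny HD HNy).
assert (Hw := cell_weight_pos A Nx Ny N HG).
assert (N1 : nM A Nx Ny (err_phi A Sol Nx Ny N X 0) = 0)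
  by (apply nM_zero; intros i j Hij; apply (HI i j Hij)).
assert (N2 : nM A Nx Ny (err_p A Sol Nx Ny N X 0) = 0)
  by (apply nM_zero; intros i j Hij; apply (HI i j Hij)).
unfold energy_flow; rewrite N1, N2; rewrite N1 in T.
assert (Hpt : forall r t, 0 < / K <= r /\ r <= K -> r * (- (0 + t) / r) ^ 2 <= K * t ^ 2).
{ intros r t [a b].
  replace (r * (- (0 + t) / r) ^ 2) with (/ r * t ^ 2) by (field; lra).
  apply Rmult_le_compat_r; [apply pow2_ge_0|].
  rewrite <- (Rinv_inv K); apply Rinv_le_contravar; lra. }
assert (E : energy_u A Sol P Nx Ny N X 0 <=
  / 2 * (K * nE A Nx Ny (thetax A Sol P Nx Ny N X 0) (thetay A Sol P Nx Ny N X 0))).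
{ unfold energy_u, nE; apply Rmult_le_compat_l; [lra|].
  rewrite Rmult_plus_distr_l, <- !I2_scal; apply Rplus_le_compat; apply I2_le; try lra;
    intros i j Hi Hj.
  - unfold err_ux; cbv beta iota.
    replace (dxm (hx A Nx) (err_p A Sol Nx Ny N X 0) i j) with 0.
    + apply Hpt, Px; split; lia.
    + unfold dxm.
      destruct (HI i j ltac:(split; lia)) as (_ & -> & _).
      destruct (HI (S i) j ltac:(split; lia)) as (_ & -> & _); unfold Rdiv; ring.
  - unfold err_uy; cbv beta iota.
    replace (dym (ky A Ny) (err_p A Sol Nx Ny N X 0) i j) with 0.
    + apply Hpt, Py; split; lia.
    + unfold dym.
      destruct (HI i j ltac:(split; lia)) as (_ & -> & _).
      destruct (HI i (S j) ltac:(split; lia)) as (_ & -> & _); unfold Rdiv; ring. }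
assert (E2 : / 2 * (K * nE A Nx Ny (thetax A Sol P Nx Ny N X 0) (thetay A Sol P Nx Ny N X 0))
  <= / 2 * (K * (16 * K ^ 9 * (0 + area A * eps A Nx Ny N ^ 2))))
  by (apply Rmult_le_compat_l; [lra|apply Rmult_le_compat_l; lra]).
assert (0 <= K ^ 10 * area A * eps A Nx Ny N ^ 2).
{ apply Rmult_le_pos; [apply Rmult_le_pos|apply pow2_ge_0].
  - apply pow_le; lra.
  - apply Rlt_le, area_pos, HD. }
lra.
Qed.

(** The velocity times the mesh size is small, because so are the differences of the
    pressure error between neighbours. *)
Lemma velocity_small eta : 0 < eta -> exists kappa, 0 < kappa /\
  forall Nx Ny N X n, good_grid A Nx Ny N -> scheme A P Nx Ny N X -> (n < N)%nat ->
  in_range P lo hi Nx Ny X (S n) ->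
  hx A Nx <= kappa -> ky A Ny <= kappa ->
  nD A Nx Ny (err_p A Sol Nx Ny N X (S n)) <= kappa ->
  (forall i j, is_xedge Nx Ny i j -> hx A Nx * Rabs (Ux X (S n) i j) <= eta) /\
  (forall i j, is_yedge Nx Ny i j -> ky A Ny * Rabs (Uy X (S n) i j) <= eta).
Proof.
intros Heta.
assert (K2 : 1 <= K ^ 2) by (apply pow_R1_Rle; lra).
set (d1 := eta / (2 * K ^ 2)); set (d2 := (eta / (2 * K)) ^ 2 / 6).
assert (Hd1 : 0 < d1) by (apply Rdiv_lt_0_compat; lra).
assert (He : 0 < eta / (2 * K)) by (apply Rdiv_lt_0_compat; lra).
assert (Hd2 : 0 < d2) by (apply Rdiv_lt_0_compat; [now apply pow_lt|lra]).
set (L := Rmin (Lrx A - Llx A) (Lry A - Lly A)).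
assert (HL : 0 < L) by (destruct HD as (a & b & _); apply Rmin_pos; lra).
exists (Rmin (Rmin d1 d2) L); split; [apply Rmin_pos; [apply Rmin_pos|]; assumption|].
intros Nx Ny N X n HG HX Hn [R1 R2] Hh Hk HDq.
assert (M1 := Rmin_l (Rmin d1 d2) L); assert (M2 := Rmin_r (Rmin d1 d2) L).
assert (M3 := Rmin_l d1 d2); assert (M4 := Rmin_r d1 d2).
assert (M5 := Rmin_l (Lrx A - Llx A) (Lry A - Lly A)); fold L in M5.
assert (M6 := Rmin_r (Lrx A - Llx A) (Lry A - Lly A)); fold L in M6.
destruct (st_grid _ _ _ _ _ _ _ _ ST Nx Ny N X HG HX) as (HDx & HDy & _).
assert (Hfin : forall s dq, s <= d1 -> dq ^ 2 <= 6 * nD A Nx Ny (err_p A Sol Nx Ny N X (S n)) ->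
  K * (K * s + Rabs dq) <= eta).
{ intros s dq Hs Hdq.
  assert (B : Rabs dq <= eta / (2 * K)).
  { apply pow2_le_abs; [lra|].
    replace ((eta / (2 * K)) ^ 2) with (6 * d2) by (unfold d2; field; lra). lra. }
  assert (B2 : K ^ 2 * s <= K ^ 2 * d1) by (apply Rmult_le_compat_l; lra).
  replace (K ^ 2 * d1) with (eta / 2) in B2 by (unfold d1; field; lra).
  assert (B3 : K * Rabs dq <= K * (eta / (2 * K))) by (apply Rmult_le_compat_l; lra).
  replace (K * (eta / (2 * K))) with (eta / 2) in B3 by (field; lra).
  replace (K * (K * s + Rabs dq)) with (K ^ 2 * s + K * Rabs dq) by ring; lra. }
split; intros i j Hij.
- eapply Rle_trans; [apply (velocity_bound _ _ _ _ _ _ _ _ _ _ _ _ HDx (S n) (Ux X (S n)) (Pd X) i j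
    Hij R1 Hn)|].
  + apply (sch_darcy_x _ _ _ _ _ _ HX n i j); assumption.
  + apply Hfin; [lra|]. apply (oscillation_x A Nx Ny N _ i j HG); [lra|assumption].
- assert (Hji : is_xedge Ny Nx j i) by (destruct Hij; split; assumption).
  eapply Rle_trans; [apply (velocity_bound _ _ _ _ _ _ _ _ _ _ _ _ HDy (S n) (tr (Uy X) (S n))
    (tr (Pd X)) j i Hji R2 Hn)|].
  + apply (sch_darcy_y _ _ _ _ _ _ HX n i j); assumption.
  + apply (Hfin (ky A Ny)); [lra|].
    apply (oscillation_y A Nx Ny N (err_p A Sol Nx Ny N X (S n)) i j HG); [lra|assumption].
Qed.

(** By the mass balance, in which the time increments of the exact pressure and of both
    porosities are bounded. *)
Lemma divergence_bound Nx Ny N X n i j : good_grid A Nx Ny N -> scheme A P Nx Ny N X ->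
  (n < N)%nat -> is_cell Nx Ny i j ->
  Rabs (Dxm (hx A Nx) (Ux X (S n)) i j + Dym (ky A Ny) (Uy X (S n)) i j
    + gamma A * ((err_p A Sol Nx Ny N X (S n) i j - err_p A Sol Nx Ny N X n i j) / dt A N))
  <= (2 * gamma A + 4) * K.
Proof.
intros HG HX Hn Hij.
assert (HG0 := HG); destruct HG0 as (_ & HNx & HNy & HN).
assert (Ht := dt_pos A N HD HN); assert (Gam := gamma_pos A HA).
assert (HO := center_in_Omega A Nx Ny N HG i j Hij).
assert (HB := center_in_box A Nx Ny N HG i j (S n) Hij Hn).
assert (M := sch_mass _ _ _ _ _ _ HX n i j Hn Hij).
assert (ME := mass_eq A Sol HS _ _ _ HO (tn_pos A N n HD HN Hn)); unfold div2 in ME.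
unfold sample at 1, at_centers at 1 in M; rewrite <- ME in M; clear ME.
assert (Sp := st_p _ _ _ _ _ _ _ _ ST); assert (Sphi := st_phi _ _ _ _ _ _ _ _ ST).
assert (Sux := st_ux _ _ _ _ _ _ _ _ ST); assert (Suy := st_uy _ _ _ _ _ _ _ _ ST).
assert (B1 := Csm_bound A 4 K _ _ _ _ (Csm_pt A 4 K _ Sp) HB).
assert (B2 := Csm_bound A 4 K _ _ _ _ (Csm_pt A 4 K _ Sphi) HB).
assert (B3 := Csm_bound A 4 K _ _ _ _ (Csm_px A 4 K _ Sux) HB).
assert (B4 := Csm_bound A 4 K _ _ _ _ (Csm_py A 4 K _ Suy) HB).
assert (Lp := time_lipschitz A Nx Ny N HG (p Sol) K (xc A Nx i) (yc A Ny j) n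
  (Csm_le A 5 1 K _ ltac:(lia) Sp) (proj1 HB) Hn).
destruct (st_grid _ _ _ _ _ _ _ _ ST Nx Ny N X HG HX) as (HDx & _).
assert (St := ed_step _ _ _ _ _ _ _ _ _ _ _ _ HDx n i j Hn Hij).
assert (Hdiv : forall a, Rabs a <= K * dt A N -> Rabs (a / dt A N) <= K).
{ intros a Ha; unfold Rdiv; rewrite Rabs_mult, Rabs_inv, (Rabs_pos_eq (dt A N)) by lra.
  apply Rmult_le_reg_r with (dt A N); [assumption|]. rewrite Rmult_assoc, Rinv_l by lra; lra. }
apply Hdiv in Lp; apply Hdiv in St.
set (tp := pt (p Sol) _ _ _) in *; set (tf := pt (phi Sol) _ _ _) in *.
set (ax := px (ux Sol) _ _ _) in *; set (ay := py (uy Sol) _ _ _) in *.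
set (lp := (_ - _) / dt A N) in Lp.
assert (E : Dxm (hx A Nx) (Ux X (S n)) i j + Dym (ky A Ny) (Uy X (S n)) i j
    + gamma A * ((err_p A Sol Nx Ny N X (S n) i j - err_p A Sol Nx Ny N X n i j) / dt A N)
  = gamma A * tp + (tf + (ax + (ay + (- (gamma A * lp)
     + - ((Psi X (S n) i j - Psi X n i j) / dt A N)))))).
{ transitivity ((gamma A * dtm (dt A N) (Pd X) (S n) i j + dtm (dt A N) (Psi X) (S n) i j
    + Dxm (hx A Nx) (Ux X (S n)) i j + Dym (ky A Ny) (Uy X (S n)) i j)
    - gamma A * lp - (Psi X (S n) i j - Psi X n i j) / dt A N); [|rewrite M; ring].
  unfold lp, err_p, err_center, sample, at_centers, dtm.
  replace (S n - 1)%nat with n by lia; field; lra. }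
set (sp := (Psi X (S n) i j - Psi X n i j) / dt A N) in *.
rewrite E; clear E M.
eapply Rle_trans; [apply Rabs_triang|].
eapply Rle_trans; [apply Rplus_le_compat_l, Rabs_triang|].
eapply Rle_trans; [apply Rplus_le_compat_l, Rplus_le_compat_l, Rabs_triang|].
eapply Rle_trans; [apply Rplus_le_compat_l, Rplus_le_compat_l, Rplus_le_compat_l, Rabs_triang|].
eapply Rle_trans; [apply Rplus_le_compat_l, Rplus_le_compat_l, Rplus_le_compat_l,
  Rplus_le_compat_l, Rabs_triang|].
rewrite !Rabs_Ropp, (Rabs_mult (gamma A) tp), (Rabs_mult (gamma A) lp), (Rabs_pos_eq (gamma A)) by lra.
assert (gamma A * Rabs tp <= gamma A * K) by (apply Rmult_le_compat_l; lra).
assert (gamma A * Rabs lp <= gamma A * K) by (apply Rmult_le_compat_l; lra).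
lra.
Qed.

End Small.

(** * Concentration and temperature *)

Lemma Cclass_convection r v u c : Cclass r u -> Cclass r c ->
  Cclass r (fun x y t => v * u x y t * c x y t).
Proof.
intros Hu Hc; apply (Cclass_mult r (fun x y t => v * u x y t)); [|assumption].
apply (Cclass_mult r (fun _ _ _ => v)); [apply Cclass_const|assumption].
Qed.

Lemma Cclass_fluxx r v l0 l1 f u c : Cclass (S r) f -> Cclass (S r) u -> Cclass (S r) c ->
  Cclass r (fluxx v l0 l1 f u c).
Proof.
intros Hf Hu Hc; apply Cclass_minus.
- apply Cclass_convection; now apply Cclass_pred.
- apply Cclass_mult; [now apply Cclass_affine, Cclass_pred|apply Hc].
Qed.

Lemma Cclass_fluxy r v l0 l1 f u c : Cclass (S r) f -> Cclass (S r) u -> Cclass (S r) c ->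
  Cclass r (fluxy v l0 l1 f u c).
Proof.
intros Hf Hu Hc; apply Cclass_minus.
- apply Cclass_convection; now apply Cclass_pred.
- apply Cclass_mult; [now apply Cclass_affine, Cclass_pred|apply Hc].
Qed.

Lemma small_factor a b : 0 < a -> 0 <= b -> exists s, 0 < s /\ b * s ^ 2 <= a.
Proof.
intros Ha Hb; set (s := Rmin 1 (a / (b + 1))).
assert (H0 : 0 < a / (b + 1)) by (apply Rdiv_lt_0_compat; lra).
assert (H1 := Rmin_l 1 (a / (b + 1))); assert (H2 := Rmin_r 1 (a / (b + 1))); fold s in H1, H2.
assert (H3 : 0 < s) by (apply Rmin_pos; lra).
exists s; split; [assumption|].
assert (b * s <= b * (a / (b + 1))) by (apply Rmult_le_compat_l; assumption).
assert (E : b * (a / (b + 1)) = a - a / (b + 1)) by (field; lra).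
assert (b * s * s <= b * s * 1) by (apply Rmult_le_compat_l; [apply Rmult_le_pos; lra|lra]).
lra.
Qed.

Lemma acid_source_difference (b f0 w psi ph r1 r2 C c fp L K M dT : R) :
  0 <= b -> 0 < w -> w <= 1 - f0 -> 0 <= psi <= 1 -> 0 <= ph <= 1 ->
  0 <= r1 <= 1 -> 0 <= r2 <= 1 -> Rabs (r1 - r2) <= L * dT -> 0 <= L -> 0 <= dT ->
  Rabs c <= K -> 0 <= K -> Rabs fp <= M ->
  Rabs ((- (b * ((1 - psi) / (1 - f0)) * r1 * C) + fp * C)
      - (- (b * ((1 - ph) / (1 - f0)) * r2 * c) + fp * c))
  <= b / w * (Rabs (C - c) + K * (L * dT + Rabs (psi - ph))) + M * Rabs (C - c).
Proof.
intros Hb Hw Hw' Hpsi Hph Hr1 Hr2 HL HL0 HdT Hc HK HM.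
replace ((- (b * ((1 - psi) / (1 - f0)) * r1 * C) + fp * C)
      - (- (b * ((1 - ph) / (1 - f0)) * r2 * c) + fp * c)) with
  (- (b / (1 - f0) * ((1 - psi) * r1 * (C - c)
      + c * ((1 - psi) * (r1 - r2) + r2 * (ph - psi)))) + fp * (C - c)) by (field; lra).
eapply Rle_trans; [apply Rabs_triang|]; apply Rplus_le_compat.
- assert (B : 0 <= b / (1 - f0) <= b / w).
  { split; [apply Rdiv_le_0_compat; lra|].
    apply Rmult_le_compat_l; [assumption|apply Rinv_le_contravar; lra]. }
  rewrite Rabs_Ropp, Rabs_mult, (Rabs_pos_eq (b / (1 - f0))) by lra.
  apply Rmult_le_compat; try lra; [apply Rabs_pos|].
  eapply Rle_trans; [apply Rabs_triang|]; apply Rplus_le_compat.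
  + rewrite Rabs_mult, (Rabs_pos_eq ((1 - psi) * r1)) by (apply Rmult_le_pos; lra).
    rewrite <- (Rmult_1_l (Rabs (C - c))) at 2; apply Rmult_le_compat_r; [apply Rabs_pos|].
    apply Rmult_le_1; lra.
  + rewrite Rabs_mult; apply Rmult_le_compat; try apply Rabs_pos; [assumption|].
    eapply Rle_trans; [apply Rabs_triang|]; rewrite !Rabs_mult, (Rabs_pos_eq (1 - psi)),
      (Rabs_pos_eq r2), (Rabs_minus_sym ph) by lra.
    apply Rplus_le_compat.
    * rewrite <- (Rmult_1_l (L * dT)); apply Rmult_le_compat; try lra; apply Rabs_pos.
    * rewrite <- (Rmult_1_l (Rabs (psi - ph))) at 2; apply Rmult_le_compat_r; [apply Rabs_pos|lra].
- rewrite Rabs_mult; apply Rmult_le_compat_r; [apply Rabs_pos|assumption].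
Qed.

Lemma heat_source_difference (b f0 w psi ph r1 r2 C c h1 h2 L LH HB dT : R) :
  0 <= b -> 0 < w -> w <= 1 - f0 -> 0 <= psi <= 1 -> 0 <= ph <= 1 ->
  0 <= r1 <= 1 -> 0 <= r2 <= 1 -> Rabs (r1 - r2) <= L * dT -> 0 <= L -> 0 <= dT ->
  0 <= C <= 1 -> 0 <= c <= 1 -> Rabs (h1 - h2) <= LH * dT -> 0 <= LH -> Rabs h2 <= HB ->
  Rabs (b * ((1 - psi) / (1 - f0)) * h1 * (C * r1) - b * ((1 - ph) / (1 - f0)) * h2 * (c * r2))
  <= b / w * (LH * dT + HB * (L * dT + Rabs (C - c) + Rabs (psi - ph))).
Proof.
intros Hb Hw Hw' Hpsi Hph Hr1 Hr2 HL HL0 HdT HC Hc HLH HLH0 HHB.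
replace (b * ((1 - psi) / (1 - f0)) * h1 * (C * r1) - b * ((1 - ph) / (1 - f0)) * h2 * (c * r2))
  with (b / (1 - f0) * ((1 - psi) * (C * r1) * (h1 - h2)
    + h2 * ((1 - psi) * C * (r1 - r2) + ((1 - psi) * r2 * (C - c) + r2 * c * (ph - psi)))))
  by (field; lra).
assert (B : 0 <= b / (1 - f0) <= b / w).
{ split; [apply Rdiv_le_0_compat; lra|].
  apply Rmult_le_compat_l; [assumption|apply Rinv_le_contravar; lra]. }
rewrite Rabs_mult, (Rabs_pos_eq (b / (1 - f0))) by lra.
apply Rmult_le_compat; try lra; [apply Rabs_pos|].
assert (P1 : 0 <= C * r1 <= 1) by (split; [apply Rmult_le_pos; lra|apply Rmult_le_1; lra]).
assert (P2 : 0 <= (1 - psi) * (C * r1) <= 1)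
  by (split; [apply Rmult_le_pos; lra|apply Rmult_le_1; lra]).
assert (P3 : 0 <= (1 - psi) * C <= 1) by (split; [apply Rmult_le_pos; lra|apply Rmult_le_1; lra]).
assert (P4 : 0 <= (1 - psi) * r2 <= 1) by (split; [apply Rmult_le_pos; lra|apply Rmult_le_1; lra]).
assert (P5 : 0 <= r2 * c <= 1) by (split; [apply Rmult_le_pos; lra|apply Rmult_le_1; lra]).
assert (Q : forall a x y, 0 <= a <= 1 -> Rabs x <= y -> Rabs (a * x) <= y).
{ intros a x y Ha Hx; rewrite Rabs_mult, (Rabs_pos_eq a) by lra.
  generalize (Rabs_pos x); nra. }
eapply Rle_trans; [apply Rabs_triang|]; apply Rplus_le_compat; [now apply Q|].
rewrite Rabs_mult; apply Rmult_le_compat; try apply Rabs_pos; [assumption|].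
eapply Rle_trans; [apply Rabs_triang|].
eapply Rle_trans; [apply Rplus_le_compat_l, Rabs_triang|].
assert (Q1 := Q _ _ _ P3 HL); assert (Q2 := Q _ _ _ P4 (Rle_refl (Rabs (C - c)))).
assert (Q3 := Q _ (ph - psi) (Rabs (psi - ph)) P5 (Req_le _ _ (Rabs_minus_sym _ _))).
lra.
Qed.

Section Transported.

Variables (A : problem) (Sol : state) (P : interp) (K lo hi lo0 hi1 : R).
Hypotheses (ST : setting A Sol P K lo hi lo0 hi1) (HA : standing_assumptions A)
  (HS : exact_solution A Sol).

Let HK : 1 <= K := st_K _ _ _ _ _ _ _ _ ST.
Let HD : nonempty_domain A := st_domain _ _ _ _ _ _ _ _ ST.

Definition energy_c Nx Ny N X n : R := / 2 * I2 (hx A Nx * ky A Ny) Nx Ny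
  (fun i j => Psi X n i j * err_c A Sol Nx Ny N X n i j ^ 2).
Definition energy_T Nx Ny N X n : R := / 2 * I2 (hx A Nx * ky A Ny) Nx Ny
  (fun i j => heat_cap A (Psi X n i j) * err_T A Sol Nx Ny N X n i j ^ 2).

(** Quadratic in the errors but for the last term, which is cubic and has to be absorbed by
    the dissipation of the flow estimate. *)
Definition growth Nx Ny N X n : R :=
  nM A Nx Ny (err_c A Sol Nx Ny N X (S n)) + nM A Nx Ny (err_c A Sol Nx Ny N X n)
  + nM A Nx Ny (err_T A Sol Nx Ny N X (S n)) + nM A Nx Ny (err_T A Sol Nx Ny N X n)
  + nE A Nx Ny (err_ux A Sol P Nx Ny N X (S n)) (err_uy A Sol P Nx Ny N X (S n))
  + nM A Nx Ny (err_phi A Sol Nx Ny N X (S n)) + nM A Nx Ny (err_phi A Sol Nx Ny N X n)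
  + eps A Nx Ny N ^ 2
  + rate_p A Sol Nx Ny N X (S n) * (nM A Nx Ny (err_c A Sol Nx Ny N X (S n))
                                    + nM A Nx Ny (err_T A Sol Nx Ny N X (S n))).

Lemma growth_bound Nx Ny N X n C Cs e Sb : good_grid A Nx Ny N -> scheme A P Nx Ny N X ->
  (n < N)%nat -> 0 <= C -> 0 <= Cs ->
  (e = err_c A Sol Nx Ny N X (S n) \/ e = err_T A Sol Nx Ny N X (S n)) ->
  (forall i j, Sb i j = Cs * (Rabs (err_c A Sol Nx Ny N X (S n) i j)
     + Rabs (err_T A Sol Nx Ny N X n i j) + Rabs (err_phi A Sol Nx Ny N X (S n) i j)
     + dt A N)) ->
  C * (nM A Nx Ny e + nM A Nx Ny Sb
     + nE A Nx Ny (err_xedge A Nx Ny N (Ux X) (ux Sol) (S n))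
                  (err_yedge A Nx Ny N (Uy X) (uy Sol) (S n))
     + nM A Nx Ny (err_phi A Sol Nx Ny N X (S n)) + nM A Nx Ny (err_phi A Sol Nx Ny N X n)
     + nM A Nx Ny (dtm (dt A N) (err_phi A Sol Nx Ny N X) (S n))
     + eps A Nx Ny N ^ 2
     + nM A Nx Ny (fun i j => (err_p A Sol Nx Ny N X (S n) i j - err_p A Sol Nx Ny N X n i j)
                               / dt A N) * nM A Nx Ny e)
  <= C * (1 + 4 * Cs ^ 2 * (1 + area A) + 4 * K ^ 2 * (1 + area A)) * growth Nx Ny N X n.
Proof.
intros HG HX Hn HC HCs He HSb; rewrite Rmult_assoc; apply Rmult_le_compat_l; [assumption|].
assert (HG0 := HG); destruct HG0 as (_ & HNx & HNy & HN).
assert (Ht := dt_pos A N HD HN); assert (A0 := area_pos A HD).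
assert (Hw := cell_weight_pos A Nx Ny N HG).
assert (Hd := porosity_rate_norm A Sol P K lo hi lo0 hi1 ST Nx Ny N X HG HX n Hn).
destruct (e2_le_eps A Nx Ny N HG) as (_ & Te & _).
assert (HB : nM A Nx Ny Sb <= 4 * Cs ^ 2 * (1 + area A) *
  (nM A Nx Ny (err_c A Sol Nx Ny N X (S n)) + nM A Nx Ny (err_T A Sol Nx Ny N X n)
   + nM A Nx Ny (err_phi A Sol Nx Ny N X (S n)) + eps A Nx Ny N ^ 2)).
{ assert (E : nM A Nx Ny Sb <= I2 (hx A Nx * ky A Ny) Nx Ny (fun i j => 4 * Cs ^ 2 *
    (err_c A Sol Nx Ny N X (S n) i j ^ 2 + err_T A Sol Nx Ny N X n i j ^ 2
     + err_phi A Sol Nx Ny N X (S n) i j ^ 2 + eps A Nx Ny N ^ 2))).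
  { apply I2_le; [lra|]; intros i j Hi Hj; rewrite HSb, Rpow_mult_distr.
    replace (4 * Cs ^ 2) with (Cs ^ 2 * 4) by ring.
    rewrite (Rmult_assoc (Cs ^ 2)); apply Rmult_le_compat_l; [apply pow2_ge_0|].
    rewrite <- (pow2_abs (err_c _ _ _ _ _ _ _ i j)), <- (pow2_abs (err_T _ _ _ _ _ _ _ i j)),
      <- (pow2_abs (err_phi _ _ _ _ _ _ _ i j)).
    set (a := Rabs (err_c _ _ _ _ _ _ _ i j)); set (b := Rabs (err_T _ _ _ _ _ _ _ i j)).
    set (c := Rabs (err_phi _ _ _ _ _ _ _ i j)).
    assert (dt A N ^ 2 <= eps A Nx Ny N ^ 2) by (apply pow_incr; lra).
    set (tau := dt A N) in *.
    generalize (pow2_ge_0 (a - b)) (pow2_ge_0 (a - c)) (pow2_ge_0 (a - tau))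
      (pow2_ge_0 (b - c)) (pow2_ge_0 (b - tau)) (pow2_ge_0 (c - tau)); lra. }
  eapply Rle_trans; [exact E|]; I2_push; rewrite (I2_const_area A Nx Ny N _ HG).
  assert (N1 := nM_ge0 A Nx Ny N (err_c A Sol Nx Ny N X (S n)) HG).
  assert (N2 := nM_ge0 A Nx Ny N (err_T A Sol Nx Ny N X n) HG).
  assert (N3 := nM_ge0 A Nx Ny N (err_phi A Sol Nx Ny N X (S n)) HG).
  clear Hd; unfold nM in *.
  set (x1 := I2 _ _ _ (fun i j => err_c _ _ _ _ _ _ _ i j ^ 2)) in *.
  set (x2 := I2 _ _ _ (fun i j => err_T _ _ _ _ _ _ _ i j ^ 2)) in *.
  set (x3 := I2 _ _ _ (fun i j => err_phi _ _ _ _ _ _ _ i j ^ 2)) in *.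
  assert (N4 := pow2_ge_0 (eps A Nx Ny N)).
  rewrite (Rmult_assoc (4 * Cs ^ 2)); apply Rmult_le_compat_l; [generalize (pow2_ge_0 Cs); lra|].
  assert (0 <= area A * (x1 + x2 + x3)) by (apply Rmult_le_pos; lra). lra. }
assert (HR : nM A Nx Ny (fun i j => (err_p A Sol Nx Ny N X (S n) i j
     - err_p A Sol Nx Ny N X n i j) / dt A N) = rate_p A Sol Nx Ny N X (S n)).
{ unfold rate_p; replace (S n - 1)%nat with n by lia; reflexivity. }
rewrite HR; unfold growth.
change (err_ux A Sol P Nx Ny N X (S n)) with (err_xedge A Nx Ny N (Ux X) (ux Sol) (S n)).
change (err_uy A Sol P Nx Ny N X (S n)) with (err_yedge A Nx Ny N (Uy X) (uy Sol) (S n)).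
assert (N1 := nM_ge0 A Nx Ny N (err_c A Sol Nx Ny N X (S n)) HG).
assert (N1' := nM_ge0 A Nx Ny N (err_c A Sol Nx Ny N X n) HG).
assert (N2 := nM_ge0 A Nx Ny N (err_T A Sol Nx Ny N X n) HG).
assert (N2' := nM_ge0 A Nx Ny N (err_T A Sol Nx Ny N X (S n)) HG).
assert (N3 := nM_ge0 A Nx Ny N (err_phi A Sol Nx Ny N X (S n)) HG).
assert (N3' := nM_ge0 A Nx Ny N (err_phi A Sol Nx Ny N X n) HG).
assert (N4 := pow2_ge_0 (eps A Nx Ny N)).
assert (N5 := nE_ge0 A Nx Ny N (err_xedge A Nx Ny N (Ux X) (ux Sol) (S n))
  (err_yedge A Nx Ny N (Uy X) (uy Sol) (S n)) HG).
assert (N6 : 0 <= rate_p A Sol Nx Ny N X (S n)) by apply (nM_ge0 A Nx Ny N _ HG).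
assert (He' : nM A Nx Ny e <= nM A Nx Ny (err_c A Sol Nx Ny N X (S n))
  + nM A Nx Ny (err_T A Sol Nx Ny N X (S n))) by (destruct He as [-> | ->]; lra).
set (ec' := nM _ _ _ (err_c A Sol Nx Ny N X (S n))) in *.
set (ec := nM _ _ _ (err_c A Sol Nx Ny N X n)) in *.
set (eT' := nM _ _ _ (err_T A Sol Nx Ny N X (S n))) in *.
set (eT := nM _ _ _ (err_T A Sol Nx Ny N X n)) in *.
set (f' := nM _ _ _ (err_phi A Sol Nx Ny N X (S n))) in *.
set (f := nM _ _ _ (err_phi A Sol Nx Ny N X n)) in *.
set (d := nM _ _ _ (dtm _ _ _)) in *; set (ee := eps A Nx Ny N ^ 2) in *.
set (u := nE _ _ _ _ _) in *; set (R := rate_p _ _ _ _ _ _ _) in *.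
set (S1 := 4 * Cs ^ 2 * (1 + area A)) in *; set (S2 := 4 * K ^ 2 * (1 + area A)) in *.
assert (S10 : 0 <= S1) by (apply Rmult_le_pos; [generalize (pow2_ge_0 Cs); lra|lra]).
assert (S20 : 0 <= S2) by (apply Rmult_le_pos; [generalize (pow2_ge_0 K); lra|lra]).
assert (Re : R * nM A Nx Ny e <= R * (ec' + eT')) by (apply Rmult_le_compat_l; assumption).
assert (R0 : 0 <= R * (ec' + eT')) by (apply Rmult_le_pos; lra).
set (RR := R * (ec' + eT')) in *.
assert (0 <= S1 * (ec + eT' + u + f + RR)) by (apply Rmult_le_pos; lra).
assert (0 <= S2 * (ec' + eT' + u + f + RR)) by (apply Rmult_le_pos; lra).
lra.
Qed.

(** The mesh size and the pressure gradient error must be small for the velocity to satisfy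
    the smallness condition of [transported_step].  The reaction term
    is linear in the new concentration, with a coefficient that is Lipschitz continuous in
    the porosity and in the old temperature. *)
Lemma acid_step : exists C c kappa, 0 <= C /\ 0 < c /\ 0 < kappa /\
  forall Nx Ny N X n, good_grid A Nx Ny N -> scheme A P Nx Ny N X -> (n < N)%nat ->
  eps A Nx Ny N <= 1 -> in_range P lo hi Nx Ny X (S n) ->
  hx A Nx <= kappa -> ky A Ny <= kappa -> nD A Nx Ny (err_p A Sol Nx Ny N X (S n)) <= kappa ->
  energy_c Nx Ny N X (S n) + dt A N * c * nD A Nx Ny (err_c A Sol Nx Ny N X (S n))
  <= energy_c Nx Ny N X n + dt A N * C * growth Nx Ny N X n.
Proof.
assert (Hdm := dmol_pos A HA); assert (Hlo := st_lo _ _ _ _ _ _ _ _ ST).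
assert (Hhi := st_hi _ _ _ _ _ _ _ _ ST); assert (Gam := gamma_pos A HA).
assert (Hlo0 := st_lo0 _ _ _ _ _ _ _ _ ST); assert (Hhi1 := st_hi1 _ _ _ _ _ _ _ _ ST).
set (lam0 := dmol A * lo).
assert (Hlam : 0 < lam0) by (apply Rmult_lt_0_compat; assumption).
destruct (small_factor (lam0 ^ 2 / 4) (2 * K)) as (eta & Heta & Heta2);
  [apply Rdiv_lt_0_compat; [now apply pow_lt|lra]|lra|].
assert (Cphi := proj1 (st_phi _ _ _ _ _ _ _ _ ST)); assert (Cc := proj1 (st_c _ _ _ _ _ _ _ _ ST)).
assert (Cux := proj1 (st_ux _ _ _ _ _ _ _ _ ST)); assert (Cuy := proj1 (st_uy _ _ _ _ _ _ _ _ ST)).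
assert (Fx := Cclass_fluxx 4 1 0 (dmol A) _ _ _ Cphi Cux Cc).
assert (Fy := Cclass_fluxy 4 1 0 (dmol A) _ _ _ Cphi Cuy Cc).
assert (Fc : Cclass 5 (content 0 1 (phi Sol) (cf Sol)))
  by (apply Cclass_mult; [now apply Cclass_affine|assumption]).
destruct (Cclass_Bd A 3 _ (Cclass_le 4 3 _ ltac:(lia) Fx)) as (k1 & P1 & B1).
destruct (Cclass_Bd A 3 _ (Cclass_le 4 3 _ ltac:(lia) Fy)) as (k2 & P2 & B2).
destruct (Cclass_Bd A 2 _ (Cclass_le 5 2 _ ltac:(lia) Fc)) as (k3 & P3 & B3).
set (K1 := k1 + k2 + k3).
destruct (react_props A HA) as [Rr (L & HL0 & HL)].
destruct (fP_bounded A HA) as [M HM].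
assert (Hkc := kc_pos A HA); assert (Ha0 := a0_pos A HA).
set (b := kc A * a0 A); assert (Hb : 0 < b) by (apply Rmult_lt_0_compat; assumption).
set (B0 := b / (1 - hi)); assert (HB0 : 0 < B0) by (apply Rdiv_lt_0_compat; lra).
set (Cs := B0 * (1 + K * (L * (1 + K) + 1)) + Rabs M).
assert (HCs : 0 <= Cs).
{ unfold Cs; apply Rplus_le_le_0_compat; [|apply Rabs_pos].
  apply Rmult_le_pos; [lra|]. assert (0 <= L * (1 + K)) by (apply Rmult_le_pos; lra).
  assert (0 <= K * (L * (1 + K) + 1)) by (apply Rmult_le_pos; lra). lra. }
destruct (velocity_small A Sol P K lo hi lo0 hi1 ST eta Heta) as (kappa & Hkappa & Hvel).
destruct (transported_step A Sol P K lo hi lo0 hi1 (cf Sol) 1 0 (dmol A) 0 1 lam0 eta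
  ((2 * gamma A + 4) * K) K1 ST Gam (st_c _ _ _ _ _ _ _ _ ST)) as (C & HC & Hstep).
- lra.
- exact Hlam.
- apply Rmult_le_pos; lra.
- unfold K1; lra.
- intros s Hs; unfold lam0; rewrite Rplus_0_l; apply Rmult_le_compat_l; lra.
- intros s Hs; lra.
- replace (2 * 1 ^ 2 * eta ^ 2 * K) with (2 * K * eta ^ 2) by ring; exact Heta2.
- split; [exact (Cclass_le 4 3 _ ltac:(lia) Fx)|apply Bd_mono with k1; [unfold K1; lra|assumption]].
- split; [exact (Cclass_le 4 3 _ ltac:(lia) Fy)|apply Bd_mono with k2; [unfold K1; lra|assumption]].
- split; [exact (Cclass_le 5 2 _ ltac:(lia) Fc)|apply Bd_mono with k3; [unfold K1; lra|assumption]].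
- exists (C * (1 + 4 * Cs ^ 2 * (1 + area A) + 4 * K ^ 2 * (1 + area A))), (lam0 / 4), kappa.
  assert (A0 := area_pos A HD).
  split; [|split; [lra|split; [assumption|]]].
  { apply Rmult_le_pos; [assumption|].
    assert (0 <= 4 * Cs ^ 2 * (1 + area A))
      by (apply Rmult_le_pos; [generalize (pow2_ge_0 Cs); lra|lra]).
    assert (0 <= 4 * K ^ 2 * (1 + area A))
      by (apply Rmult_le_pos; [generalize (pow2_ge_0 K); lra|lra]). lra. }
  intros Nx Ny N X n HG HX Hn Heps HR Hh Hk HDq.
  destruct (Hvel Nx Ny N X n HG HX Hn HR Hh Hk HDq) as [Vx Vy].
  assert (HG0 := HG); destruct HG0 as (_ & HNx & HNy & HN).
  assert (Ht := dt_pos A N HD HN); assert (Htn := tn_pos A N n HD HN Hn).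
  destruct (st_grid _ _ _ _ _ _ _ _ ST Nx Ny N X HG HX) as (HDx & _ & HPsi & _).
  set (Sb := fun i j => Cs * (Rabs (err_c A Sol Nx Ny N X (S n) i j)
     + Rabs (err_T A Sol Nx Ny N X n i j) + Rabs (err_phi A Sol Nx Ny N X (S n) i j) + dt A N)).
  set (Rs := fun i j => kc A * av A (at_centers A Nx Ny (phi0 A) i j) (Psi X (S n) i j)
        * (1 / (1 + ks A (Z X n i j) / kc A) - 1) * Cf X (S n) i j
      + sample A Nx Ny N (fP A) (S n) i j * Cf X (S n) i j
      + sample A Nx Ny N (fI A) (S n) i j * sample A Nx Ny N (cI A) (S n) i j).
  set (Rex := fun i j => let x := xc A Nx i in let y := yc A Ny j in let t := tn A N (S n) in
      kc A * av A (phi0 A x y) (phi Sol x y t)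
        * (csurf A (cf Sol x y t) (Tf Sol x y t) - cf Sol x y t)
      + fP A x y t * cf Sol x y t + fI A x y t * cI A x y t).
  assert (GB := growth_bound Nx Ny N X n C Cs _ Sb HG HX Hn HC HCs (or_introl eq_refl)
    (fun i j => eq_refl)).
  assert (MAIN := Hstep Nx Ny N X (Cf X) (Wx X) (Wy X) Rs Rex Sb n); cbv zeta in MAIN.
  fold (err_c A Sol Nx Ny N X) (err_phi A Sol Nx Ny N X) (err_p A Sol Nx Ny N X) in MAIN.
  assert (Ecap : forall m, / 2 * I2 (hx A Nx * ky A Ny) Nx Ny
      (fun i j => (0 + 1 * Psi X m i j) * err_c A Sol Nx Ny N X m i j ^ 2)
    = energy_c Nx Ny N X m).
  { intros m; unfold energy_c; f_equal; apply I2_ext; intros; ring. }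
  rewrite !Ecap in MAIN.
  rewrite (Rmult_assoc (dt A N) (C * _)).
  eapply Rle_trans; [apply MAIN; clear MAIN Ecap; try assumption|].
  + apply HR.
  + apply HR.
  + intros i j Hij.
    assert (HO := center_in_Omega A Nx Ny N HG i j Hij).
    assert (HB := center_in_box A Nx Ny N HG i j (S n) Hij Hn).
    split; [|split; [|split]].
    * transitivity (dtm (dt A N) (fun m i j => Psi X m i j * Cf X m i j) (S n) i j
        + Dxm (hx A Nx) (Wx X (S n)) i j + Dym (ky A Ny) (Wy X (S n)) i j);
        [|exact (sch_acid _ _ _ _ _ _ HX n i j Hn Hij)].
      f_equal; f_equal; unfold dtm; rewrite !Rplus_0_l, !Rmult_1_l; reflexivity.
    * unfold Rex; rewrite <- (acid_eq A Sol HS _ _ _ HO Htn).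
      assert (E1 : content 0 1 (phi Sol) (cf Sol) = fun x y t => phi Sol x y t * cf Sol x y t)
        by (apply field_ext; intros; unfold content; ring).
      assert (E2 : fluxx 1 0 (dmol A) (phi Sol) (ux Sol) (cf Sol) = fun x y t =>
         (fun x y t => ux Sol x y t * cf Sol x y t) x y t
         - (fun x y t => phi Sol x y t * D11 A * px (cf Sol) x y t) x y t)
        by (apply field_ext; intros; unfold fluxx, D11; ring).
      assert (E3 : fluxy 1 0 (dmol A) (phi Sol) (uy Sol) (cf Sol) = fun x y t =>
         (fun x y t => uy Sol x y t * cf Sol x y t) x y t
         - (fun x y t => phi Sol x y t * D22 A * py (cf Sol) x y t) x y t)
        by (apply field_ext; intros; unfold fluxy, D22; ring).
      assert (G : forall g, Cclass 4 g -> Cclass 1 (fun x y t => phi Sol x y t * dmol A * g x y t)).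
      { intros g Hg; apply Cclass_mult; [|apply (Cclass_le 4); [lia|assumption]].
        apply (Cclass_mult 1 (phi Sol) (fun _ _ _ => dmol A));
          [apply (Cclass_le 5); [lia|assumption]|apply Cclass_const]. }
      rewrite E1, E2, E3, px_minus, py_minus.
      -- unfold div2; ring.
      -- apply Cclass_mult; apply (Cclass_le 5); try lia; assumption.
      -- apply (G (py (cf Sol))), Cc.
      -- apply Cclass_mult; apply (Cclass_le 5); try lia; assumption.
      -- apply (G (px (cf Sol))), Cc.
    * assert (Rphi0 := ed_phi0 _ _ _ _ _ _ _ _ _ _ _ _ HDx _ _ HO).
      assert (Rphi := ed_range _ _ _ _ _ _ _ _ _ _ _ _ HDx _ _ _ HO (proj2 HB)).
      assert (RPsi := HPsi (S n) i j Hij Hn).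
      assert (Bc := Csm_bound A 5 K _ _ _ _ (st_c _ _ _ _ _ _ _ _ ST) HB).
      assert (LT := time_lipschitz A Nx Ny N HG (Tf Sol) K (xc A Nx i) (yc A Ny j) n
        (Csm_le A 5 1 K _ ltac:(lia) (st_T _ _ _ _ _ _ _ _ ST)) (proj1 HB) Hn).
      assert (BM := HM _ _ _ HO Htn).
      set (T1 := Tf Sol (xc A Nx i) (yc A Ny j) (tn A N (S n))) in *.
      set (dT := Rabs (err_T A Sol Nx Ny N X n i j) + K * dt A N).
      assert (HZ : Rabs (Z X n i j - T1) <= dT).
      { replace (Z X n i j - T1) with (err_T A Sol Nx Ny N X n i j
          - (T1 - Tf Sol (xc A Nx i) (yc A Ny j) (tn A N n)))
          by (unfold err_T, err_center, sample, at_centers; ring).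
        eapply Rle_trans; [apply Rabs_triang|]; rewrite Rabs_Ropp; unfold dT; lra. }
      assert (HdT : 0 <= dT) by (eapply Rle_trans; [apply Rabs_pos|exact HZ]).
      assert (HLr : Rabs (react A (Z X n i j) - react A T1) <= L * dT)
        by (eapply Rle_trans; [apply HL|apply Rmult_le_compat_l; assumption]).
      assert (Q := acid_source_difference b (phi0 A (xc A Nx i) (yc A Ny j)) (1 - hi)
        (Psi X (S n) i j) (phi Sol (xc A Nx i) (yc A Ny j) (tn A N (S n)))
        (react A (Z X n i j)) (react A T1) (Cf X (S n) i j)
        (cf Sol (xc A Nx i) (yc A Ny j) (tn A N (S n)))
        (fP A (xc A Nx i) (yc A Ny j) (tn A N (S n))) L K (Rabs M) dT).
      assert (ER : Rs i j - Rex i j =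
        (- (b * ((1 - Psi X (S n) i j) / (1 - phi0 A (xc A Nx i) (yc A Ny j)))
            * react A (Z X n i j) * Cf X (S n) i j)
         + fP A (xc A Nx i) (yc A Ny j) (tn A N (S n)) * Cf X (S n) i j)
        - (- (b * ((1 - phi Sol (xc A Nx i) (yc A Ny j) (tn A N (S n)))
                / (1 - phi0 A (xc A Nx i) (yc A Ny j)))
            * react A T1 * cf Sol (xc A Nx i) (yc A Ny j) (tn A N (S n)))
         + fP A (xc A Nx i) (yc A Ny j) (tn A N (S n))
            * cf Sol (xc A Nx i) (yc A Ny j) (tn A N (S n)))).
      { unfold Rs, Rex, av, csurf, react, sample, at_centers; fold T1; unfold b.
        unfold Rdiv; ring. }
      rewrite ER; eapply Rle_trans; [apply Q; try lra; try apply Rr; try assumption|].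
      -- eapply Rle_trans; [exact BM|apply Rle_abs].
      -- fold B0.
         change (Cf X (S n) i j - cf Sol (xc A Nx i) (yc A Ny j) (tn A N (S n)))
           with (err_c A Sol Nx Ny N X (S n) i j).
         change (Psi X (S n) i j - phi Sol (xc A Nx i) (yc A Ny j) (tn A N (S n)))
           with (err_phi A Sol Nx Ny N X (S n) i j).
         unfold Sb, Cs, dT.
         assert (a1 := Rabs_pos (err_c A Sol Nx Ny N X (S n) i j)).
         assert (a2 := Rabs_pos (err_T A Sol Nx Ny N X n i j)).
         assert (a3 := Rabs_pos (err_phi A Sol Nx Ny N X (S n) i j)).
         set (xc_ := Rabs (err_c _ _ _ _ _ _ _ _ _)) in *.
         set (xT := Rabs (err_T _ _ _ _ _ _ _ _ _)) in *.
         set (xf := Rabs (err_phi _ _ _ _ _ _ _ _ _)) in *.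
         set (t := dt A N) in *; assert (m0 := Rabs_pos M).
         assert (l1 : 0 <= L * (1 + K)) by (apply Rmult_le_pos; lra).
         assert (s1 : xc_ + K * (L * (xT + K * t) + xf)
           <= (1 + K * (L * (1 + K) + 1)) * (xc_ + xT + xf + t)).
         { assert (0 <= K * (L * (1 + K)) * (xc_ + xf)) by (repeat apply Rmult_le_pos; lra).
           assert (0 <= K * (xc_ + xT + t)) by (apply Rmult_le_pos; lra).
           assert (0 <= K * (L * K) * xT) by (repeat apply Rmult_le_pos; lra).
           assert (0 <= K * L * t) by (apply Rmult_le_pos; [apply Rmult_le_pos; lra|lra]).
           lra. }
         assert (s2 : B0 * (xc_ + K * (L * (xT + K * t) + xf))
           <= B0 * ((1 + K * (L * (1 + K) + 1)) * (xc_ + xT + xf + t)))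
           by (apply Rmult_le_compat_l; lra).
         assert (s3 : 0 <= Rabs M * (xT + xf + t)) by (apply Rmult_le_pos; lra).
         lra.
    * exact (divergence_bound A Sol P K lo hi lo0 hi1 ST HA HS Nx Ny N X n i j HG HX Hn Hij).
  + intros i j Hij; split; [|now apply Vx].
    rewrite (sch_W_x _ _ _ _ _ _ HX n i j Hn Hij); unfold D11; ring.
  + intros i j Hij; split; [|now apply Vy].
    rewrite (sch_W_y _ _ _ _ _ _ HX n i j Hn Hij); unfold D22; ring.
  + intros i j Hi Hj; destruct (sch_bdry_x _ _ _ _ _ _ HX n i j Hn Hi Hj) as (_ & Wz & _).
    split; [exact Wz|].
    assert (X0 : xe A Nx 0 = Llx A) by (unfold xe; simpl; ring).
    assert (X1 : xe A Nx Nx = Lrx A) by (unfold xe, hx; field; apply not_0_INR; lia).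
    assert (Ei : xe A Nx i = Llx A \/ xe A Nx i = Lrx A) by (destruct Hi as [-> | ->]; auto).
    destruct (no_flow_x A Sol HS _ _ _ Ei (yc_interior A Ny j HD Hj) Htn) as (z0 & z1 & _).
    unfold fluxx; rewrite z0; unfold D11 in z1; lra.
  + intros i j Hj Hi; destruct (sch_bdry_y _ _ _ _ _ _ HX n i j Hn Hj Hi) as (_ & Wz & _).
    split; [exact Wz|].
    assert (X0 : ye A Ny 0 = Lly A) by (unfold ye; simpl; ring).
    assert (X1 : ye A Ny Ny = Lry A) by (unfold ye, ky; field; apply not_0_INR; lia).
    assert (Ej : ye A Ny j = Lly A \/ ye A Ny j = Lry A) by (destruct Hj as [-> | ->]; auto).
    destruct (no_flow_y A Sol HS _ _ _ Ej (xc_interior A Nx i HD Hi) Htn) as (z0 & z1 & _).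
    unfold fluxy; rewrite z0; unfold D22 in z1; lra.
  + apply Rplus_le_compat_l.
    rewrite (Rmult_assoc (dt A N) C); apply Rmult_le_compat_l; [lra|exact GB].
Qed.

(** As for the concentration; the reaction heat contains the cut-off concentration, which is
    as close to the exact concentration as the discrete one because the latter takes values
    between 0 and 1. *)
Lemma heat_step : exists C c kappa, 0 <= C /\ 0 < c /\ 0 < kappa /\
  forall Nx Ny N X n, good_grid A Nx Ny N -> scheme A P Nx Ny N X -> (n < N)%nat ->
  eps A Nx Ny N <= 1 -> in_range P lo hi Nx Ny X (S n) ->
  hx A Nx <= kappa -> ky A Ny <= kappa -> nD A Nx Ny (err_p A Sol Nx Ny N X (S n)) <= kappa ->
  energy_T Nx Ny N X (S n) + dt A N * c * nD A Nx Ny (err_T A Sol Nx Ny N X (S n))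
  <= energy_T Nx Ny N X n + dt A N * C * growth Nx Ny N X n.
Proof.
destruct (lambda_pos A HA) as [Hls Hlf]; destruct (rho_pos A HA) as [Hrs Hrf].
destruct (theta_pos A HA) as [Hts Htf].
assert (Hlo := st_lo _ _ _ _ _ _ _ _ ST).
assert (Hhi := st_hi _ _ _ _ _ _ _ _ ST); assert (Gam := gamma_pos A HA).
assert (Hlo0 := st_lo0 _ _ _ _ _ _ _ _ ST); assert (Hhi1 := st_hi1 _ _ _ _ _ _ _ _ ST).
set (lam0 := Rmin (lambda_s A) (lambda_f A)).
assert (Hlam : 0 < lam0) by (apply Rmin_pos; assumption).
assert (Hlams := Rmin_l (lambda_s A) (lambda_f A)); fold lam0 in Hlams.
assert (Hlamf := Rmin_r (lambda_s A) (lambda_f A)); fold lam0 in Hlamf.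
set (v := rho_f A * theta_f A); assert (Hv : 0 < v) by (apply Rmult_lt_0_compat; assumption).
set (cs := rho_s A * theta_s A); assert (Hcs : 0 < cs) by (apply Rmult_lt_0_compat; assumption).
set (l1 := lambda_f A - lambda_s A).
destruct (small_factor (lam0 ^ 2 / 4) (2 * v ^ 2 * K)) as (eta & Heta & Heta2);
  [apply Rdiv_lt_0_compat; [now apply pow_lt|lra]
  |apply Rmult_le_pos; [generalize (pow2_ge_0 v); lra|lra]|].
assert (Cphi := proj1 (st_phi _ _ _ _ _ _ _ _ ST)); assert (Cc := proj1 (st_T _ _ _ _ _ _ _ _ ST)).
assert (Cux := proj1 (st_ux _ _ _ _ _ _ _ _ ST)); assert (Cuy := proj1 (st_uy _ _ _ _ _ _ _ _ ST)).
assert (Fx := Cclass_fluxx 4 v (lambda_s A) l1 _ _ _ Cphi Cux Cc).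
assert (Fy := Cclass_fluxy 4 v (lambda_s A) l1 _ _ _ Cphi Cuy Cc).
assert (Fc : Cclass 5 (content cs (v - cs) (phi Sol) (Tf Sol)))
  by (apply Cclass_mult; [now apply Cclass_affine|assumption]).
destruct (Cclass_Bd A 3 _ (Cclass_le 4 3 _ ltac:(lia) Fx)) as (k1 & P1 & B1).
destruct (Cclass_Bd A 3 _ (Cclass_le 4 3 _ ltac:(lia) Fy)) as (k2 & P2 & B2).
destruct (Cclass_Bd A 2 _ (Cclass_le 5 2 _ ltac:(lia) Fc)) as (k3 & P3 & B3).
set (K1 := k1 + k2 + k3).
destruct (react_props A HA) as [Rr (L & HL0 & HL)].
destruct (Hr_lipschitz A HA) as [LH0 HLH0].
set (LH := Rabs LH0); assert (HLH0' : 0 <= LH) by apply Rabs_pos.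
assert (HLH : forall T T', Rabs (Hr A T - Hr A T') <= LH * Rabs (T - T')).
{ intros T T'; eapply Rle_trans; [apply HLH0|].
  apply Rmult_le_compat_r; [apply Rabs_pos|apply Rle_abs]. }
set (HB := Rabs (Hr A 0) + LH * K).
assert (HHB : 0 <= HB).
{ unfold HB; apply Rplus_le_le_0_compat; [apply Rabs_pos|apply Rmult_le_pos; lra]. }
assert (Hkc := kc_pos A HA); assert (Ha0 := a0_pos A HA).
set (b := kc A * a0 A); assert (Hb : 0 < b) by (apply Rmult_lt_0_compat; assumption).
set (B0 := b / (1 - hi)); assert (HB0 : 0 < B0) by (apply Rdiv_lt_0_compat; lra).
set (Cs := B0 * ((LH + HB * L) * (1 + K) + HB)).
assert (HCs : 0 <= Cs).
{ unfold Cs; apply Rmult_le_pos; [lra|].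
  assert (0 <= HB * L) by (apply Rmult_le_pos; lra).
  assert (0 <= (LH + HB * L) * (1 + K)) by (apply Rmult_le_pos; lra). lra. }
destruct (velocity_small A Sol P K lo hi lo0 hi1 ST eta Heta) as (kappa & Hkappa & Hvel).
destruct (transported_step A Sol P K lo hi lo0 hi1 (Tf Sol) v (lambda_s A) l1 cs (v - cs) lam0 eta
  ((2 * gamma A + 4) * K) K1 ST Gam (st_T _ _ _ _ _ _ _ _ ST)) as (C & HC & Hstep).
- lra.
- exact Hlam.
- apply Rmult_le_pos; lra.
- unfold K1; lra.
- intros s Hs; unfold l1.
  assert (0 <= (lambda_s A - lam0) * (1 - s)) by (apply Rmult_le_pos; lra).
  assert (0 <= (lambda_f A - lam0) * s) by (apply Rmult_le_pos; lra). lra.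
- intros s Hs; assert (0 <= cs * (1 - s)) by (apply Rmult_le_pos; lra).
  assert (0 <= v * s) by (apply Rmult_le_pos; lra). lra.
- replace (2 * v ^ 2 * eta ^ 2 * K) with (2 * v ^ 2 * K * eta ^ 2) by ring; exact Heta2.
- split; [exact (Cclass_le 4 3 _ ltac:(lia) Fx)|apply Bd_mono with k1; [unfold K1; lra|assumption]].
- split; [exact (Cclass_le 4 3 _ ltac:(lia) Fy)|apply Bd_mono with k2; [unfold K1; lra|assumption]].
- split; [exact (Cclass_le 5 2 _ ltac:(lia) Fc)|apply Bd_mono with k3; [unfold K1; lra|assumption]].
- exists (C * (1 + 4 * Cs ^ 2 * (1 + area A) + 4 * K ^ 2 * (1 + area A))), (lam0 / 4), kappa.
  assert (A0 := area_pos A HD).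
  split; [|split; [lra|split; [assumption|]]].
  { apply Rmult_le_pos; [assumption|].
    assert (0 <= 4 * Cs ^ 2 * (1 + area A))
      by (apply Rmult_le_pos; [generalize (pow2_ge_0 Cs); lra|lra]).
    assert (0 <= 4 * K ^ 2 * (1 + area A))
      by (apply Rmult_le_pos; [generalize (pow2_ge_0 K); lra|lra]). lra. }
  intros Nx Ny N X n HG HX Hn Heps HR Hh Hk HDq.
  destruct (Hvel Nx Ny N X n HG HX Hn HR Hh Hk HDq) as [HVx HVy].
  assert (HG0 := HG); destruct HG0 as (_ & HNx & HNy & HN).
  assert (Ht := dt_pos A N HD HN); assert (Htn := tn_pos A N n HD HN Hn).
  destruct (st_grid _ _ _ _ _ _ _ _ ST Nx Ny N X HG HX) as (HDx & _ & HPsi & _).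
  set (Sb := fun i j => Cs * (Rabs (err_c A Sol Nx Ny N X (S n) i j)
     + Rabs (err_T A Sol Nx Ny N X n i j) + Rabs (err_phi A Sol Nx Ny N X (S n) i j) + dt A N)).
  set (Rs := fun i j => av A (at_centers A Nx Ny (phi0 A) i j) (Psi X (S n) i j)
      * Hr A (Z X n i j) * Rreact A (cutoff (Cf X (S n) i j)) (Z X n i j)).
  set (Rex := fun i j => let x := xc A Nx i in let y := yc A Ny j in let t := tn A N (S n) in
      av A (phi0 A x y) (phi Sol x y t) * Hr A (Tf Sol x y t)
        * Rreact A (cf Sol x y t) (Tf Sol x y t)).
  assert (GB := growth_bound Nx Ny N X n C Cs _ Sb HG HX Hn HC HCs (or_intror eq_refl)
    (fun i j => eq_refl)).
  assert (MAIN := Hstep Nx Ny N X (Z X) (Vx X) (Vy X) Rs Rex Sb n); cbv zeta in MAIN.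
  fold (err_T A Sol Nx Ny N X) (err_phi A Sol Nx Ny N X) (err_p A Sol Nx Ny N X) in MAIN.
  assert (Ecap : forall m, / 2 * I2 (hx A Nx * ky A Ny) Nx Ny
      (fun i j => (cs + (v - cs) * Psi X m i j) * err_T A Sol Nx Ny N X m i j ^ 2)
    = energy_T Nx Ny N X m).
  { intros m; unfold energy_T, heat_cap, v, cs; f_equal; apply I2_ext; intros; ring. }
  rewrite !Ecap in MAIN.
  rewrite (Rmult_assoc (dt A N) (C * _)).
  eapply Rle_trans; [apply MAIN; clear MAIN Ecap; try assumption|].
  + apply HR.
  + apply HR.
  + intros i j Hij.
    assert (HO := center_in_Omega A Nx Ny N HG i j Hij).
    assert (HB' := center_in_box A Nx Ny N HG i j (S n) Hij Hn).
    split; [|split; [|split]].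
    * transitivity (dtm (dt A N) (fun m i j => heat_cap A (Psi X m i j) * Z X m i j) (S n) i j
        + Dxm (hx A Nx) (Vx X (S n)) i j + Dym (ky A Ny) (Vy X (S n)) i j);
        [|exact (sch_heat _ _ _ _ _ _ HX n i j Hn Hij)].
      f_equal; f_equal; unfold dtm, heat_cap, v, cs, Rdiv; ring.
    * unfold Rex.
      assert (E1 : content cs (v - cs) (phi Sol) (Tf Sol)
          = fun x y t => heat_cap A (phi Sol x y t) * Tf Sol x y t)
        by (apply field_ext; intros; unfold content, heat_cap, v, cs; ring).
      assert (E2 : fluxx v (lambda_s A) l1 (phi Sol) (ux Sol) (Tf Sol) = fun x y t =>
         (fun x y t => rho_f A * theta_f A * ux Sol x y t * Tf Sol x y t) x y t
         - (fun x y t => lambda A (phi Sol x y t) * px (Tf Sol) x y t) x y t)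
        by (apply field_ext; intros; unfold fluxx, lambda, l1, v; ring).
      assert (E3 : fluxy v (lambda_s A) l1 (phi Sol) (uy Sol) (Tf Sol) = fun x y t =>
         (fun x y t => rho_f A * theta_f A * uy Sol x y t * Tf Sol x y t) x y t
         - (fun x y t => lambda A (phi Sol x y t) * py (Tf Sol) x y t) x y t)
        by (apply field_ext; intros; unfold fluxy, lambda, l1, v; ring).
      assert (G : forall g, Cclass 4 g ->
          Cclass 1 (fun x y t => lambda A (phi Sol x y t) * g x y t)).
      { intros g Hg; apply (Cclass_mult 1 (fun x y t => lambda A (phi Sol x y t)));
          [|apply (Cclass_le 4); [lia|assumption]].
        replace (fun x y t => lambda A (phi Sol x y t)) with
          (fun x y t => lambda_s A + l1 * phi Sol x y t)
          by (apply field_ext; intros; unfold lambda, l1; ring).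
        apply Cclass_affine, (Cclass_le 5); [lia|assumption]. }
      assert (HE := heat_eq A Sol HS _ _ _ HO Htn); unfold div2 in HE.
      rewrite E1, E2, E3, px_minus, py_minus.
      -- lra.
      -- apply (Cclass_convection 1 (rho_f A * theta_f A)); apply (Cclass_le 5); try lia; assumption.
      -- apply (G (py (Tf Sol))), Cc.
      -- apply (Cclass_convection 1 (rho_f A * theta_f A)); apply (Cclass_le 5); try lia; assumption.
      -- apply (G (px (Tf Sol))), Cc.
    * assert (Rphi0 := ed_phi0 _ _ _ _ _ _ _ _ _ _ _ _ HDx _ _ HO).
      assert (Rphi := ed_range _ _ _ _ _ _ _ _ _ _ _ _ HDx _ _ _ HO (proj2 HB')).
      assert (RPsi := HPsi (S n) i j Hij Hn).
      assert (Cr := concentration_range A Sol HS _ _ _ HO (proj2 HB')).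
      assert (BT := Csm_bound A 5 K _ _ _ _ (st_T _ _ _ _ _ _ _ _ ST) HB').
      assert (LT := time_lipschitz A Nx Ny N HG (Tf Sol) K (xc A Nx i) (yc A Ny j) n
        (Csm_le A 5 1 K _ ltac:(lia) (st_T _ _ _ _ _ _ _ _ ST)) (proj1 HB') Hn).
      set (T1 := Tf Sol (xc A Nx i) (yc A Ny j) (tn A N (S n))) in *.
      set (dT := Rabs (err_T A Sol Nx Ny N X n i j) + K * dt A N).
      assert (HZ : Rabs (Z X n i j - T1) <= dT).
      { replace (Z X n i j - T1) with (err_T A Sol Nx Ny N X n i j
          - (T1 - Tf Sol (xc A Nx i) (yc A Ny j) (tn A N n)))
          by (unfold err_T, err_center, sample, at_centers; ring).
        eapply Rle_trans; [apply Rabs_triang|]; rewrite Rabs_Ropp; unfold dT; lra. }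
      assert (HdT : 0 <= dT) by (eapply Rle_trans; [apply Rabs_pos|exact HZ]).
      assert (HLr : Rabs (react A (Z X n i j) - react A T1) <= L * dT)
        by (eapply Rle_trans; [apply HL|apply Rmult_le_compat_l; assumption]).
      assert (HLh : Rabs (Hr A (Z X n i j) - Hr A T1) <= LH * dT)
        by (eapply Rle_trans; [apply HLH|apply Rmult_le_compat_l; assumption]).
      assert (BH : Rabs (Hr A T1) <= HB).
      { replace (Hr A T1) with (Hr A 0 + (Hr A T1 - Hr A 0)) by ring.
        eapply Rle_trans; [apply Rabs_triang|]; apply Rplus_le_compat_l.
        eapply Rle_trans; [apply HLH|]; rewrite Rminus_0_r.
        apply Rmult_le_compat_l; assumption. }
      assert (Cr' := cutoff_range (Cf X (S n) i j)).
      assert (LC := cutoff_lipschitz (Cf X (S n) i j) (cf Sol (xc A Nx i) (yc A Ny j) (tn A N (S n)))).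
      rewrite (cutoff_id (cf Sol _ _ _)) in LC by assumption.
      assert (Q := heat_source_difference b (phi0 A (xc A Nx i) (yc A Ny j)) (1 - hi)
        (Psi X (S n) i j) (phi Sol (xc A Nx i) (yc A Ny j) (tn A N (S n)))
        (react A (Z X n i j)) (react A T1) (cutoff (Cf X (S n) i j))
        (cf Sol (xc A Nx i) (yc A Ny j) (tn A N (S n)))
        (Hr A (Z X n i j)) (Hr A T1) L LH HB dT).
      assert (ER : Rs i j - Rex i j =
        b * ((1 - Psi X (S n) i j) / (1 - phi0 A (xc A Nx i) (yc A Ny j)))
          * Hr A (Z X n i j) * (cutoff (Cf X (S n) i j) * react A (Z X n i j))
        - b * ((1 - phi Sol (xc A Nx i) (yc A Ny j) (tn A N (S n)))
               / (1 - phi0 A (xc A Nx i) (yc A Ny j)))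
          * Hr A T1 * (cf Sol (xc A Nx i) (yc A Ny j) (tn A N (S n)) * react A T1)).
      { unfold Rs, Rex, av, Rreact, csurf, react, at_centers; fold T1; unfold b.
        unfold Rdiv; ring. }
      rewrite ER; eapply Rle_trans; [apply Q; try lra; try apply Rr; try assumption|].
      fold B0.
      change (Cf X (S n) i j - cf Sol (xc A Nx i) (yc A Ny j) (tn A N (S n)))
        with (err_c A Sol Nx Ny N X (S n) i j) in LC.
      change (Psi X (S n) i j - phi Sol (xc A Nx i) (yc A Ny j) (tn A N (S n)))
        with (err_phi A Sol Nx Ny N X (S n) i j).
      unfold Sb, Cs, dT.
      set (dc := Rabs (cutoff _ - _)) in *.
      assert (a1 := Rabs_pos (err_c A Sol Nx Ny N X (S n) i j)).
      assert (a2 := Rabs_pos (err_T A Sol Nx Ny N X n i j)).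
      assert (a3 := Rabs_pos (err_phi A Sol Nx Ny N X (S n) i j)).
      set (xc_ := Rabs (err_c _ _ _ _ _ _ _ _ _)) in *.
      set (xT := Rabs (err_T _ _ _ _ _ _ _ _ _)) in *.
      set (xf := Rabs (err_phi _ _ _ _ _ _ _ _ _)) in *.
      set (t := dt A N) in *; clearbody t HB.
      rewrite (Rmult_assoc B0); apply Rmult_le_compat_l; [lra|].
      assert (HBL : 0 <= HB * L) by (apply Rmult_le_pos; lra).
      assert (s0 : HB * dc <= HB * xc_) by (apply Rmult_le_compat_l; lra).
      set (G0 := LH + HB * L); assert (HG00 : 0 <= G0) by (unfold G0; lra).
      assert (s1 : LH * (xT + K * t) + HB * (L * (xT + K * t) + dc + xf)
        <= G0 * (xT + K * t) + HB * (xc_ + xf)) by (unfold G0; lra).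
      eapply Rle_trans; [exact s1|].
      assert (0 <= G0 * (1 + K) * (xc_ + xf)) by (apply Rmult_le_pos; [apply Rmult_le_pos; lra|lra]).
      assert (0 <= HB * (xT + t)) by (apply Rmult_le_pos; lra).
      assert (0 <= G0 * K * xT) by (apply Rmult_le_pos; [apply Rmult_le_pos; lra|lra]).
      assert (0 <= G0 * t) by (apply Rmult_le_pos; lra).
      lra.
    * exact (divergence_bound A Sol P K lo hi lo0 hi1 ST HA HS Nx Ny N X n i j HG HX Hn Hij).
  + intros i j Hij; split; [|now apply HVx].
    rewrite (sch_V_x _ _ _ _ _ _ HX n i j Hn Hij); unfold lambda, l1, v; ring.
  + intros i j Hij; split; [|now apply HVy].
    rewrite (sch_V_y _ _ _ _ _ _ HX n i j Hn Hij); unfold lambda, l1, v; ring.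
  + intros i j Hi Hj; destruct (sch_bdry_x _ _ _ _ _ _ HX n i j Hn Hi Hj) as (_ & _ & Wz).
    split; [exact Wz|].
    assert (X0 : xe A Nx 0 = Llx A) by (unfold xe; simpl; ring).
    assert (X1 : xe A Nx Nx = Lrx A) by (unfold xe, hx; field; apply not_0_INR; lia).
    assert (Ei : xe A Nx i = Llx A \/ xe A Nx i = Lrx A) by (destruct Hi as [-> | ->]; auto).
    destruct (no_flow_x A Sol HS _ _ _ Ei (yc_interior A Ny j HD Hj) Htn) as (z0 & _ & z1).
    unfold fluxx; rewrite z0; unfold lambda in z1; unfold l1; lra.
  + intros i j Hj Hi; destruct (sch_bdry_y _ _ _ _ _ _ HX n i j Hn Hj Hi) as (_ & _ & Wz).
    split; [exact Wz|].
    assert (X0 : ye A Ny 0 = Lly A) by (unfold ye; simpl; ring).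
    assert (X1 : ye A Ny Ny = Lry A) by (unfold ye, ky; field; apply not_0_INR; lia).
    assert (Ej : ye A Ny j = Lly A \/ ye A Ny j = Lry A) by (destruct Hj as [-> | ->]; auto).
    destruct (no_flow_y A Sol HS _ _ _ Ej (xc_interior A Nx i HD Hi) Htn) as (z0 & _ & z1).
    unfold fluxy; rewrite z0; unfold lambda in z1; unfold l1; lra.
  + apply Rplus_le_compat_l.
    rewrite (Rmult_assoc (dt A N) C); apply Rmult_le_compat_l; [lra|exact GB].
Qed.

End Transported.

(** * The convergence theorem *)

Lemma gronwall_factor a x y : 0 <= a <= / 2 -> 0 <= x ->
  y <= x + a * (y + x) -> y <= exp (4 * a) * x.
Proof.
intros Ha Hx H.
assert (E : 1 + 4 * a <= exp (4 * a)).
{ destruct (Req_dec a 0) as [-> | Ha0]; [rewrite Rmult_0_r, exp_0; lra|].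
  apply Rlt_le, exp_ineq1; lra. }
apply Rle_trans with ((1 + 4 * a) * x); [|now apply Rmult_le_compat_r].
assert (0 <= a * (1 - 2 * a) * x) by (repeat apply Rmult_le_pos; lra).
apply Rmult_le_reg_l with (1 - a); [lra|]. nra.
Qed.

(** Here [x1] is the energy of the flow, [t] its dissipation (the squared pressure rate),
    [x2] the energy of concentration and temperature, [d] their dissipation, and [range n]
    says that the interpolated porosities at level [n] are admissible.  The second estimate
    holds only for small [x1] and contains the product of [t] and [x2]; both are dealt with
    by crude bounds at the new level, which are small because [B] is fixed before [e0].
    The quantity to which the Gronwall inequality applies contains the total
    dissipation, which yields the admissibility at the next level. *)
Lemma bootstrap (K c kappa delta Q : R) :
  1 <= K -> 0 < c -> 0 < kappa -> 0 < delta -> 0 <= Q ->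
  exists B e0, 0 < B /\ 0 < e0 /\
  forall (N : nat) (tau ee : R) (x1 x2 t d : nat -> R) (range : nat -> Prop),
  0 < tau <= e0 -> INR N * tau <= Q -> 0 <= ee <= e0 ->
  (forall n, (n <= N)%nat -> range n -> 0 <= x1 n) ->
  (forall n, (n <= N)%nat -> 0 <= x2 n /\ 0 <= t n /\ 0 <= d n) ->
  (range 0%nat -> x1 0%nat <= K * ee) -> x2 0%nat = 0 -> d 0%nat = 0 ->
  (forall n, (n < N)%nat -> range n -> range (S n) ->
     x1 (S n) + tau * c * t (S n) <= x1 n + tau * K * (x1 (S n) + x1 n + x2 n + ee)) ->
  (forall n, (n < N)%nat -> range n -> range (S n) -> x1 (S n) + ee <= kappa ->
     x2 (S n) + tau * c * d (S n)
     <= x2 n + tau * K * (x1 (S n) + x1 n + x2 (S n) + x2 n + ee + t (S n) * x2 (S n))) ->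
  (forall n, (n <= N)%nat -> psum (fun m => tau * d m) n <= delta -> range n) ->
  forall n, (n <= N)%nat -> range n /\ x1 n + x2 n <= B * ee.
Proof.
intros HK Hc Hkappa Hdelta HQ.
set (B := exp (8 * K * Q) * (K + 1)).
assert (HE : 1 <= exp (8 * K * Q)).
{ rewrite <- exp_0; destruct (Req_dec Q 0) as [-> | HQ0]; [rewrite Rmult_0_r; lra|].
  apply Rlt_le, exp_increasing, Rmult_lt_0_compat; lra. }
assert (HB : 1 <= B).
{ unfold B; rewrite <- (Rmult_1_l 1); apply Rmult_le_compat; lra. }
set (e0 := Rmin (Rmin (c * delta / B) (kappa / (3 * B))) (Rmin (c / (8 * K * B)) (/ (4 * K)))).
assert (HKB : 0 < K * B) by (apply Rmult_lt_0_compat; lra).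
assert (He0 : 0 < e0).
{ repeat apply Rmin_pos; try apply Rdiv_lt_0_compat; try apply Rinv_0_lt_compat; try lra.
  apply Rmult_lt_0_compat; lra. }
assert (E1 : e0 <= c * delta / B)
  by (eapply Rle_trans; [apply Rmin_l|apply Rmin_l]).
assert (E2 : e0 <= kappa / (3 * B))
  by (eapply Rle_trans; [apply Rmin_l|apply Rmin_r]).
assert (E3 : e0 <= c / (8 * K * B))
  by (eapply Rle_trans; [apply Rmin_r|apply Rmin_l]).
assert (E4 : e0 <= / (4 * K))
  by (eapply Rle_trans; [apply Rmin_r|apply Rmin_r]).
clearbody e0; exists B, e0; split; [lra|]; split; [assumption|].
intros N tau ee x1 x2 t d range [Ht Hte] HN [Hee0 Hee] P1 P2 F0 Hx20 Hd0 F1 F2 F3.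
assert (G1 : B * ee <= c * delta).
{ replace (c * delta) with (B * (c * delta / B)) by (field; lra).
  apply Rmult_le_compat_l; lra. }
assert (G2 : 3 * (B * ee) <= kappa).
{ replace kappa with (3 * (B * (kappa / (3 * B)))) by (field; lra).
  apply Rmult_le_compat_l; [lra|]; apply Rmult_le_compat_l; lra. }
assert (G3 : 8 * (K * (B * ee)) <= c).
{ replace c with (8 * (K * (B * (c / (8 * K * B))))) by (field; lra).
  apply Rmult_le_compat_l; [lra|]; apply Rmult_le_compat_l; [lra|]; apply Rmult_le_compat_l; lra. }
assert (G4 : tau * K <= / 4).
{ replace (/ 4) with (/ (4 * K) * K) by (field; lra).
  apply Rmult_le_compat_r; lra. }
assert (G0 : 0 < tau * K) by (apply Rmult_lt_0_compat; lra).
set (X := fun n => x1 n + x2 n + c * psum (fun m => tau * d m) (S n) + ee).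
assert (HS : forall n, (n <= N)%nat -> 0 <= psum (fun m => tau * d m) n).
{ intros n Hn; apply psum_ge0; intros m Hm; apply Rmult_le_pos; [lra|].
  apply P2; lia. }
assert (HBe : forall n, (n <= N)%nat ->
  exp (8 * K * (INR n * tau)) * ((K + 1) * ee) <= B * ee).
{ intros n Hn; unfold B; rewrite (Rmult_assoc (exp _)).
  apply Rmult_le_compat_r; [apply Rmult_le_pos; lra|].
  assert (INR n * tau <= Q).
  { eapply Rle_trans; [|exact HN]; apply Rmult_le_compat_r; [lra|now apply le_INR]. }
  assert (L : 8 * K * (INR n * tau) <= 8 * K * Q) by (apply Rmult_le_compat_l; lra).
  destruct (Rle_lt_or_eq_dec _ _ L) as [L' | L']; [left; now apply exp_increasing|rewrite L'; lra]. }
assert (MAIN : forall n, (n <= N)%nat -> range n /\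
  X n <= exp (8 * K * (INR n * tau)) * ((K + 1) * ee)).
{ induction n as [|n IH]; intros Hn.
  - assert (R0 : range 0%nat) by (apply F3; [assumption|simpl; lra]).
    split; [assumption|]; unfold X; simpl psum; rewrite Hx20, Hd0; simpl INR.
    replace (8 * K * (0 * tau)) with 0 by ring; rewrite exp_0; specialize (F0 R0); lra.
  - destruct (IH ltac:(lia)) as [Rn HX].
    destruct (P2 n ltac:(lia)) as (a1 & _ & _); assert (a0 := P1 n ltac:(lia) Rn).
    destruct (P2 (S n) Hn) as (b1 & b2 & b3).
    assert (s0 := HS n ltac:(lia)).
    assert (dn : 0 <= tau * d n) by (apply Rmult_le_pos; [lra|apply P2; lia]).
    assert (s1 : 0 <= c * psum (fun m => tau * d m) (S n))
      by (apply Rmult_le_pos; [lra|simpl; lra]).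
    assert (HXB : X n <= B * ee)
      by (eapply Rle_trans; [exact HX|apply HBe; lia]).
    assert (Rn' : range (S n)).
    { apply F3; [assumption|]; apply Rmult_le_reg_l with c; [lra|].
      unfold X in HXB; lra. }
    split; [assumption|].
    assert (c0 := P1 (S n) Hn Rn').
    assert (H1 := F1 n ltac:(lia) Rn Rn').
    (* crude bounds for the new level, which put the smallness conditions of
       the second estimate in force *)
    assert (q0 : 0 <= tau * c * t (S n)) by (apply Rmult_le_pos; [apply Rmult_le_pos; lra|lra]).
    assert (q1 : tau * K * (x1 (S n) + x1 n + x2 n + ee) <= / 4 * (x1 (S n) + x1 n + x2 n + ee))
      by (apply Rmult_le_compat_r; lra).
    assert (HXn : x1 n + x2 n + ee <= B * ee) by (unfold X in HXB; lra).
    assert (B1 : x1 (S n) <= 2 * (B * ee)) by lra.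
    assert (B2 : tau * c * t (S n) <= 2 * (B * ee)) by lra.
    assert (BE : ee <= B * ee) by lra.
    assert (H2 := F2 n ltac:(lia) Rn Rn' ltac:(lra)).
    assert (B3 : tau * K * t (S n) <= / 4).
    { apply Rmult_le_reg_l with c; [lra|].
      assert (K * (tau * c * t (S n)) <= K * (2 * (B * ee))) by (apply Rmult_le_compat_l; lra).
      lra. }
    assert (q2 : tau * K * (x1 (S n) + x1 n + x2 (S n) + x2 n + ee)
       <= / 4 * (x1 (S n) + x1 n + x2 (S n) + x2 n + ee)) by (apply Rmult_le_compat_r; lra).
    assert (q3 : tau * K * t (S n) * x2 (S n) <= / 4 * x2 (S n)) by (apply Rmult_le_compat_r; lra).
    assert (q4 : 0 <= tau * c * d (S n)) by (apply Rmult_le_pos; [apply Rmult_le_pos; lra|lra]).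
    assert (B4 : x2 (S n) <= 4 * (B * ee)) by lra.
    (* the product of the pressure rate with the new error is absorbed by the
       dissipation of the flow estimate *)
    assert (q5 : K * x2 (S n) <= c).
    { assert (K * x2 (S n) <= K * (4 * (B * ee))) by (apply Rmult_le_compat_l; lra).
      assert (0 <= K * (B * ee)) by (apply Rmult_le_pos; lra). lra. }
    assert (q6 : tau * t (S n) * (K * x2 (S n)) <= tau * t (S n) * c)
      by (apply Rmult_le_compat_l; [apply Rmult_le_pos; lra|lra]).
    assert (ST : X (S n) <= X n + 2 * (tau * K) * (X (S n) + X n)).
    { assert (s2 : 0 <= c * psum (fun m => tau * d m) (S (S n))).
      { apply Rmult_le_pos; [lra|]; change (0 <= psum (fun m => tau * d m) (S n) + tau * d (S n)).
        assert (0 <= tau * d (S n)) by (apply Rmult_le_pos; lra). simpl; lra. }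
      assert (EX : X (S n) = x1 (S n) + x2 (S n)
         + (c * psum (fun m => tau * d m) (S n) + c * (tau * d (S n))) + ee)
        by (unfold X; change (psum (fun m => tau * d m) (S (S n))) with
              (psum (fun m => tau * d m) (S n) + tau * d (S n)); ring).
      set (p := psum (fun m => tau * d m) (S n)) in *.
      assert (EX0 : X n = x1 n + x2 n + c * p + ee) by reflexivity.
      assert (u1 : tau * K * (x1 (S n) + x1 n + x2 n + ee) <= tau * K * (X (S n) + X n)).
      { apply Rmult_le_compat_l; [lra|]; rewrite EX, EX0.
        assert (0 <= c * (tau * d (S n))) by (apply Rmult_le_pos; [lra|apply Rmult_le_pos; lra]).
        lra. }
      assert (u2 : tau * K * (x1 (S n) + x1 n + x2 (S n) + x2 n + ee) <= tau * K * (X (S n) + X n)).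
      { apply Rmult_le_compat_l; [lra|]; rewrite EX, EX0.
        assert (0 <= c * (tau * d (S n))) by (apply Rmult_le_pos; [lra|apply Rmult_le_pos; lra]).
        lra. }
      lra. }
    assert (X0 : 0 <= X n) by (unfold X; lra).
    apply Rle_trans with (exp (4 * (2 * (tau * K))) * X n);
      [apply gronwall_factor; [lra|assumption|exact ST]|].
    replace (8 * K * (INR (S n) * tau)) with (4 * (2 * (tau * K)) + 8 * K * (INR n * tau))
      by (rewrite S_INR; ring).
    rewrite exp_plus, Rmult_assoc; apply Rmult_le_compat_l; [left; apply exp_pos|exact HX]. }
intros n Hn; destruct (MAIN n Hn) as [Rn HX]; split; [assumption|].
assert (s1 : 0 <= c * psum (fun m => tau * d m) (S n)).
{ apply Rmult_le_pos; [lra|]; apply psum_ge0; intros m Hm; apply Rmult_le_pos; [lra|].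
  apply P2; lia. }
unfold X in HX; eapply Rle_trans with (X n); [unfold X; lra|].
eapply Rle_trans; [exact HX|now apply HBe].
Qed.

Lemma energy_lower_bound A Sol P K lo hi lo0 hi1 Nx Ny N X n :
  setting A Sol P K lo hi lo0 hi1 -> standing_assumptions A ->
  good_grid A Nx Ny N -> scheme A P Nx Ny N X -> (n <= N)%nat ->
  nM A Nx Ny (err_c A Sol Nx Ny N X n) + nM A Nx Ny (err_T A Sol Nx Ny N X n)
  <= 2 / Rmin lo (Rmin (rho_s A * theta_s A) (rho_f A * theta_f A))
     * (energy_c A Sol Nx Ny N X n + energy_T A Sol Nx Ny N X n).
Proof.
intros ST HA HG HX Hn.
assert (Hlo := st_lo _ _ _ _ _ _ _ _ ST); assert (Hlo0 := st_lo0 _ _ _ _ _ _ _ _ ST).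
assert (Hhi := st_hi _ _ _ _ _ _ _ _ ST); assert (Hhi1 := st_hi1 _ _ _ _ _ _ _ _ ST).
destruct (st_grid _ _ _ _ _ _ _ _ ST Nx Ny N X HG HX) as (_ & _ & HPsi & _).
destruct (rho_pos A HA) as [Hrs Hrf]; destruct (theta_pos A HA) as [Hts Htf].
assert (Hw := cell_weight_pos A Nx Ny N HG).
set (a := rho_s A * theta_s A); set (b := rho_f A * theta_f A).
assert (Ha : 0 < a) by (apply Rmult_lt_0_compat; assumption).
assert (Hb : 0 < b) by (apply Rmult_lt_0_compat; assumption).
set (m := Rmin lo (Rmin a b)).
assert (Hm : 0 < m) by (apply Rmin_pos; [assumption|apply Rmin_pos; assumption]).
assert (M1 : m <= lo) by apply Rmin_l.
assert (M2 : m <= a) by (eapply Rle_trans; [apply Rmin_r|apply Rmin_l]).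
assert (M3 : m <= b) by (eapply Rle_trans; [apply Rmin_r|apply Rmin_r]).
assert (B : forall e cap, (forall i j, is_cell Nx Ny i j -> m <= cap i j) ->
  nM A Nx Ny e <= 2 / m * (/ 2 * I2 (hx A Nx * ky A Ny) Nx Ny (fun i j => cap i j * e i j ^ 2))).
{ intros e cap Hcap; replace (2 / m * (/ 2 * I2 (hx A Nx * ky A Ny) Nx Ny
    (fun i j => cap i j * e i j ^ 2)))
  with (/ m * I2 (hx A Nx * ky A Ny) Nx Ny (fun i j => cap i j * e i j ^ 2)) by (field; lra).
  rewrite <- I2_scal; apply I2_le; [lra|]; intros i j Hi Hj.
  rewrite <- (Rmult_1_l (e i j ^ 2)) at 1; rewrite <- (Rinv_l m), Rmult_assoc by lra.
  apply Rmult_le_compat_l; [left; apply Rinv_0_lt_compat; lra|].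
  apply Rmult_le_compat_r; [apply pow2_ge_0|apply Hcap; split; assumption]. }
rewrite Rmult_plus_distr_l; apply Rplus_le_compat; apply B; intros i j Hij.
- specialize (HPsi n i j Hij Hn); lra.
- specialize (HPsi n i j Hij Hn).
  unfold heat_cap; replace (rho_s A * (1 - Psi X n i j) * theta_s A
    + rho_f A * Psi X n i j * theta_f A) with (a * (1 - Psi X n i j) + b * Psi X n i j)
    by (unfold a, b; ring).
  assert (0 <= (a - m) * (1 - Psi X n i j)) by (apply Rmult_le_pos; lra).
  assert (0 <= (b - m) * Psi X n i j) by (apply Rmult_le_pos; lra). lra.
Qed.

(** The error estimates put into the form required by [bootstrap], with common constants;
    the grid is so fine that [eps A Nx Ny N ^ 2] meets its smallness condition. *)
Lemma uniform_error_bound A Sol P K lo hi lo0 hi1 :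
  setting A Sol P K lo hi lo0 hi1 -> standing_assumptions A -> exact_solution A Sol ->
  exists C delta, 0 < C /\ 0 < delta /\
  forall Nx Ny N X n, good_grid A Nx Ny N -> scheme A P Nx Ny N X -> (n <= N)%nat ->
  hx A Nx <= delta -> ky A Ny <= delta -> dt A N <= delta ->
  nM A Nx Ny (err_phi A Sol Nx Ny N X n)
  + nE A Nx Ny (err_ux A Sol P Nx Ny N X n) (err_uy A Sol P Nx Ny N X n)
  + nM A Nx Ny (err_p A Sol Nx Ny N X n) + nM A Nx Ny (err_c A Sol Nx Ny N X n)
  + nM A Nx Ny (err_T A Sol Nx Ny N X n) <= C * eps A Nx Ny N ^ 2.
Proof.
intros ST HA HS.
assert (HK := st_K _ _ _ _ _ _ _ _ ST); assert (HD := st_domain _ _ _ _ _ _ _ _ ST).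
assert (Gam := gamma_pos A HA); assert (A0 := area_pos A HD).
destruct (acid_step A Sol P K lo hi lo0 hi1 ST HA HS) as (C1 & c1 & k1 & HC1 & Hc1 & Hk1 & Acid).
destruct (heat_step A Sol P K lo hi lo0 hi1 ST HA HS) as (C2 & c2 & k2 & HC2 & Hc2 & Hk2 & Heat).
destruct (range_of_dissipation A Sol P K lo hi lo0 hi1 ST HS) as (dl & Hdl & HF3).
assert (HCf : 0 <= Cflow A K).
{ destruct (flow_constants A Sol P K lo hi lo0 hi1 ST HA) as [_ HCp]; unfold Cflow; cbv zeta.
  set (Cp := _ + 1 + _ / gamma A) in *.
  assert (p11 := pow_le K 11 ltac:(lra)); assert (p2 := pow2_ge_0 K).
  assert (0 <= (1 + 200 * K ^ 11) * (1 + area A)) by (apply Rmult_le_pos; lra).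
  assert (0 <= Cp * (2 * K + (1 + 200 * K ^ 11) * (1 + area A))) by (apply Rmult_le_pos; lra).
  assert (0 <= 4 * K ^ 2 * (1 + area A)) by (apply Rmult_le_pos; lra).
  apply Rmult_le_pos; lra. }
set (m := Rmin lo (Rmin (rho_s A * theta_s A) (rho_f A * theta_f A))).
assert (Hm : 0 < m).
{ destruct (rho_pos A HA), (theta_pos A HA).
  repeat apply Rmin_pos; try (apply Rmult_lt_0_compat; assumption).
  apply (st_lo _ _ _ _ _ _ _ _ ST). }
set (M := 2 / m); assert (HM : 0 < M) by (apply Rdiv_lt_0_compat; lra).
set (G := M + 2 * K + 1).
set (Kp := 4 * K ^ 3 + 32 * K ^ 9 * (1 + area A)).
assert (HKp : 0 < Kp).
{ assert (0 < K ^ 3) by (apply pow_lt; lra).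
  assert (0 < K ^ 9 * (1 + area A)) by (apply Rmult_lt_0_compat; [apply pow_lt|]; lra).
  unfold Kp; lra. }
set (KK := 1 + 16 * K ^ 10 * area A + Cflow A K * (1 + M) + (C1 + C2) * G).
assert (T1 : 0 <= 16 * K ^ 10 * area A)
  by (apply Rmult_le_pos; [assert (0 < K ^ 10) by (apply pow_lt; lra)|]; lra).
assert (T2 : 0 <= Cflow A K * (1 + M)) by (apply Rmult_le_pos; lra).
assert (T3 : 0 <= (C1 + C2) * G) by (apply Rmult_le_pos; unfold G; lra).
set (c := Rmin (gamma A / 4) (Rmin c1 c2)).
assert (Hc : 0 < c) by (repeat apply Rmin_pos; lra).
assert (U1 : c <= gamma A / 4) by apply Rmin_l.
assert (U2 : c <= c1) by (eapply Rle_trans; [apply Rmin_r|apply Rmin_l]).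
assert (U3 : c <= c2) by (eapply Rle_trans; [apply Rmin_r|apply Rmin_r]).
set (k := Rmin k1 k2); assert (Hk : 0 < k) by (apply Rmin_pos; assumption).
assert (V1 : k <= k1) by apply Rmin_l; assert (V2 : k <= k2) by apply Rmin_r.
assert (HQ : 0 < Qend A) by apply HD.
destruct (bootstrap KK c (k / Kp) dl (Qend A)) as (B & e0 & HB & He0 & BOOT);
  [unfold KK; lra|assumption|apply Rdiv_lt_0_compat; lra|assumption|lra|].
set (D := Rmin (Rmin (/ 3) (e0 / 9)) (Rmin k dl)).
assert (HD0 : 0 < D) by (repeat apply Rmin_pos; lra).
assert (D1 : D <= / 3) by (eapply Rle_trans; [apply Rmin_l|apply Rmin_l]).
assert (D2 : D <= e0 / 9) by (eapply Rle_trans; [apply Rmin_l|apply Rmin_r]).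
assert (D3 : D <= k) by (eapply Rle_trans; [apply Rmin_r|apply Rmin_l]).
assert (D4 : D <= dl) by (eapply Rle_trans; [apply Rmin_r|apply Rmin_r]).
clearbody c k D.
exists ((1 + 2 * K + M) * B), D; split; [apply Rmult_lt_0_compat; lra|]; split; [assumption|].
intros Nx Ny N X n HG HX Hn Hh Hky Hdt.
assert (HG0 := HG); destruct HG0 as (_ & HNx & HNy & HN).
assert (h0 := hx_pos A Nx HD HNx); assert (k0 := ky_pos A Ny HD HNy).
assert (t0 := dt_pos A N HD HN).
assert (He : 0 <= eps A Nx Ny N <= 3 * D).
{ unfold eps; assert (hx A Nx ^ 2 <= D * 1) by (simpl; apply Rmult_le_compat; lra).
  assert (ky A Ny ^ 2 <= D * 1) by (simpl; apply Rmult_le_compat; lra).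
  generalize (pow2_ge_0 (hx A Nx)) (pow2_ge_0 (ky A Ny)); lra. }
assert (Hee : eps A Nx Ny N ^ 2 <= e0).
{ apply Rle_trans with (3 * D * 1); [|lra].
  simpl; rewrite Rmult_1_r; apply Rmult_le_compat; lra. }
assert (Hee0 := pow2_ge_0 (eps A Nx Ny N)).
set (x1 := energy_flow A Sol P Nx Ny N X).
set (x2 := fun n => energy_c A Sol Nx Ny N X n + energy_T A Sol Nx Ny N X n).
set (t := rate_p A Sol Nx Ny N X).
set (d := fun n => nD A Nx Ny (err_c A Sol Nx Ny N X n) + nD A Nx Ny (err_T A Sol Nx Ny N X n)).
assert (LB : forall n, (n <= N)%nat ->
  nM A Nx Ny (err_c A Sol Nx Ny N X n) + nM A Nx Ny (err_T A Sol Nx Ny N X n) <= M * x2 n)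
  by (intros l Hl; now apply (energy_lower_bound A Sol P K lo hi lo0 hi1)).
assert (NM : forall g, 0 <= nM A Nx Ny g) by (intros; now apply (nM_ge0 A Nx Ny N)).
assert (Nt : forall n, 0 <= t n) by (intros; apply NM).
assert (Nd : forall n, 0 <= nD A Nx Ny (err_c A Sol Nx Ny N X n)
  /\ 0 <= nD A Nx Ny (err_T A Sol Nx Ny N X n))
  by (split; now apply (nE_ge0 A Nx Ny N)).
assert (N2 : forall n, (n <= N)%nat -> 0 <= x2 n).
{ intros l Hl; apply Rmult_le_reg_l with M; [assumption|].
  generalize (LB l Hl) (NM (err_c A Sol Nx Ny N X l)) (NM (err_T A Sol Nx Ny N X l)); lra. }
assert (N1 : forall n, in_range P lo hi Nx Ny X n ->
  0 <= energy_u A Sol P Nx Ny N X n)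
  by (intros; now apply (energy_u_ge0 A Sol P K lo hi lo0 hi1)).
assert (IE := initial_errors A Sol P HS Nx Ny N X HG HX).
assert (END : forall n, (n <= N)%nat ->
  in_range P lo hi Nx Ny X n /\ x1 n + x2 n <= B * eps A Nx Ny N ^ 2).
{ apply (BOOT N (dt A N) _ x1 x2 t d); try (split; lra).
  - unfold dt; apply Req_le; field; apply not_0_INR; lia.
  - intros l Hl Rl; unfold x1, energy_flow.
    generalize (N1 l Rl) (NM (err_p A Sol Nx Ny N X l)) (NM (err_phi A Sol Nx Ny N X l)); lra.
  - intros l Hl; split; [now apply N2|]; split; [apply Nt|].
    destruct (Nd l); unfold d; lra.
  - intros R0; unfold x1.
    eapply Rle_trans; [apply (initial_energy A Sol P K lo hi lo0 hi1); assumption|].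
    apply Rmult_le_compat_r; [assumption|unfold KK; lra].
  - unfold x2, energy_c, energy_T; set (w := hx A Nx * ky A Ny).
    assert (Z0 : forall cap e, (forall i j, is_cell Nx Ny i j -> e i j = 0) ->
      I2 w Nx Ny (fun i j => cap i j * e i j ^ 2) = 0).
    { intros cap e H; rewrite (I2_ext w Nx Ny _ (fun i j => 0 * 0)).
      - rewrite (I2_scal w Nx Ny 0 (fun _ _ => 0)); ring.
      - intros i j Hi Hj; rewrite (H i j (conj Hi Hj)); ring. }
    rewrite (Z0 (Psi X 0%nat) _ (fun i j Hij => proj1 (proj2 (proj2 (IE i j Hij))))).
    rewrite (Z0 (fun i j => heat_cap A (Psi X 0%nat i j)) _
      (fun i j Hij => proj2 (proj2 (proj2 (IE i j Hij))))). ring.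
  - unfold d; rewrite !nD_zero; [ring| |]; intros i j Hij; now apply IE.
  - intros l Hl Rl Rl'.
    assert (F := flow_step A Sol P K lo hi lo0 hi1 ST HA HS Nx Ny N X HG HX l Hl Rl Rl').
    fold x1 t in F; assert (L := LB l ltac:(lia)).
    assert (F1 : dt A N * c * t (S l) <= dt A N * (gamma A / 4) * t (S l))
      by (apply Rmult_le_compat_r; [apply Nt|apply Rmult_le_compat_l; lra]).
    eapply Rle_trans; [apply Rplus_le_compat_l, F1|]; eapply Rle_trans; [exact F|].
    apply Rplus_le_compat_l; rewrite !(Rmult_assoc (dt A N)).
    apply Rmult_le_compat_l; [lra|].
    assert (p1 : 0 <= x1 l /\ 0 <= x1 (S l)).
    { unfold x1, energy_flow.
      generalize (N1 l Rl) (N1 _ Rl') (NM (err_p A Sol Nx Ny N X l))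
        (NM (err_phi A Sol Nx Ny N X l)) (NM (err_p A Sol Nx Ny N X (S l)))
        (NM (err_phi A Sol Nx Ny N X (S l))); lra. }
    assert (p2 := N2 l ltac:(lia)).
    set (s := x1 (S l) + x1 l + x2 l + eps A Nx Ny N ^ 2).
    apply Rle_trans with (Cflow A K * ((1 + M) * s)).
    + apply Rmult_le_compat_l; [assumption|]; unfold s.
      assert (0 <= M * (x1 (S l) + x1 l + eps A Nx Ny N ^ 2)) by (apply Rmult_le_pos; lra).
      lra.
    + rewrite <- Rmult_assoc; apply Rmult_le_compat_r; [unfold s|unfold KK]; lra.
  - intros l Hl Rl Rl' Hsmall.
    assert (p0 : 0 <= energy_u A Sol P Nx Ny N X l /\ 0 <= energy_u A Sol P Nx Ny N X (S l))
      by (split; now apply N1).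
    assert (HDp : nD A Nx Ny (err_p A Sol Nx Ny N X (S l)) <= k).
    { eapply Rle_trans; [apply (pressure_gradient A Sol P K lo hi lo0 hi1); assumption|].
      fold Kp; replace k with (Kp * (k / Kp)) by (field; lra).
      apply Rmult_le_compat_l; [lra|exact Hsmall]. }
    assert (S1 := Acid Nx Ny N X l HG HX Hl ltac:(lra) Rl' ltac:(lra) ltac:(lra) ltac:(lra)).
    assert (S2 := Heat Nx Ny N X l HG HX Hl ltac:(lra) Rl' ltac:(lra) ltac:(lra) ltac:(lra)).
    assert (V := velocity_energy A Sol P K lo hi lo0 hi1 ST Nx Ny N X HG HX (S l) Rl').
    assert (L := LB l ltac:(lia)); assert (L' := LB (S l) ltac:(lia)).
    assert (p2 := N2 l ltac:(lia)); assert (p2' := N2 (S l) ltac:(lia)).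
    assert (pt := Nt (S l)).
    assert (Y : growth A Sol P Nx Ny N X l <= G * (x1 (S l) + x1 l + x2 (S l) + x2 l
       + eps A Nx Ny N ^ 2 + t (S l) * x2 (S l))).
    { unfold growth; fold t.
      assert (Lt := Rmult_le_compat_l _ _ _ pt L').
      unfold x1, energy_flow.
      assert (q1 := NM (err_p A Sol Nx Ny N X l)); assert (q2 := NM (err_phi A Sol Nx Ny N X l)).
      assert (q1' := NM (err_p A Sol Nx Ny N X (S l))).
      assert (q2' := NM (err_phi A Sol Nx Ny N X (S l))).
      set (u := energy_u _ _ _ _ _ _ _ l) in *; set (u' := energy_u _ _ _ _ _ _ _ (S l)) in *.
      set (y1 := nM _ _ _ (err_p _ _ _ _ _ _ l)) in *.
      set (y2 := nM _ _ _ (err_phi _ _ _ _ _ _ l)) in *.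
      set (y1' := nM _ _ _ (err_p _ _ _ _ _ _ (S l))) in *.
      set (y2' := nM _ _ _ (err_phi _ _ _ _ _ _ (S l))) in *.
      assert (r0 : 0 <= t (S l) * x2 (S l)) by (apply Rmult_le_pos; lra).
      assert (r1 : 0 <= M * (u' + y1' + y2' + (u + y1 + y2) + eps A Nx Ny N ^ 2))
        by (apply Rmult_le_pos; lra).
      assert (r2 : 0 <= 2 * K * (y1' + y2' + (u + y1 + y2) + x2 (S l) + x2 l
        + eps A Nx Ny N ^ 2 + t (S l) * x2 (S l))) by (apply Rmult_le_pos; lra).
      unfold G; lra. }
    set (s := x1 (S l) + x1 l + x2 (S l) + x2 l + eps A Nx Ny N ^ 2 + t (S l) * x2 (S l)) in *.
    assert (s0 : 0 <= s).
    { unfold s, x1, energy_flow.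
      generalize (NM (err_p A Sol Nx Ny N X l)) (NM (err_phi A Sol Nx Ny N X l))
        (NM (err_p A Sol Nx Ny N X (S l))) (NM (err_phi A Sol Nx Ny N X (S l))).
      assert (r0 : 0 <= t (S l) * x2 (S l)) by (apply Rmult_le_pos; lra). lra. }
    destruct (Nd (S l)) as [n1 n2].
    assert (W1 : dt A N * c * nD A Nx Ny (err_c A Sol Nx Ny N X (S l))
      <= dt A N * c1 * nD A Nx Ny (err_c A Sol Nx Ny N X (S l)))
      by (apply Rmult_le_compat_r; [|apply Rmult_le_compat_l]; lra).
    assert (W2 : dt A N * c * nD A Nx Ny (err_T A Sol Nx Ny N X (S l))
      <= dt A N * c2 * nD A Nx Ny (err_T A Sol Nx Ny N X (S l)))
      by (apply Rmult_le_compat_r; [|apply Rmult_le_compat_l]; lra).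
    assert (W3 : dt A N * (C1 + C2) * growth A Sol P Nx Ny N X l <= dt A N * KK * s).
    { rewrite !(Rmult_assoc (dt A N)); apply Rmult_le_compat_l; [lra|].
      apply Rle_trans with ((C1 + C2) * (G * s)); [apply Rmult_le_compat_l; lra|].
      rewrite <- Rmult_assoc; apply Rmult_le_compat_r; [assumption|unfold KK; lra]. }
    unfold x2 at 1 2, d; lra.
  - intros l Hl HP; apply (HF3 Nx Ny N X l HG HX Hl); [lra|lra|exact HP]. }
destruct (END n Hn) as [Rn Bn].
assert (V := velocity_energy A Sol P K lo hi lo0 hi1 ST Nx Ny N X HG HX n Rn).
assert (L := LB n Hn); assert (p0 := N1 n Rn); assert (p2 := N2 n Hn).
apply Rle_trans with ((1 + 2 * K + M) * (x1 n + x2 n));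
  [|rewrite Rmult_assoc; apply Rmult_le_compat_l; lra].
unfold x1, energy_flow.
assert (q1 := NM (err_p A Sol Nx Ny N X n)); assert (q2 := NM (err_phi A Sol Nx Ny N X n)).
set (u := energy_u _ _ _ _ _ _ _ n) in *.
set (y1 := nM _ _ _ (err_p _ _ _ _ _ _ n)) in *.
set (y2 := nM _ _ _ (err_phi _ _ _ _ _ _ n)) in *.
assert (0 <= M * (u + y1 + y2)) by (apply Rmult_le_pos; lra).
assert (0 <= 2 * K * (y1 + y2 + x2 n)) by (apply Rmult_le_pos; lra).
lra.
Qed.

Theorem theorem4p7 :
  exists r : nat,
  forall (A : problem) (Sol : state) (P : interp),
    standing_assumptions A ->
    exact_solution A Sol ->
    smooth r Sol ->
    interpolation_operator A P ->
    exists C delta : R, 0 < C /\ 0 < delta /\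
      forall (Nx Ny N : nat),
        (1 <= Nx)%nat -> (1 <= Ny)%nat -> (1 <= N)%nat ->
        hx A Nx <= delta -> ky A Ny <= delta -> dt A N <= delta ->
        forall X : discrete,
          scheme A P Nx Ny N X ->
          forall m : nat, (m <= N - 1)%nat ->
            normM2 A Nx Ny (err_center A Nx Ny N (Psi X) (phi Sol) (m + 1))
            + normTM2 A Nx Ny
                (err_xedge A Nx Ny N (Ux X) (ux Sol) (m + 1))
                (err_yedge A Nx Ny N (Uy X) (uy Sol) (m + 1))
            + normM2 A Nx Ny (err_center A Nx Ny N (Pd X) (p Sol) (m + 1))
            + normM2 A Nx Ny (err_center A Nx Ny N (Cf X) (cf Sol) (m + 1))
            + normM2 A Nx Ny (err_center A Nx Ny N (Z X) (Tf Sol) (m + 1))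
            <= C * (dt A N ^ 2 + hx A Nx ^ 4 + ky A Ny ^ 4).
Proof.
exists 5%nat; intros A Sol P HA HS Hsm HP.
destruct (setting_exists A Sol P HA HS Hsm HP) as (K & lo & hi & lo0 & hi1 & ST).
assert (HD := st_domain _ _ _ _ _ _ _ _ ST).
destruct (uniform_error_bound A Sol P K lo hi lo0 hi1 ST HA HS) as (C & delta & HC & Hdelta & H).
exists (3 * C), delta; split; [lra|]; split; [assumption|].
intros Nx Ny N HNx HNy HN Hh Hk Ht X HX m Hm; rewrite Nat.add_1_r.
assert (HG : good_grid A Nx Ny N) by (repeat split; assumption || apply HD).
apply Rle_trans with (C * eps A Nx Ny N ^ 2).
- exact (H Nx Ny N X (S m) HG HX ltac:(lia) Hh Hk Ht).
- rewrite (Rmult_comm 3), Rmult_assoc; apply Rmult_le_compat_l; [lra|]; unfold eps.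
  generalize (pow2_ge_0 (dt A N - hx A Nx ^ 2)) (pow2_ge_0 (dt A N - ky A Ny ^ 2))
    (pow2_ge_0 (hx A Nx ^ 2 - ky A Ny ^ 2)).
  replace (hx A Nx ^ 4) with ((hx A Nx ^ 2) ^ 2) by ring.
  replace (ky A Ny ^ 4) with ((ky A Ny ^ 2) ^ 2) by ring.
  lra.
Qed.
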